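(* Let $\mathcal D\subset\mathbb C$ be a domain containing $0$ and let $A:\mathcal D\to\mathcal S_\infty(\mathcal H)$ be a holomorphic operator-valued function such that $A(0)$ is selfadjoint and $I-A'(0)\Pi_0$ is invertible. Let $\theta>0$ be fixed, with $\mathcal C_\theta(r,1)\subset\mathcal D$ for $0<r<1$. Suppose that $$n([r,1])=\Phi(r)(1+o(1)),\qquad r\searrow0,$$ where, for some $\gamma,C>0$, either $\Phi(r)=Cr^{-\gamma}$, or $\Phi(r)=C|\ln r|^{\gamma}$, or $\Phi(r)=C\,\dfrac{|\ln r|}{\ln|\ln r|}$. Then $$\mathcal N(\mathcal C_\theta(r,1))=\Phi(r)(1+o(1)),\qquad r\searrow0 .$$
   Context: $\mathcal H$ is a separable complex Hilbert space and $\mathcal S_\infty(\mathcal H)$ is the space of compact operators on $\mathcal H$. $\Pi_0$ is the orthogonal projection onto $\ker A(0)$, and $A'(0)$ is the derivative of $A$ at $0$. For $\theta>0$ and $0<a<b$, $$\mathcal C_\theta(a,b):=\{x+iy\in\mathbb C:\ a\le x\le b,\ |y|\le\theta|x|\}.$$ A characteristic value of $I-A(z)/z$ is a point $w\in\mathcal D\setminus\{0\}$ such that $F(w):=I-A(w)/w$ is not invertible. Under the hypotheses the characteristic values form a discrete closed subset of $\mathcal D\setminus\{0\}$; the multiplicity of a characteristic value $w$ is the integer $\frac1{2i\pi}\operatorname{tr}\int_{|z-w|=\rho}F'(z)F(z)^{-1}\,dz$ for $\rho>0$ small enough that $w$ is the only characteristic value in $\{|z-w|\le\rho\}$ (and this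 disc lies in $\mathcal D\setminus\{0\}$). For $\Omega\subset\mathcal D$, $\mathcal N(\Omega)$ is the number of characteristic values in $\Omega\setminus\{0\}$, counted with multiplicities. For $\Lambda\subset\mathbb R$, $n(\Lambda):=\operatorname{tr}\mathbf 1_\Lambda(A(0))$ is the number of eigenvalues of $A(0)$ in $\Lambda$, counted with multiplicities. *)

(* Defs.v *)
From HB Require Import structures.
From mathcomp Require Import all_boot all_order all_algebra.
From mathcomp Require Import all_classical all_reals all_analysis.
From mathcomp Require Import complex.

Set Implicit Arguments.
Unset Strict Implicit.
Unset Printing Implicit Defensive.

Import Order.TTheory GRing.Theory Num.Theory.
Import numFieldNormedType.Exports.

Local Open Scope classical_set_scope.
Local Open Scope ring_scope.

(* The normed-module structures are attached to R[i]^o in the libraries; this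
   makes them available on R[i] itself. *)
HB.instance Definition _ (R : realType) := NormedModule.copy R[i] R[i]^o.

Lemma realcD (R : realType) (x y : R) : ((x + y)%:C = x%:C + y%:C)%C.
Proof. exact: rmorphD. Qed.

Lemma realcM (R : realType) (x y : R) : ((x * y)%:C = x%:C * y%:C)%C.
Proof. exact: rmorphM. Qed.

Section BoundedOperators.
Context {R : realType} {E : normedModType R[i]}.
Implicit Types (f g : E -> E).

Lemma Re_norm (F : normedModType R[i]) (x : F) :
  ((complex.Re `|x|)%:C)%C = `|x|.
Proof. by apply: RRe_real; exact: normr_real. Qed.

Lemma Re_normC (a : R[i]) : ((complex.Re `|a|)%:C)%C = `|a|.
Proof. by apply: RRe_real; exact: normr_real. Qed.

Definition bounded_linear : {pred E -> E} :=
  mem [set f : E -> E | linear f /\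
    exists M : R, forall x, `|f x| <= M%:C%C * `|x|].

Lemma bounded_linear_submod : submod_closed bounded_linear.
Proof.
split=> [|a f g /set_mem[lf [M fM]] /set_mem[lg [N gN]]].
  apply/mem_set; split=> [a x y /=|]; first by rewrite /= scaler0 addr0.
  by exists 0 => x; rewrite normr0 mul0r.
apply/mem_set; split=> [b x y|].
  rewrite /= !fctE lf lg !scalerDr !scalerA mulrC.
  by rewrite -!addrA; congr (_ + _); rewrite addrCA.
exists (complex.Re `|a| * M + N) => x.
rewrite !fctE realcD realcM mulrDl (le_trans (ler_normD _ _))// lerD//.
by rewrite normrZ (Re_normC a) -mulrA ler_wpM2l.
Qed.

HB.instance Definition _ :=
  GRing.isSubmodClosed.Build _ _ bounded_linear bounded_linear_submod.

End BoundedOperators.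

Record boundedOp (R : realType) (E : normedModType R[i]) := BoundedOp {
  op_fun :> E -> E;
  op_bounded_linear : op_fun \in bounded_linear }.

HB.instance Definition _ (R : realType) (E : normedModType R[i]) :=
  [isSub for @op_fun R E].
HB.instance Definition _ (R : realType) (E : normedModType R[i]) :=
  [Choice of boundedOp E by <:].
HB.instance Definition _ (R : realType) (E : normedModType R[i]) :=
  [SubChoice_isSubLmodule of boundedOp E by <:].


Section OperatorNorm.
Context {R : realType} {E : normedModType R[i]}.
Implicit Types (T S : boundedOp E).

Definition opnorm T : R[i] :=
  ((sup [set complex.Re `|T x| | x in [set x | `|x| <= 1]])%:C)%C.

Lemma opP T : linear T /\ exists M : R, forall x, `|T x| <= M%:C%C * `|x|.
Proof. exact: set_mem (op_bounded_linear T). Qed.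

Lemma op0 T : T 0 = 0.
Proof.
by have := (opP T).1 (-1) 0 0; rewrite scaler0 addr0 scaleN1r addNr.
Qed.

Lemma opZ T (a : R[i]) x : T (a *: x) = a *: T x.
Proof. by have := (opP T).1 a x 0; rewrite op0 !addr0. Qed.

Lemma opnorm_has_sup T :
  has_sup [set complex.Re `|T x| | x in [set x | `|x| <= 1]].
Proof.
split; first by exists (complex.Re `|T 0|), 0 => //=; rewrite normr0.
have [_ [M TM]] := opP T; exists `|M| => _ [x /= x1 <-].
rewrite -(lecR (R := R)) (Re_norm (T x)) (le_trans (TM x))//.
rewrite (@le_trans _ _ (`|M|%:C%C * `|x|))//.
  by rewrite ler_wpM2r// lecR ler_norm.
by rewrite ler_piMr// lecR.
Qed.

Lemma opnorm_ge T x : `|x| <= 1 -> `|T x| <= opnorm T.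
Proof.
move=> x1; rewrite -(Re_norm (T x)) lecR; apply: ub_le_sup.
  exact: (opnorm_has_sup T).2.
by exists x.
Qed.

Lemma le_opnorm T x : `|T x| <= opnorm T * `|x|.
Proof.
have [->|x0] := eqVneq x 0; first by rewrite op0 !normr0 mulr0.
have nx0 : 0 < `|x| by rewrite normr_gt0.
rewrite -ler_pdivrMr// mulrC.
have -> : `|x|^-1 * `|T x| = `|T (`|x|^-1 *: x)|.
  by rewrite opZ normrZ ger0_norm// invr_ge0.
by apply: opnorm_ge; rewrite normrZ ger0_norm ?invr_ge0// mulVf// gt_eqF.
Qed.

Lemma opnorm_le T (M : R) :
  (forall x, `|x| <= 1 -> `|T x| <= (M%:C)%C) -> opnorm T <= (M%:C)%C.
Proof.
move=> TM; rewrite lecR; apply: ge_sup; first exact: (opnorm_has_sup T).1.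
by move=> _ [x /= x1 <-]; rewrite -(lecR (R := R)) (Re_norm (T x)) TM.
Qed.

Lemma opnormD T S : opnorm (T + S) <= opnorm T + opnorm S.
Proof.
rewrite -[leRHS]realcD; apply: opnorm_le => x x1; rewrite realcD.
by rewrite (le_trans (ler_normD _ _))// lerD// opnorm_ge.
Qed.

Lemma opnormZ (a : R[i]) T : opnorm (a *: T) = `|a| * opnorm T.
Proof.
have le_Z b S : opnorm (b *: S) <= `|b| * opnorm S.
  rewrite -(Re_normC b) -[leRHS]realcM; apply: opnorm_le => x x1.
  rewrite realcM (Re_normC b) normrZ ler_wpM2l//; exact: opnorm_ge.
apply/eqP; rewrite eq_le le_Z/=.
have [->|a0] := eqVneq a 0.
  rewrite normr0 mul0r; apply: le_trans (opnorm_ge _ (x := 0) _) => //.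
  by rewrite normr0.
rewrite -ler_pdivlMl ?normr_gt0// -normfV.
by rewrite -{1}[T](scalerK a0) le_Z.
Qed.

Lemma opnorm0_eq0 T : opnorm T = 0 -> T = 0.
Proof.
move=> T0; apply/val_inj/funext => x /=; apply/eqP; rewrite -normr_le0.
by rewrite (le_trans (le_opnorm T x))// T0 mul0r.
Qed.

HB.instance Definition _ := @Lmodule_isNormed.Build R[i] (boundedOp E)
  opnorm opnormD opnormZ opnorm0_eq0.

Lemma idop_subproof : (@idfun E) \in bounded_linear.
Proof.
by apply/mem_set; split=> // ; exists 1 => x /=; rewrite mul1r.
Qed.
Definition idop : boundedOp E := BoundedOp idop_subproof.

Lemma compop_subproof T S : (T \o S) \in bounded_linear.
Proof.
have [lT [M TM]] := opP T; have [lS [N SN]] := opP S.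
apply/mem_set; split=> [a x y /=|]; first by rewrite lS lT.
exists (`|M| * N) => x /=; rewrite realcM -mulrA.
apply: (le_trans (TM _)); apply: (@le_trans _ _ (`|M|%:C%C * `|S x|)).
  by rewrite ler_wpM2r// lecR ler_norm.
by rewrite ler_wpM2l// lecR.
Qed.
Definition compop T S : boundedOp E := BoundedOp (compop_subproof T S).

Definition inverse_of T S := compop T S = idop /\ compop S T = idop.
Definition op_invertible T := exists S, inverse_of T S.
(* junk value 0 when T is not invertible *)
Definition invop T : boundedOp E := xget 0 [set S | inverse_of T S].

Definition compact_op T := precompact (T @` [set x | `|x| <= 1]).

Definition op_ker T : set E := [set x | T x = 0].

(* The sizes of linearly independent families in P; +oo when unbounded. *)
Definition subspace_dim (P : set E) : \bar R :=
  ereal_sup [set (n%:R)%:E | n in [set n : nat |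
    exists2 v : 'I_n -> E, (forall i, P (v i)) &
      forall c : 'I_n -> R[i], \sum_i c i *: v i = 0 -> forall i, c i = 0]].

(* tr 1_L(T) for T compact selfadjoint and L away from 0: the spectral projection
   is then the sum of the eigenprojections. *)
Definition eigen_count T (L : set R) : \bar R :=
  \esum_(l in L) subspace_dim (op_ker (T - (l%:C)%C *: idop)).

End OperatorNorm.
Arguments idop {R} E.

Section HilbertSpace.
Context {R : realType} {H : completeNormedModType R[i]}.
Variable dot : {dot H for (@Num.conj R[i])}.
Implicit Types (T P : boundedOp H).

(* H is a Hilbert space for dot, linear in its first argument: completeness is
   part of completeNormedModType. *)
Definition hilbert_norm := forall x : H, `|x| ^+ 2 = dot x x.

Definition selfadjoint_op T := forall x y, dot (T x) y = dot x (T y).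

Definition orth_proj (K : set H) P :=
  forall x, K (P x) /\ forall y, K y -> dot (x - P x) y = 0.

(* T has finite rank and trace t; the operators whose trace is taken below,
   residues of F' F^-1, have finite rank. *)
Definition finite_rank_trace T (t : R[i]) :=
  exists n (u v : 'I_n -> H),
    (forall x, T x = \sum_i dot x (u i) *: v i) /\ t = \sum_i dot (v i) (u i).

End HilbertSpace.

Definition separable_space (T : topologicalType) :=
  exists2 S : set T, countable S & dense S.

Section ContourIntegral.
Context {R : realType} {V : normedModType R[i]}.

Definition is_riemann_integral (f : R -> V) (a b : R) (J : V) :=
  forall eps : R, 0 < eps -> exists2 delta : R, 0 < delta &
    forall (n : nat) (s xi : nat -> R), s 0%N = a -> s n = b ->
      (forall i, (i < n)%N -> s i <= xi i <= s i.+1 /\ s i.+1 - s i < delta) ->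
      `|\sum_(i < n) ((s i.+1 - s i)%:C)%C *: f (xi i) - J| < (eps%:C)%C.

Definition expi (t : R) : R[i] := (cos t +i* sin t)%C.

Definition is_circle_integral (G : R[i] -> V) (w : R[i]) (rho : R) (J : V) :=
  is_riemann_integral (fun t => ('i * (rho%:C)%C * expi t) *:
    G (w + (rho%:C)%C * expi t)) 0 (2 * pi) J.

End ContourIntegral.

Section CharacteristicValues.
Context {R : realType} {H : completeNormedModType R[i]}.
Variable dot : {dot H for (@Num.conj R[i])}.
Variables (D : set R[i]) (A : R[i] -> boundedOp H).

Definition holomorphic_on := forall z, D z -> derivable A z 1.

Definition char_fun (z : R[i]) : boundedOp H := idop H - z^-1 *: A z.

Definition char_value (w : R[i]) :=
  [/\ D w, w != 0 & ~ op_invertible (char_fun w)].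

Definition log_derivative (z : R[i]) : boundedOp H :=
  compop (derive1 char_fun z) (invop (char_fun z)).

Definition isolating_radius (w : R[i]) (rho : R) :=
  0 < rho /\ forall z, `|z - w| <= (rho%:C)%C ->
    [/\ D z, z != 0 & char_value z -> z = w].

Definition is_char_mult (w : R[i]) (m : int) :=
  exists (rho : R) (J : boundedOp H), [/\ isolating_radius w rho,
    is_circle_integral log_derivative w rho J &
    finite_rank_trace dot J (2 * (pi%:C)%C * 'i * m%:~R)].

(* junk value 0 when w is not an isolated characteristic value *)
Definition char_mult (w : R[i]) : int := xget 0 [set m | is_char_mult w m].

Definition char_count (Omega : set R[i]) : \bar R :=
  \esum_(w in Omega `&` char_value) ((char_mult w)%:~R)%:E.

End CharacteristicValues.

Section Asymptotics.
Context {R : realType}.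

Definition sector (theta a b : R) : set R[i] :=
  [set z | a <= complex.Re z <= b /\
    `|complex.Im z| <= theta * `|complex.Re z|].

Definition admissible_growth (Phi : R -> R) :=
  exists gamma C : R, [/\ 0 < gamma, 0 < C &
    [\/ forall r, Phi r = C * r `^ (- gamma),
        forall r, Phi r = C * `|ln r| `^ gamma
      | forall r, Phi r = C * (`|ln r| / ln `|ln r|)]].

(* As an equality in \bar R, this forces N r to be finite for r > 0 small. *)
Definition asymptotic_at0 (N : R -> \bar R) (Phi : R -> R) :=
  exists2 e : R -> R, e @ 0^'+ --> 0 &
    \forall r \near 0^'+, N r = (Phi r * (1 + e r))%:E.

End Asymptotics.

(* Main.v *)
(** Write [I - A(z)/z = z^-1 (z - A(0) - z B(z))] with [B(0) = A'(0)].  Since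
    [I - B(0) Pi0] is invertible, the part of this pencil outside the spectral
    window [[t/2, 2t]] of [A(0)] is invertible for small [z] close to [t], so the
    characteristic values [z = t u] with [u] close to [1] are the zeros of a
    determinant [f(u)] of size [n], the number of eigenvalues of [A(0)] in the
    window.  Off the real axis [ln |f(u)|] is
    [\sum_j ln |1 - lambda_j / (t u)| + o(n)]; in particular the zeros are almost
    real.  Comparing the fourth-order difference of [ln |f|] in the imaginary
    direction with the one computed from the zeros of [f] gives
    [\sum_zeros kern(Re u) - \sum_j kern(lambda_j / t) = o(k n)] for a bump
    kernel of width [k].  Summing these estimates over a geometric grid of scales
    [t] in [[r, t0]] turns the kernels into a nearly constant weight and bounds
    each counting function by the other one at a slightly different radius, up
    to [eta n([r/2, 1]) + O(1)]; the regular growth of [Phi] absorbs the errors. *)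

Require Import Defs.
From mathcomp Require Import all_boot all_order all_algebra.
From mathcomp Require Import all_classical all_reals all_analysis.
From mathcomp Require Import perm complex.
From mathcomp Require Import ring lra.

Set Implicit Arguments.
Unset Strict Implicit.
Unset Printing Implicit Defensive.

Import Order.TTheory GRing.Theory Num.Theory.
Import numFieldNormedType.Exports.

Local Open Scope classical_set_scope.
Local Open Scope ring_scope.

(* [lra] reifies the whole context: dropping the hypotheses that it cannot use
   makes it several times faster. *)
Ltac keep_inequalities := repeat match goal with H : ?T |- _ =>
  lazymatch type of T with Prop => lazymatch T with
  | is_true (Order.le _ _) => fail | is_true (Order.lt _ _) => fail
  | is_true (_ && _) => fail | is_true (_ || _) => fail | _ /\ _ => fail
  | @eq _ _ _ => fail | _ => clear H end end end.
Ltac slra := keep_inequalities; lra.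
Ltac snra := keep_inequalities; nra.

(** * Moduli in complex normed spaces *)

(** The kernel has mass of order [k], so an error of order [k n] would be fatal. Hence bounds on
    determinants have the form [c ^+ n], with logarithm linear in [n], and the constants are chosen
    in a fixed order: the zero-free factor costs [k ^+ 2] per eigenvalue and the approximation of
    [ln |f|] costs [eta / k], so [k] comes first and [eta] after it. On the axis [f] may vanish and
    nothing is known from below; this is why differences are taken in the imaginary direction and
    zeros are counted from a centre off the axis.

    The invertibility hypothesis enters through one fact: [z (z - T)^-1] tends strongly to the
    kernel projection, both for [T = A(0)] off the axis and for [A(0)] with its window removed near
    [t], and composition with the compact operator [B(0)] turns this into norm convergence with the
    same limit.

    Multiplicities are traces of operator-valued contour integrals; Jacobi's formula identifies them
    with orders of vanishing of a determinant. The function theory is therefore set up for values in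
    any sequentially complete complex normed space. Norms there lie in [R[i]], whose order is
    partial, and [nrm] brings them back to [R]. *)

Definition nrm (R : realType) (V : normedModType R[i]) (x : V) : R :=
  complex.Re `|x|.

Section Norm.
Context {R : realType}.
Implicit Types (V : normedModType R[i]) (a b : R[i]) (r : R).

Lemma nrmE V (x : V) : ((nrm x)%:C)%C = `|x|.
Proof. exact: Re_norm. Qed.

Lemma nrm_le V (x : V) r : (nrm x <= r) = (`|x| <= (r%:C)%C).
Proof. by rewrite -nrmE lecR. Qed.

Lemma nrm_lt V (x : V) r : (nrm x < r) = (`|x| < (r%:C)%C).
Proof. by rewrite -nrmE ltcR. Qed.

Lemma nrm_ge0 V (x : V) : 0 <= nrm x.
Proof. by rewrite -ler0c nrmE normr_ge0. Qed.

Lemma nrm0 V : nrm (0 : V) = 0.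
Proof. by apply: complexI; rewrite nrmE normr0. Qed.

Lemma nrm_eq0 V (x : V) : (nrm x == 0) = (x == 0).
Proof.
apply/eqP/eqP => [x0|->]; last exact: nrm0.
by apply/eqP; rewrite -normr_eq0 -nrmE x0.
Qed.

Lemma nrm_gt0 V (x : V) : (0 < nrm x) = (x != 0).
Proof. by rewrite lt_neqAle nrm_ge0 andbT eq_sym nrm_eq0. Qed.

Lemma nrmN V (x : V) : nrm (- x) = nrm x.
Proof. by rewrite /nrm normrN. Qed.

Lemma nrmD V (x y : V) : nrm (x + y) <= nrm x + nrm y.
Proof. by rewrite -lecR nrmE realcD !nrmE ler_normD. Qed.

Lemma nrmB V (x y : V) : nrm (x - y) <= nrm x + nrm y.
Proof. by rewrite -(nrmN y) nrmD. Qed.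

Lemma nrmBC V (x y : V) : nrm (x - y) = nrm (y - x).
Proof. by rewrite -nrmN opprB. Qed.

Lemma nrmB_tri V (x y z : V) : nrm (x - z) <= nrm (x - y) + nrm (y - z).
Proof. by rewrite -[x - z](subrKA y) nrmD. Qed.

Lemma nrmBD V (x y : V) : nrm x - nrm y <= nrm (x - y).
Proof. by rewrite lerBlDr -{1}(subrK y x) nrmD. Qed.

Lemma nrmZ V a (x : V) : nrm (a *: x) = nrm a * nrm x.
Proof. by apply: complexI; rewrite realcM !nrmE normrZ. Qed.

Lemma nrmM a b : nrm (a * b) = nrm a * nrm b.
Proof. exact: (nrmZ a (b : R[i])). Qed.

Lemma nrmR r : nrm (r%:C)%C = `|r|.
Proof.
apply: complexI; rewrite nrmE normc_def /= expr0n/= addr0 sqrtr_sqr.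
by [].
Qed.

Lemma nrmRZ V r (x : V) : nrm ((r%:C)%C *: x) = `|r| * nrm x.
Proof. by rewrite nrmZ nrmR. Qed.

Lemma nrm1 : nrm (1 : R[i]) = 1.
Proof. by rewrite -[1]/((1%:C)%C) nrmR normr1. Qed.

Lemma nrmi : nrm ('i%C : R[i]) = 1.
Proof.
apply: complexI; rewrite nrmE normc_def /= expr0n/= add0r expr1n sqrtr1.
by [].
Qed.

Lemma nrmV a : nrm a^-1 = (nrm a)^-1.
Proof.
have [->|a0] := eqVneq a 0; first by rewrite invr0 nrm0 invr0.
have na0 : nrm a != 0 by rewrite nrm_eq0.
by apply: (mulIf na0); rewrite -nrmM !mulVf// nrm1.
Qed.

Lemma nrmX a n : nrm (a ^+ n) = nrm a ^+ n.
Proof. by elim: n => [|n IH]; rewrite ?expr0 ?nrm1// !exprS nrmM IH. Qed.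

Lemma nrm_sum V I (s : seq I) (P : pred I) (f : I -> V) :
  nrm (\sum_(i <- s | P i) f i) <= \sum_(i <- s | P i) nrm (f i).
Proof.
elim/big_ind2 : _ => [||i _]; rewrite ?nrm0// => x y x' y' xy xy'.
by rewrite (le_trans (nrmD _ _))// lerD.
Qed.

Lemma nrm_prod I (s : seq I) (P : pred I) (f : I -> R[i]) :
  nrm (\prod_(i <- s | P i) f i) = \prod_(i <- s | P i) nrm (f i).
Proof. by apply: big_morph; [exact: nrmM | exact: nrm1]. Qed.

Lemma nrm_sqr a : nrm a ^+ 2 = complex.Re a ^+ 2 + complex.Im a ^+ 2.
Proof.
by apply: complexI; rewrite add_Re2_Im2 rmorphXn/= nrmE.
Qed.

Lemma Re_le_nrm a : `|complex.Re a| <= nrm a.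
Proof.
rewrite -(@ler_pXn2r _ 2)// ?nnegrE ?nrm_ge0// nrm_sqr real_normK ?num_real//.
by rewrite lerDl sqr_ge0.
Qed.

Lemma Im_le_nrm a : `|complex.Im a| <= nrm a.
Proof.
rewrite -(@ler_pXn2r _ 2)// ?nnegrE ?nrm_ge0// nrm_sqr real_normK ?num_real//.
by rewrite lerDr sqr_ge0.
Qed.

Lemma nrm_le_ReIm a : nrm a <= `|complex.Re a| + `|complex.Im a|.
Proof.
rewrite -(@ler_pXn2r _ 2)// ?nnegrE ?nrm_ge0 ?addr_ge0// nrm_sqr.
rewrite -(real_normK (num_real (complex.Re a))).
rewrite -(real_normK (num_real (complex.Im a))).
have := normr_ge0 (complex.Re a); have := normr_ge0 (complex.Im a); snra.
Qed.

Lemma cReD a b : complex.Re (a + b) = complex.Re a + complex.Re b.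
Proof. by case: a b => [? ?] []. Qed.
Lemma cImD a b : complex.Im (a + b) = complex.Im a + complex.Im b.
Proof. by case: a b => [? ?] []. Qed.
Lemma cReN a : complex.Re (- a) = - complex.Re a.
Proof. by case: a. Qed.
Lemma cImN a : complex.Im (- a) = - complex.Im a.
Proof. by case: a. Qed.
Lemma cReM a b : complex.Re (a * b) =
  complex.Re a * complex.Re b - complex.Im a * complex.Im b.
Proof. by case: a b => [? ?] []. Qed.
Lemma cImM a b : complex.Im (a * b) =
  complex.Re a * complex.Im b + complex.Im a * complex.Re b.
Proof. by case: a b => [? ?] []. Qed.
Lemma ReC r : complex.Re (r%:C)%C = r. Proof. by []. Qed.
Lemma ImC r : complex.Im (r%:C)%C = 0. Proof. by []. Qed.

Lemma complex_eq a b :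
  complex.Re a = complex.Re b -> complex.Im a = complex.Im b -> a = b.
Proof. by case: a b => [? ?] [? ?] /= -> ->. Qed.

Lemma nrm_conj a : nrm (a^*)%C = nrm a.
Proof. by rewrite /nrm normcJ. Qed.

End Norm.

(** * Limits of sequences and sequential completeness *)

Section Sequences.
Context {R : realType}.
Implicit Types V : normedModType R[i].

Definition slim V (u : nat -> V) (l : V) :=
  forall e : R, 0 < e -> exists n0, forall n, (n0 <= n)%N -> nrm (u n - l) < e.

Definition scauchy V (u : nat -> V) :=
  forall e : R, 0 < e -> exists n0, forall n m, (n0 <= n)%N -> (n0 <= m)%N ->
    nrm (u n - u m) < e.

(** A predicate on a normed space, so that the Cauchy theory applies alike to [R[i]], to [H] and to
    [boundedOp H]; see [seqcompleteC], [complete_seqcomplete] and [seqcomplete_op]. *)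
Definition seqcomplete V := forall u : nat -> V, scauchy u -> exists l, slim u l.

Lemma slim_unique V (u : nat -> V) l l' : slim u l -> slim u l' -> l = l'.
Proof.
move=> ul ul'; apply/eqP; rewrite -subr_eq0 -nrm_eq0; apply/eqP/le_anti.
rewrite nrm_ge0 andbT; apply/ler_addgt0Pr => e e0; rewrite add0r.
have e2 : 0 < e / 2 by rewrite divr_gt0.
have [n hn] := ul _ e2; have [m hm] := ul' _ e2.
have := hn (maxn n m) (leq_maxl _ _); have := hm (maxn n m) (leq_maxr _ _).
have := nrmB_tri l (u (maxn n m)) l'; rewrite (nrmBC l (u _)); slra.
Qed.

Lemma slim_le V (u : nat -> V) l (x : V) (r : R) n0 :
  slim u l -> (forall n, (n0 <= n)%N -> nrm (u n - x) <= r) -> nrm (l - x) <= r.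
Proof.
move=> ul ur; apply/ler_addgt0Pr => e e0; have [n hn] := ul _ e0.
have := hn (maxn n n0) (leq_maxl _ _); have := ur _ (leq_maxr n n0).
have := nrmB_tri l (u (maxn n n0)) x; rewrite (nrmBC l (u _)); slra.
Qed.

Lemma slimD V (u v : nat -> V) l m : slim u l -> slim v m ->
  slim (fun n => u n + v n) (l + m).
Proof.
move=> ul vm e e0; have e2 : 0 < e / 2 by rewrite divr_gt0.
have [n1 h1] := ul _ e2; have [n2 h2] := vm _ e2; exists (maxn n1 n2) => n.
rewrite geq_max => /andP[/h1 ? /h2 ?]; rewrite opprD addrACA.
by have := nrmD (u n - l) (v n - m); slra.
Qed.

Lemma slim_lin V (W : normedModType R[i]) (f : V -> W) (K : R) u l :
  (forall x y, f (x - y) = f x - f y) -> (forall x, nrm (f x) <= K * nrm x) ->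
  slim u l -> slim (fun n => f (u n)) (f l).
Proof.
move=> fB fK ul e e0; have K1 : 0 < `|K| + 1 by have := normr_ge0 K; slra.
have [n0 hn] := ul (e / (`|K| + 1)) ltac:(by rewrite divr_gt0).
exists n0 => n /hn; rewrite -fB ltr_pdivlMr// => h.
have := fK (u n - l); have := nrm_ge0 (u n - l); have := ler_norm K; snra.
Qed.

Lemma slim_cst V (x : V) : slim (fun=> x) x.
Proof. by move=> e e0; exists 0%N => n _; rewrite subrr nrm0. Qed.

Lemma slim_eq V (u v : nat -> V) l : u =1 v -> slim u l -> slim v l.
Proof. by move=> uv ul e /ul[n0 h]; exists n0 => n /h; rewrite uv. Qed.

Lemma nbhs_nrmP V (x : V) (P : set V) :
  nbhs x P <-> exists2 d : R, 0 < d & forall y, nrm (y - x) < d -> P y.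
Proof.
rewrite -nbhs_ballE; split=> [[d /= d0 dP]|[d d0 dP]].
  exists (complex.Re d); first by case: d d0 {dP} => a b; rewrite ltcE/= => /andP[].
  move=> y yx; apply: dP; rewrite -ball_normE /ball_ /= -normrN opprB.
  by move: yx; rewrite nrm_lt RRe_real// gtr0_real.
exists (d%:C)%C => /=; first by rewrite ltcR.
move=> y; rewrite -ball_normE /ball_ /= => xy; apply: dP.
by rewrite nrmBC nrm_lt.
Qed.

Lemma complete_seqcomplete (V : completeNormedModType R[i]) : seqcomplete V.
Proof.
move=> u cu; have cvu : cvg (u @ \oo).
  apply/cauchy_cvgP/cauchy_ballP => e e0.
  have [|n0 hn0] := cu (complex.Re e).
    by case: e e0 => a b; rewrite ltcE/= => /andP[].
  pose S := [set u n | n in [set n | (n0 <= n)%N]].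
  have S_oo : \forall n \near \oo, S (u n) by exists n0 => // n ?; exists n.
  exists (S, S) => // -[_ _] /= [[n nn <-] [m mm <-]].
  rewrite -ball_normE /ball_ /=.
  by have := hn0 n m nn mm; rewrite nrm_lt RRe_real// gtr0_real.
exists (lim (u @ \oo)) => e e0.
have : nbhs (lim (u @ \oo)) [set y | nrm (y - lim (u @ \oo)) < e].
  by apply/(@nbhs_nrmP V); exists e.
move=> /cvu[n0 _ hn]; exists n0 => n nn; exact: hn.
Qed.

Lemma seqcompleteC : seqcomplete (R[i] : normedModType R[i]).
Proof.
move=> u cu.
have cvgR (v : nat -> R) : (forall n m, `|v n - v m| <= nrm (u n - u m)) ->
    exists l, forall e, 0 < e -> exists n0, forall n, (n0 <= n)%N -> `|v n - l| < e.
  move=> vu; have cvv : cvg (v @ \oo).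
    apply/cauchy_cvgP/cauchy_ballP => e e0; have [n0 hn0] := cu e e0.
    pose S := [set v n | n in [set n | (n0 <= n)%N]].
    have S_oo : \forall n \near \oo, S (v n) by exists n0 => // n ?; exists n.
    exists (S, S) => // -[_ _] /= [[n nn <-] [m mm <-]].
    rewrite -ball_normE /ball_ /=.
    exact: le_lt_trans (vu _ _) (hn0 n m nn mm).
  exists (lim (v @ \oo)) => e e0.
  have /cvgrPdist_lt /(_ _ e0)[n0 _ hn] := cvv; exists n0 => n nn.
  by rewrite distrC; exact: hn.
have [a ha] : exists l, forall e, 0 < e -> exists n0, forall n, (n0 <= n)%N ->
    `|complex.Re (u n) - l| < e.
  by apply: cvgR => n m; rewrite -cReN -cReD Re_le_nrm.
have [b hb] : exists l, forall e, 0 < e -> exists n0, forall n, (n0 <= n)%N ->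
    `|complex.Im (u n) - l| < e.
  by apply: cvgR => n m; rewrite -cImN -cImD Im_le_nrm.
exists (a +i* b)%C => e e0; have e2 : 0 < e / 2 by rewrite divr_gt0.
have [n1 h1] := ha _ e2; have [n2 h2] := hb _ e2; exists (maxn n1 n2) => n.
rewrite geq_max => /andP[/h1 ? /h2 ?].
by have := nrm_le_ReIm (u n - (a +i* b)%C); rewrite cReD cReN cImD cImN/=; slra.
Qed.

End Sequences.

(** * Bisection arguments *)

Section Cousin.
Context {R : realType}.

(* A property of rectangles [x, x + a] x [y, y + b] inherited from the four
   quarters holds everywhere once it holds for small rectangles around each
   point. *)
Lemma cousin2 (P : R -> R -> R -> R -> Prop) (x0 y0 a0 b0 : R) :
  0 <= a0 -> 0 <= b0 ->
  (forall x y a b, x0 <= x -> x + a <= x0 + a0 -> y0 <= y -> y + b <= y0 + b0 ->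
    0 <= a -> 0 <= b ->
    P x y (a / 2) (b / 2) -> P (x + a / 2) y (a / 2) (b / 2) ->
    P x (y + b / 2) (a / 2) (b / 2) -> P (x + a / 2) (y + b / 2) (a / 2) (b / 2) ->
    P x y a b) ->
  (forall X Y, x0 <= X <= x0 + a0 -> y0 <= Y <= y0 + b0 -> exists2 d, 0 < d &
    forall x y a b, x0 <= x -> x + a <= x0 + a0 -> y0 <= y -> y + b <= y0 + b0 ->
    x <= X <= x + a -> y <= Y <= y + b -> a < d -> b < d -> P x y a b) ->
  P x0 y0 a0 b0.
Proof.
move=> a00 b00 Psplit Ploc; apply: contrapT => nP.
(* Some quarter of a bad rectangle is bad; nested bad rectangles shrink to a point [(X, Y)], where
   the local hypothesis gives the contradiction. *)
pose an n := a0 / 2 ^+ n; pose bn n := b0 / 2 ^+ n.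
have anS n : an n.+1 = an n / 2 by rewrite /an exprSr invfM mulrA.
have bnS n : bn n.+1 = bn n / 2 by rewrite /bn exprSr invfM mulrA.
have an0 n : 0 <= an n by rewrite divr_ge0// exprn_ge0.
have bn0 n : 0 <= bn n by rewrite divr_ge0// exprn_ge0.
pose Q n (p : R * R) := [/\ x0 <= p.1, p.1 + an n <= x0 + a0, y0 <= p.2,
  p.2 + bn n <= y0 + b0 & ~ P p.1 p.2 (an n) (bn n)].
pose T n (p q : R * R) := [/\ p.1 <= q.1, q.1 + an n.+1 <= p.1 + an n,
  p.2 <= q.2 & q.2 + bn n.+1 <= p.2 + bn n].
have step n p : exists q, Q n p -> Q n.+1 q /\ T n p q.
  have [[q1 q2 q3 q4 q5]|nQ] := pselect (Q n p); last by exists p => /nQ.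
  have ha := an0 n; have hb := bn0 n.
  apply: contrapT => nq; apply: q5; apply: Psplit => //; rewrite -anS -bnS;
    apply: contrapT => nP'; apply: nq.
  - by exists p; split; split; rewrite /= ?anS ?bnS//; try slra; rewrite -anS -bnS.
  - by exists (p.1 + an n.+1, p.2); split; split; rewrite /= ?anS ?bnS//; try slra;
      rewrite -anS -bnS.
  - by exists (p.1, p.2 + bn n.+1); split; split; rewrite /= ?anS ?bnS//; try slra;
      rewrite -anS -bnS.
  - by exists (p.1 + an n.+1, p.2 + bn n.+1); split; split; rewrite /= ?anS ?bnS//;
      try slra; rewrite -anS -bnS.
have [f hf] : exists f : nat -> R * R -> R * R, forall n p, Q n p ->
    Q n.+1 (f n p) /\ T n p (f n p).
  have /choice[f hf] : forall np : nat * (R * R), exists q, Q np.1 np.2 ->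
    Q np.1.+1 q /\ T np.1 np.2 q by move=> [n p]; exact: step.
  by exists (fun n p => f (n, p)) => n p; exact: (hf (n, p)).
pose u := fix u n : R * R := if n is m.+1 then f m (u m) else (x0, y0).
have uQ n : Q n (u n).
  elim: n => [|n IH]; last exact: (hf n _ IH).1.
  by split; rewrite /= /an /bn ?expr0 ?divr1.
have uT n : T n (u n) (u n.+1) by exact: (hf n _ (uQ n)).2.
have uTk n k : [/\ (u n).1 <= (u (n + k)%N).1, (u (n + k)%N).1 + an (n + k)%N <= (u n).1 + an n,
   (u n).2 <= (u (n + k)%N).2 & (u (n + k)%N).2 + bn (n + k)%N <= (u n).2 + bn n].
  elim: k => [|k [h1 h2 h3 h4]]; first by rewrite addn0.
  by rewrite addnS; have [k1 k2 k3 k4] := uT (n + k)%N; split; slra.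
have sandwich (v : nat -> R) (c : nat -> R) :
    (forall n, 0 <= c n) ->
    (forall n k, v n <= v (n + k)%N /\ v (n + k)%N + c (n + k)%N <= v n + c n) ->
    exists X, forall n, v n <= X <= v n + c n.
  move=> c0 vc; exists (sup (range v)) => n.
  have ub m : ubound (range v) (v m + c m).
    move=> _ [k _ <-]; have [mk|/ltnW km] := leqP m k.
      by have [_] := vc m (k - m)%N; rewrite subnKC//; have := c0 k; slra.
    have [+ _] := vc k (m - k)%N; rewrite subnKC//; have := c0 m; slra.
  apply/andP; split.
    by apply: ub_le_sup; [exists (v n + c n); exact: ub | exists n].
  by apply: ge_sup; [exists (v n), n | exact: ub].
have [X hX] := sandwich (fun n => (u n).1) an an0
  (fun n k => let: And4 h1 h2 _ _ := uTk n k in conj h1 h2).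
have [Y hY] := sandwich (fun n => (u n).2) bn bn0
  (fun n k => let: And4 _ _ h1 h2 := uTk n k in conj h1 h2).
have X0 := hX 0%N; have Y0 := hY 0%N; rewrite /an /bn expr0 !divr1 /= in X0 Y0.
have [d d0 hd] := Ploc X Y X0 Y0.
have [n hn] : exists n, a0 + b0 < d * 2 ^+ n.
  pose m := Num.trunc ((a0 + b0) / d); exists m.+1.
  rewrite -ltr_pdivrMl// mulrC.
  have := truncnS_gt ((a0 + b0) / d); rewrite -/m => /lt_le_trans; apply.
  by rewrite -natrX ler_nat ltnW// ltn_expl.
have [q1 q2 q3 q4 q5] := uQ n; apply: q5; apply: hd => //.
- by rewrite /an ltr_pdivrMr ?exprn_gt0//; slra.
- by rewrite /bn ltr_pdivrMr ?exprn_gt0//; slra.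
Qed.

Lemma cousin1 (P : R -> R -> Prop) (x0 a0 : R) : 0 <= a0 ->
  (forall x a, x0 <= x -> x + a <= x0 + a0 -> 0 <= a ->
    P x (a / 2) -> P (x + a / 2) (a / 2) -> P x a) ->
  (forall X, x0 <= X <= x0 + a0 -> exists2 d, 0 < d &
    forall x a, x0 <= x -> x + a <= x0 + a0 -> x <= X <= x + a -> a < d -> P x a) ->
  P x0 a0.
Proof.
move=> a00 Ps Pl; apply: (@cousin2 (fun x _ a _ => P x a) x0 0 a0 0) => //.
  by move=> x y a b h1 h2 _ _ h3 _ h4 h5 _ _; exact: Ps.
move=> X Y hX _; have [d d0 hd] := Pl X hX; exists d => // x y a b ? ? _ _ ? _ ? _.
exact: hd.
Qed.

End Cousin.

(** * Dyadic means *)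

Lemma realcX (R : realType) (x : R) n : ((x ^+ n)%:C = (x%:C) ^+ n)%C.
Proof. exact: rmorphXn. Qed.

Section DyadicMean.
Context {R : realType} {V : normedModType R[i]}.
Implicit Types (f g : R -> V) (l : V) (e : R).

(** Left Riemann sum on [[0, 1]]. Dyadic meshes make the recursion [dsumS] exact, so that estimates
    go by induction on [n] and cutting a path in two is an identity between means. *)
Definition dsum f n : V :=
  ((2 ^- n)%:C)%C *: \sum_(k < 2 ^ n) f (k%:R / 2 ^+ n).

Definition is_mean f l := slim (dsum f) l.

(* junk value 0 when the dyadic sums diverge *)
Definition mn f : V := xget 0 [set l | is_mean f l].

Definition ucont f := forall e, 0 < e -> exists2 d : R, 0 < d &
  forall u v, 0 <= u <= 1 -> 0 <= v <= 1 -> `|u - v| < d -> nrm (f u - f v) < e.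

Lemma dsum0 f : dsum f 0 = f 0.
Proof.
by rewrite /dsum !expr0 invr1 scale1r expn0 big_ord1 mul0r.
Qed.

Lemma dsumS f n : dsum f n.+1 =
  ((2^-1)%:C)%C *: (dsum (fun u => f (u / 2)) n + dsum (fun u => f ((1 + u) / 2)) n).
Proof.
rewrite /dsum -scalerDr scalerA -rmorphM/= -invfM -exprS.
congr (_ *: _).
have -> : (\sum_(k < 2 ^ n.+1) f (k%:R / 2 ^+ n.+1) =
    \sum_(k < 2 ^ n + 2 ^ n) f (k%:R / 2 ^+ n.+1)).
  by rewrite addnn -mul2n -expnS.
rewrite big_split_ord/=; congr (_ + _); apply: eq_bigr => k _; congr f.
  by rewrite exprSr invfM mulrA.
have n0 : (2 : R) ^+ n != 0 by rewrite expf_neq0.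
rewrite natrD natrX exprSr invfM mulrA; congr (_ / 2).
by rewrite mulrDl divff.
Qed.

Lemma half_in (u : R) : 0 <= u <= 1 -> 0 <= u / 2 <= 1 /\ 0 <= (1 + u) / 2 <= 1.
Proof. by move=> /andP[? ?]; split; apply/andP; split; slra. Qed.

Lemma dsum_dist f g n e : (forall u, 0 <= u <= 1 -> nrm (f u - g u) <= e) ->
  nrm (dsum f n - dsum g n) <= e.
Proof.
elim: n f g => [|n IH] f g fg.
  by rewrite !dsum0; apply: fg; rewrite lexx ler01.
rewrite !dsumS -scalerBr nrmRZ gtr0_norm ?invr_gt0// opprD addrACA.
have h1 := IH (fun u => f (u / 2)) (fun u => g (u / 2))
  (fun u hu => fg _ (half_in hu).1).
have h2 := IH (fun u => f ((1 + u) / 2)) (fun u => g ((1 + u) / 2))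
  (fun u hu => fg _ (half_in hu).2).
by have := nrmD (dsum (fun u => f (u / 2)) n - dsum (fun u => g (u / 2)) n)
  (dsum (fun u => f ((1 + u) / 2)) n - dsum (fun u => g ((1 + u) / 2)) n); slra.
Qed.

Lemma dsum_cst (x : V) n : dsum (fun=> x) n = x.
Proof.
rewrite /dsum sumr_const card_ord -[x *+ _]scaler_nat scalerA natrX.
have -> : (2 : R[i]) = (2%:C)%C by rewrite rmorph_nat.
by rewrite -realcX -realcM mulVf ?expf_neq0// scale1r.
Qed.

(** Induction on [n] through [dsumS]: passing to a half doubles the scale at which the oscillation
    is controlled, and for [n = 0] the sum is the single value [f 0]. *)
Lemma dsum_cauchy f n e :
  (forall u v, 0 <= u <= 1 -> 0 <= v <= 1 -> `|u - v| <= 2 ^- n ->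
     nrm (f u - f v) <= e) ->
  forall j, nrm (dsum f (n + j) - dsum f n) <= e.
Proof.
elim: n f => [|n IH] f fe j.
  rewrite add0n dsum0 -(dsum_cst (f 0) j); apply: dsum_dist => u u1.
  apply: fe => //; first by rewrite lexx ler01.
  rewrite subr0 expr0 invr1 ger0_norm; slra.
rewrite addSn !dsumS -scalerBr nrmRZ gtr0_norm ?invr_gt0// opprD addrACA.
have hh (s : R) : forall u v : R, `|u - v| <= 2 ^- n ->
    `|(s + u) / 2 - (s + v) / 2| <= 2 ^- n.+1.
  move=> u v uv; rewrite -mulrBl opprD addrACA subrr add0r normrM.
  by rewrite exprSr invfM [X in _ * X]ger0_norm ?ler_wpM2r// invr_ge0.
have h1 := IH (fun u => f (u / 2)) (fun u v hu hv uv =>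
  fe _ _ (half_in hu).1 (half_in hv).1
     ltac:(by have := hh 0 u v uv; rewrite !add0r)) j.
have h2 := IH (fun u => f ((1 + u) / 2)) (fun u v hu hv uv =>
  fe _ _ (half_in hu).2 (half_in hv).2 (hh 1 u v uv)) j.
by have := nrmD (dsum (fun u => f (u / 2)) (n + j) - dsum (fun u => f (u / 2)) n)
  (dsum (fun u => f ((1 + u) / 2)) (n + j) - dsum (fun u => f ((1 + u) / 2)) n); slra.
Qed.

Lemma exp2V_small (d : R) : 0 < d -> exists n, 2 ^- n < d.
Proof.
move=> d0; exists (Num.trunc d^-1).+1.
rewrite -[ltRHS]invrK ltf_pV2 ?posrE ?invr_gt0 ?exprn_gt0//.
have := truncnS_gt d^-1 => /lt_le_trans; apply.
by rewrite -natrX ler_nat ltnW// ltn_expl.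
Qed.

Lemma ucont_mean f : seqcomplete V -> ucont f -> exists l, is_mean f l.
Proof.
move=> cV uf; apply: cV => e e0.
have [d d0 hd] := uf (e / 3) ltac:(by rewrite divr_gt0).
have [n0 hn0] := exp2V_small d0.
have h k : (n0 <= k)%N -> nrm (dsum f k - dsum f n0) <= e / 3.
  move=> /subnKC <-; apply: dsum_cauchy => u v hu hv uv; apply/ltW/hd => //.
  exact: le_lt_trans hn0.
exists n0 => n m /h hn /h hm.
by have := nrmB_tri (dsum f n) (dsum f n0) (dsum f m); rewrite (nrmBC (dsum f n0)); slra.
Qed.

Lemma mnE f l : is_mean f l -> mn f = l.
Proof.
move=> fl; have := xgetI 0 fl; rewrite -/(mn f) => h.
exact: slim_unique h fl.
Qed.

Lemma mnP f : seqcomplete V -> ucont f -> is_mean f (mn f).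
Proof. by move=> cV /(ucont_mean cV)[l fl]; rewrite (mnE fl). Qed.

Lemma is_mean_eq f g l : (forall u, 0 <= u <= 1 -> f u = g u) ->
  is_mean f l -> is_mean g l.
Proof.
move=> fg; apply: slim_eq => n; apply/eqP; rewrite -subr_eq0 -nrm_eq0.
apply/eqP/le_anti; rewrite nrm_ge0 andbT; apply: dsum_dist => u /fg ->.
by rewrite subrr nrm0.
Qed.

Lemma mn_eq f g : (forall u, 0 <= u <= 1 -> f u = g u) -> mn f = mn g.
Proof.
move=> fg; congr xget; apply/seteqP; split => l; apply: is_mean_eq => // u hu.
by rewrite fg.
Qed.

Lemma is_mean_cst (x : V) : is_mean (fun=> x) x.
Proof. by apply: slim_eq (slim_cst x) => n; rewrite dsum_cst. Qed.

Lemma is_meanD f g l m : is_mean f l -> is_mean g m ->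
  is_mean (fun u => f u + g u) (l + m).
Proof.
move=> fl gm; apply: slim_eq (slimD fl gm) => n.
by rewrite /dsum -scalerDr -big_split.
Qed.

Lemma is_mean_dist f g l m e : is_mean f l -> is_mean g m ->
  (forall u, 0 <= u <= 1 -> nrm (f u - g u) <= e) -> nrm (l - m) <= e.
Proof.
move=> fl gm fg; apply/ler_addgt0Pr => d d0.
have [n1 h1] := fl (d / 2) ltac:(by rewrite divr_gt0).
have [n2 h2] := gm (d / 2) ltac:(by rewrite divr_gt0).
pose n := maxn n1 n2.
have := h1 n (leq_maxl _ _); have := h2 n (leq_maxr _ _).
have := dsum_dist n fg.
have := nrmB_tri l (dsum f n) m; have := nrmB_tri (dsum f n) (dsum g n) m.
by rewrite (nrmBC l (dsum f n)); slra.
Qed.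

Lemma is_mean_bound f l e : is_mean f l ->
  (forall u, 0 <= u <= 1 -> nrm (f u) <= e) -> nrm l <= e.
Proof.
move=> fl fe; rewrite -(subr0 l); apply: is_mean_dist fl (is_mean_cst 0) _ => u.
by rewrite subr0; exact: fe.
Qed.

Lemma is_mean_half f l m : is_mean (fun u => f (u / 2)) l ->
  is_mean (fun u => f ((1 + u) / 2)) m -> is_mean f (((2^-1)%:C)%C *: (l + m)).
Proof.
move=> fl fm e e0; have [n1 h1] := fl _ e0; have [n2 h2] := fm _ e0.
exists (maxn n1 n2).+1 => -[//|n]; rewrite ltnS geq_max => /andP[/h1 k1 /h2 k2].
rewrite dsumS -scalerBr nrmRZ gtr0_norm ?invr_gt0// opprD addrACA.
by have := nrmD (dsum (fun u => f (u / 2)) n - l)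
  (dsum (fun u => f ((1 + u) / 2)) n - m); slra.
Qed.

(** Heine's theorem by bisection; continuity at the midpoint [x + a / 2] joins the moduli of the two
    halves. *)
Lemma ucontP f : (forall u, 0 <= u <= 1 -> forall e, 0 < e ->
    exists2 d : R, 0 < d & forall v, 0 <= v <= 1 -> `|v - u| < d ->
      nrm (f v - f u) < e) -> ucont f.
Proof.
move=> cf e e0; pose P (x a : R) := exists2 d : R, 0 < d &
  forall u v, x <= u <= x + a -> x <= v <= x + a -> `|u - v| < d -> nrm (f u - f v) < e.
suff: P 0 1 by rewrite /P add0r.
apply: cousin1 => //.
  move=> x a x0 xa a0 [d1 d10 h1] [d2 d20 h2].
  have [d3 d30 h3] := cf (x + a / 2) ltac:(by apply/andP; slra)
    (e / 2) ltac:(by rewrite divr_gt0).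
  exists (Num.min d3 (Num.min d1 d2)); first by rewrite !lt_min d10 d20 d30.
  have key u v : x <= u <= x + a / 2 -> x + a / 2 <= v <= x + a ->
      `|u - v| < d3 -> nrm (f u - f v) < e.
    move=> /andP[u1 u2] /andP[v1 v2] uv.
    have k1 := h3 u ltac:(by apply/andP; slra) ltac:(by move: uv; rewrite !ltr_norml; slra).
    have k2 := h3 v ltac:(by apply/andP; slra) ltac:(by move: uv; rewrite !ltr_norml; slra).
    by have := nrmB_tri (f u) (f (x + a / 2)) (f v); rewrite (nrmBC (f (x + a / 2)) (f v)); slra.
  move=> u v /andP[u1 u2] /andP[v1 v2]; rewrite !lt_min => /and3P[q3 q1 q2].
  have [um|um] := leP u (x + a / 2); have [vm|vm] := leP v (x + a / 2).
  - by apply: h1 => //; apply/andP.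
  - by apply: key => //; apply/andP; slra.
  - by rewrite nrmBC; apply: key; rewrite 1?distrC//; apply/andP; slra.
  - by apply: h2 => //; apply/andP; slra.
move=> X; rewrite add0r => X01.
have [d d0 hd] := cf X X01 (e / 2) ltac:(by rewrite divr_gt0).
exists d => // x a x0 xa /andP[xX Xa] ad; exists 1 => // u v /andP[u1 u2] /andP[v1 v2] _.
have k1 := hd u ltac:(by apply/andP; slra) ltac:(by rewrite ltr_norml; slra).
have k2 := hd v ltac:(by apply/andP; slra) ltac:(by rewrite ltr_norml; slra).
by have := nrmB_tri (f u) (f X) (f v); rewrite (nrmBC (f X) (f v)); slra.
Qed.

End DyadicMean.

Lemma is_mean_lin (R : realType) (V W : normedModType R[i]) (L : V -> W) (K : R)
  (f : R -> V) l :
  (forall x y, L (x + y) = L x + L y) -> (forall a x, L (a *: x) = a *: L x) ->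
  (forall x, nrm (L x) <= K * nrm x) ->
  is_mean f l -> is_mean (fun u => L (f u)) (L l).
Proof.
move=> LD LZ LK fl.
have LB x y : L (x - y) = L x - L y by rewrite LD -scaleN1r LZ scaleN1r.
have L0 : L 0 = 0 by rewrite -(scale0r 0) LZ scale0r.
apply: slim_eq (slim_lin LB LK fl) => n; rewrite /dsum LZ; congr (_ *: _).
by rewrite (big_morph L LD L0).
Qed.

(** * Complex differentiation in normed spaces *)

Section HolDeriv.
Context {R : realType}.
Implicit Types (V W : normedModType R[i]) (z : R[i]).

(** The complex derivative in epsilon form with real bounds; [hd_derive] and [derivable_hd] relate
    it to [derivable] and [derive1]. *)
Definition hd V (f : R[i] -> V) z (c : V) := forall e : R, 0 < e ->
  exists2 d : R, 0 < d & forall h, nrm h < d ->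
    nrm (f (z + h) - f z - h *: c) <= e * nrm h.

Definition hol V (f : R[i] -> V) z := exists c, hd f z c.

Definition ccont V (f : R[i] -> V) z := forall e : R, 0 < e ->
  exists2 d : R, 0 < d & forall y, nrm (y - z) < d -> nrm (f y - f z) < e.

Lemma hd_near V (f g : R[i] -> V) z c (r : R) : 0 < r ->
  (forall y, nrm (y - z) < r -> f y = g y) -> hd f z c -> hd g z c.
Proof.
move=> r0 fg fc e e0; have [d d0 hdd] := fc e e0.
exists (Num.min d r); first by rewrite lt_min d0.
move=> h; rewrite lt_min => /andP[hhd hr].
rewrite -(fg z) ?subrr ?nrm0// -(fg (z + h)); first exact: hdd.
by rewrite addrC addKr.
Qed.

Lemma hol_near V (f g : R[i] -> V) z (r : R) : 0 < r ->
  (forall y, nrm (y - z) < r -> f y = g y) -> hol f z -> hol g z.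
Proof. by move=> r0 fg [c fc]; exists c; exact: (hd_near r0 fg fc). Qed.

Lemma hd_ext V (f g : R[i] -> V) z c : f =1 g -> hd f z c -> hd g z c.
Proof. by move=> fg; apply: (hd_near ltr01) => y _; exact: fg. Qed.

Lemma hd_ccont V (f : R[i] -> V) z c : hd f z c -> ccont f z.
Proof.
move=> fc e e0; have [d d0 hdd] := fc 1 ltr01.
have c1 : 0 < nrm c + 1 by have := nrm_ge0 c; slra.
exists (Num.min d (e / (nrm c + 1))); first by rewrite lt_min d0 divr_gt0.
move=> y; rewrite lt_min ltr_pdivlMr// => /andP[/hdd].
rewrite [z + _]addrC subrK mul1r => h1 h2.
have := nrmD (f y - f z - (y - z) *: c) ((y - z) *: c).
by rewrite subrK nrmZ; snra.
Qed.

Lemma hol_ccont V (f : R[i] -> V) z : hol f z -> ccont f z.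
Proof. by move=> [c /hd_ccont]. Qed.

Lemma hd_cvg V (f : R[i] -> V) z c : hd f z c ->
  (h^-1 *: (f (h + z) - f z)) @[h --> 0^'] --> c.
Proof.
move=> fc; apply/cvgrPdist_le => /= e e0.
have [|d d0 hdd] := fc (complex.Re e).
  by case: e e0 => a b; rewrite ltcE/= => /andP[].
near=> h.
have h0 : h != 0 by near: h; exact: nbhs_dnbhs_neq.
have hd' : nrm h < d.
  near: h; apply: nbhs_dnbhs; apply/(@nbhs_nrmP R (R[i] : normedModType R[i])).
  by exists d => // y; rewrite subr0.
have hh := hdd h hd'.
rewrite -[X in _ <= X]RRe_real ?gtr0_real// -nrm_le nrmBC.
rewrite (_ : _ - c = h^-1 *: (f (z + h) - f z - h *: c)).
  by rewrite nrmZ nrmV ler_pdivrMl ?nrm_gt0// mulrC.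
by rewrite [RHS]scalerBr scalerA mulVf// scale1r (addrC z).
Unshelve. all: by end_near. Qed.

Lemma hd_derive V (f : R[i] -> V) z c : hd f z c ->
  derivable f z 1 /\ derive1 f z = c.
Proof.
move=> /hd_cvg fc; split; last first.
  by apply/cvg_lim; [exact: norm_hausdorff | exact: fc].
apply/cvg_ex; exists c; move: fc; apply: cvg_trans; apply: near_eq_cvg.
by near=> h; rewrite /= /shift/= [h *: 1]mulr1.
Unshelve. all: by end_near. Qed.

Lemma derivable_hd V (f : R[i] -> V) z : derivable f z 1 -> hd f z (derive1 f z).
Proof.
move=> /cvg_ex[/= c fc].
have {}fc : hd f z c.
  move=> e e0; move/cvgrPdist_le : fc => /(_ (e%:C)%C); rewrite ltcR => /(_ e0).
  move=> /(@nbhs_nrmP R (R[i] : normedModType R[i]))[d d0 hdd].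
  exists d => // h hh; have [->|h0] := eqVneq h 0.
    by rewrite addr0 subrr scale0r subr0 !nrm0 mulr0.
  have := hdd h; rewrite subr0 => /(_ hh h0).
  rewrite -nrm_le /shift/= [h *: 1]mulr1 nrmBC addrC.
  rewrite (_ : f (z + h) - f z - h *: c = h *: (- c + h^-1 *: (f (z + h) - f z))).
    by rewrite nrmZ mulrC (addrC h) => ?; rewrite ler_wpM2r// nrm_ge0.
  by rewrite scalerDr scalerA divff// scale1r scalerN addrC.
by rewrite (hd_derive fc).2.
Qed.

Lemma hd_unique V (f : R[i] -> V) z c c' : hd f z c -> hd f z c' -> c = c'.
Proof. by move=> /hd_derive[_ <-] /hd_derive[_ <-]. Qed.

Lemma hol_hd V (f : R[i] -> V) z : hol f z -> hd f z (derive1 f z).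
Proof. by move=> [c fc]; rewrite (hd_derive fc).2. Qed.

Lemma hd_cst V (x : V) z : hd (fun=> x) z 0.
Proof. by move=> e e0; exists 1 => // h _; rewrite subrr sub0r scaler0 oppr0 nrm0 mulr_ge0 ?nrm_ge0 ?ltW. Qed.

Lemma hd_id z : hd (fun y => y) z (1 : R[i]).
Proof.
move=> e e0; exists 1 => // h _; rewrite [h *: _]mulr1.
by rewrite [z + h]addrC addrK subrr nrm0 mulr_ge0 ?nrm_ge0 ?ltW.
Qed.

Lemma hdD V (f g : R[i] -> V) z c d : hd f z c -> hd g z d ->
  hd (fun y => f y + g y) z (c + d).
Proof.
move=> fc gd e e0; have e2 : 0 < e / 2 by rewrite divr_gt0.
have [d1 d10 h1] := fc _ e2; have [d2 d20 h2] := gd _ e2.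
exists (Num.min d1 d2); first by rewrite lt_min d10.
move=> h; rewrite lt_min => /andP[/h1 k1 /h2 k2].
have := nrmD (f (z + h) - f z - h *: c) (g (z + h) - g z - h *: d).
by rewrite addrACA -opprD -scalerDr addrACA -opprD; slra.
Qed.

(** One product rule, [hd_bil], then serves scalar multiplication, composition of operators and
    evaluation of an operator at a vector. *)
Definition blin V1 V2 V3 (b : V1 -> V2 -> V3) (K : R) := [/\ 0 <= K,
  (forall x x' y, b (x + x') y = b x y + b x' y),
  (forall x y y', b x (y + y') = b x y + b x y'),
  (forall a x y, b (a *: x) y = a *: b x y /\ b x (a *: y) = a *: b x y) &
  forall x y, nrm (b x y) <= K * nrm x * nrm y].

Lemma hd_bil V1 V2 V3 (b : V1 -> V2 -> V3) K f g z c d : blin b K ->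
  hd f z c -> hd g z d -> hd (fun y => b (f y) (g y)) z (b c (g z) + b (f z) d).
Proof.
move=> [K0 bDl bDr bZ bK] fc gd e e0.
have bBl x x' y : b (x - x') y = b x y - b x' y.
  by rewrite bDl -scaleN1r (bZ _ _ _).1 scaleN1r.
have bBr x y y' : b x (y - y') = b x y - b x y'.
  by rewrite bDr -scaleN1r (bZ _ _ _).2 scaleN1r.
(* The three error terms below have coefficients [K (|g z| + 1)], [K |f z|] and [K |c|]. *)
pose M := K * (nrm (g z) + 1 + nrm (f z) + nrm c) + 1.
have ge0 := (nrm_ge0 (g z), nrm_ge0 (f z), nrm_ge0 c).
have M0 : 0 < M.
  rewrite ltr_wpDl// mulr_ge0//; case: ge0 => -[? ?] ?; slra.
have eM : 0 < Num.min 1 (e / M) by rewrite lt_min ltr01 divr_gt0.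
have [d1 d10 h1] := fc _ eM; have [d2 d20 h2] := gd _ eM.
have [d3 d30 h3] := hd_ccont gd eM.
exists (Num.min d1 (Num.min d2 d3)); first by rewrite !lt_min d10 d20.
move=> h; rewrite !lt_min => /and3P[/h1 k1 /h2 k2 hd3].
have {}k3 := h3 (z + h) ltac:(by rewrite addrC addKr).
set m := Num.min 1 _ in eM k1 k2 k3.
have m1 : m <= 1 by rewrite /m ge_min lexx.
have mM : m * M <= e by rewrite -ler_pdivlMr// /m ge_min lexx orbT.
rewrite (_ : _ - _ - _ = b (f (z + h) - f z - h *: c) (g (z + h)) +
   b (f z) (g (z + h) - g z - h *: d) + h *: b c (g (z + h) - g z)); last first.
  rewrite !bBl !bBr !(bZ _ _ _).1 !(bZ _ _ _).2 scalerBr scalerDr.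
  rewrite [X in _ = X + _]addrACA subrKA -[RHS]addrA; congr (_ + _).
  by rewrite [RHS]addrACA addNr add0r opprD addrC.
have n1 := nrm_ge0 h.
have hg : nrm (g (z + h)) <= nrm (g z) + 1.
  by have := nrmD (g z) (g (z + h) - g z); rewrite addrC subrK; slra.
apply: le_trans (nrmD _ _) _; rewrite nrmZ.
have t1 := nrmD (b (f (z + h) - f z - h *: c) (g (z + h)))
  (b (f z) (g (z + h) - g z - h *: d)).
have t2 := bK (f (z + h) - f z - h *: c) (g (z + h)).
have t3 := bK (f z) (g (z + h) - g z - h *: d).
have t4 := bK c (g (z + h) - g z).
set A := nrm (f (z + h) - _ - _) in t2 k1.
set B := nrm (g (z + h) - _ - _) in t3 k2.
set G := nrm (g (z + h) - g z) in t4 k3.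
have A0 : 0 <= A := nrm_ge0 _.
have q2 : K * A * nrm (g (z + h)) <= K * (m * nrm h) * (nrm (g z) + 1).
  by apply: ler_pM; rewrite ?mulr_ge0 ?nrm_ge0// ler_wpM2l.
have q3 : K * nrm (f z) * B <= K * nrm (f z) * (m * nrm h).
  by apply: ler_wpM2l; rewrite ?mulr_ge0 ?nrm_ge0.
have q4 : nrm h * nrm (b c (g (z + h) - g z)) <= nrm h * (K * nrm c * m).
  by rewrite ler_wpM2l// (le_trans t4)// ler_wpM2l ?mulr_ge0 ?nrm_ge0// ltW.
have : m * M * nrm h <= e * nrm h by rewrite ler_wpM2r.
have := mulr_ge0 (ltW eM) n1; rewrite /M -/m; snra.
Qed.

Lemma hd_lin V W (L : V -> W) (K : R) f z c :
  (forall x y, L (x + y) = L x + L y) -> (forall a x, L (a *: x) = a *: L x) ->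
  (forall x, nrm (L x) <= K * nrm x) ->
  hd f z c -> hd (fun y => L (f y)) z (L c).
Proof.
move=> LD LZ LK fc.
have LB x y : L (x - y) = L x - L y by rewrite LD -scaleN1r LZ scaleN1r.
move=> e e0; have K1 : 0 < `|K| + 1 by have := normr_ge0 K; slra.
have [d d0 hdd] := fc _ (divr_gt0 e0 K1); exists d => // h /hdd.
rewrite -LZ -!LB => k; apply: le_trans (LK _) _.
have := ler_norm K; have := nrm_ge0 (f (z + h) - f z - h *: c).
rewrite mulrAC ler_pdivlMr// in k; snra.
Qed.

Lemma blin_scale V : blin (fun (a : R[i]) (x : V) => a *: x) 1.
Proof.
split=> // [x x' y|x y y'|a x y|x y]; rewrite ?scalerDl ?scalerDr ?nrmZ ?mul1r//.
by split; [rewrite scalerA | rewrite !scalerA mulrC].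
Qed.

Lemma hdZ V (k : R[i] -> R[i]) (f : R[i] -> V) z c d :
  hd k z c -> hd f z d -> hd (fun y => k y *: f y) z (c *: f z + k z *: d).
Proof. exact: hd_bil (blin_scale V). Qed.

Lemma hdM (k f : R[i] -> R[i]) z c d :
  hd k z c -> hd f z d -> hd (fun y => k y * f y) z (c * f z + k z * d).
Proof. exact: (@hdZ (R[i] : normedModType R[i])). Qed.

Lemma hdcZ V (a : R[i]) (f : R[i] -> V) z d :
  hd f z d -> hd (fun y => a *: f y) z (a *: d).
Proof.
by move=> fd; have := hdZ (hd_cst (a : R[i]) z) fd; rewrite scale0r add0r.
Qed.

Lemma hdN V (f : R[i] -> V) z d : hd f z d -> hd (fun y => - f y) z (- d).
Proof.
move=> /(hdcZ (-1)); rewrite scaleN1r; apply: hd_ext => y.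
by rewrite scaleN1r.
Qed.

Lemma hdB V (f g : R[i] -> V) z c d : hd f z c -> hd g z d ->
  hd (fun y => f y - g y) z (c - d).
Proof. by move=> fc /hdN; exact: hdD. Qed.

Lemma hd_comp V (f : R[i] -> V) (g : R[i] -> R[i]) z c d :
  hd g z d -> hd f (g z) c -> hd (fun y => f (g y)) z (d *: c).
Proof.
move=> gd fc e e0.
have d1 : 0 < nrm d + 1 by have := nrm_ge0 d; slra.
have c1 : 0 < nrm c + 1 by have := nrm_ge0 c; slra.
have [r r0 hr] := fc (e / 2 / (nrm d + 1)) ltac:(by rewrite !divr_gt0).
have [s s0 hs] := gd (Num.min 1 (e / 2 / (nrm c + 1)))
  ltac:(by rewrite lt_min ltr01 !divr_gt0).
have [t t0 ht] := hd_ccont gd r0.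
exists (Num.min s t); first by rewrite lt_min s0.
move=> h; rewrite lt_min => /andP[/hs ks hht].
have {}ht := ht (z + h) ltac:(by rewrite addrC addKr).
have {}hr := hr _ ht; rewrite [g z + _]addrC subrK in hr.
set k := g (z + h) - g z in hr ks ht *.
have -> : f (g (z + h)) - f (g z) - h *: (d *: c) =
  (f (g (z + h)) - f (g z) - k *: c) + (k - h *: d) *: c.
  by rewrite [(k - _) *: c]scalerBl subrKA scalerA.
apply: le_trans (nrmD _ _) _; rewrite nrmZ.
have n0 := nrm_ge0 h.
have kle : nrm k <= (nrm d + 1) * nrm h.
  have := nrmD (k - h *: d) (h *: d); rewrite subrK nrmZ.
  have : Num.min 1 (e / 2 / (nrm c + 1)) * nrm h <= 1 * nrm h.
    by rewrite ler_wpM2r// ge_min lexx.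
  slra.
have k2 : nrm (k - h *: d) <= e / 2 / (nrm c + 1) * nrm h.
  by apply: le_trans ks _; rewrite ler_wpM2r// ge_min lexx orbT.
have k3 : e / 2 / (nrm d + 1) * nrm k <= e / 2 * nrm h.
  rewrite -mulrA; apply: ler_wpM2l; first by rewrite divr_ge0 ?ltW.
  by rewrite ler_pdivrMl.
have k4 : nrm (k - h *: d) * nrm c <= e / 2 * nrm h.
  have : nrm (k - h *: d) * (nrm c + 1) <= e / 2 * nrm h.
    by rewrite -ler_pdivlMr// mulrAC.
  have := nrm_ge0 (k - h *: d); slra.
slra.
Qed.

Lemma inv_taylor2 (F : fieldType) (z h : F) : z != 0 -> z + h != 0 ->
  (z + h)^-1 - z^-1 - h * - (z^-1 ^+ 2) = h ^+ 2 / (z ^+ 2 * (z + h)).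
Proof. by move=> z0 zh0; field; rewrite ?z0 ?zh0. Qed.

Lemma hd_inv z : z != 0 -> hd (fun y => y^-1) z (- (z^-1 ^+ 2) : R[i]).
Proof.
move=> z0 e e0; have nz : 0 < nrm z by rewrite nrm_gt0.
exists (Num.min (nrm z / 2) (e * nrm z ^+ 3 / 2)).
  by rewrite lt_min !divr_gt0// mulr_gt0// exprn_gt0.
move=> h; rewrite lt_min => /andP[h1 h2].
have zh : nrm z / 2 <= nrm (z + h).
  by have := nrmBD z (- h); rewrite nrmN opprK; slra.
have zh0 : z + h != 0 by rewrite -nrm_gt0; slra.
have -> : (z + h)^-1 - z^-1 - h *: - (z^-1 ^+ 2) = h ^+ 2 / (z ^+ 2 * (z + h)).
  exact: inv_taylor2.
rewrite nrmM nrmV nrmM !nrmX expr2 -mulrA mulrC ler_wpM2r ?nrm_ge0//.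
rewrite ler_pdivrMr ?mulr_gt0 ?exprn_gt0//; last by rewrite nrm_gt0.
have : e * nrm z ^+ 2 * (nrm z / 2) <= e * nrm z ^+ 2 * nrm (z + h).
  by rewrite ler_wpM2l// mulr_ge0 ?exprn_ge0 ?ltW.
have : e * nrm z ^+ 2 * (nrm z / 2) = e * nrm z ^+ 3 / 2 by rewrite exprS; ring.
by rewrite -mulrA; slra.
Qed.

Lemma hd_invf (f : R[i] -> R[i]) z c : f z != 0 -> hd f z c ->
  hd (fun y => (f y)^-1) z (- c / f z ^+ 2).
Proof.
move=> f0 fc; have := hd_comp fc (hd_inv f0).
rewrite (_ : c *: _ = - c / f z ^+ 2)//.
by rewrite -[LHS]/(c * - ((f z)^-1 ^+ 2)) mulrN mulNr exprVn.
Qed.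

Lemma hol_cst V (x : V) z : hol (fun=> x) z. Proof. by exists 0; exact: hd_cst. Qed.
Lemma hol_id z : hol (fun y => y) z. Proof. by exists 1; exact: hd_id. Qed.
Lemma holD V (f g : R[i] -> V) z : hol f z -> hol g z -> hol (fun y => f y + g y) z.
Proof. by move=> [c fc] [d gd]; exists (c + d); exact: hdD. Qed.
Lemma holB V (f g : R[i] -> V) z : hol f z -> hol g z -> hol (fun y => f y - g y) z.
Proof. by move=> [c fc] [d gd]; exists (c - d); exact: hdB. Qed.
Lemma holZ V (k : R[i] -> R[i]) (f : R[i] -> V) z : hol k z -> hol f z ->
  hol (fun y => k y *: f y) z.
Proof. by move=> [c fc] [d gd]; exists (c *: f z + k z *: d); exact: hdZ. Qed.
Lemma holM (k f : R[i] -> R[i]) z : hol k z -> hol f z -> hol (fun y => k y * f y) z.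
Proof. exact: (@holZ (R[i] : normedModType R[i])). Qed.
Lemma hol_invf (f : R[i] -> R[i]) z : f z != 0 -> hol f z -> hol (fun y => (f y)^-1) z.
Proof. by move=> f0 [c fc]; eexists; exact: hd_invf fc. Qed.
Lemma hol_comp V (f : R[i] -> V) (g : R[i] -> R[i]) z :
  hol g z -> hol f (g z) -> hol (fun y => f (g y)) z.
Proof. by move=> [d gd] [c fc]; exists (d *: c); exact: hd_comp. Qed.
Lemma hol_bil V1 V2 V3 (b : V1 -> V2 -> V3) K f g z : blin b K ->
  hol f z -> hol g z -> hol (fun y => b (f y) (g y)) z.
Proof. by move=> bK [c fc] [d gd]; eexists; exact: hd_bil bK fc gd. Qed.
Lemma hol_ext V (f g : R[i] -> V) z : f =1 g -> hol f z -> hol g z.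
Proof. by move=> fg [c fc]; exists c; exact: hd_ext fc. Qed.
Lemma hol_sum V I (s : seq I) (P : pred I) (f : I -> R[i] -> V) z :
  (forall i, P i -> hol (f i) z) -> hol (fun y => \sum_(i <- s | P i) f i y) z.
Proof.
move=> hf; elim: s => [|i s IH].
  by apply: hol_ext (hol_cst 0 z) => y; rewrite big_nil.
case Pi : (P i); last by apply: hol_ext IH => y; rewrite big_cons Pi.
by apply: hol_ext (holD (hf i Pi) IH) => y; rewrite big_cons Pi.
Qed.
Lemma hol_prod I (s : seq I) (P : pred I) (f : I -> R[i] -> R[i]) z :
  (forall i, P i -> hol (f i) z) -> hol (fun y => \prod_(i <- s | P i) f i y) z.
Proof.
move=> hf; elim: s => [|i s IH].
  by apply: hol_ext (hol_cst (1 : R[i]) z) => y; rewrite big_nil.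
case Pi : (P i); last by apply: hol_ext IH => y; rewrite big_cons Pi.
by apply: hol_ext (holM (hf i Pi) IH) => y; rewrite big_cons Pi.
Qed.

Lemma holX (f : R[i] -> R[i]) n z : hol f z -> hol (fun y => f y ^+ n) z.
Proof.
move=> hf; elim: n => [|n IH]; first by apply: hol_ext (hol_cst (1 : R[i]) z) => y.
by apply: hol_ext (holM hf IH) => y; rewrite exprS.
Qed.

End HolDeriv.

(** * Goursat's theorem *)

Section Goursat.
Context {R : realType} {V : normedModType R[i]}.
Hypothesis cV : seqcomplete V.
Implicit Types (g : R[i] -> V) (p q : R[i]).

(** The integral of [g] along the segment from [p] to [p + q], divided by [q]. *)
Definition segmean g p q : V := mn (fun u : R => g (p + (u%:C)%C * q)).

Lemma seg_ucont g p q :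
  (forall u : R, 0 <= u <= 1 -> ccont g (p + (u%:C)%C * q)) ->
  ucont (fun u : R => g (p + (u%:C)%C * q)).
Proof.
move=> cg; apply: ucontP => u u01 e e0; have [d d0 hdd] := cg u u01 e e0.
have q1 : 0 < nrm q + 1 by have := nrm_ge0 q; slra.
exists (d / (nrm q + 1)); first by rewrite divr_gt0.
move=> v _ uv; apply: hdd; rewrite opprD addrACA subrr add0r -mulrBl.
rewrite -rmorphB nrmM nrmR; move: uv; rewrite ltr_pdivlMr//.
have := normr_ge0 (v - u); snra.
Qed.

Lemma segmeanP g p q :
  (forall u : R, 0 <= u <= 1 -> ccont g (p + (u%:C)%C * q)) ->
  is_mean (fun u : R => g (p + (u%:C)%C * q)) (segmean g p q).
Proof. by move=> cg; apply: mnP => //; exact: seg_ucont. Qed.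

Lemma segmean_half g p q :
  (forall u : R, 0 <= u <= 1 -> ccont g (p + (u%:C)%C * q)) ->
  segmean g p q = ((2^-1)%:C)%C *:
    (segmean g p (q * (2^-1)%:C%C) + segmean g (p + q * (2^-1)%:C%C) (q * (2^-1)%:C%C)).
Proof.
move=> cg; apply: mnE.
have e1 (u : R) : (u / 2)%:C%C * q = u%:C%C * (q * (2^-1)%:C%C).
  by rewrite realcM mulrAC mulrA.
have e2 (u : R) : ((1 + u) / 2)%:C%C * q = q * (2^-1)%:C%C + u%:C%C * (q * (2^-1)%:C%C).
  by rewrite mulrDl realcD mulrDl mul1r -e1 mulrC.
apply: is_mean_half.
  apply: (@is_mean_eq _ _ (fun u : R => g (p + u%:C%C * (q * (2^-1)%:C%C)))).
    by move=> u _; rewrite -e1.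
  by apply: segmeanP => u hu; rewrite -e1; apply: cg; exact: (half_in hu).1.
apply: (@is_mean_eq _ _ (fun u : R =>
    g (p + q * (2^-1)%:C%C + u%:C%C * (q * (2^-1)%:C%C)))).
  by move=> u _; rewrite e2 addrA.
by apply: segmeanP => u hu; rewrite -addrA -e2; apply: cg; exact: (half_in hu).2.
Qed.

(** The contour integral around the rectangle with lower left corner [p]: segment means multiplied
    by the increments along the sides. *)
Definition rectint g p (a b : R) : V :=
  (a%:C)%C *: (segmean g p (a%:C)%C - segmean g (p + 'i%C * (b%:C)%C) (a%:C)%C) +
  ('i%C * (b%:C)%C) *: (segmean g (p + (a%:C)%C) ('i%C * (b%:C)%C)
     - segmean g p ('i%C * (b%:C)%C)).

Definition rect p (a b : R) (z : R[i]) :=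
  complex.Re p <= complex.Re z <= complex.Re p + a /\
  complex.Im p <= complex.Im z <= complex.Im p + b.

Lemma zmod_quarter (W : zmodType) (s1 s2 t1 t2 m1 m2 : W) :
  s1 + s2 - (t1 + t2) = (s1 - m1) + (s2 - m2) + ((m1 - t1) + (m2 - t2)).
Proof. by rewrite addrACA !subrKA opprD addrACA. Qed.

Lemma rect_hseg p a b (c u : R) : 0 <= a -> 0 <= c <= b -> 0 <= u <= 1 ->
  rect p a b (p + 'i%C * (c%:C)%C + (u%:C)%C * (a%:C)%C).
Proof.
move=> a0 /andP[c0 cb] /andP[u0 u1]; case: p => x y; rewrite /rect/=.
by split; apply/andP; snra.
Qed.

Lemma rect_vseg p a b (c u : R) : 0 <= b -> 0 <= c <= a -> 0 <= u <= 1 ->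
  rect p a b (p + (c%:C)%C + (u%:C)%C * ('i%C * (b%:C)%C)).
Proof.
move=> a0 /andP[c0 cb] /andP[u0 u1]; case: p => x y; rewrite /rect/=.
by split; apply/andP; snra.
Qed.

Lemma rectint_quarter g p (a b : R) : 0 <= a -> 0 <= b ->
  (forall z, rect p a b z -> ccont g z) ->
  rectint g p a b = rectint g p (a / 2) (b / 2) +
    rectint g (p + ((a / 2)%:C)%C) (a / 2) (b / 2) +
   (rectint g (p + 'i%C * ((b / 2)%:C)%C) (a / 2) (b / 2) +
    rectint g (p + ((a / 2)%:C)%C + 'i%C * ((b / 2)%:C)%C) (a / 2) (b / 2)).
Proof.
move=> a0 b0 cg.
have hs c : 0 <= c <= b -> segmean g (p + 'i%C * (c%:C)%C) (a%:C)%C = _ :=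
  fun cb => segmean_half (fun u hu => cg _ (rect_hseg p a0 cb hu)).
have vs c : 0 <= c <= a -> segmean g (p + (c%:C)%C) ('i%C * (b%:C)%C) = _ :=
  fun cb => segmean_half (fun u hu => cg _ (rect_vseg p b0 cb hu)).
have hs0 := hs 0 ltac:(by rewrite lexx b0); rewrite mulr0 !addr0 in hs0.
have hsb := hs b ltac:(by rewrite lexx b0).
have vs0 := vs 0 ltac:(by rewrite lexx a0); rewrite !addr0 in vs0.
have vsa := vs a ltac:(by rewrite lexx a0).
rewrite /rectint hs0 hsb vs0 vsa {hs vs hs0 hsb vs0 vsa}.
have ea : (a%:C * (2^-1)%:C)%C = ((a / 2)%:C)%C by rewrite realcM.
have eb : ('i * b%:C * (2^-1)%:C)%C = ('i * (b / 2)%:C)%C by rewrite realcM mulrA.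
rewrite ea eb -!scalerBr !scalerA ea eb.
have b2 : 'i%C * (b / 2)%:C%C + 'i%C * (b / 2)%:C%C = 'i%C * b%:C%C.
  by rewrite -mulrDr -rmorphD/= -splitr.
have a2 : (a / 2)%:C%C + (a / 2)%:C%C = a%:C%C by rewrite -rmorphD/= -splitr.
set A := (a / 2)%:C%C in a2 *; set B := 'i%C * (b / 2)%:C%C in b2 *.
rewrite -a2 -b2 !addrA !(addrAC _ B A).
rewrite (zmod_quarter _ _ _ _ (segmean g (p + B) A) (segmean g (p + A + B) A)).
rewrite (zmod_quarter _ _ _ _ (segmean g (p + A) B) (segmean g (p + A + B) B)).
rewrite [in LHS]scalerDr ![in LHS]scalerDr.
by rewrite (AC ((2*2)*(2*2))%AC (1*7*2*5*3*8*4*6)%AC)/= -!scalerDr.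
Qed.

(** Opposite sides are paired before estimating. They differ by a translation, whose effect under
    the affine approximation is [c] times the translation, and the two main terms [- a (i b) c] and
    [(i b) a c] cancel. *)
Lemma rectint_local g p (a b e : R) z c : 0 <= a -> 0 <= b -> 0 <= e ->
  (forall y, rect p a b y -> ccont g y) -> rect p a b z ->
  (forall y, rect p a b y -> nrm (g y - g z - (y - z) *: c) <= e * nrm (y - z)) ->
  nrm (rectint g p a b) <= 2 * e * (a + b) ^+ 2.
Proof.
move=> a0 b0 e0 cg rz gz.
have ge y : rect p a b y -> nrm (g y - g z - (y - z) *: c) <= e * (a + b).
  move=> ry; apply: le_trans (gz y ry) _; apply: ler_wpM2l => //.
  apply: le_trans (nrm_le_ReIm _) _; rewrite cReD cReN cImD cImN.
  move: ry rz; rewrite /rect => -[/andP[? ?] /andP[? ?]] [/andP[? ?] /andP[? ?]].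
  by apply: lerD; rewrite ler_norml; apply/andP; slra.
have key y y' (h : R[i]) : rect p a b y -> rect p a b y' -> y - y' = h ->
    nrm (g y - g y' - h *: c) <= 2 * e * (a + b).
  move=> /ge ry /ge ry' <-.
  have -> : g y - g y' - (y - y') *: c =
     (g y - g z - (y - z) *: c) - (g y' - g z - (y' - z) *: c).
    have -> : (y - y') *: c = (y - z) *: c - (y' - z) *: c.
      by rewrite -scalerBl opprB subrKA.
    rewrite !opprD !opprK [RHS](AC ((2*1)*(2*1))%AC ((1*4)*(3*6)*(2*5))%AC)/=.
    by rewrite addNr addr0.
  by have := nrmB (g y - g z - (y - z) *: c) (g y' - g z - (y' - z) *: c); slra.
have h0 : 0 <= (0 : R) <= b by apply/andP.
have hb : 0 <= b <= b by apply/andP.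
have v0 : 0 <= (0 : R) <= a by apply/andP.
have va : 0 <= a <= a by apply/andP.
have hs d (hd : 0 <= d <= b) := segmeanP (fun u hu => cg _ (rect_hseg p a0 hd hu)).
have vs d (hd : 0 <= d <= a) := segmeanP (fun u hu => cg _ (rect_vseg p b0 hd hu)).
have hs0 := hs 0 h0; rewrite mulr0 !addr0 in hs0.
have vs0 := vs 0 v0; rewrite !addr0 in vs0.
have rh0 := rect_hseg p a0 h0; rewrite mulr0 !addr0 in rh0.
have rv0 := rect_vseg p b0 v0; rewrite !addr0 in rv0.
have subm (f f' : R -> V) l l' (d : V) : is_mean f l -> is_mean f' l' ->
    (forall u, 0 <= u <= 1 -> nrm (f u - f' u - d) <= 2 * e * (a + b)) ->
    nrm (l - l' - d) <= 2 * e * (a + b).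
  move=> fl fl' h; rewrite -addrA -opprD.
  apply: is_mean_dist fl (is_meanD fl' (is_mean_cst d)) _ => u hu.
  by rewrite opprD addrA; exact: h.
have y1 (x q i : R[i]) : x + q - (x + i + q) = - i.
  by rewrite [x + i + q]addrAC opprD addrA subrr add0r.
have y2 (x q i : R[i]) : x + i + q - (x + q) = i.
  by rewrite [x + i + q]addrAC [LHS]addrC addKr.
have D1 := subm _ _ _ _ (- ('i%C * (b%:C)%C) *: c) hs0 (hs b hb) (fun u hu =>
  key _ _ _ (rh0 _ hu) (rect_hseg p a0 hb hu) (y1 _ _ _)).
have D2 := subm _ _ _ _ ((a%:C)%C *: c) (vs a va) vs0 (fun u hu =>
  key _ _ _ (rect_vseg p b0 va hu) (rv0 _ hu) (y2 _ _ _)).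
have -> : rectint g p a b =
  (a%:C)%C *: (segmean g p (a%:C)%C - segmean g (p + 'i%C * (b%:C)%C) (a%:C)%C
     - - ('i%C * (b%:C)%C) *: c) +
  ('i%C * (b%:C)%C) *: (segmean g (p + (a%:C)%C) ('i%C * (b%:C)%C)
     - segmean g p ('i%C * (b%:C)%C) - (a%:C)%C *: c).
  rewrite !scalerBr !scalerA mulrN scaleNr opprK addrACA.
  by rewrite [_ * a%:C%C]mulrC subrr addr0 -!scalerBr.
apply: le_trans (nrmD _ _) _; rewrite !nrmZ nrmM nrmi mul1r !nrmR !ger0_norm//.
rewrite /segmean in D1 D2 *.
set X := nrm _ in D1 *; set Y := nrm _ in D2 *.
have : a * X <= a * (2 * e * (a + b)) by rewrite ler_wpM2l.
have : b * Y <= b * (2 * e * (a + b)) by rewrite ler_wpM2l.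
snra.
Qed.

(** The bound [2 * e * (s + t) ^+ 2] is the sum of the same bounds over the four quarters and holds
    on small rectangles by differentiability; [cousin2] then gives it on the whole rectangle for
    every [e]. *)
Lemma goursat g p (a b : R) : 0 <= a -> 0 <= b ->
  (forall z, rect p a b z -> hol g z) -> rectint g p a b = 0.
Proof.
move=> a0 b0 hg; apply/eqP; rewrite -nrm_eq0; apply/eqP/le_anti.
rewrite nrm_ge0 andbT; apply/ler_addgt0Pr => e' e'0; rewrite add0r.
pose e := e' / (2 * (a + b) ^+ 2 + 1).
have M0 : 0 < 2 * (a + b) ^+ 2 + 1 by rewrite ltr_wpDl// mulr_ge0// sqr_ge0.
have e0 : 0 < e by rewrite divr_gt0.
suff H : nrm (rectint g p a b) <= 2 * e * (a + b) ^+ 2.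
  apply: le_trans H _; rewrite mulrAC mulrC /e mulrAC ler_pdivrMr//.
  by rewrite ler_wpM2l ?ltW//; slra.
pose pt (x y : R) : R[i] := (x +i* y)%C.
pose P (x y s t : R) := nrm (rectint g (pt x y) s t) <= 2 * e * (s + t) ^+ 2.
have -> : p = pt (complex.Re p) (complex.Im p) by case: (p).
have sub x y s t : complex.Re p <= x -> x + s <= complex.Re p + a ->
    complex.Im p <= y -> y + t <= complex.Im p + b ->
    forall z, rect (pt x y) s t z -> rect p a b z.
  by move=> ? ? ? ? z [/andP[/= ? ?] /andP[/= ? ?]]; split; apply/andP; slra.
apply: (@cousin2 _ P) => //.
  move=> x y s t h1 h2 h3 h4 s0 t0 k1 k2 k3 k4; rewrite /P rectint_quarter//; last first.
    by move=> z /(sub _ _ _ _ h1 h2 h3 h4)/hg/hol_ccont.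
  have E1 : pt x y + (s / 2)%:C%C = pt (x + s / 2) y by rewrite /pt; simpc.
  have E2 z w : pt z w + 'i%C * (t / 2)%:C%C = pt z (w + t / 2).
    by apply: complex_eq; rewrite ?cReD ?cImD ?cReM ?cImM/=; ring.
  rewrite E1 !E2.
  apply: le_trans (nrmD _ _) _; move: k1 k2 k3 k4; rewrite /P => k1 k2 k3 k4.
  have := nrmD (rectint g (pt x y) (s / 2) (t / 2))
    (rectint g (pt (x + s / 2) y) (s / 2) (t / 2)).
  have := nrmD (rectint g (pt x (y + t / 2)) (s / 2) (t / 2))
    (rectint g (pt (x + s / 2) (y + t / 2)) (s / 2) (t / 2)).
  have -> : (s + t) ^+ 2 = 4 * (s / 2 + t / 2) ^+ 2 by field.
  slra.
move=> X Y hX hY.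
have hZ : rect p a b (pt X Y) by split.
have [c hc] := hg _ hZ; have [d d0 hdd] := hc e e0.
exists (d / 2); first by rewrite divr_gt0.
move=> x y s t h1 h2 h3 h4 hx hy sd td; rewrite /P.
have /andP[? ?] := hx; have /andP[? ?] := hy.
apply: (@rectint_local g _ s t e (pt X Y) c); try slra.
- by move=> z /(sub _ _ _ _ h1 h2 h3 h4)/hg/hol_ccont.
- by split.
- move=> z rz; have := hdd (z - pt X Y).
  rewrite [pt X Y + _]addrC subrK; apply.
  apply: le_lt_trans (nrm_le_ReIm _) _; rewrite cReD cReN cImD cImN/=.
  case: rz => /andP[/= ? ?] /andP[/= ? ?].
  have : `|complex.Re z - X| <= s by rewrite ler_norml; apply/andP; slra.
  have : `|complex.Im z - Y| <= t by rewrite ler_norml; apply/andP; slra.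
  slra.
Qed.

End Goursat.

(** * Circle means and Cauchy's theorem *)

Section ComplexExponential.
Context {R : realType}.

Lemma real_derive_eps (f : R -> R) (x d : R) : is_derive x 1 f d ->
  forall e, 0 < e -> exists2 r, 0 < r &
    forall h, `|h| < r -> `|f (x + h) - f x - h * d| <= e * `|h|.
Proof.
move=> [fd fE] e e0; move: fd => /cvg_ex[/= c fc].
have cE : c = d by rewrite -fE; apply/esym/cvg_lim.
move/cvgrPdist_le : fc => /(_ e e0)/nbhs_ballP[r /= r0 hr].
exists r => // h hh; have [->|h0] := eqVneq h 0.
  by rewrite addr0 subrr mul0r subr0 normr0 mulr0.
have := hr h; rewrite -ball_normE /ball_/= sub0r normrN => /(_ hh h0).
rewrite cE /shift/= [h *: 1]mulr1 distrC (addrC h).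
rewrite (_ : f (x + h) - f x - h * d = (h^-1 *: (f (x + h) - f x) - d) * h).
  by rewrite normrM => ?; rewrite ler_wpM2r.
by rewrite mulrBl [h^-1 *: _]/(h^-1 * _) mulrAC mulVf// mul1r (mulrC d).
Qed.

Definition cexp (z : R[i]) : R[i] :=
  ((expR (complex.Re z))%:C)%C * expi (complex.Im z).

Lemma expiD (s t : R) : expi (s + t) = expi s * expi t.
Proof.
by apply: complex_eq; rewrite ?cReM ?cImM /= ?cosD ?sinD; ring.
Qed.

Lemma cexpD z w : cexp (z + w) = cexp z * cexp w.
Proof. by rewrite /cexp cReD cImD expRD expiD realcM; ring. Qed.

Lemma nrm_expi (t : R) : nrm (expi t) = 1.
Proof.
apply/eqP; rewrite -(@eqrXn2 _ 2)// ?nrm_ge0// nrm_sqr /= expr1n.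
by rewrite cos2Dsin2.
Qed.

Lemma expR_taylor2 (x : R) : `|x| <= 1 / 2 -> `|expR x - 1 - x| <= 2 * `|x| ^+ 2.
Proof.
rewrite ler_norml => /andP[x1 x2].
have h1 := expR_ge1Dx x; have h2 := expR_ge1Dx (- x); rewrite expRN in h2.
rewrite real_normK ?num_real// ger0_norm; last slra.
have e0 := expR_gt0 x.
have : (1 - x) * expR x <= 1 by rewrite -ler_pdivlMr// div1r.
snra.
Qed.

Lemma hd_cexp0 : hd cexp 0 (1 : R[i]).
Proof.
move=> e e0; have e6 : 0 < Num.min (1/2) (e / 16).
  by rewrite lt_min; apply/andP; slra.
have [r1 r10 h1] := real_derive_eps (is_derive_cos 0) e6.
have [r2 r20 h2] := real_derive_eps (is_derive_sin 0) e6.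
exists (Num.min (Num.min (1/2) (e / 16)) (Num.min r1 r2)).
  by rewrite !lt_min r10 r20 -lt_min e6.
move=> h; rewrite !lt_min => /andP[/andP[he1 he2] /andP[hr1 hr2]].
rewrite add0r /cexp/=.
have ha := Re_le_nrm h; have hb := Im_le_nrm h.
case: h he1 he2 hr1 hr2 ha hb => a b he1 he2 hr1 hr2 /= ha hb.
set N := nrm (a +i* b)%C in he1 he2 hr1 hr2 ha hb *.
have := h1 b (le_lt_trans hb hr1); have := h2 b (le_lt_trans hb hr2).
rewrite !add0r cos0 sin0 oppr0 mulr0 mulr1 !subr0 addr0 => k2 k1.
have {}k1 : `|cos b - 1| <= e / 16 * `|b|.
  by apply: le_trans k1 _; rewrite ler_wpM2r// ge_min lexx orbT.
have {}k2 : `|sin b - b| <= e / 16 * `|b|.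
  by apply: le_trans k2 _; rewrite ler_wpM2r// ge_min lexx orbT.
have k3 := expR_taylor2 (ltW (le_lt_trans ha he1)).
have a2 : `|a| ^+ 2 <= e / 16 * N.
  rewrite expr2; apply: ler_pM => //; exact: ltW (le_lt_trans ha he2).
have ab : `|a| * `|b| <= e / 16 * N.
  apply: ler_pM => //; exact: ltW (le_lt_trans ha he2).
have ea : `|expR a| <= 2.
  have : `|expR a - 1 - a| <= 2 * (1/2 * (1/2)).
    apply: le_trans k3 _; rewrite ler_wpM2l// expr2 ler_pM//; slra.
  have /ltW := le_lt_trans ha he1.
  by rewrite !ler_norml => /andP[? ?] /andP[? ?]; apply/andP; slra.
have ea1 : `|expR a - 1| <= 2 * `|a|.
  have : `|expR a - 1| <= `|expR a - 1 - a| + `|a|.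
    by rewrite -{1}(subrK a (expR a - 1)) ler_normD.
  have : `|a| * `|a| <= 1/2 * `|a| by rewrite ler_wpM2r//; slra.
  by move: k3; rewrite expr2; slra.
apply: le_trans (nrm_le_ReIm _) _.
rewrite expR0 [_ *: 1]mulr1 !cReD !cImD !cReN !cImN !cReM !cImM /= cos0 sin0.
rewrite !mul0r ?mulr0 !mul1r !addr0 !subr0.
have -> : expR a * cos b - 1 - a = expR a * (cos b - 1) + (expR a - 1 - a) by ring.
have -> : expR a * sin b - b = expR a * (sin b - b) + (expR a - 1) * b by ring.
have t1 := ler_normD (expR a * (cos b - 1)) (expR a - 1 - a).
have t2 := ler_normD (expR a * (sin b - b)) ((expR a - 1) * b).
have q1 : `|expR a * (cos b - 1)| <= 2 * (e / 16 * `|b|).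
  by rewrite normrM; apply: ler_pM.
have q2 : `|expR a * (sin b - b)| <= 2 * (e / 16 * `|b|).
  by rewrite normrM; apply: ler_pM.
have q3 : `|(expR a - 1) * b| <= 2 * `|a| * `|b|.
  by rewrite normrM ler_wpM2r.
have : e / 16 * `|b| <= e / 16 * N by rewrite ler_wpM2l//; slra.
have := nrm_ge0 (a +i* b)%C; rewrite -/N => N0.
have := mulr_ge0 (ltW e0) N0.
slra.
Qed.

Lemma hd_cexp z : hd cexp z (cexp z).
Proof.
have := hdcZ (cexp z) hd_cexp0; rewrite [_ *: 1]mulr1 => h e /h[d d0 hdd].
exists d => // k /hdd; rewrite add0r cexpD.
have -> : cexp 0 = 1 by rewrite /cexp/= expR0 /expi cos0 sin0 mul1r.
by rewrite [cexp z *: 1]mulr1.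
Qed.

Lemma expiE (t : R) : expi t = cexp (0 +i* t)%C.
Proof. by rewrite /cexp/= expR0 mul1r. Qed.

Lemma expi_cont (t e : R) : 0 < e -> exists2 d, 0 < d & forall s, `|s - t| < d ->
  nrm (expi s - expi t) < e.
Proof.
move=> e0; have [d d0 h] := hd_ccont (hd_cexp (0 +i* t)%C) e0.
exists d => // s st; rewrite !expiE; apply: h.
by apply: le_lt_trans (nrm_le_ReIm _) _; rewrite cReD cImD cReN cImN/= subrr normr0 add0r.
Qed.

Lemma cexp_2pi z : cexp (z + 'i%C * ((2 * pi)%:C)%C) = cexp z.
Proof.
rewrite /cexp cReD cImD cReM cImM/= !(mul0r, mulr0, mul1r, subr0, addr0, add0r, oppr0).
by rewrite expiD /expi mulrDl mul1r cos2pi sin2pi mulr1.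
Qed.

End ComplexExponential.

Section CircleMean.
Context {R : realType} {V : normedModType R[i]}.
Hypothesis cV : seqcomplete V.
Implicit Types (f k : R[i] -> V) (w : R[i]).

Definition circ (r u : R) : R[i] := (r%:C)%C * expi (2 * pi * u).

Lemma nrm_circ (r u : R) : 0 <= r -> nrm (circ r u) = r.
Proof. by move=> r0; rewrite nrmM nrmR nrm_expi mulr1 ger0_norm. Qed.

Definition cmean f w r : V := mn (fun u : R => f (w + circ r u)).

Lemma circ_cont (r u e : R) : 0 < e -> exists2 d, 0 < d & forall v s,
  `|v - u| < d -> `|s - r| < d -> nrm (circ s v - circ r u) < e.
Proof.
move=> e0; have r1 : 0 < `|r| + 1 by have := normr_ge0 r; slra.
have [d d0 hdd] := @expi_cont R (2 * pi * u) (e / 2 / (`|r| + 1))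
  ltac:(by rewrite !divr_gt0).
have p0 : 0 < 2 * (pi : R) by rewrite mulr_gt0// pi_gt0.
exists (Num.min (d / (2 * pi)) (e / 2)); first by rewrite lt_min !divr_gt0.
move=> v s; rewrite !lt_min => /andP[vu _] /andP[_ sr].
have {}vu : `|2 * pi * v - 2 * pi * u| < d.
  by rewrite -mulrBr normrM gtr0_norm// mulrC -ltr_pdivlMr.
rewrite /circ; set E := expi _ in hdd *.
rewrite (_ : _ - _ = ((s - r)%:C)%C * expi (2 * pi * v) +
  (r%:C)%C * (expi (2 * pi * v) - E)); last by rewrite rmorphB/=; ring.
apply: le_lt_trans (nrmD _ _) _; rewrite !nrmM !nrmR nrm_expi mulr1.
have : `|r| * nrm (expi (2 * pi * v) - E) <= e / 2.
  have := hdd _ vu; rewrite ltr_pdivlMr// => /ltW; apply: le_trans.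
  by rewrite mulrC ler_wpM2l ?nrm_ge0//; slra.
slra.
Qed.

Lemma circ_ucont f w r : (forall u, 0 <= u <= 1 -> ccont f (w + circ r u)) ->
  ucont (fun u : R => f (w + circ r u)).
Proof.
move=> cf; apply: ucontP => u u01 e e0; have [d d0 hdd] := cf u u01 e e0.
have [d' d'0 h'] := circ_cont r u d0; exists d' => // v _ vu.
by apply: hdd; rewrite opprD addrACA subrr add0r; apply: h' => //; rewrite subrr normr0.
Qed.

Lemma cmeanP f w r : (forall z, nrm (z - w) = r -> ccont f z) -> 0 <= r ->
  is_mean (fun u : R => f (w + circ r u)) (cmean f w r).
Proof.
move=> cf r0; apply: mnP => //; apply: circ_ucont => u _; apply: cf.
by rewrite addrC addKr nrm_circ.
Qed.

Lemma circ_unif f w r e : 0 < e -> (forall u, 0 <= u <= 1 -> ccont f (w + circ r u)) ->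
  exists2 d, 0 < d & forall s u, `|s - r| < d -> 0 <= u <= 1 ->
    nrm (f (w + circ s u) - f (w + circ r u)) < e.
Proof.
move=> e0 cf; pose P (x a : R) := exists2 d, 0 < d & forall s u, `|s - r| < d ->
  x <= u <= x + a -> nrm (f (w + circ s u) - f (w + circ r u)) < e.
suff : P 0 1 by rewrite /P add0r.
apply: cousin1 => //.
  move=> x a _ _ _ [d1 d10 h1] [d2 d20 h2].
  exists (Num.min d1 d2); first by rewrite lt_min d10.
  move=> s u; rewrite lt_min => /andP[s1 s2] /andP[u1 u2].
  have [um|um] := leP u (x + a / 2); first by apply: h1; rewrite ?u1.
  by apply: h2 => //; apply/andP; slra.
move=> X; rewrite add0r => X01; have [d d0 hdd] := cf X X01 (e / 2) ltac:(by rewrite divr_gt0).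
have [d' d'0 h'] := circ_cont r X d0; exists d' => // x a _ _ /andP[? ?] ad.
exists d' => // s u sr /andP[? ?].
have uX : `|u - X| < d' by rewrite ltr_norml; apply/andP; slra.
have k1 := hdd (w + circ s u) ltac:(by rewrite opprD addrACA subrr add0r; apply: h').
have k2 := hdd (w + circ r u) ltac:(by rewrite opprD addrACA subrr add0r; apply: h'; rewrite ?subrr ?normr0).
have := nrmB_tri (f (w + circ s u)) (f (w + circ r X)) (f (w + circ r u)).
by rewrite (nrmBC (f (w + circ r X))); slra.
Qed.

(** The substitution [z = w + cexp zeta] turns the annulus into a rectangle of height [2 * pi]. Its
    horizontal sides cancel by periodicity, its vertical sides are the two circle means, and
    [goursat] equates them. *)
Lemma cmean_const f w (r1 r2 : R) : 0 < r1 -> r1 <= r2 ->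
  (forall z, r1 <= nrm (z - w) <= r2 -> hol f z) -> cmean f w r1 = cmean f w r2.
Proof.
move=> r10 r12 hf; have r20 : 0 < r2 by exact: lt_le_trans r12.
have p0 : 0 < 2 * (pi : R) by rewrite mulr_gt0// pi_gt0.
pose g z := f (w + cexp z); pose p := ((ln r1)%:C)%C; pose a := ln r2 - ln r1.
have a0 : 0 <= a by rewrite subr_ge0 ler_ln.
have hg z : rect p a (2 * pi) z -> hol g z.
  move=> [/andP[+ +] _]; rewrite /p /a/= addrC subrK => z1 z2.
  apply: (@hol_comp _ _ f (fun z => w + cexp z)).
    by apply: holD; [exact: hol_cst | exists (cexp z); exact: hd_cexp].
  apply: hf; rewrite addrC addKr /cexp nrmM nrmR nrm_expi mulr1.
  rewrite gtr0_norm ?expR_gt0//.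
  by rewrite -{1}(@lnK _ r1)// -(@lnK _ r2)// !ler_expR z1 z2.
have := goursat cV a0 (ltW p0) hg.
have -> : rectint g p a (2 * pi) = ('i%C * ((2 * pi)%:C)%C) *:
    (cmean f w r2 - cmean f w r1).
  rewrite /rectint; have -> : segmean g (p + 'i%C * ((2 * pi)%:C)%C) (a%:C)%C =
      segmean g p (a%:C)%C.
    by apply: mn_eq => u _; rewrite /g addrAC cexp_2pi.
  rewrite subrr scaler0 add0r; congr (_ *: (_ - _)); apply: mn_eq => u _; rewrite /g.
    congr (f (w + _)); rewrite /cexp /circ /p /a !cReD !cImD !cReM !cImM/=.
    rewrite !(mul0r, mulr0, mul1r, subr0, addr0, add0r, oppr0) [ln r1 + _]addrC subrK lnK//.
    by rewrite [u * _]mulrC.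
  congr (f (w + _)); rewrite /cexp /circ /p !cReD !cImD !cReM !cImM/=.
  rewrite !(mul0r, mulr0, mul1r, subr0, addr0, add0r, oppr0) lnK//.
  by rewrite [u * _]mulrC.
move=> /eqP; rewrite scaler_eq0 => /orP[|]; last by rewrite subr_eq0 => /eqP.
rewrite mulf_eq0 -!nrm_eq0 nrmi oner_eq0 nrmR /= normr_eq0.
by rewrite gt_eqF.
Qed.

(** Let the radius shrink to 0. Only continuity is asked at the centre, which is what later yields
    [removable]. *)
Lemma cmean_center f w (R0 r : R) : 0 < r < R0 -> ccont f w ->
  (forall z, 0 < nrm (z - w) < R0 -> hol f z) -> cmean f w r = f w.
Proof.
move=> /andP[r0 rR] cf hf.
apply/eqP; rewrite -subr_eq0 -nrm_eq0; apply/eqP/le_anti; rewrite nrm_ge0 andbT.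
apply/ler_addgt0Pr => e e0; rewrite add0r.
have [d d0 hdd] := cf e e0; pose s := Num.min (d / 2) r.
have s0 : 0 < s by rewrite lt_min divr_gt0.
have sr : s <= r by rewrite ge_min lexx orbT.
rewrite -(@cmean_const f w s r)//; last first.
  by move=> z /andP[z1 z2]; apply: hf; apply/andP; slra.
have sm : is_mean (fun u : R => f (w + circ s u)) (cmean f w s).
  apply: cmeanP (ltW s0) => z zs; apply/hol_ccont/hf; rewrite zs s0/=; slra.
apply: is_mean_dist sm (is_mean_cst _) _ => u _; apply/ltW/hdd.
rewrite addrC addKr nrm_circ ?ltW// /s gt_min; apply/orP; left; slra.
Qed.

End CircleMean.

Lemma nrm_nat (R : realType) n : nrm (n%:R : R[i]) = n%:R.
Proof. by rewrite -(rmorph_nat (real_complex R)) nrmR normr_nat. Qed.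

Section Continuity.
Context {R : realType}.
Implicit Types (V : normedModType R[i]) (z a : R[i]).

Lemma ccont_near V (f g : R[i] -> V) z (r : R) : 0 < r ->
  (forall y, nrm (y - z) < r -> f y = g y) -> ccont f z -> ccont g z.
Proof.
move=> r0 fg cf e e0; have [d d0 hdd] := cf e e0.
exists (Num.min d r); first by rewrite lt_min d0.
move=> y; rewrite lt_min => /andP[yd yr].
by rewrite -fg// -fg ?subrr ?nrm0//; exact: hdd.
Qed.

Lemma ccontB V (f g : R[i] -> V) z : ccont f z -> ccont g z ->
  ccont (fun y => f y - g y) z.
Proof.
move=> cf cg e e0; have [d1 d10 h1] := cf (e / 2) ltac:(by rewrite divr_gt0).
have [d2 d20 h2] := cg (e / 2) ltac:(by rewrite divr_gt0).
exists (Num.min d1 d2); first by rewrite lt_min d10.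
move=> y; rewrite lt_min => /andP[/h1 k1 /h2 k2].
have := nrmB (f y - f z) (g y - g z); rewrite !opprD !opprK addrACA; slra.
Qed.

Lemma ccontZ V (k : R[i] -> R[i]) (f : R[i] -> V) z : ccont k z -> ccont f z ->
  ccont (fun y => k y *: f y) z.
Proof.
move=> ck cf e e0.
have f1 : 0 < nrm (f z) + 1 by have := nrm_ge0 (f z); slra.
have k1 : 0 < nrm (k z) + 1 by have := nrm_ge0 (k z); slra.
have [d1 d10 h1] := ck (e / 2 / (nrm (f z) + 1)) ltac:(by rewrite !divr_gt0).
have [d2 d20 h2] := cf (Num.min 1 (e / 2 / (nrm (k z) + 1)))
  ltac:(by rewrite lt_min ltr01 !divr_gt0).
exists (Num.min d1 d2); first by rewrite lt_min d10.
move=> y; rewrite lt_min => /andP[/h1 q1 /h2]; rewrite lt_min => /andP[q2 q3].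
have -> : k y *: f y - k z *: f z = (k y - k z) *: f y + k z *: (f y - f z).
  by rewrite scalerBl scalerBr subrKA.
apply: le_lt_trans (nrmD _ _) _; rewrite !nrmZ.
have fy : nrm (f y) <= nrm (f z) + 1.
  by have := nrmD (f y - f z) (f z); rewrite subrK; slra.
have : nrm (k y - k z) * nrm (f y) <= e / 2.
  apply: le_trans (_ : nrm (k y - k z) * (nrm (f z) + 1) <= _).
    by rewrite ler_wpM2l ?nrm_ge0.
  by rewrite -ler_pdivlMr// ltW.
have : nrm (f y - f z) * (nrm (k z) + 1) < e / 2 by rewrite -ltr_pdivlMr.
have := nrm_ge0 (f y - f z); snra.
Qed.

(** The divided difference, completed at [a] by the derivative. It serves to divide out zeros; at
    [a = 0] it is the operator function [B] of the pencil. *)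
Definition quot V (f : R[i] -> V) a z : V :=
  if z == a then derive1 f a else (z - a)^-1 *: (f z - f a).

Lemma quotE V (f : R[i] -> V) a z : f z = f a + (z - a) *: quot f a z.
Proof.
rewrite /quot; have [->|za] := eqVneq z a; first by rewrite subrr scale0r addr0.
by rewrite scalerA divff ?subr_eq0// scale1r addrC subrK.
Qed.

Lemma quot_off V (f : R[i] -> V) a z : z != a -> forall y, nrm (y - z) < nrm (z - a) ->
  (y - a)^-1 *: (f y - f a) = quot f a y.
Proof.
move=> za y yz; rewrite /quot; case: eqVneq => // ya.
by move: yz; rewrite ya nrmBC ltxx.
Qed.

Lemma quot_hol_off V (f : R[i] -> V) a z : z != a -> hol f z -> hol (quot f a) z.
Proof.
move=> za hf; have r0 : 0 < nrm (z - a) by rewrite nrm_gt0 subr_eq0.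
apply: (hol_near r0 (quot_off f za)); apply: holZ.
  by apply: hol_invf; [rewrite subr_eq0 | apply: holB; [exact: hol_id|exact: hol_cst]].
by apply: holB => //; exact: hol_cst.
Qed.

Lemma quot_ccont_off V (f : R[i] -> V) a z : z != a -> ccont f z -> ccont (quot f a) z.
Proof.
move=> za cf; have r0 : 0 < nrm (z - a) by rewrite nrm_gt0 subr_eq0.
apply: (ccont_near r0 (quot_off f za)); apply: ccontZ.
  apply: hol_ccont; apply: hol_invf; first by rewrite subr_eq0.
  by apply: holB; [exact: hol_id|exact: hol_cst].
by apply: ccontB => //; apply: hol_ccont; exact: hol_cst.
Qed.

Lemma quot_ccont V (f : R[i] -> V) a : hol f a -> ccont (quot f a) a.
Proof.
move=> /hol_hd fa e e0; have [d d0 hdd] := fa (e / 2) ltac:(by rewrite divr_gt0).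
exists d => // y yd; rewrite /quot eqxx; have [_|ya] := eqVneq y a.
  by rewrite subrr nrm0.
have := hdd _ yd; rewrite [a + _]addrC subrK => h.
have y0 : 0 < nrm (y - a) by rewrite nrm_gt0 subr_eq0.
have -> : (y - a)^-1 *: (f y - f a) - derive1 f a =
    (y - a)^-1 *: (f y - f a - (y - a) *: derive1 f a).
  by rewrite [RHS]scalerBr scalerA mulVf ?subr_eq0// scale1r.
rewrite nrmZ nrmV; apply: le_lt_trans (_ : e / 2 < e); last slra.
by rewrite ler_pdivrMl// mulrC.
Qed.

End Continuity.

(** * Cauchy's integral formula and its consequences *)

Section CauchyFormula.
Context {R : realType} {V : normedModType R[i]}.
Hypothesis cV : seqcomplete V.
Implicit Types (f : R[i] -> V) (w a : R[i]).

(** Beyond [|al|] the mean does not depend on the radius, and the kernel tends to 1 as the radius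
    grows; [s] is a radius at which it is within [e] of 1. *)
Lemma kernel_mean (al : R[i]) (r : R) : nrm al < r ->
  is_mean (fun u => circ r u / (circ r u - al)) (1 : R[i]).
Proof.
move=> ar; have r0 : 0 < r := le_lt_trans (nrm_ge0 al) ar.
pose q (z : R[i]) : R[i] := z / (z - al).
have hq z : nrm al < nrm z -> hol q z.
  move=> az; apply: holM; first exact: hol_id.
  apply: hol_invf; last by apply: holB; [exact: hol_id|exact: hol_cst].
  by rewrite subr_eq0; apply: contraTneq az => ->; rewrite ltxx.
have cC := @seqcompleteC R.
have mq (s : R) : nrm al < s -> is_mean (fun u => q (0 + circ s u)) (cmean q 0 s).
  move=> als; apply: (cmeanP cC); last exact: le_trans (nrm_ge0 al) (ltW als).
  by move=> z; rewrite subr0 => zs; apply/hol_ccont/hq; rewrite zs.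
suff <- : cmean q 0 r = 1.
  by apply: is_mean_eq (mq r ar) => u _; rewrite /q add0r.
apply/eqP; rewrite -subr_eq0 -nrm_eq0; apply/eqP/le_anti; rewrite nrm_ge0 andbT.
apply/ler_addgt0Pr => e e0; rewrite add0r.
pose s := r + nrm al + nrm al / e.
have al0 := nrm_ge0 al; have ae0 : 0 <= nrm al / e by rewrite divr_ge0// ltW.
have rs : r <= s by rewrite /s; slra.
rewrite (@cmean_const _ _ cC q 0 r s)//; last first.
  by move=> z; rewrite subr0 => /andP[rz _]; apply: hq; exact: lt_le_trans rz.
apply: is_mean_dist (mq s (lt_le_trans ar rs)) (is_mean_cst _) _ => u _.
have cs : nrm (circ s u) = s by rewrite nrm_circ//; slra.
rewrite /q add0r.
have ns : s - nrm al <= nrm (circ s u - al) by have := nrmBD (circ s u) al; rewrite cs.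
have n0 : circ s u - al != 0 by rewrite -nrm_gt0; rewrite /s in ns; slra.
have -> : circ s u / (circ s u - al) - 1 = al / (circ s u - al) by field.
rewrite nrmM nrmV ler_pdivrMr ?nrm_gt0//.
apply: le_trans (_ : e * (s - nrm al) <= _); last by rewrite ler_wpM2l// ltW.
rewrite /s; have -> : e * (r + nrm al + nrm al / e - nrm al) = e * r + nrm al.
  by field; rewrite gt_eqF.
by rewrite lerDr mulr_ge0 ?ltW.
Qed.

(** Split [f = f a + (z - a) * quot f a]. The kernel times the second part is [k], which vanishes at
    [w], so its circle means are 0; the first part is [kernel_mean]. *)
Lemma cif f w (R0 r : R) a : ccont f w ->
  (forall z, 0 < nrm (z - w) < R0 -> hol f z) -> nrm (a - w) < r -> r < R0 ->
  is_mean (fun u => (circ r u / (circ r u - (a - w))) *: f (w + circ r u)) (f a).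
Proof.
move=> cf hf ar rR; have r0 : 0 < r := le_lt_trans (nrm_ge0 _) ar.
have hc s u : nrm (w + circ s u - w) = `|s|.
  by rewrite addrC addKr nrmM nrmR nrm_expi mulr1.
have [->|aw] := eqVneq a w.
  have fm := @cmean_center _ _ cV f w R0 r ltac:(by apply/andP) cf hf.
  rewrite -fm; apply: (@is_mean_eq _ _ (fun u => f (w + circ r u))).
    move=> u _; rewrite subrr subr0 divff ?scale1r//.
    by rewrite -nrm_gt0 nrm_circ// ltW.
  apply: cmeanP (ltW r0) => // z zr; apply/hol_ccont/hf; rewrite zr r0//.
pose rho := nrm (a - w); have rho0 : 0 < rho by rewrite nrm_gt0 subr_eq0.
have ha : hol f a by apply: hf; rewrite -/rho rho0 (lt_trans ar).
pose k z := (z - w) *: quot f a z.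
have cl z : ccont (fun y : R[i] => y - w) z.
  by apply: hol_ccont; apply: holB; [exact: hol_id|exact: hol_cst].
have hk z : z != a -> 0 < nrm (z - w) < R0 -> hol k z.
  move=> za /hf hz; apply: holZ; last exact: quot_hol_off.
  by apply: holB; [exact: hol_id|exact: hol_cst].
have ck z : nrm (z - w) < R0 -> ccont k z.
  move=> zR; apply: ccontZ => //; have [->|za] := eqVneq z a; first exact: quot_ccont.
  apply: quot_ccont_off => //; have [->//|zw] := eqVneq z w.
  by apply/hol_ccont/hf; rewrite zR nrm_gt0 subr_eq0 zw.
have mk s : 0 <= s < R0 -> is_mean (fun u => k (w + circ s u)) (cmean k w s).
  by move=> /andP[s0 sR]; apply: cmeanP => // z zs; apply: ck; rewrite zs.
have kw : k w = 0 by rewrite /k subrr scale0r.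
have kin s : 0 < s < rho -> cmean k w s = 0.
  move=> sr; rewrite -kw; apply: (@cmean_center _ _ cV k w rho s) => //.
    by apply: ck; rewrite subrr nrm0; slra.
  move=> z /andP[z0 zr]; apply: hk; last by rewrite z0/=; rewrite /rho in zr; slra.
  by apply: contraTneq zr => ->; rewrite ltxx.
(* At [a] the function [k] is only known to be continuous, so [cmean_const] cannot cross the circle
   of radius [rho] through [a]. The means at radii [s1 < rho < s2] are compared by uniform
   continuity instead. *)
have kr : cmean k w r = 0.
  apply/eqP; rewrite -nrm_eq0; apply/eqP/le_anti; rewrite nrm_ge0 andbT.
  apply/ler_addgt0Pr => e e0; rewrite add0r.
  have [d d0 hdd] := @circ_unif _ _ k w rho (e / 2) ltac:(by rewrite divr_gt0)
    (fun u _ => ck (w + circ rho u) ltac:(by rewrite hc gtr0_norm// (lt_trans ar rR))).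
  pose s1 := Num.max (rho / 2) (rho - d / 2); pose s2 := Num.min r (rho + d / 2).
  have s1a : rho / 2 <= s1 by rewrite le_max lexx.
  have s1b : rho - d / 2 <= s1 by rewrite le_max lexx orbT.
  have s1c : s1 < rho by rewrite gt_max; apply/andP; slra.
  have s2a : s2 <= r by rewrite ge_min lexx.
  have s2b : s2 <= rho + d / 2 by rewrite ge_min lexx orbT.
  have s2c : rho < s2 by rewrite lt_min; apply/andP; rewrite /rho in ar *; slra.
  have s20 : 0 < s2 by slra.
  rewrite -(@cmean_const _ _ cV k w s2 r s20 s2a); last first.
    move=> z /andP[z1 z2]; apply: hk; last by apply/andP; slra.
    by apply: contraTneq z1 => ->; rewrite -/rho; slra.
  rewrite -(subr0 (cmean k w s2)) -(kin s1); last by apply/andP; slra.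
  apply: is_mean_dist (mk s2 ltac:(by apply/andP; slra)) (mk s1 ltac:(by apply/andP; slra)) _.
  move=> u u01; have k1 := hdd s1 u ltac:(by rewrite ltr_norml; apply/andP; slra) u01.
  have k2 := hdd s2 u ltac:(by rewrite ltr_norml; apply/andP; slra) u01.
  have := nrmB_tri (k (w + circ s2 u)) (k (w + circ rho u)) (k (w + circ s1 u)).
  by rewrite (nrmBC (k (w + circ rho u))); slra.
have := is_meanD (mk r ltac:(by apply/andP; slra))
  (@is_mean_lin _ _ _ (fun x : R[i] => x *: f a) (nrm (f a)) _ _
    (fun x y => scalerDl _ x y) (fun b x => esym (scalerA b x (f a)))
    (fun x => ltac:(by rewrite nrmZ mulrC)) (kernel_mean ar)).
rewrite kr add0r scale1r; apply: is_mean_eq => u _.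
set z := w + circ r u; have zw : z - w = circ r u by rewrite /z addrC addKr.
have za : z - a = circ r u - (a - w) by rewrite /z opprB addrCA addrA.
have za0 : z != a.
  by apply: contraTneq ar => za'; rewrite -za' /z hc gtr0_norm// ltxx.
rewrite /k /quot (negbTE za0) zw za scalerA scalerBr.
by rewrite subrK.
Qed.

(** Second-order expansion of the Cauchy kernel: [c] is the mean of [f z / (z - w)], and the
    remaining kernel has modulus at most [|a - w|^2 / (r * (r / 2))]. *)
Lemma cif_taylor f w (R0 r M : R) : ccont f w ->
  (forall z, 0 < nrm (z - w) < R0 -> hol f z) -> 0 < r < R0 ->
  (forall z, nrm (z - w) = r -> nrm (f z) <= M) ->
  exists2 c, nrm c <= M / r & forall a, nrm (a - w) <= r / 2 ->
    nrm (f a - f w - (a - w) *: c) <= 2 * M / r ^+ 2 * nrm (a - w) ^+ 2.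
Proof.
move=> cf hf /andP[r0 rR] fM.
pose g z := (z - w)^-1 *: f z.
have cg z : nrm (z - w) = r -> ccont g z.
  move=> zr; have z0 : z - w != 0 by rewrite -nrm_gt0 zr.
  apply: hol_ccont; apply: holZ; last by apply: hf; rewrite zr r0.
  by apply: hol_invf => //; apply: holB; [exact: hol_id|exact: hol_cst].
have gm := cmeanP cV cg (ltW r0).
have cn u : nrm (circ r u) = r by rewrite nrm_circ// ltW.
have zw u : w + circ r u - w = circ r u by rewrite addrC addKr.
have fn u : nrm (f (w + circ r u)) <= M by apply: fM; rewrite zw.
exists (cmean g w r).
  apply: is_mean_bound gm _ => u _; rewrite /g nrmZ nrmV zw cn mulrC.
  by apply: ler_wpM2r; rewrite ?invr_ge0 ?fn// ltW.
move=> a ar; have ar' : nrm (a - w) < r by slra.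
have wr : nrm (w - w) < r by rewrite subrr nrm0.
have m1 := cif cf hf ar' rR; have m2 := cif cf hf wr rR.
have m3 := @is_mean_lin _ _ _ (fun x : V => (a - w) *: x) (nrm (a - w)) _ _
   (fun x y => scalerDr _ x y) (fun b x => ltac:(by rewrite !scalerA mulrC))
   (fun x => ltac:(by rewrite nrmZ)) gm.
rewrite -addrA -opprD; apply: is_mean_dist m1 (is_meanD m2 m3) _ => u _.
set F := f (w + circ r u).
have c0 : circ r u != 0 by rewrite -nrm_gt0 cn.
have ca : nrm (circ r u - (a - w)) >= r / 2.
  by have := nrmBD (circ r u) (a - w); rewrite cn; slra.
have ca0 : circ r u - (a - w) != 0 by rewrite -nrm_gt0; slra.
rewrite /g zw -/F !scalerA -scalerDl -scalerBl subrr subr0.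
have -> : circ r u / (circ r u - (a - w)) - (circ r u / circ r u + (a - w) / circ r u) =
  (a - w) ^+ 2 / (circ r u * (circ r u - (a - w))).
  by move: ca0 c0; set c := circ r u; set b := a - w => ? ?; field; apply/andP.
rewrite nrmZ nrmM nrmV nrmM nrmX cn mulrC.
have M0 : 0 <= M := le_trans (nrm_ge0 _) (fn u).
rewrite mulrA -mulrA [X in _ <= X](_ : _ = M * (nrm (a - w) ^+ 2 / (r * (r / 2)))); last first.
  by field; rewrite gt_eqF.
rewrite mulrA [X in _ <= X]mulrA; apply: ler_pM.
- by rewrite mulr_ge0 ?nrm_ge0 ?sqr_ge0.
- by rewrite invr_ge0 mulr_ge0 ?nrm_ge0 ?ltW.
- by rewrite ler_wpM2r ?sqr_ge0 ?fn.
- by rewrite lef_pV2 ?posrE ?mulr_gt0 ?nrm_gt0 ?divr_gt0// ler_wpM2l// ltW.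
Qed.

Lemma hd_of_taylor f w c (K s : R) : 0 < s ->
  (forall a, nrm (a - w) <= s -> nrm (f a - f w - (a - w) *: c) <= K * nrm (a - w) ^+ 2) ->
  hd f w c.
Proof.
move=> s0 hK e e0; have K1 : 0 < `|K| + 1 by have := normr_ge0 K; slra.
exists (Num.min s (e / (`|K| + 1))); first by rewrite lt_min s0 divr_gt0.
move=> h; rewrite lt_min ltr_pdivlMr// => /andP[hs he].
have := hK (w + h); rewrite addrC addKr => /(_ (ltW hs)) H; apply: le_trans H _.
rewrite expr2 mulrA ler_wpM2r ?nrm_ge0//.
have := ler_norm K; have := nrm_ge0 h; snra.
Qed.

Lemma ccont_bounded f w : ccont f w -> exists2 d, 0 < d &
  forall z, nrm (z - w) < d -> nrm (f z) <= nrm (f w) + 1.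
Proof.
move=> /(_ 1 ltr01)[d d0 hdd]; exists d => // z /hdd h.
by have := nrmD (f z - f w) (f w); rewrite subrK; slra.
Qed.

Lemma removable f w (R0 : R) : 0 < R0 -> ccont f w ->
  (forall z, 0 < nrm (z - w) < R0 -> hol f z) -> hol f w.
Proof.
move=> R00 cf hf; have [d d0 fd] := ccont_bounded cf.
pose r := Num.min R0 d / 2; have m0 : 0 < Num.min R0 d by rewrite lt_min R00.
have r0 : 0 < r by rewrite divr_gt0.
have rm : r < Num.min R0 d by rewrite /r; slra.
have [c _ hc] := @cif_taylor f w R0 r (nrm (f w) + 1) cf hf
  ltac:(by rewrite r0 (lt_le_trans rm)// ge_min lexx)
  (fun z zr => fd z ltac:(by rewrite zr (lt_le_trans rm)// ge_min lexx orbT)).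
by exists c; apply: (hd_of_taylor _ hc); rewrite divr_gt0.
Qed.

Lemma hol_taylor f w (R0 r M : R) :
  (forall z, nrm (z - w) < R0 -> hol f z) -> 0 < r < R0 ->
  (forall z, nrm (z - w) = r -> nrm (f z) <= M) ->
  nrm (derive1 f w) <= M / r /\ forall a, nrm (a - w) <= r / 2 ->
    nrm (f a - f w - (a - w) *: derive1 f w) <= 2 * M / r ^+ 2 * nrm (a - w) ^+ 2.
Proof.
move=> hf rR fM; have R00 : 0 < R0 by case/andP: rR => r0 /(lt_trans r0).
have hw : hol f w by apply: hf; rewrite subrr nrm0.
have [c cM hc] := @cif_taylor f w R0 r M (hol_ccont hw)
  (fun z hz => hf z (andP hz).2) rR fM.
have fc : hd f w c.
  by apply: (hd_of_taylor _ hc); case/andP: rR => r0 _; rewrite divr_gt0.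
by rewrite (hd_derive fc).2; split.
Qed.

Lemma quot_hol f a (R0 : R) : (forall z, nrm (z - a) < R0 -> hol f z) ->
  forall z, nrm (z - a) < R0 -> hol (quot f a) z.
Proof.
move=> hf z zR; have [->|za] := eqVneq z a; last exact: quot_hol_off (hf _ zR).
have R00 : 0 < R0 := le_lt_trans (nrm_ge0 _) zR.
apply: (removable R00); first by apply: quot_ccont; apply: hf; rewrite subrr nrm0.
move=> y /andP[y0 yR]; apply: quot_hol_off; last exact: hf.
by rewrite -subr_eq0 -nrm_gt0.
Qed.

(** A weak maximum principle: on the disc of half the radius the Cauchy kernel has modulus at most
    2. *)
Lemma max_twice f w (R0 r M : R) a :
  (forall z, nrm (z - w) < R0 -> hol f z) -> 0 < r < R0 ->
  (forall z, nrm (z - w) = r -> nrm (f z) <= M) ->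
  nrm (a - w) <= r / 2 -> nrm (f a) <= 2 * M.
Proof.
move=> hf /andP[r0 rR] fM ar; have R00 : 0 < R0 := lt_trans r0 rR.
have hw : hol f w by apply: hf; rewrite subrr nrm0.
have ar' : nrm (a - w) < r by slra.
apply: is_mean_bound (cif (hol_ccont hw) (fun z hz => hf z (andP hz).2) ar' rR) _ => u _.
have cn : nrm (circ r u) = r by rewrite nrm_circ// ltW.
have ca : nrm (circ r u - (a - w)) >= r / 2.
  by have := nrmBD (circ r u) (a - w); rewrite cn; slra.
rewrite nrmZ; apply: ler_pM; rewrite ?nrm_ge0//.
  by rewrite nrmM nrmV cn ler_pdivrMr; slra.
by apply: fM; rewrite addrC addKr.
Qed.

(** Divide twice: [f = f w + (z - w) g] and [g = g w + (z - w) g2], so [f' = g + (z - w) g'] has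
    derivative [2 * g2 w] at [w]. The remainder needs [derive1 g2] bounded near [w], which is
    Cauchy's estimate [g2d]. *)
Lemma derive_hol f w (R0 : R) : 0 < R0 -> (forall z, nrm (z - w) < R0 -> hol f z) ->
  hol (derive1 f) w.
Proof.
move=> R00 hf; pose g := quot f w; pose g2 := quot g w.
have hg := quot_hol hf; have hg2 := quot_hol hg.
have ww : nrm (w - w) < R0 by rewrite subrr nrm0.
have dq (k : R[i] -> V) z : hol (quot k w) z ->
    derive1 k z = quot k w z + (z - w) *: derive1 (quot k w) z.
  move=> /hol_hd hq.
  have : hd (fun z => k w + (z - w) *: quot k w z) z
      (0 + ((1 - 0) *: quot k w z + (z - w) *: derive1 (quot k w) z)).
    apply: hdD; first exact: hd_cst.
    by apply: hdZ => //; apply: hdB; [exact: hd_id|exact: hd_cst].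
  move=> /(hd_ext (fun y => esym (quotE k w y)))/hd_derive[_ ->].
  by rewrite add0r subr0 scale1r.
have [d d0 g2b] := ccont_bounded (hol_ccont (hg2 w ww)).
pose r := Num.min R0 d / 4; have m0 : 0 < Num.min R0 d by rewrite lt_min R00.
have r0 : 0 < r by rewrite divr_gt0.
have rm : 4 * r = Num.min R0 d by rewrite /r; field.
have rR : 4 * r <= R0 by rewrite rm ge_min lexx.
have rd : 4 * r <= d by rewrite rm ge_min lexx orbT.
pose B := nrm (g2 w) + 1.
have g2d z : nrm (z - w) < r -> nrm (derive1 g2 z) <= B / r.
  move=> zr.
  have sub y : nrm (y - z) < 2 * r -> nrm (y - w) < 4 * r.
    by have := nrmB_tri y z w; slra.
  apply: (@hol_taylor g2 z (2 * r) r B _ _ _).1.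
  - by move=> y /sub yr; apply: hg2; slra.
  - by apply/andP; slra.
  - by move=> y yr; apply: g2b; have := sub y; rewrite yr; slra.
have cg2 := hol_ccont (hg2 w ww).
exists (2 *: g2 w) => e e0; have B0 : 0 < B by have := nrm_ge0 (g2 w); rewrite /B; slra.
have [d' d'0 h'] := cg2 (e / 4) ltac:(by rewrite divr_gt0).
exists (Num.min (Num.min r d') (e / 2 / (B / r))).
  by rewrite !lt_min r0 d'0 !divr_gt0.
move=> h; rewrite !lt_min => /andP[/andP[hr hd'] he].
have wh : w + h - w = h by rewrite addrC addKr.
have whr : nrm (w + h - w) < R0 by rewrite wh; slra.
rewrite (dq f (w + h)); last exact: hg.
rewrite (dq f w); last exact: hg.
rewrite -/g wh subrr scale0r addr0 (dq g (w + h)); last exact: hg2.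
rewrite -/g2 wh (quotE g w (w + h)) -/g2 wh.
have -> : g w + h *: g2 (w + h) + h *: (g2 (w + h) + h *: derive1 g2 (w + h)) - g w -
   h *: (2 *: g2 w) = h *: (2 *: (g2 (w + h) - g2 w) + h *: derive1 g2 (w + h)).
  rewrite [LHS](AC 5%AC ((1*4)*(2*3*5))%AC)/= subrr add0r -!scalerDr -scalerBr.
  congr (_ *: _); rewrite scalerBr [2 *: g2 (w + h)]scaler_nat [g2 (w + h) *+ 2]mulr2n !addrA.
  by rewrite [LHS]addrAC; reflexivity.
rewrite nrmZ mulrC ler_wpM2r ?nrm_ge0//.
apply: le_trans (nrmD _ _) _; rewrite !nrmZ.
rewrite nrm_nat.
have k1 := h' (w + h) ltac:(by rewrite wh).
have k2 := g2d (w + h) ltac:(by rewrite wh).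
have : nrm h * nrm (derive1 g2 (w + h)) <= e / 2.
  apply: le_trans (_ : nrm h * (B / r) <= _); first by rewrite ler_wpM2l ?nrm_ge0.
  by rewrite -ler_pdivlMr ?divr_gt0// ltW.
slra.
Qed.

End CauchyFormula.

(** * Zeros of holomorphic functions *)

Section ScalarZeros.
Context {R : realType}.
Notation C := (R[i] : normedModType R[i]).
Implicit Types (f g k K : R[i] -> R[i]) (p a z w : R[i]).

Let cC := @seqcompleteC R.

Lemma hol_ball_center f p (R0 : R) z : (forall z, nrm (z - p) < R0 -> hol f z) ->
  nrm (z - p) < R0 -> exists2 d : R, 0 < d & forall y, nrm (y - z) < d -> hol f y.
Proof.
move=> hf zR; exists (R0 - nrm (z - p)); first by rewrite subr_gt0.
by move=> y yz; apply: hf; have := nrmB_tri y z p; slra.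
Qed.

Lemma quot_hol_ball f p (R0 : R) a : (forall z, nrm (z - p) < R0 -> hol f z) ->
  nrm (a - p) < R0 -> forall z, nrm (z - p) < R0 -> hol (quot f a) z.
Proof.
move=> hf aR z zR; have [->|za] := eqVneq z a; last exact: quot_hol_off (hf _ zR).
have [d d0 hd'] := hol_ball_center hf aR.
by apply: (quot_hol cC hd'); rewrite subrr nrm0.
Qed.

Lemma derive_hol_ball f p (R0 : R) : (forall z, nrm (z - p) < R0 -> hol f z) ->
  forall z, nrm (z - p) < R0 -> hol (derive1 f) z.
Proof.
move=> hf z zR; have [d d0 hd'] := hol_ball_center hf zR.
exact: (derive_hol cC d0 hd').
Qed.

Lemma center_le f p (R0 r M : R) : (forall z, nrm (z - p) < R0 -> hol f z) ->
  0 < r < R0 -> (forall z, nrm (z - p) = r -> nrm (f z) <= M) -> nrm (f p) <= M.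
Proof.
move=> hf /andP[r0 rR] fM; have R00 : 0 < R0 := lt_trans r0 rR.
have cp : ccont f p by apply/hol_ccont/hf; rewrite subrr nrm0.
have hf' z : 0 < nrm (z - p) < R0 -> hol f z by move=> /andP[_ /hf].
have rp : nrm (p - p) < r by rewrite subrr nrm0.
apply: is_mean_bound (cif cC cp hf' rp rR) _ => u _.
have cn : nrm (circ r u) = r by rewrite nrm_circ// ltW.
rewrite subrr subr0 divff ?scale1r -?nrm_gt0 ?cn//.
by apply: fM; rewrite addrC addKr.
Qed.

(** [g] may still vanish, so that zeros can be extracted one at a time; its nonvanishing is stated
    separately where it is needed. *)
Definition factorized f p (R0 r1 : R) (zs : seq R[i]) g :=
  [/\ forall z, nrm (z - p) < R0 -> hol g z,
      forall z, z \in zs -> nrm (z - p) < r1 &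
      forall z, nrm (z - p) < R0 -> f z = (\prod_(w <- zs) (z - w)) * g z].

Lemma prod_seq_ge (s : seq R[i]) z (c : R) : 0 <= c ->
  (forall w, w \in s -> c <= nrm (z - w)) ->
  c ^+ size s <= nrm (\prod_(w <- s) (z - w)).
Proof.
move=> c0; rewrite nrm_prod; elim: s => [|w s IH] h; first by rewrite big_nil.
rewrite big_cons exprS ler_pM ?exprn_ge0//; first by rewrite h// mem_head.
by apply: IH => x xs; rewrite h// in_cons xs orbT.
Qed.

Lemma prod_seq_le (s : seq R[i]) z (c : R) :
  (forall w, w \in s -> nrm (z - w) <= c) ->
  nrm (\prod_(w <- s) (z - w)) <= c ^+ size s.
Proof.
rewrite nrm_prod; elim: s => [|w s IH] h; first by rewrite big_nil.
rewrite big_cons exprS; apply: ler_pM; rewrite ?nrm_ge0//.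
- by rewrite -nrm_prod nrm_ge0.
- by rewrite h// mem_head.
- by apply: IH => x xs; rewrite h// in_cons xs orbT.
Qed.

(** Jensen's bound in product form: each factor [z - w] has modulus at least [r2 - r1] on the circle
    of radius [r2] and at most [r1] at the centre. *)
Lemma zero_count f p (R0 r1 r2 M : R) zs g : 0 < r1 -> r1 < r2 -> r2 < R0 ->
  (forall z, nrm (z - p) = r2 -> nrm (f z) <= M) ->
  factorized f p R0 r1 zs g ->
  nrm (g p) <= M / (r2 - r1) ^+ size zs /\ nrm (f p) <= r1 ^+ size zs * nrm (g p).
Proof.
move=> r10 r12 r2R fM [hg hz fg]; split.
  apply: (@center_le g p R0 r2) => //; first by rewrite r2R andbT (lt_trans r10).
  move=> z zr; rewrite ler_pdivlMr ?exprn_gt0 ?subr_gt0// mulrC.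
  apply: le_trans (fM z zr); rewrite fg ?zr// nrmM ler_wpM2r ?nrm_ge0//.
  apply: prod_seq_ge; first by rewrite subr_ge0 ltW.
  by move=> w /hz wr; have := nrmB_tri z w p; rewrite zr; slra.
rewrite fg ?subrr ?nrm0 ?(lt_trans _ r2R) ?(lt_trans r10)// nrmM.
rewrite ler_wpM2r ?nrm_ge0//; apply: prod_seq_le => w /hz wr.
by rewrite nrmBC ltW.
Qed.

(** If every cofactor had a zero in the small disc, zeros could be extracted without end, against
    [zero_count]: the ratio [(r2 - r1) / r1] exceeds 1, so its powers are unbounded. *)
Lemma factorization f p (R0 r1 r2 M : R) : (forall z, nrm (z - p) < R0 -> hol f z) ->
  0 < r1 -> 2 * r1 < r2 -> r2 < R0 ->
  (forall z, nrm (z - p) = r2 -> nrm (f z) <= M) -> f p != 0 ->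
  exists zs g, factorized f p R0 r1 zs g /\ forall z, nrm (z - p) < r1 -> g z != 0.
Proof.
move=> hf r10 r12 r2R fM fp0; apply: contrapT => nex.
have ex m : exists zs g, size zs = m /\ factorized f p R0 r1 zs g.
  elim: m => [|m [zs [g [szs fact]]]].
    by exists [::], f; split=> //; split=> // z zR; rewrite big_nil mul1r.
  have [z0 z0r gz0] : exists2 z, nrm (z - p) < r1 & g z = 0.
    apply: contrapT => nz; apply: nex; exists zs, g; split=> // z zr.
    by apply/eqP => gz; apply: nz; exists z.
  have [hg hz fg] := fact; exists (z0 :: zs), (quot g z0); split; first by rewrite /= szs.
  have z0R : nrm (z0 - p) < R0 by slra.
  split; first exact: quot_hol_ball hg z0R.
    by move=> z; rewrite in_cons => /orP[/eqP->|/hz].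
  move=> z zR; rewrite fg// big_cons {1}(quotE g z0 z) gz0 add0r.
  by rewrite [(z - z0) *: _]/((z - z0) * _) mulrCA mulrA.
have r120 : 0 < (r2 - r1) / r1 by rewrite divr_gt0; slra.
have nf0 : 0 < nrm (f p) by rewrite nrm_gt0.
have bound m : ((r2 - r1) / r1) ^+ m <= M / nrm (f p).
  have [zs [g [<- fact]]] := ex m.
  have r1r2 : r1 < r2 by slra.
  have [b1 b2] := zero_count r10 r1r2 r2R fM fact.
  rewrite ler_pdivlMr// expr_div_n mulrAC ler_pdivrMr ?exprn_gt0//.
  have D0 : 0 < (r2 - r1) ^+ size zs by rewrite exprn_gt0//; slra.
  move: b1; rewrite ler_pdivlMr// => b1.
  apply: le_trans (_ : (r2 - r1) ^+ size zs * (r1 ^+ size zs * nrm (g p)) <= _).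
    by rewrite ler_wpM2l// ltW.
  by rewrite mulrCA [leRHS]mulrC ler_wpM2l ?exprn_ge0 ?(ltW r10)// mulrC.
pose q := (r2 - r1) / r1 - 1.
have q0 : 0 < q by rewrite /q subr_gt0 ltr_pdivlMr//; slra.
have bern m : 1 + q *+ m <= ((r2 - r1) / r1) ^+ m.
  have -> : (r2 - r1) / r1 = 1 + q by rewrite /q [1 + _]addrC subrK.
  elim: m => [|m IH]; first by rewrite mulr0n addr0.
  rewrite exprS mulrS; have : 0 <= q *+ m by rewrite mulrn_wge0// ltW.
  snra.
pose m := (Num.trunc (M / nrm (f p) / q)).+1.
have := le_trans (bern m) (bound m); rewrite -mulr_natr => h.
have := truncnS_gt (M / nrm (f p) / q); rewrite -/m ltr_pdivrMr//; slra.
Qed.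

Lemma ln_nrm1D (x : R[i]) : nrm x <= 1 / 2 ->
  `|ln (nrm (1 + x)) - complex.Re x| <= 16 * nrm x ^+ 2.
Proof.
move=> x2; have x0 := nrm_ge0 x.
have n1 : 1 - nrm x <= nrm (1 + x).
  by have := nrmBD (1 : R[i]) (- x); rewrite nrm1 nrmN opprK.
have s0 : 0 < nrm (1 + x) by slra.
pose t := 2 * complex.Re x + nrm x ^+ 2.
have sE : nrm (1 + x) ^+ 2 = 1 + t.
  by rewrite /t !nrm_sqr cReD cImD/= add0r; ring.
have t0 : 1 / 4 <= 1 + t by rewrite -sE expr2; snra.
have lE : ln (1 + t) = 2 * ln (nrm (1 + x)).
  by rewrite -sE lnXn// mulr_natl.
have up : ln (1 + t) <= t by have := @le_ln1Dx R t; slra.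
have lo : t - t ^+ 2 / (1 + t) <= ln (1 + t).
  have : ln (1 + (- t / (1 + t))) <= - t / (1 + t).
    by apply: le_ln1Dx; rewrite ltr_pdivlMr; slra.
  have -> : 1 + (- t / (1 + t)) = (1 + t)^-1 by field; slra.
  rewrite lnV ?posrE; last slra.
  have -> : t - t ^+ 2 / (1 + t) = - (- t / (1 + t)) by field; slra.
  slra.
have rx := Re_le_nrm x; have /andP[rx1 rx2] : - nrm x <= complex.Re x <= nrm x by rewrite -ler_norml.
have tb : `|t| <= 5 / 2 * nrm x.
  by rewrite ler_norml; apply/andP; rewrite /t expr2; split; snra.
have t2 : t ^+ 2 / (1 + t) <= 25 * nrm x ^+ 2.
  rewrite ler_pdivrMr; last slra.
  have : t ^+ 2 <= 25 / 4 * nrm x ^+ 2.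
    rewrite -(real_normK (num_real t)) expr2 [nrm x ^+ 2]expr2.
    have := normr_ge0 t; snra.
  have := sqr_ge0 (nrm x); snra.
have n2 := sqr_ge0 (nrm x).
have tE : t = 2 * complex.Re x + nrm x ^+ 2 by [].
rewrite lE in up lo; rewrite ler_norml; apply/andP; split; slra.
Qed.

Lemma segmean_dist k p q w (e : R) :
  (forall u : R, 0 <= u <= 1 -> ccont k (p + (u%:C)%C * q)) ->
  (forall u : R, 0 <= u <= 1 -> nrm (k (p + (u%:C)%C * q) - w) <= e) ->
  nrm (segmean (k : R[i] -> C) p q - w) <= e.
Proof. by move=> ck; exact: is_mean_dist (segmeanP cC ck) (is_mean_cst _). Qed.

(** The fundamental theorem of calculus for interval functions: an additive [J] that agrees with the
    increments of [psi] up to [e * s] on short intervals agrees with them exactly. *)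
Lemma interval_additive_eq (J : R -> R -> R) (psi : R -> R) :
  (forall x s, 0 <= x -> 0 <= s -> x + s <= 1 ->
    J x s = J x (s / 2) + J (x + s / 2) (s / 2)) ->
  (forall X e, 0 <= X <= 1 -> 0 < e -> exists2 d, 0 < d & forall x s,
    0 <= x -> x + s <= 1 -> x <= X <= x + s -> s < d ->
    `|J x s - (psi (x + s) - psi x)| <= e * s) ->
  J 0 1 = psi 1 - psi 0.
Proof.
move=> Jadd Jloc; apply/eqP; rewrite -subr_eq0 -normr_eq0; apply/eqP/le_anti.
rewrite normr_ge0 andbT; apply/ler_addgt0Pr => e e0; rewrite add0r.
pose P (x s : R) := `|J x s - (psi (x + s) - psi x)| <= e * s.
suff : P 0 1 by rewrite /P add0r mulr1.
apply: (@cousin1 _ P) => //; rewrite add0r.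
  move=> x s x0 xs s0; rewrite /P (Jadd x s)//.
  have <- : x + s = x + s / 2 + s / 2 by slra.
  by rewrite !ler_norml => /andP[? ?] /andP[? ?]; apply/andP; split; slra.
move=> X X01; have [d d0 hdd] := Jloc X e X01 e0; by exists d.
Qed.

(** Only the real part of the logarithm is used, so no branch of the argument has to be chosen. *)
Lemma ln_norm_ftc g p q : (forall u : R, 0 <= u <= 1 ->
    [/\ hol g (p + (u%:C)%C * q), hol (derive1 g) (p + (u%:C)%C * q) &
        g (p + (u%:C)%C * q) != 0]) ->
  complex.Re (q * segmean (fun z => derive1 g z / g z : C) p q) =
    ln (nrm (g (p + q))) - ln (nrm (g p)).
Proof.
move=> hg; pose k z : C := derive1 g z / g z; pose c (u : R) := p + (u%:C)%C * q.
have hk u : 0 <= u <= 1 -> hol k (c u).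
  by move=> /hg[h1 h2 h3]; apply: holM => //; exact: hol_invf.
pose I x s : R[i] := (s%:C)%C * q * segmean k (c x) ((s%:C)%C * q).
pose psi u := ln (nrm (g (c u))).
have cE x s u : c x + (u%:C)%C * ((s%:C)%C * q) = c (x + u * s).
  by rewrite /c rmorphD/= realcM mulrDl addrA mulrA.
have -> : ln (nrm (g (p + q))) - ln (nrm (g p)) = psi 1 - psi 0.
  by rewrite /psi /c mul1r mul0r addr0.
have -> : q * segmean (fun z : R[i] => derive1 g z / g z : C) p q = I 0 1.
  by rewrite /I /c mul0r addr0 mul1r.
have csub (x s : R) : 0 <= x -> 0 <= s -> x + s <= 1 -> forall u : R, 0 <= u <= 1 ->
    0 <= x + u * s <= 1.
  by move=> x0 s0 xs u /andP[u0 u1]; apply/andP; split; snra.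
apply: (@interval_additive_eq (fun x s => complex.Re (I x s)) psi).
  move=> x s x0 s0 xs; rewrite -cReD; congr complex.Re.
  have ck u : 0 <= u <= 1 -> ccont k (c x + (u%:C)%C * ((s%:C)%C * q)).
    by move=> hu; rewrite cE; apply/hol_ccont/hk/csub.
  have e1 : (s%:C)%C * q * (2^-1)%:C%C = ((s / 2)%:C)%C * q.
    by rewrite mulrAC -realcM.
  rewrite /I (segmean_half cC ck) e1.
  have -> : c x + ((s / 2)%:C)%C * q = c (x + s / 2).
    by rewrite /c rmorphD/= mulrDl addrA.
  by rewrite -[_ *: _]/(_ * _) mulrA e1 mulrDr.
move=> X e X01 e0; have [h1 h2 h3] := hg X X01.
rewrite -/(c X) in h1 h2 h3.
have [q0|qn0] := eqVneq q 0.
  exists 1 => // x s _ _ /andP[? ?] _; rewrite /I /psi /c q0 !mulr0 mul0r !addr0 /=.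
  by rewrite subrr subr0 normr0 mulr_ge0; slra.
have nq0 : 0 < nrm q by rewrite nrm_gt0.
pose zeta := q * k (c X).
have psid : exists2 d : R, 0 < d & forall y, `|y - X| < d ->
    `|psi y - psi X - (y - X) * complex.Re zeta| <= e / 2 * `|y - X|.
  have hd1 : hd (fun z => g z / g (c X)) (c X) (k (c X)).
    have := hdcZ (g (c X))^-1 (hol_hd h1); rewrite [_ *: _]mulrC.
    by apply: hd_ext => z; rewrite -[LHS]/(_ * _) mulrC.
  pose Z := nrm zeta + 1; have Z0 : 0 < Z by have := nrm_ge0 zeta; rewrite /Z; slra.
  have [d d0 hdd] := hd1 (Num.min (1 / nrm q) (e / 4 / nrm q))
     ltac:(by rewrite lt_min !divr_gt0).
  exists (Num.min (d / nrm q) (Num.min (1 / 2 / Z) (e / 64 / Z ^+ 2))).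
    by rewrite !lt_min !divr_gt0// exprn_gt0.
  move=> y; rewrite !lt_min => /and3P[y1 y2 y3].
  have yq : nrm (((y - X)%:C)%C * q) = `|y - X| * nrm q by rewrite nrmM nrmR.
  have := hdd (((y - X)%:C)%C * q); rewrite yq -ltr_pdivlMr// => /(_ y1).
  have -> : c X + ((y - X)%:C)%C * q = c y by rewrite /c rmorphB/=; ring.
  rewrite divff//; set m := Num.min _ _ => hm.
  pose xi := g (c y) / g (c X) - 1.
  have hxi : nrm (xi - ((y - X)%:C)%C * zeta) <= m * nrm q * `|y - X|.
    rewrite -mulrA [nrm q * _]mulrC; apply: le_trans hm.
    by rewrite /xi /zeta mulrA.
  have m1 : m * nrm q <= 1 by rewrite -ler_pdivlMr// ge_min lexx.
  have m2 : m * nrm q <= e / 4 by rewrite -ler_pdivlMr// ge_min lexx orbT.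
  have y0 := normr_ge0 (y - X).
  have nxi : nrm xi <= Z * `|y - X|.
    have := nrmD (xi - ((y - X)%:C)%C * zeta) (((y - X)%:C)%C * zeta).
    rewrite subrK nrmM nrmR /Z; snra.
  have nxi2 : nrm xi <= 1 / 2.
    by apply: le_trans nxi _; rewrite mulrC -ler_pdivlMr// ltW.
  have := ln_nrm1D nxi2.
  have gy0 : nrm (g (c y) / g (c X)) = nrm (1 + xi) by rewrite /xi addrC subrK.
  have n1 : 0 < nrm (1 + xi) by have := nrmBD (1 : R[i]) (- xi); rewrite nrm1 nrmN opprK; slra.
  have -> : ln (nrm (1 + xi)) = psi y - psi X.
    rewrite -gy0 nrmM nrmV lnM ?lnV ?posrE ?invr_gt0 ?nrm_gt0//.
    by apply: contraTneq n1 => gy; rewrite -gy0 gy mul0r nrm0 ltxx.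
  have := Re_le_nrm (xi - ((y - X)%:C)%C * zeta).
  rewrite cReD cReN cReM/= mul0r subr0.
  have : nrm xi ^+ 2 <= Z ^+ 2 * `|y - X| * `|y - X|.
    by rewrite -mulrA -expr2 -exprMn ler_pXn2r ?nnegrE ?nrm_ge0 ?mulr_ge0// ltW.
  have : Z ^+ 2 * `|y - X| * `|y - X| <= e / 64 * `|y - X|.
    by rewrite ler_wpM2r// mulrC -ler_pdivlMr ?exprn_gt0// ltW.
  have : m * nrm q * `|y - X| <= e / 4 * `|y - X| by rewrite ler_wpM2r.
  move: (psi y) (psi X) (complex.Re xi) (complex.Re zeta) => u v w t.
  move=> a1 a2 a3; rewrite !ler_norml => /andP[? ?] /andP[? ?]; apply/andP; split; slra.
have [d1 d10 hd1] := psid.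
have [d2 d20 hd2] := hol_ccont (hk X X01) (divr_gt0 e0 (mulr_gt0 (ltr0n _ 2) nq0)).
exists (Num.min d1 (d2 / nrm q)); first by rewrite lt_min d10 divr_gt0.
move=> x s x0 xs /andP[xX Xs]; rewrite lt_min => /andP[s1 s2].
have s0 : 0 <= s by slra.
have k1 := hd1 x ltac:(by rewrite ltr_norml; apply/andP; slra).
have k2 := hd1 (x + s) ltac:(by rewrite ltr_norml; apply/andP; slra).
have k3 : nrm (segmean k (c x) ((s%:C)%C * q) - k (c X)) <= e / (2 * nrm q).
  apply: segmean_dist => u hu; rewrite cE; first by apply/hol_ccont/hk/csub.
  apply/ltW/hd2; rewrite /c opprD addrACA subrr add0r -mulrBl -rmorphB nrmM nrmR.
  rewrite -ltr_pdivlMr//; apply: le_lt_trans s2.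
  by case/andP: hu => ? ?; rewrite ler_norml; apply/andP; split; snra.
have k4 : `|complex.Re (I x s) - s * complex.Re zeta| <= e / 2 * s.
  have -> : complex.Re (I x s) - s * complex.Re zeta =
      complex.Re ((s%:C)%C * q * (segmean k (c x) ((s%:C)%C * q) - k (c X))).
    rewrite mulrBr cReD cReN; congr (_ - _).
    by rewrite -mulrA [RHS]cReM ReC ImC mul0r subr0.
  apply: le_trans (Re_le_nrm _) _; rewrite !nrmM nrmR ger0_norm//.
  rewrite -mulrA mulrC ler_wpM2r//.
  by move: k3; rewrite ler_pdivlMr ?mulr_gt0//; slra.
have a1 : `|x - X| = X - x by rewrite distrC ger0_norm; slra.
have a2 : `|x + s - X| = x + s - X by rewrite ger0_norm; slra.
move: k1 k2 k4; rewrite a1 a2.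
move: (psi x) (psi (x + s)) (psi X) (complex.Re (I x s)) (complex.Re zeta) => u v w A B.
rewrite !ler_norml => /andP[? ?] /andP[? ?] /andP[? ?].
by apply/andP; split; slra.
Qed.

End ScalarZeros.

(** * Logarithms of zero-free functions and four-point differences *)

Section Logarithm.
Context {R : realType}.
Notation C := (R[i] : normedModType R[i]).
Implicit Types (f g k K : R[i] -> R[i]) (p a z w : R[i]).

Let cC := @seqcompleteC R.

Lemma nrm_itv (u : R) z : 0 <= u <= 1 -> nrm ((u%:C)%C * z) <= nrm z.
Proof.
move=> /andP[u0 u1]; rewrite nrmM nrmR ger0_norm// -[leRHS]mul1r.
by rewrite ler_wpM2r ?nrm_ge0.
Qed.

Lemma hol_segment_bound k p q : (forall u : R, 0 <= u <= 1 -> exists2 d : R, 0 < d &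
    forall y, nrm (y - (p + (u%:C)%C * q)) < d -> hol k y) ->
  exists r M : R, 0 < r /\ forall (u : R) y, 0 <= u <= 1 ->
    nrm (y - (p + (u%:C)%C * q)) < r -> hol k y /\ nrm (k y) <= M.
Proof.
move=> hk; pose c (u : R) := p + (u%:C)%C * q.
pose P (x s : R) := exists r M : R, 0 < r /\ forall (u : R) y, x <= u <= x + s ->
    nrm (y - c u) < r -> hol k y /\ nrm (k y) <= M.
suff : P 0 1 by rewrite /P add0r.
apply: cousin1 => //.
  move=> x s _ _ _ [r1 [M1 [r10 h1]]] [r2 [M2 [r20 h2]]].
  exists (Num.min r1 r2), (Num.max M1 M2); rewrite lt_min r10; split=> // u y /andP[u1 u2].
  rewrite lt_min => /andP[y1 y2]; have [um|um] := leP u (x + s / 2).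
    by have [//|? ?] := h1 u y _ y1; [rewrite u1|split=> //; rewrite le_max; apply/orP; left].
  have [//|? ?] := h2 u y _ y2; first by apply/andP; slra.
  by split=> //; rewrite le_max; apply/orP; right.
move=> X; rewrite add0r => X01; have [d d0 hdd] := hk X X01.
have [d' d'0 hb] := ccont_bounded (hol_ccont (hdd (c X) ltac:(by rewrite subrr nrm0))).
have m0 : 0 < Num.min d d' by rewrite lt_min d0.
have q1 : 0 < nrm q + 1 by have := nrm_ge0 q; slra.
exists (Num.min d d' / 2 / (nrm q + 1)); first by rewrite !divr_gt0.
move=> x s _ _ /andP[xX Xs]; rewrite ltr_pdivlMr// => sq.
exists (Num.min d d' / 2), (nrm (k (c X)) + 1); split; first by rewrite divr_gt0.
move=> u y /andP[u1 u2] yu.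
have cc : nrm (c u - c X) <= s * (nrm q + 1).
  rewrite /c opprD addrACA subrr add0r -mulrBl -rmorphB nrmM nrmR.
  have : `|u - X| <= s by rewrite ler_norml; apply/andP; slra.
  have := normr_ge0 (u - X); have := nrm_ge0 q; snra.
have yX : nrm (y - c X) < Num.min d d' by have := nrmB_tri y (c u) (c X); slra.
by move: yX; rewrite lt_min => /andP[yd yd']; split; [exact: hdd|exact: hb].
Qed.

(** Differentiation under the mean: [k] is bounded on a neighbourhood of the segment, so the
    second-order remainder of [hol_taylor] is uniform along it. *)
Lemma hol_primitive_mean k p (r : R) : (forall z, nrm (z - p) < r -> hol k z) ->
  forall z, nrm (z - p) < r -> hol (fun z => (z - p) * segmean (k : R[i] -> C) p (z - p)) z.
Proof.
move=> hk z zr; apply: holM; first by apply: holB; [exact: hol_id|exact: hol_cst].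
have inb (u : R) y : 0 <= u <= 1 -> nrm (y - p) < r -> nrm (p + (u%:C)%C * (y - p) - p) < r.
  by move=> u01 yr; rewrite addrC addKr; apply: le_lt_trans (nrm_itv _ u01) yr.
have [r' [M [r'0 hM]]] : exists r' M : R, 0 < r' /\ forall (u : R) y, 0 <= u <= 1 ->
    nrm (y - (p + (u%:C)%C * (z - p))) < r' -> hol k y /\ nrm (k y) <= M.
  by apply: hol_segment_bound => u u01; apply: (hol_ball_center hk); exact: inb.
pose s := r' / 2; have s0 : 0 < s by rewrite divr_gt0.
pose m := mn (fun u : R => (u%:C)%C * derive1 k (p + (u%:C)%C * (z - p)) : C).
have mP : is_mean (fun u : R => (u%:C)%C * derive1 k (p + (u%:C)%C * (z - p)) : C) m.
  apply: (mnP cC).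
  pose g y : C := y * derive1 k (p + y * (z - p)).
  have ug : ucont (fun u : R => g (0 + (u%:C)%C * 1)).
    apply: seg_ucont => u u01; rewrite add0r mulr1; apply: hol_ccont.
    apply: holM; first exact: hol_id.
    apply: (@hol_comp _ C (derive1 k) (fun y => p + y * (z - p))).
      apply: holD; first exact: hol_cst.
      by apply: holM; [exact: hol_id|exact: hol_cst].
    by apply: (derive_hol_ball hk); exact: inb.
  have gE : (fun u : R => g (0 + (u%:C)%C * 1)) =
      (fun u : R => (u%:C)%C * derive1 k (p + (u%:C)%C * (z - p)) : C).
    by apply/funext => u; rewrite add0r mulr1.
  by rewrite -gE.
have sP y : nrm (y - p) < r ->
    is_mean (fun u : R => k (p + (u%:C)%C * (y - p)) : C) (segmean (k : R[i] -> C) p (y - p)).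
  by move=> yr; apply: (segmeanP cC) => u u01; apply/hol_ccont/hk/inb.
exists m; pose t := Num.min (s / 2) ((r - nrm (z - p)) / 2).
have t0 : 0 < t by rewrite lt_min !divr_gt0 ?subr_gt0.
apply: (hd_of_taylor t0) (_ : forall a, _ -> _ <= 2 * M / s ^+ 2 * _) => a at'.
have ap : nrm (a - p) < r.
  have : t <= (r - nrm (z - p)) / 2 by rewrite ge_min lexx orbT.
  by have := nrmB_tri a z p; slra.
have as' : nrm (a - z) <= s / 2 by apply: le_trans at' _; rewrite ge_min lexx.
have mP' := @is_mean_lin _ C C (fun x => (a - z) *: x) (nrm (a - z)) _ _
   (fun x y => scalerDr _ x y) (fun b x => ltac:(by rewrite !scalerA mulrC))
   (fun x => ltac:(by rewrite nrmZ)) mP.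
rewrite -addrA -opprD; apply: is_mean_dist (sP a ap) (is_meanD (sP z zr) mP') _ => u u01.
set w := p + (u%:C)%C * (z - p).
have hw : forall y, nrm (y - w) < r' -> hol k y /\ nrm (k y) <= M by move=> y; exact: hM.
have := (@hol_taylor _ C cC k w r' s M (fun y h => (hw y h).1)
  ltac:(by rewrite s0 /s; slra) (fun y h => (hw y ltac:(by rewrite h /s; slra)).2)).2
  (p + (u%:C)%C * (a - p)).
have wE : p + (u%:C)%C * (a - p) - w = (u%:C)%C * (a - z).
  by rewrite /w opprD addrACA subrr add0r -mulrBr opprB addrA subrK.
rewrite wE => H.
have ua : nrm ((u%:C)%C * (a - z)) <= nrm (a - z) := nrm_itv _ u01.
have M0 : 0 <= M.
  apply: le_trans (nrm_ge0 (k w)) (hw w _).2; by rewrite subrr nrm0.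
have {}H := H (le_trans ua as').
rewrite opprD addrA [(a - z) *: _]mulrA [(a - z) * _]mulrC.
apply: le_trans H _; apply: ler_wpM2l.
  by apply: divr_ge0; [exact: mulr_ge0|exact: sqr_ge0].
by rewrite ler_pXn2r ?nnegrE ?nrm_ge0.
Qed.

Lemma log_exists g p (r : R) : (forall z, nrm (z - p) < r -> hol g z) ->
  (forall z, nrm (z - p) < r -> g z != 0) ->
  exists K, [/\ K p = 0, forall z, nrm (z - p) < r -> hol K z &
    forall z, nrm (z - p) < r ->
      complex.Re (K z) = ln (nrm (g z)) - ln (nrm (g p))].
Proof.
move=> hg g0; have hk z : nrm (z - p) < r -> hol (fun z => derive1 g z / g z) z.
  move=> zr; apply: holM; first exact: derive_hol_ball hg _ zr.
  by apply: hol_invf; [exact: g0|exact: hg].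
exists (fun z => (z - p) * segmean (fun z => derive1 g z / g z : C) p (z - p)); split.
- by rewrite subrr mul0r.
- exact: hol_primitive_mean.
- move=> z zr; rewrite ln_norm_ftc ?[p + _]addrC ?subrK// => u u01.
  have ur : nrm (p + (u%:C)%C * (z - p) - p) < r.
    by rewrite addrC addKr; apply: le_lt_trans (nrm_itv _ u01) zr.
  by split; [exact: hg|exact: derive_hol_ball hg _ ur|exact: g0].
Qed.

(** Since [Re K <= M], the quotient [T = K / (2 M - K)] has modulus at most 1, and it vanishes at
    [p]. A Schwarz estimate on [quot T p] gives [|T| <= 1 / 2] on the small disc, whence
    [|K| <= (2 M + |K|) / 2]. *)
Lemma borel_caratheodory K p (r M : R) : 0 < M -> 0 < r -> K p = 0 ->
  (forall z, nrm (z - p) < r -> hol K z) ->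
  (forall z, nrm (z - p) < r -> complex.Re (K z) <= M) ->
  forall z, nrm (z - p) <= r / 8 -> nrm (K z) <= 2 * M.
Proof.
move=> M0 r0 Kp hK KM; pose D z := ((2 * M)%:C)%C - K z; pose T z := K z / D z.
have ReDM z : nrm (z - p) < r -> M <= complex.Re (D z).
  by move=> /KM; rewrite cReD cReN/=; slra.
have D0 z : nrm (z - p) < r -> 0 < nrm (D z).
  by move=> /ReDM h; have := Re_le_nrm (D z); rewrite ler_norml => /andP[]; slra.
have hT z : nrm (z - p) < r -> hol T z.
  move=> zr; apply: holM; first exact: hK.
  apply: hol_invf; first by rewrite -nrm_gt0 D0.
  by apply: holB; [exact: hol_cst|exact: hK].
have T1 z : nrm (z - p) < r -> nrm (T z) <= 1.
  move=> zr; rewrite nrmM nrmV ler_pdivrMr ?D0// mul1r.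
  rewrite -(@ler_pXn2r _ 2)// ?nnegrE ?nrm_ge0// !nrm_sqr cReD cImD cReN cImN/=.
  by rewrite add0r sqrrN lerD2r; have := KM z zr; snra.
have Tp : T p = 0 by rewrite /T Kp mul0r.
have pr : nrm (p - p) < r by rewrite subrr nrm0.
have hQ := quot_hol_ball hT pr.
have Qb z : nrm (z - p) <= r / 4 -> nrm (quot T p z : C) <= 4 / r.
  move=> zr; have -> : 4 / r = 2 * (2 / r) by ring.
  apply: (@max_twice _ C cC (quot T p) p r (r / 2)) => //; first by apply/andP; slra.
    move=> y yr; have yp : y != p by rewrite -subr_eq0 -nrm_gt0 yr; slra.
    rewrite /quot (negbTE yp) Tp subr0 nrmZ nrmV yr invf_div.
    by rewrite -[leRHS]mulr1 ler_wpM2l ?T1 ?yr ?divr_ge0 ?ltW//; slra.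
  by have -> : r / 2 / 2 = r / 4 by field.
move=> z zr; have zr' : nrm (z - p) < r by slra.
have Tz : nrm (T z) <= 1 / 2.
  rewrite (quotE T p z) Tp add0r nrmZ.
  have := Qb z ltac:(slra); rewrite ler_pdivlMr// => h.
  have := nrm_ge0 (z - p); have := nrm_ge0 (quot T p z : C); snra.
have Dz := D0 z zr'.
have KT : K z = T z * D z by rewrite /T divfK// -nrm_gt0.
have Dle : nrm (D z) <= 2 * M + nrm (K z).
  have M2 : 0 <= 2 * M by slra.
  by have := nrmB ((2 * M)%:C)%C (K z); rewrite nrmR (ger0_norm M2).
have := nrm_ge0 (D z); move: Dle; rewrite {2}KT nrmM; have := nrm_ge0 (T z).
rewrite KT nrmM; snra.
Qed.

(** The coefficients annihilate affine functions, so a smooth [phi] contributes only a quadratic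
    term in [h], while a logarithmic singularity near [a] contributes a bump of height of order
    1. *)
Definition diff4 (phi : R[i] -> R) a h : R :=
  phi (a + 2 * h) + phi (a - 2 * h) - phi (a + h) - phi (a - h).

(** Second-order Taylor remainders at the four points; the constant is
    [20 = 2 * (4 + 4 + 1 + 1)]. *)
Lemma diff4_hol K a h (R0 r M : R) : (forall z, nrm (z - a) < R0 -> hol K z) ->
  0 < r < R0 -> (forall z, nrm (z - a) = r -> nrm (K z) <= M) -> 4 * nrm h <= r ->
  `|diff4 (fun z => complex.Re (K z)) a h| <= 20 * M / r ^+ 2 * nrm h ^+ 2.
Proof.
move=> hK rR KM hr; have := @hol_taylor _ C cC K a R0 r M hK rR KM.
move=> [_ tay]; set c := derive1 K a in tay.
have r0 : 0 < r by case/andP: rR.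
pose err b := K (a + b) - K a - b * c.
have h0 := nrm_ge0 h.
have terr b : nrm b <= r / 2 -> nrm (err b) <= 2 * M / r ^+ 2 * nrm b ^+ 2.
  by move=> br; have := tay (a + b); rewrite addrC addKr; apply.
have n2 : nrm (2 * h) = 2 * nrm h by rewrite nrmM nrm_nat.
pose X := M / r ^+ 2 * nrm h ^+ 2.
have -> : diff4 (fun z => complex.Re (K z)) a h =
   complex.Re (err (2 * h)) + complex.Re (err (- (2 * h))) - complex.Re (err h)
   - complex.Re (err (- h)).
  rewrite -!cReN -!cReD /diff4 -!cReN -!cReD; congr complex.Re.
  by rewrite /err; ring.
have tX b (c' : R) : nrm b <= r / 2 -> nrm b = c' * nrm h ->
    `|complex.Re (err b)| <= 2 * c' ^+ 2 * X.
  move=> br bh; apply: le_trans (Re_le_nrm _) _; apply: le_trans (terr b br) _.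
  by rewrite bh le_eqVlt /X; apply/orP; left; apply/eqP; ring.
have t1 := tX (2 * h) 2 ltac:(by rewrite n2; slra) n2.
have t2 := tX (- (2 * h)) 2 ltac:(by rewrite nrmN n2; slra) ltac:(by rewrite nrmN).
have t3 := tX h 1 ltac:(slra) ltac:(by rewrite mul1r).
have t4 := tX (- h) 1 ltac:(by rewrite nrmN; slra) ltac:(by rewrite nrmN mul1r).
have -> : 20 * M / r ^+ 2 * nrm h ^+ 2 = 20 * X by rewrite /X; ring.
move: t1 t2 t3 t4; clear tX; move: (complex.Re (err _)) (complex.Re (err _)) (complex.Re (err _))
  (complex.Re (err _)) => A B D E.
rewrite !ler_norml => /andP[? ?] /andP[? ?] /andP[? ?] /andP[? ?].
by apply/andP; split; slra.
Qed.

(* Comparing second differences of ln|f| with those of the logarithmic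
   potential of the zeros: the zero-free factor is e^K with K bounded by
   Borel-Caratheodory, so its contribution is quadratic in h. *)
Lemma zeros_diff4 f p a (R0 r M : R) :
  (forall z, nrm (z - p) < R0 -> hol f z) -> 0 < r -> 5 * r < R0 ->
  (forall z, nrm (z - p) = 5 * r -> nrm (f z) <= M) -> f p != 0 ->
  nrm (a - p) <= r / 16 ->
  exists zs g, [/\ factorized f p R0 r zs g,
    forall z, nrm (z - p) < r -> g z != 0,
    4 ^+ size zs <= M / nrm (f p) &
    forall h : R[i], 128 * nrm h <= r ->
      f (a + 2 * h) != 0 -> f (a - 2 * h) != 0 -> f (a + h) != 0 -> f (a - h) != 0 ->
      `|diff4 (fun z => ln (nrm (f z))) a h -
        \sum_(w <- zs) diff4 (fun z => ln (nrm (z - w))) a h| <=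
      40 * ln (2 * M / nrm (f p)) / (r / 32) ^+ 2 * nrm h ^+ 2].
Proof.
move=> hf r0 rR fM fp ap.
have r25 : 2 * r < 5 * r by slra.
have [zs [g [fact g0]]] := factorization hf r0 r25 rR fM fp.
have r5 : r < 5 * r by slra.
exists zs, g; have [b1 b2] := zero_count r0 r5 rR fM fact.
have nf0 : 0 < nrm (f p) by rewrite nrm_gt0.
have e4 : 5 * r - r = 4 * r by ring.
rewrite e4 exprMn in b1.
have r4 : 0 < (4 : R) ^+ size zs by rewrite exprn_gt0.
have rn : 0 < r ^+ size zs by rewrite exprn_gt0.
have gp0 : 0 < nrm (g p) by rewrite nrm_gt0 g0// subrr nrm0.
have cnt : 4 ^+ size zs <= M / nrm (f p).
  rewrite ler_pdivlMr//; move: b1; rewrite ler_pdivlMr ?mulr_gt0// => b1.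
  apply: le_trans b1; rewrite [leRHS]mulrC -mulrA ler_wpM2l// ltW.
have M0 : 0 < M.
  by have : 0 < M / nrm (f p) by [exact: lt_le_trans cnt]; rewrite ltr_pdivlMr// mul0r.
have [hg hz fg] := fact; split=> //.
have hgr z : nrm (z - p) < r -> hol g z by move=> zr; apply: hg; slra.
have [K [Kp hK ReK]] := log_exists hgr g0.
pose L0 := ln (2 * M / nrm (f p)).
have Mf : 1 <= M / nrm (f p) by apply: le_trans cnt; rewrite exprn_ege1// ler1n.
have L00 : 0 < L0 by rewrite ln_gt0// -mulrA; slra.
have gz z : nrm (z - p) < r -> nrm (g z) <= 2 * (M / (4 * r) ^+ size zs).
  move=> zr; apply: (@max_twice _ C cC g p R0 (5 * r)) => //; try slra.
  move=> y yr; rewrite ler_pdivlMr ?exprn_gt0 ?mulr_gt0// mulrC.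
  apply: le_trans (fM y yr); rewrite fg ?yr// nrmM ler_wpM2r ?nrm_ge0//.
  apply: prod_seq_ge; first by rewrite mulr_ge0 ?ltW.
  by move=> w /hz wr; have := nrmB_tri y w p; rewrite yr; slra.
(* With [m] zeros, [|g z| <= 2 M / (4 r) ^ m] and [|f p| <= r ^ m |g p|], so [|g z| / |g p|] is at
   most [2 M / |f p|]. *)
have KL z : nrm (z - p) < r -> complex.Re (K z) <= L0.
  move=> zr; rewrite ReK// -ln_div ?posrE ?nrm_gt0 ?g0//; last by rewrite subrr nrm0.
  rewrite ler_ln ?posrE; last by rewrite divr_gt0// mulr_gt0.
    rewrite ler_pdivrMr//; apply: le_trans (gz z zr) _.
    have -> : 2 * M / nrm (f p) * nrm (g p) = 2 * (M * nrm (g p) / nrm (f p)) by ring.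
    apply: ler_wpM2l => //; rewrite ler_pdivrMr ?exprn_gt0 ?mulr_gt0// mulrAC.
    rewrite ler_pdivlMr// -mulrA; apply: ler_wpM2l; first exact: ltW.
    rewrite exprMn mulrC; apply: le_trans b2 _; rewrite -mulrA.
    by rewrite ler_peMl ?mulr_ge0 ?(ltW rn) ?(ltW gp0)// exprn_ege1// ler1n.
  by rewrite divr_gt0// nrm_gt0 g0.
have Kb := borel_caratheodory L00 r0 Kp hK KL.
move=> h hr f1 f2 f3 f4.
have h0 := nrm_ge0 h.
have inr b : nrm b <= 2 * nrm h -> nrm (a + b - p) < r.
  by move=> bh; have := nrmD (a - p) b; rewrite addrAC; slra.
have n2 : nrm (2 * h) = 2 * nrm h by rewrite nrmM nrm_nat.
have i1 := inr (2 * h) ltac:(by rewrite n2).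
have i2 := inr (- (2 * h)) ltac:(by rewrite nrmN n2).
have i3 := inr h ltac:(slra).
have i4 := inr (- h) ltac:(by rewrite nrmN; slra).
have lnf z : nrm (z - p) < r -> f z != 0 -> ln (nrm (f z)) =
    \sum_(w <- zs) ln (nrm (z - w)) + (complex.Re (K z) + ln (nrm (g p))).
  move=> zr fz; have zR : nrm (z - p) < R0 by slra.
  rewrite ReK// subrK fg// nrmM lnM ?posrE ?nrm_gt0//; last 2 first.
  - by apply: contraNneq fz; rewrite fg// => ->; rewrite mul0r.
  - exact: g0.
  congr (_ + _); have : \prod_(w <- zs) (z - w) != 0.
    by apply: contraNneq fz; rewrite fg// => ->; rewrite mul0r.
  elim: (zs) => [|w s IH]; first by rewrite !big_nil nrm1 ln1.
  rewrite !big_cons mulf_eq0 negb_or => /andP[w0 s0].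
  by rewrite nrmM lnM ?posrE ?nrm_gt0// IH.
pose S z : R := \sum_(w <- zs) ln (nrm (z - w)).
have -> : \sum_(w <- zs) diff4 (fun z => ln (nrm (z - w))) a h = diff4 S a h.
  by rewrite /diff4 !sumrB big_split.
have -> : diff4 (fun z => ln (nrm (f z))) a h - diff4 S a h =
    diff4 (fun z => complex.Re (K z)) a h.
  by rewrite /diff4 !lnf// -![\sum_(w <- zs) _]/(S _); ring.
(* The circle of radius [r / 32] about [a] lies in the disc of radius [r / 8] about [p], where
   [borel_caratheodory] bounds [K]. *)
have := @diff4_hol K a h (r / 16) (r / 32) (2 * L0).
rewrite /diff4 => H; apply: le_trans (H _ _ _ _) _.
- by move=> z za; apply: hK; have := nrmB_tri z a p; slra.
- by apply/andP; slra.
- by move=> z za; apply: Kb; have := nrmB_tri z a p; rewrite za; slra.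
- slra.
- rewrite ler_wpM2r ?sqr_ge0// -/L0 le_eqVlt; apply/orP; left; apply/eqP.
  by field; rewrite gt_eqF.
Qed.

End Logarithm.

(** * Bounded operators *)

Section Operators.
Context {R : realType} {H : completeNormedModType R[i]}.
Implicit Types (T S X : boundedOp H) (x y : H) (a : R[i]).

Lemma opext T S : (forall x, T x = S x) -> T = S.
Proof. by move=> TS; apply/val_inj/funext. Qed.

Lemma opD T x y : T (x + y) = T x + T y.
Proof. by have := (opP T).1 1 x y; rewrite !scale1r. Qed.

Lemma opN T x : T (- x) = - T x.
Proof. by rewrite -scaleN1r opZ scaleN1r. Qed.

Lemma opB T x y : T (x - y) = T x - T y.
Proof. by rewrite opD opN. Qed.

Lemma op_sum T I (s : seq I) (P : pred I) (f : I -> H) :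
  T (\sum_(i <- s | P i) f i) = \sum_(i <- s | P i) T (f i).
Proof. exact: (big_morph _ (opD T) (op0 T)). Qed.

Lemma nrm_op T x : nrm (T x) <= nrm T * nrm x.
Proof. by rewrite nrm_le realcM !nrmE; exact: le_opnorm. Qed.

Lemma nrm_op_le T (M : R) : 0 <= M -> (forall x, nrm (T x) <= M * nrm x) -> nrm T <= M.
Proof.
move=> M0 TM; rewrite nrm_le; apply: opnorm_le => x x1; rewrite -nrm_le.
apply: le_trans (TM x) _; rewrite ler_piMr//.
by rewrite nrm_le.
Qed.

Lemma mkop (f : H -> H) (M : R) : (forall a x y, f (a *: x + y) = a *: f x + f y) ->
  (forall x, nrm (f x) <= M * nrm x) -> exists T, forall x, T x = f x.
Proof.
move=> lf fM; have fb : f \in bounded_linear.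
  by apply/mem_set; split=> //; exists M => x; rewrite -!nrmE -realcM lecR.
by exists (BoundedOp fb).
Qed.

Lemma seqcomplete_op : seqcomplete (boundedOp H).
Proof.
move=> u cu.
have cx x : scauchy (fun n => u n x).
  move=> e e0; have x1 : 0 < nrm x + 1 by have := nrm_ge0 x; slra.
  have [n0 hn] := cu (e / (nrm x + 1)) ltac:(by rewrite divr_gt0).
  exists n0 => n m nn mm; have := hn n m nn mm; rewrite ltr_pdivlMr//.
  have := nrm_op (u n - u m) x; rewrite -[(u n - u m) x]/(u n x - u m x).
  have := nrm_ge0 x; have := nrm_ge0 (u n - u m); snra.
have [f hf] := choice (fun x => @complete_seqcomplete _ H _ (cx x)).
have [n1 h1] := cu 1 ltr01.
pose M := nrm (u n1) + 1.
have uM n x : (n1 <= n)%N -> nrm (u n x) <= M * nrm x.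
  move=> nn; apply: le_trans (nrm_op _ _) _; rewrite ler_wpM2r ?nrm_ge0//.
  by have := h1 n n1 nn (leqnn _); have := nrmD (u n - u n1) (u n1); rewrite subrK /M; slra.
have fM x : nrm (f x) <= M * nrm x.
  rewrite -[f x]subr0; apply: (slim_le (hf x) (n0 := n1)) => n nn.
  by rewrite subr0 uM.
have flin a x y : f (a *: x + y) = a *: f x + f y.
  have h := slimD (slim_lin (fun u v => scalerBr a u v) (fun u => ltac:(by rewrite nrmZ)) (hf x)) (hf y).
  by apply: slim_unique (hf _) (slim_eq _ h) => n; rewrite opD opZ.
have [T hT] := mkop flin fM.
exists T => e e0; have [n0 hn] := cu (e / 2) ltac:(by rewrite divr_gt0).
exists n0 => n nn; apply: (@le_lt_trans _ _ (e / 2)); last slra.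
apply: nrm_op_le; first slra.
move=> x; rewrite -[(u n - T) x]/(u n x - T x) hT nrmBC.
apply: (slim_le (hf x) (n0 := n0)) => m mm.
apply: le_trans (nrm_op (u m - u n) x) _; rewrite ler_wpM2r ?nrm_ge0//.
exact: ltW (hn _ _ mm nn).
Qed.

Lemma nrm_comp T S : nrm (compop T S) <= nrm T * nrm S.
Proof.
apply: nrm_op_le => [|x]; first by rewrite mulr_ge0 ?nrm_ge0.
apply: le_trans (nrm_op T (S x)) _; rewrite -mulrA ler_wpM2l ?nrm_ge0//.
exact: nrm_op.
Qed.

Lemma nrm_id : nrm (idop H) <= 1.
Proof. by apply: nrm_op_le => // x; rewrite mul1r. Qed.

Lemma blin_comp : blin (fun T S => compop T S) 1.
Proof.
split=> // [T S X|X T S|a T S|T S].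
- exact: opext.
- by apply: opext => x; exact: opD.
- by split; apply: opext => // x; exact: opZ.
- by rewrite mul1r nrm_comp.
Qed.

Lemma blin_app : blin (fun T x => T x) 1.
Proof.
split=> // [X x y|a T x|T x]; first exact: opD.
  by split=> //; exact: opZ.
by rewrite mul1r nrm_op.
Qed.

Lemma inverse_of_unique T S S' : inverse_of T S -> inverse_of T S' -> S = S'.
Proof.
move=> [_ h1] [h2 _]; apply: opext => x.
have /(congr1 (fun X : boundedOp H => X x)) := h2 => /= h.
have /(congr1 (fun X : boundedOp H => X (S' x))) := h1 => /= <-.
by rewrite h.
Qed.

Lemma inverse_ofP T S : inverse_of T S <->
  (forall x, T (S x) = x) /\ (forall x, S (T x) = x).
Proof.
split=> [[h1 h2]|[h1 h2]]; split.
- by move=> x; have := congr1 (fun X : boundedOp H => X x) h1.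
- by move=> x; have := congr1 (fun X : boundedOp H => X x) h2.
- exact: opext.
- exact: opext.
Qed.

Lemma invopP T : op_invertible T -> inverse_of T (invop T).
Proof. by move=> [S hS]; exact: (xgetI 0 hS). Qed.

Lemma invopE T S : inverse_of T S -> invop T = S.
Proof.
by move=> TS; apply: (@inverse_of_unique T); [apply: invopP; exists S|exact: TS].
Qed.

Lemma inverse_of_comp T S T' S' : inverse_of T S -> inverse_of T' S' ->
  inverse_of (compop T T') (compop S' S).
Proof.
move=> /inverse_ofP[h1 h2] /inverse_ofP[h3 h4]; apply/inverse_ofP.
by split=> x /=; rewrite ?h3 ?h1 ?h2 ?h4.
Qed.

Lemma neumann X : nrm X <= 1 / 2 ->
  exists2 S, inverse_of (idop H - X) S & nrm S <= 2.
Proof.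
move=> X2; pose p := fix p n := if n is m.+1 then compop X (p m) else idop H.
have pn n : nrm (p n) <= (1 / 2) ^+ n.
  elim: n => [|n IH]; first exact: nrm_id.
  by rewrite exprS; apply: le_trans (nrm_comp _ _) _; rewrite ler_pM ?nrm_ge0.
pose s n := \sum_(k < n) p k.
have sS n : s n.+1 = s n + p n by rewrite /s big_ord_recr.
have sdist n k : nrm (s (n + k)%N - s n) <= 2 * (1 / 2) ^+ n - 2 * (1 / 2) ^+ (n + k).
  elim: k => [|k IH]; first by rewrite addn0 !subrr nrm0.
  rewrite addnS sS addrAC; apply: le_trans (nrmD _ _) _.
  by have := pn (n + k)%N; move: IH; rewrite exprS; slra.
have h0 n : 0 <= (1 / 2 : R) ^+ n by rewrite exprn_ge0.
have sdist' n m : (n <= m)%N -> nrm (s m - s n) <= 2 * (1 / 2) ^+ n.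
  by move=> /subnKC <-; have := sdist n (m - n)%N; have := h0 (n + (m - n))%N; slra.
have small (e : R) : 0 < e -> exists n, 2 * (1 / 2) ^+ n < e.
  move=> e0; have [n hn] := exp2V_small (divr_gt0 e0 (ltr0n _ 2)).
  by exists n; rewrite div1r exprVn; slra.
have cs : scauchy s.
  move=> e e0; have [n0 hn0] := small (e / 2) ltac:(by rewrite divr_gt0).
  exists n0 => n m /sdist' nn /sdist' mm.
  apply: le_lt_trans (nrmB_tri (s n) (s n0) (s m)) _; rewrite (nrmBC (s n0)) (splitr e).
  exact: ltrD (le_lt_trans nn hn0) (le_lt_trans mm hn0).
have [S hS] := seqcomplete_op cs.
have XS n : compop X (s n) = s n.+1 - idop H /\ compop (s n) X = s n.+1 - idop H.
  elim: n => [|n [IH1 IH2]].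
    rewrite /s big_ord_recr /= big_ord0 add0r subrr; split; apply: opext => // x.
    exact: op0.
  split; rewrite {1}sS [in RHS]sS.
    have -> : compop X (s n + p n) = compop X (s n) + compop X (p n).
      by apply: opext => x; exact: opD.
    by rewrite IH1 addrAC.
  have -> : compop (s n + p n) X = compop (s n) X + compop (p n) X by exact: opext.
  have -> : compop (p n) X = compop X (p n).
    elim: (n) => [|m IHm]; first exact: opext.
    apply: opext => x /=; congr (X _).
    exact: (congr1 (fun Y : boundedOp H => Y x) IHm).
  by rewrite IH2 addrAC.
have lim1 : slim (fun n => s n.+1 - idop H) (S - idop H).
  move=> e /hS[n0 hn]; exists n0 => n nn; rewrite opprB addrA subrK.
  exact/hn/leqW.
have [_ Dl Dr Z bb] := blin_comp.
have e1 : compop X S = S - idop H.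
  apply: slim_unique lim1; apply: slim_eq (fun n => (XS n).1) _.
  refine (@slim_lin _ _ _ (fun Y => compop X Y) (nrm X) s S _ _ hS) => [Y Y'|Y].
    by apply: opext => x; exact: opB.
  exact: nrm_comp.
have e2 : compop S X = S - idop H.
  apply: slim_unique lim1; apply: slim_eq (fun n => (XS n).2) _.
  refine (@slim_lin _ _ _ (fun Y => compop Y X) (nrm X) s S _ _ hS) => [Y Y'|Y].
    exact: opext.
  by rewrite mulrC nrm_comp.
exists S.
  apply/inverse_ofP; split=> x.
    have e1x : X (S x) = S x - x := congr1 (fun Y : boundedOp H => Y x) e1.
    by rewrite -[LHS]/(S x - X (S x)) e1x opprB addrC subrK.
  have e2x : S (X x) = S x - x := congr1 (fun Y : boundedOp H => Y x) e2.
  by rewrite -[LHS]/(S (x - X x)) opB e2x opprB addrC subrK.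
rewrite -[S]subr0; apply: (slim_le hS (n0 := 0%N)) => n _.
have := sdist' 0%N n (leq0n _); rewrite expr0 mulr1.
by rewrite {2}/s big_ord0.
Qed.

Lemma inverse_perturb T S T' : inverse_of T S -> nrm (T' - T) * nrm S <= 1 / 2 ->
  exists2 S', inverse_of T' S' & nrm S' <= 2 * nrm S.
Proof.
move=> TS small; pose X := compop S (T - T').
have X2 : nrm X <= 1 / 2.
  by apply: le_trans (nrm_comp _ _) _; rewrite mulrC nrmBC.
have [Q hQ Q2] := neumann X2; exists (compop Q S).
  have -> : T' = compop T (idop H - X).
    have /inverse_ofP[h1 h2] := TS; apply: opext => x.
    rewrite -[RHS]/(T (x - S (T x - T' x))) opB h1 opprB addrC.
    by rewrite subrK.
  exact: inverse_of_comp.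
by apply: le_trans (nrm_comp _ _) _; rewrite ler_wpM2r ?nrm_ge0.
Qed.

(** With [D] the increment of [T], the identity [S' - S = - S' D S] is used twice: the first-order
    term is [- S D S] and the rest, [S' D S D S], is quadratic. *)
Lemma hol_invop (T : R[i] -> boundedOp H) z : hol T z -> op_invertible (T z) ->
  hol (fun w => invop (T w)) z.
Proof.
move=> [c hc] iT; have TS := invopP iT; set S := invop (T z) in TS.
exists (- compop S (compop c S)) => e e0.
have s1 : 0 < nrm S + 1 by have := nrm_ge0 S; slra.
have c1 : 0 < nrm c + 1 by have := nrm_ge0 c; slra.
have [d1 d10 h1] := hd_ccont hc (divr_gt0 (divr_gt0 ltr01 (ltr0n _ 2)) s1).
have [d2 d20 h2] := hc (Num.min 1 (e / 2 / (nrm S + 1) ^+ 2))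
  ltac:(by rewrite lt_min ltr01 !divr_gt0// exprn_gt0).
pose K := 2 * (nrm S + 1) ^+ 3 * (nrm c + 1) ^+ 2.
have K0 : 0 < K by rewrite !mulr_gt0// exprn_gt0.
exists (Num.min (Num.min d1 d2) (e / 2 / K)).
  by rewrite !lt_min d10 d20 !divr_gt0.
move=> h; rewrite !lt_min => /andP[/andP[hd1 hd2] hd3].
have {}h1 := h1 (z + h) ltac:(by rewrite addrC addKr).
have {}h2 := h2 h hd2.
have sm : nrm (T (z + h) - T z) * nrm S <= 1 / 2.
  by move: h1; rewrite ltr_pdivlMr// => h1; have := nrm_ge0 (T (z + h) - T z); slra.
have [S' TS' S'2] := inverse_perturb TS sm.
rewrite (invopE TS'); have /inverse_ofP[k1 k2] := TS; have /inverse_ofP[k3 k4] := TS'.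
set D := T (z + h) - T z in h1 h2 sm.
have S'S : S' - S = - compop S' (compop D S).
  apply: opext => x; rewrite -[LHS]/(S' x - S x) -[RHS]/(- S' (T (z + h) (S x) - T z (S x))).
  by rewrite k1 opB k4 opprB.
have -> : S' - S - h *: - compop S (compop c S) =
    - compop S (compop (D - h *: c) S) + compop S' (compop D (compop S (compop D S))).
  have e3 : compop S' (compop D (compop S (compop D S))) =
      - compop (S' - S) (compop D S).
    rewrite S'S; apply: opext => x.
    by rewrite -[RHS]/(- - S' (D (S (D (S x))))) opprK.
  rewrite e3; apply: opext => x.
  have e4 : S' x - S x = - S' (D (S x)) := congr1 (fun Y : boundedOp H => Y x) S'S.
  rewrite -[LHS]/(S' x - S x - h *: - S (c (S x))).
  rewrite -[RHS]/(- S (D (S x) - h *: c (S x)) - (S' (D (S x)) - S (D (S x)))).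
  by rewrite e4 [S (_ - _)]opB [S (h *: _)]opZ !opprB subrKA scalerN opprK addrC.
have n0 := nrm_ge0 h; have sn := nrm_ge0 S; have Dn := nrm_ge0 D.
have Dh : nrm D <= (nrm c + 1) * nrm h.
  have := nrmD (D - h *: c) (h *: c); rewrite subrK nrmZ.
  have : Num.min 1 (e / 2 / (nrm S + 1) ^+ 2) * nrm h <= 1 * nrm h.
    by rewrite ler_wpM2r// ge_min lexx.
  slra.
have a1 : nrm (compop S (compop (D - h *: c) S)) <= e / 2 * nrm h.
  apply: le_trans (nrm_comp _ _) _.
  apply: (@le_trans _ _ ((nrm S + 1) * ((e / 2 / (nrm S + 1) ^+ 2 * nrm h) * (nrm S + 1)))).
    apply: ler_pM; rewrite ?nrm_ge0//; first slra.
    apply: le_trans (nrm_comp _ _) _; apply: ler_pM; rewrite ?nrm_ge0//; last slra.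
    by apply: le_trans h2 _; rewrite ler_wpM2r// ge_min lexx orbT.
  rewrite le_eqVlt; apply/orP; left; apply/eqP; field; slra.
have a2 : nrm (compop S' (compop D (compop S (compop D S)))) <= e / 2 * nrm h.
  have q1 : nrm (compop D S) <= (nrm c + 1) * nrm h * (nrm S + 1).
    by apply: le_trans (nrm_comp _ _) _; apply: ler_pM => //; slra.
  have q2 : nrm (compop S (compop D S)) <= (nrm S + 1) * ((nrm c + 1) * nrm h * (nrm S + 1)).
    by apply: le_trans (nrm_comp _ _) _; apply: ler_pM; rewrite ?nrm_ge0//; slra.
  have q3 : nrm (compop D (compop S (compop D S))) <=
      (nrm c + 1) * nrm h * ((nrm S + 1) * ((nrm c + 1) * nrm h * (nrm S + 1))).
    by apply: le_trans (nrm_comp _ _) _; apply: ler_pM; rewrite ?nrm_ge0.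
  apply: le_trans (nrm_comp _ _) _.
  apply: (@le_trans _ _ (2 * (nrm S + 1) * ((nrm c + 1) * nrm h *
       ((nrm S + 1) * ((nrm c + 1) * nrm h * (nrm S + 1)))))).
    by apply: ler_pM; rewrite ?nrm_ge0//; slra.
  have -> : 2 * (nrm S + 1) * ((nrm c + 1) * nrm h *
       ((nrm S + 1) * ((nrm c + 1) * nrm h * (nrm S + 1)))) = K * nrm h * nrm h.
    by rewrite /K; ring.
  rewrite ler_wpM2r//; move: hd3; rewrite ltr_pdivlMr//; slra.
by apply: le_trans (nrmD _ _) _; rewrite nrmN; slra.
Qed.

End Operators.

(** * Geometry of the Hilbert space *)

Section InnerProduct.
Context {R : realType} {H : completeNormedModType R[i]}.
Variable dot : {dot H for (@Num.conj R[i])}.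
Hypothesis hn : hilbert_norm dot.
Implicit Types (x y z u v : H) (a : R[i]) (T : boundedOp H).

Lemma dotDl x y z : dot (x + y) z = dot x z + dot y z.
Proof. exact: linearDl. Qed.
Lemma dotDr x y z : dot z (x + y) = dot z x + dot z y.
Proof. exact: linearDr. Qed.
Lemma dotZl a x z : dot (a *: x) z = a * dot x z.
Proof. by rewrite linearZl_LR. Qed.
Lemma dotZr a x z : dot x (a *: z) = (a^*)%C * dot x z.
Proof. by rewrite linearZr_LR. Qed.
Lemma dotC x y : dot x y = ((dot y x)^*)%C.
Proof. by rewrite hermC expr0 mul1r. Qed.
Lemma dot0l x : dot 0 x = 0.
Proof. by rewrite -(scale0r 0) dotZl mul0r. Qed.
Lemma dot0r x : dot x 0 = 0.
Proof. by rewrite dotC dot0l conjc0. Qed.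
Lemma dotNl x y : dot (- x) y = - dot x y.
Proof. by rewrite -scaleN1r dotZl mulN1r. Qed.
Lemma dotNr x y : dot x (- y) = - dot x y.
Proof. by rewrite dotC dotNl rmorphN/= -dotC. Qed.
Lemma dotBl x y z : dot (x - y) z = dot x z - dot y z.
Proof. by rewrite dotDl dotNl. Qed.
Lemma dotBr x y z : dot z (x - y) = dot z x - dot z y.
Proof. by rewrite dotDr dotNr. Qed.
Lemma dot_suml I (s : seq I) (P : pred I) (f : I -> H) z :
  dot (\sum_(i <- s | P i) f i) z = \sum_(i <- s | P i) dot (f i) z.
Proof. exact: (big_morph (fun x => dot x z) (fun x y => dotDl x y z) (dot0l z)). Qed.
Lemma dot_sumr I (s : seq I) (P : pred I) (f : I -> H) z :
  dot z (\sum_(i <- s | P i) f i) = \sum_(i <- s | P i) dot z (f i).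
Proof. exact: (big_morph (fun x => dot z x) (fun x y => dotDr x y z) (dot0r z)). Qed.

Lemma dotxx x : dot x x = ((nrm x ^+ 2)%:C)%C.
Proof. by rewrite -hn realcX nrmE. Qed.

Lemma nrm_sqD x y : nrm (x + y) ^+ 2 =
  nrm x ^+ 2 + nrm y ^+ 2 + 2 * complex.Re (dot x y).
Proof.
apply: complexI; rewrite -dotxx dotDl !dotDr !dotxx (dotC y x).
have -> : 2 * complex.Re (dot x y) =
    complex.Re (dot x y) + complex.Re (dot x y) by ring.
case: (dot x y) => p q; apply: complex_eq => /=; ring.
Qed.

Lemma nrm_sqB x y : nrm (x - y) ^+ 2 =
  nrm x ^+ 2 + nrm y ^+ 2 - 2 * complex.Re (dot x y).
Proof. by rewrite nrm_sqD nrmN dotNr cReN mulrN. Qed.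

Lemma pythagoras x y : dot x y = 0 -> nrm (x + y) ^+ 2 = nrm x ^+ 2 + nrm y ^+ 2.
Proof. by move=> xy; rewrite nrm_sqD xy mulr0 addr0. Qed.

Lemma conjc_mul_nrm a : (a^*)%C * a = ((nrm a ^+ 2)%:C)%C.
Proof.
by rewrite mulrC realcX nrmE sqr_normc.
Qed.

Lemma conjcRM (r : R) a : (((r%:C)%C * a)^*)%C = (r%:C)%C * (a^*)%C.
Proof. by case: a => p q; apply: complex_eq => /=; ring. Qed.

Lemma cauchy_schwarz x y : nrm (dot x y) <= nrm x * nrm y.
Proof.
have [->|y0] := eqVneq y 0; first by rewrite dot0r !nrm0 mulr0.
have ny : 0 < nrm y by rewrite nrm_gt0.
pose a := ((nrm y ^- 2)%:C)%C * dot x y.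
have := sqr_ge0 (nrm (x - a *: y)); rewrite nrm_sqB nrmZ dotZr.
have -> : (a^*)%C * dot x y = ((nrm (dot x y) ^+ 2 / nrm y ^+ 2)%:C)%C.
  rewrite /a conjcRM -mulrA conjc_mul_nrm.
  by rewrite -realcM mulrC.
rewrite ReC exprMn /a nrmM nrmR ger0_norm ?invr_ge0 ?sqr_ge0// [_^-1 * _]mulrC.
set d := nrm (dot x y); set n := nrm y in ny *.
have -> : (d / n ^+ 2) ^+ 2 * n ^+ 2 = d ^+ 2 / n ^+ 2 by field; rewrite gt_eqF.
move=> h; have : d ^+ 2 / n ^+ 2 <= nrm x ^+ 2 by slra.
rewrite ler_pdivrMr ?exprn_gt0// -exprMn ler_pXn2r ?nnegrE ?nrm_ge0//.
by rewrite mulr_ge0 ?nrm_ge0// ltW.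
Qed.

Lemma dot_eq0P x : (forall y, dot x y = 0) -> x = 0.
Proof.
move=> h; apply/eqP; rewrite -nrm_eq0; have := dotxx x; rewrite h => /esym/eqP.
by rewrite -nrm_eq0 nrmR normr_eq0 sqrf_eq0.
Qed.

Lemma parallelogram x y :
  nrm (x + y) ^+ 2 + nrm (x - y) ^+ 2 = 2 * nrm x ^+ 2 + 2 * nrm y ^+ 2.
Proof. by rewrite nrm_sqD nrm_sqB; ring. Qed.

Definition orthonormal_fam n (e : 'I_n -> H) :=
  forall i j, dot (e i) (e j) = (i == j)%:R.

Definition frop_fun n (u v : 'I_n -> H) x := \sum_i dot x (u i) *: v i.

Lemma frop_subproof n (u v : 'I_n -> H) : frop_fun u v \in bounded_linear.
Proof.
apply/mem_set; split=> [a x y|].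
  rewrite /frop_fun scaler_sumr -big_split/=; apply: eq_bigr => i _.
  by rewrite dotDl dotZl scalerDl scalerA.
exists (\sum_i nrm (u i) * nrm (v i)) => x; rewrite -!nrmE -realcM lecR.
rewrite mulr_suml; apply: le_trans (nrm_sum _ _ _) _; apply: ler_sum => i _.
by rewrite nrmZ mulrAC ler_wpM2r ?nrm_ge0// mulrC cauchy_schwarz.
Qed.
Definition frop n (u v : 'I_n -> H) : boundedOp H := BoundedOp (frop_subproof u v).

Lemma fropE n (u v : 'I_n -> H) x : frop u v x = \sum_i dot x (u i) *: v i.
Proof. by []. Qed.

Definition oproj n (e : 'I_n -> H) := frop e e.

Section Orthonormal.
Context {n : nat} {e : 'I_n -> H}.
Hypothesis he : orthonormal_fam e.

Lemma dot_comb (c : 'I_n -> R[i]) j : dot (\sum_i c i *: e i) (e j) = c j.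
Proof.
rewrite dot_suml (bigD1 j)//= big1 ?addr0 ?dotZl ?he ?eqxx ?mulr1// => i ij.
by rewrite dotZl he (negbTE ij) mulr0.
Qed.

Lemma dot_proj x j : dot (oproj e x) (e j) = dot x (e j).
Proof. exact: dot_comb. Qed.

Lemma proj_e j : oproj e (e j) = e j.
Proof.
rewrite fropE (bigD1 j)//= he eqxx scale1r big1 ?addr0// => i ij.
by rewrite he eq_sym (negbTE ij) scale0r.
Qed.

Lemma nrm_comb (c : 'I_n -> R[i]) :
  nrm (\sum_i c i *: e i) ^+ 2 = \sum_i nrm (c i) ^+ 2.
Proof.
apply: complexI; rewrite -dotxx dot_sumr rmorph_sum/=; apply: eq_bigr => i _.
by rewrite dotZr dot_comb conjc_mul_nrm.
Qed.

Lemma nrm_proj2 x : nrm (oproj e x) ^+ 2 = \sum_i nrm (dot x (e i)) ^+ 2.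
Proof. exact: nrm_comb. Qed.

Lemma proj_orth x y : dot (x - oproj e x) (oproj e y) = 0.
Proof.
rewrite fropE dot_sumr big1// => i _; rewrite dotZr dotBl dot_proj.
by rewrite subrr mulr0.
Qed.

Lemma proj_split x : nrm x ^+ 2 = nrm (x - oproj e x) ^+ 2 + nrm (oproj e x) ^+ 2.
Proof. by rewrite -(pythagoras (proj_orth x x)) subrK. Qed.

Lemma nrm_proj x : nrm (oproj e x) <= nrm x.
Proof.
rewrite -(@ler_pXn2r _ 2)// ?nnegrE ?nrm_ge0// (proj_split x).
by rewrite lerDr sqr_ge0.
Qed.

Lemma nrm_projC x : nrm (x - oproj e x) <= nrm x.
Proof.
rewrite -(@ler_pXn2r _ 2)// ?nnegrE ?nrm_ge0// [leRHS]proj_split.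
by rewrite lerDl sqr_ge0.
Qed.

Lemma proj_best x w : oproj e w = w -> nrm (x - oproj e x) <= nrm (x - w).
Proof.
move=> ew; have := nrm_projC (x - w); rewrite opB ew opprB addrA subrK.
by [].
Qed.

Lemma bessel x : \sum_i nrm (dot x (e i)) ^+ 2 <= nrm x ^+ 2.
Proof.
by rewrite -nrm_proj2 ler_pXn2r ?nnegrE ?nrm_ge0// nrm_proj.
Qed.

Lemma proj_dot x y : dot (oproj e x) y = dot x (oproj e y).
Proof.
rewrite !fropE dot_suml dot_sumr; apply: eq_bigr => i _.
by rewrite dotZl dotZr mulrC -dotC mulrC.
Qed.

Definition ocons v : 'I_n.+1 -> H := fun i => if unlift ord0 i is Some j then e j else v.

Lemma ocons0 v : ocons v ord0 = v.
Proof. by rewrite /ocons unlift_none. Qed.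

Lemma oconsS v j : ocons v (lift ord0 j) = e j.
Proof. by rewrite /ocons liftK. Qed.

Lemma ocons_orthonormal v : nrm v = 1 -> (forall j, dot v (e j) = 0) ->
  orthonormal_fam (ocons v).
Proof.
move=> v1 ve i j; case: (unliftP ord0 i) => [i'|] ->; case: (unliftP ord0 j) => [j'|] ->;
  rewrite ?ocons0 ?oconsS.
- by rewrite he (inj_eq lift_inj).
- by rewrite dotC ve conjc0 eq_sym eq_liftF.
- by rewrite ve eq_liftF.
- by rewrite eqxx dotxx v1 expr1n.
Qed.

Lemma proj_ocons v x : oproj (ocons v) x = dot x v *: v + oproj e x.
Proof.
rewrite !fropE big_ord_recl ocons0; congr (_ + _); apply: eq_bigr => j _.
by rewrite oconsS.
Qed.

End Orthonormal.

Lemma orthonormal_extend n (e : 'I_n -> H) y : orthonormal_fam e ->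
  exists m (f : 'I_m -> H), [/\ orthonormal_fam f, oproj f y = y &
    forall x, oproj e x = x -> oproj f x = x].
Proof.
move=> he; pose u := y - oproj e y; have [u0|u0] := eqVneq u 0.
  by exists n, e; split=> //; apply/esym/eqP; rewrite -subr_eq0 -/u u0.
have nu : 0 < nrm u by rewrite nrm_gt0.
pose v := (((nrm u)^-1)%:C)%C *: u.
have v1 : nrm v = 1 by rewrite nrmRZ ger0_norm ?invr_ge0 ?nrm_ge0// mulVf// gt_eqF.
have ve j : dot v (e j) = 0.
  by rewrite dotZl /u dotBl dot_proj// subrr mulr0.
have ho := ocons_orthonormal he v1 ve.
exists n.+1, (ocons (e := e) v); split=> //.
  rewrite proj_ocons /v dotZr conjc_real scalerA.
  have -> : dot y u = ((nrm u ^+ 2)%:C)%C.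
    by rewrite -{1}(subrK (oproj e y) y) dotDl -/u [dot (oproj e y) u]dotC proj_orth// conjc0 addr0 dotxx.
  rewrite -!realcM (_ : _ * _ = 1) ?scale1r ?subrK//.
  by field; rewrite gt_eqF.
move=> x ex; rewrite proj_ocons ex -[in dot x v]ex (proj_dot x v).
have -> : oproj e v = 0 by rewrite fropE big1// => j _; rewrite ve scale0r.
by rewrite dot0r scale0r add0r.
Qed.

Lemma gram_schmidt (ys : seq H) n (e : 'I_n -> H) : orthonormal_fam e ->
  exists m (f : 'I_m -> H), [/\ orthonormal_fam f, forall y, y \in ys -> oproj f y = y &
    forall x, oproj e x = x -> oproj f x = x].
Proof.
move=> he; elim: ys => [|y ys [m [f [hf fy fe]]]]; first by exists n, e; split.
have [k [g [hg gy gf]]] := orthonormal_extend y hf.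
exists k, g; split=> // [x|x /fe/gf//]; rewrite in_cons => /orP[/eqP->//|/fy].
exact: gf.
Qed.

Lemma proj_comb n m (e : 'I_n -> H) (f : 'I_m -> H) :
  (forall i, oproj f (e i) = e i) -> forall x, oproj f (oproj e x) = oproj e x.
Proof.
move=> fe x; have ex : oproj e x = \sum_i dot x (e i) *: e i by [].
rewrite ex op_sum; apply: eq_bigr => i _; by rewrite opZ fe.
Qed.

Lemma orthonormal_nil : orthonormal_fam (fun i : 'I_0 => 0).
Proof. by case. Qed.

(** Orthogonal projection onto the closure of [W], stated without closures: [u - s] is a limit of
    elements of [W]. It is applied to a kernel in [riesz] and to a range in [kernel_split]. *)
Lemma projection_lemma (W : H -> Prop) u : W 0 ->
  (forall a x y, W x -> W y -> W (a *: x + y)) ->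
  exists s, (forall w, W w -> dot s w = 0) /\
    forall e, 0 < e -> exists2 w, W w & nrm (u - s - w) < e.
Proof.
move=> W0 Wl; pose A := [set nrm (u - w) ^+ 2 | w in [set w | W w]].
pose d := inf A.
have A0 : has_inf A.
  by split; [exists (nrm (u - 0) ^+ 2), 0|exists 0 => _ [w _ <-]; exact: sqr_ge0].
have dA w : W w -> d <= nrm (u - w) ^+ 2 by move=> Ww; apply: ge_inf; [exact: A0.2|exists w].
have ex k : exists w, W w /\ nrm (u - w) ^+ 2 < d + 2 ^- k.
  have [_ [w Ww <-] h] := @inf_adherent _ A (2 ^- k) ltac:(by rewrite invr_gt0 exprn_gt0) A0.
  by exists w.
have [w hw] := choice ex.
have dist k m : nrm (w k - w m) ^+ 2 <= 2 * 2 ^- k + 2 * 2 ^- m.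
  have := parallelogram (u - w k) (u - w m).
  have -> : u - w k - (u - w m) = w m - w k by rewrite opprB addrC subrKA.
  have -> : u - w k + (u - w m) = 2 *: (u - (2^-1 *: w k + 2^-1 *: w m)).
    rewrite scalerBr scalerDr !scalerA divff// !scale1r scaler_nat mulr2n opprD.
    by rewrite addrACA.
  rewrite nrmZ nrm_nat exprMn [nrm (w m - w k)]nrmBC.
  have Wkm : W (2^-1 *: w k + 2^-1 *: w m).
    apply: (Wl); first exact: (hw k).1.
    by rewrite -[_ *: w m]addr0; apply: Wl => //; exact: (hw m).1.
  have := dA _ Wkm.
  have := (hw k).2; have := (hw m).2; slra.
have cw : scauchy w.
  move=> e e0; have e4 : 0 < e ^+ 2 / 4 by rewrite divr_gt0 ?exprn_gt0.
  have [n0 hn0] := exp2V_small e4.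
  have mono k : (n0 <= k)%N -> (2 : R) ^- k <= 2 ^- n0.
    by move=> nk; rewrite lef_pV2 ?posrE ?exprn_gt0// ler_weXn2l// ler1n.
  exists n0 => k m /mono hk /mono hm; rewrite -(@ltr_pXn2r _ 2)// ?nnegrE ?nrm_ge0 ?ltW//.
  by apply: le_lt_trans (dist k m) _; slra.
have [l hl] := @complete_seqcomplete _ H w cw.
have ul : nrm (u - l) ^+ 2 <= d.
  apply/ler_addgt0Pr => e e0.
  have K0 : 0 < 2 * nrm (u - l) + 1 by have := nrm_ge0 (u - l); slra.
  have [n1 h1] := hl (Num.min 1 (e / 2 / (2 * nrm (u - l) + 1)))
    ltac:(by rewrite lt_min ltr01 !divr_gt0).
  have e2 : 0 < e / 2 by rewrite divr_gt0.
  have [n2 h2] := exp2V_small e2.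
  pose k := maxn n1 n2; have := h1 k (leq_maxl _ _); rewrite lt_min => /andP[k1 k2].
  have mk : (2 : R) ^- k <= 2 ^- n2.
    by rewrite lef_pV2 ?posrE ?exprn_gt0// ler_weXn2l ?ler1n// leq_maxr.
  have := (hw k).2; have := nrmB_tri (u - l) (u - w k) 0; rewrite !subr0.
  have -> : u - l - (u - w k) = w k - l by rewrite opprB addrC subrKA.
  move: k2; rewrite ltr_pdivlMr//.
  have := nrm_ge0 (u - l); have := nrm_ge0 (u - w k); have := nrm_ge0 (w k - l).
  move: (nrm (u - l)) (nrm (u - w k)) (nrm (w k - l)) k1 K0 => X Y Z k1 K0 k2 Z0 Y0 X0 t hk.
  by have [XY|/ltW XY] := leP X Y; snra.
exists (u - l); split=> [v Wv|e e0]; last first.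
  have [n0 hn0] := hl e e0; exists (w n0); first exact: (hw n0).1.
  by rewrite opprB [u + _]addrC subrK nrmBC; exact: hn0.
have low a : d <= nrm (u - l - a *: v) ^+ 2.
  rewrite -subr_le0; apply/ler_addgt0Pr => e e0; rewrite add0r.
  set Y := nrm (u - l - a *: v).
  have K0 : 0 < 2 * Y + 1 by have := nrm_ge0 (u - l - a *: v); rewrite -/Y; slra.
  have [n1 h1] := hl (Num.min 1 (e / (2 * Y + 1))) ltac:(by rewrite lt_min ltr01 divr_gt0).
  have := h1 n1 (leqnn _); rewrite lt_min => /andP[k1]; rewrite ltr_pdivlMr// => k2.
  have Wa : W (a *: v + w n1) by apply: Wl => //; exact: (hw n1).1.
  have := dA _ Wa.
  have := nrmB_tri (u - (a *: v + w n1)) (u - l - a *: v) 0; rewrite !subr0 -/Y.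
  have -> : u - (a *: v + w n1) - (u - l - a *: v) = l - w n1.
    by rewrite -[u - l - _]addrA -opprD opprB addrC addrA subrK addrKA.
  rewrite [nrm (l - _)]nrmBC; have := nrm_ge0 (w n1 - l); have := nrm_ge0 (u - (a *: v + w n1)).
  have Y0 : 0 <= Y := nrm_ge0 _.
  move: (nrm (w n1 - l)) (nrm (u - (a *: v + w n1))) k1 k2 Y0 K0 => Z X k1 k2 Y0 K0 X0 Z0 t hk.
  have [XY|/ltW XY] := leP X Y; first by snra.
  have h3 : 0 <= (Z + Y - X) * (X + Y) by rewrite mulr_ge0; slra.
  have h4 : 0 <= Z * (1 - Z) by rewrite mulr_ge0; slra.
  have h5 : 0 <= Z * (Z + Y - X) by rewrite mulr_ge0; slra.
  by snra.
have [->|v0] := eqVneq v 0; first by rewrite dot0r.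
have nv : 0 < nrm v by rewrite nrm_gt0.
set s := u - l in ul low *.
(* The multiple of [v] closest to [s]. *)
have := low (((nrm v ^- 2)%:C)%C * dot s v).
rewrite nrm_sqB nrmZ dotZr conjcRM -mulrA conjc_mul_nrm.
rewrite -realcM ReC exprMn nrmM nrmR ger0_norm ?invr_ge0 ?sqr_ge0//.
rewrite ![nrm v ^- 2 * _]mulrC.
set D := nrm (dot s v); set n := nrm v in nv *.
have -> : (D / n ^+ 2) ^+ 2 * n ^+ 2 = D ^+ 2 / n ^+ 2 by field; rewrite gt_eqF.
move=> h; have : D ^+ 2 / n ^+ 2 <= 0 by slra.
rewrite ler_pdivrMr ?exprn_gt0// mul0r => D2.
by apply/eqP; rewrite -nrm_eq0 -sqrf_eq0; apply/eqP/le_anti; rewrite D2 sqr_ge0.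
Qed.

Lemma riesz (l : H -> R[i]) (K : R) : (forall x y, l (x + y) = l x + l y) ->
  (forall a x, l (a *: x) = a * l x) -> (forall x, nrm (l x) <= K * nrm x) ->
  exists u, forall x, l x = dot x u.
Proof.
move=> lD lZ lK.
have [nz|] := pselect (exists u0, l u0 != 0); last first.
  move=> nl; exists 0 => x; rewrite dot0r; apply/eqP; apply: contrapT => /negP lx.
  by apply: nl; exists x.
have [u0 lu0] := nz.
have l0 : l 0 = 0 by rewrite -(scale0r 0) lZ mul0r.
have lB x y : l (x - y) = l x - l y by rewrite lD -scaleN1r lZ mulN1r.
have lW a x y : l x = 0 -> l y = 0 -> l (a *: x + y) = 0.
  by move=> lx ly; rewrite lD lZ lx ly mulr0 addr0.
have [s [sW us]] := @projection_lemma (fun w => l w = 0) u0 l0 lW.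
have ls : l s = l u0.
  apply/esym/eqP; rewrite -subr_eq0 -lB -nrm_eq0; apply/eqP/le_anti; rewrite nrm_ge0 andbT.
  apply/ler_addgt0Pr => e e0; rewrite add0r.
  have K1 : 0 < `|K| + 1 by have := normr_ge0 K; slra.
  have [w lw h] := us (e / (`|K| + 1)) ltac:(by rewrite divr_gt0).
  have := lK (u0 - s - w); rewrite lB lw subr0 => h2; apply: le_trans h2 _.
  move: h; rewrite ltr_pdivlMr// => h.
  have := ler_norm K; have := nrm_ge0 (u0 - s - w); snra.
have s0 : dot s s != 0.
  rewrite dotxx -nrm_eq0 nrmR normr_eq0 sqrf_eq0 nrm_eq0.
  by apply: contra_neq lu0 => s0; rewrite -ls s0.
exists (((l s / dot s s)^*)%C *: s) => x; rewrite dotZr conjcK.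
have lsx : l (l s *: x - l x *: s) = 0 by rewrite lB !lZ mulrC subrr.
have h := sW _ lsx.
 have : dot (l s *: x - l x *: s) s = 0 by rewrite dotC h conjc0.
rewrite dotBl !dotZl => /eqP; rewrite subr_eq0 => /eqP e.
by rewrite mulrAC e mulfK.
Qed.

(** The form of compactness used from here on: the image is approximated, uniformly on the unit
    ball, by a finite-dimensional orthogonal projection of it. *)
Definition fapprox T := forall e : R, 0 < e -> exists n (f : 'I_n -> H),
  orthonormal_fam f /\ forall x, nrm (T x - oproj f (T x)) <= e * nrm x.

(** Gram-Schmidt applied to the centres of a finite [e]-net of the image of the unit ball. *)
Lemma compact_fapprox T : compact_op T -> fapprox T.
Proof.
rewrite /compact_op precompactE compact_cover => cT e e0.
set B := T @` _ in cT.
pose ball' (y : H) : set H := (ball y (e%:C)%C)%classic^°.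
have [D _ hD] := cT H setT ball' (fun y _ => @open_interior _ _) ltac:(
  move=> y /closure_subset; move=> _; exists y => //; apply: nbhsx_ballx; rewrite ltcR; exact: e0).
have [n [f [hf ff _]]] := gram_schmidt (finmap.enum_fset D) orthonormal_nil.
exists n, f; split=> // x.
have [->|x0] := eqVneq x 0; first by rewrite !op0 subrr nrm0 mulr0.
have nx : 0 < nrm x by rewrite nrm_gt0.
pose x' := (((nrm x)^-1)%:C)%C *: x.
have xx' : x = ((nrm x)%:C)%C *: x'.
  by rewrite scalerA -realcM divff ?gt_eqF// scale1r.
have x'1 : nrm x' = 1 by rewrite nrmRZ ger0_norm ?invr_ge0 ?ltW// mulVf// gt_eqF.
have BT : B (T x') by exists x' => //=; rewrite -nrmE x'1.
have [y yD] := hD _ (subset_closure BT).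
move=> /interior_subset; rewrite -ball_normE /ball_/= => h.
have {}h : nrm (T x' - y) < e by rewrite nrmBC nrm_lt.
have := proj_best hf (T x') (ff y yD) => h2.
have -> : T x - oproj f (T x) = ((nrm x)%:C)%C *: (T x' - oproj f (T x')).
  by rewrite {1 2}xx' !opZ scalerBr.
rewrite nrmRZ ger0_norm ?(ltW nx)//.
by rewrite mulrC ler_wpM2r ?ltW//; slra.
Qed.

(** Closure under linear combinations and norm limits in one statement, in the shape of a difference
    quotient. *)
Lemma fapprox_lincomb (X : boundedOp H) :
  (forall e, 0 < e -> exists a b T S, [/\ fapprox T, fapprox S &
     forall x, nrm (X x - (a *: T x + b *: S x)) <= e * nrm x]) -> fapprox X.
Proof.
move=> h e e0; have [c [c' [T' [S' [hT hS hX]]]]] := h (e / 4) ltac:(by rewrite divr_gt0).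
have c1 : 0 < nrm c + 1 by have := nrm_ge0 c; slra.
have c2 : 0 < nrm c' + 1 by have := nrm_ge0 c'; slra.
have [n [f [hf fT]]] := hT (e / 4 / (nrm c + 1)) ltac:(by rewrite !divr_gt0).
have [m [g [hg gS]]] := hS (e / 4 / (nrm c' + 1)) ltac:(by rewrite !divr_gt0).
have [k [q [hq qg qf]]] := gram_schmidt [seq g i | i <- enum 'I_m] hf.
have qf' i : oproj q (f i) = f i by apply: qf; rewrite proj_e.
have qg' i : oproj q (g i) = g i by apply: qg; apply: map_f; rewrite mem_enum.
exists k, q; split=> // x.
pose w := c *: oproj f (T' x) + c' *: oproj g (S' x).
have qw : oproj q w = w by rewrite /w opD !opZ !proj_comb.
apply: le_trans (proj_best hq (X x) qw) _.
have -> : X x - w = (X x - (c *: T' x + c' *: S' x)) +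
    (c *: (T' x - oproj f (T' x)) + c' *: (S' x - oproj g (S' x))).
  by rewrite !scalerBr [X in _ = _ + X]addrACA -opprD addrA subrK.
have := nrmD (X x - (c *: T' x + c' *: S' x))
    (c *: (T' x - oproj f (T' x)) + c' *: (S' x - oproj g (S' x))).
have := nrmD (c *: (T' x - oproj f (T' x))) (c' *: (S' x - oproj g (S' x))).
rewrite !nrmZ; have := hX x; have x0 := nrm_ge0 x.
have : nrm c * nrm (T' x - oproj f (T' x)) <= e / 4 * nrm x.
  apply: (@le_trans _ _ (nrm c * (e / 4 / (nrm c + 1) * nrm x))).
    by rewrite ler_wpM2l ?nrm_ge0.
  rewrite mulrA ler_wpM2r// mulrCA -[leRHS]mulr1 ler_wpM2l ?divr_ge0 ?(ltW e0)//.
  by rewrite ler_pdivrMr// mul1r; slra.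
have : nrm c' * nrm (S' x - oproj g (S' x)) <= e / 4 * nrm x.
  apply: (@le_trans _ _ (nrm c' * (e / 4 / (nrm c' + 1) * nrm x))).
    by rewrite ler_wpM2l ?nrm_ge0.
  rewrite mulrA ler_wpM2r// mulrCA -[leRHS]mulr1 ler_wpM2l ?divr_ge0 ?(ltW e0)//.
  by rewrite ler_pdivrMr// mul1r; slra.
have := mulr_ge0 (ltW e0) x0; slra.
Qed.

End InnerProduct.

(** * Reduction to a determinant *)

Section MatrixReduction.
Context {R : realType} {H : completeNormedModType R[i]}.
Variable dot : {dot H for (@Num.conj R[i])}.
Hypothesis hn : hilbert_norm dot.
Implicit Types (x u v : H) (a z y : R[i]) (T L G : boundedOp H).

(** The determinant is the product of the eigenvalues. Bounding these through eigenvectors costs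
    exactly [b ^+ n], with no combinatorial factor, as required for estimates of [ln |det|] that are
    small compared with [n]. *)
Lemma nrm_det_le n (M : 'M[R[i]]_n) (b : R) :
  (forall (v : 'rV_n) mu, v != 0 -> v *m M = mu *: v -> nrm mu <= b) ->
  0 <= b -> nrm (\det M) <= b ^+ n.
Proof.
move=> hb b0; have [rs hrs] := closed_field_poly_normal (char_poly M).
have mon := char_poly_monic M; rewrite (monicP mon) scale1r in hrs.
have szr : size rs = n.
  by have := size_char_poly M; rewrite hrs size_prod_XsubC => -[].
have hd0 := char_poly_det M.
have : nrm ((char_poly M)`_0) = nrm (\det M).
  by rewrite hd0 nrmM nrmX nrmN nrm1 expr1n mul1r.
move=> <-; rewrite -horner_coef0 hrs horner_prod nrm_prod -szr.
have hroot r : r \in rs -> nrm r <= b.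
  move=> rr; have : root (char_poly M) r by rewrite hrs root_prod_XsubC.
  rewrite -eigenvalue_root_char => /eigenvalueP[v vM v0]; exact: (hb v).
elim: (rs) hroot => [|r s IH] hroot; first by rewrite big_nil.
rewrite big_cons exprS ler_pM ?nrm_ge0 ?prodr_ge0//.
- by move=> i _; exact: nrm_ge0.
- by rewrite hornerXsubC sub0r nrmN hroot ?mem_head.
- by apply: IH => t ts; apply: hroot; rewrite in_cons ts orbT.
Qed.

Lemma nrm_det_ge n (M : 'M[R[i]]_n) (b : R) :
  (forall (v : 'rV_n) mu, v != 0 -> v *m M = mu *: v -> b <= nrm mu) ->
  0 <= b -> b ^+ n <= nrm (\det M).
Proof.
move=> hb b0; have [rs hrs] := closed_field_poly_normal (char_poly M).
have mon := char_poly_monic M; rewrite (monicP mon) scale1r in hrs.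
have szr : size rs = n.
  by have := size_char_poly M; rewrite hrs size_prod_XsubC => -[].
have hd0 := char_poly_det M.
have : nrm ((char_poly M)`_0) = nrm (\det M).
  by rewrite hd0 nrmM nrmX nrmN nrm1 expr1n mul1r.
move=> <-; rewrite -horner_coef0 hrs horner_prod nrm_prod -szr.
have hroot r : r \in rs -> b <= nrm r.
  move=> rr; have : root (char_poly M) r by rewrite hrs root_prod_XsubC.
  rewrite -eigenvalue_root_char => /eigenvalueP[v vM v0]; exact: (hb v).
elim: (rs) hroot => [|r s IH] hroot; first by rewrite big_nil.
rewrite big_cons exprS ler_pM ?exprn_ge0//.
- by rewrite hornerXsubC sub0r nrmN hroot ?mem_head.
- by apply: IH => t ts; apply: hroot; rewrite in_cons ts orbT.
Qed.

Section Family.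
Context {n : nat} {e : 'I_n -> H}.
Hypothesis he : orthonormal_fam dot e.
Local Notation E := (oproj hn e).

Definition comb (c : 'rV[R[i]]_n) : H := \sum_i c 0 i *: e i.

Lemma dot_combE c j : dot (comb c) (e j) = c 0 j.
Proof. exact: dot_comb. Qed.

Lemma comb_eq0 c : comb c = 0 -> c = 0.
Proof.
move=> c0; apply/rowP => j; rewrite !mxE -(dot_combE c j) c0 dot0l//.
Qed.

Lemma combD c d : comb (c + d) = comb c + comb d.
Proof.
by rewrite /comb -big_split/=; apply: eq_bigr => i _; rewrite mxE scalerDl.
Qed.

Lemma combZ a c : comb (a *: c) = a *: comb c.
Proof. by rewrite /comb scaler_sumr; apply: eq_bigr => i _; rewrite mxE scalerA. Qed.

Lemma combB c d : comb (c - d) = comb c - comb d.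
Proof. by rewrite -scaleN1r combD combZ scaleN1r. Qed.

Definition coords x : 'rV[R[i]]_n := \row_j dot x (e j).

Lemma proj_coords x : E x = comb (coords x).
Proof. by rewrite fropE; apply: eq_bigr => i _; rewrite mxE. Qed.

Lemma proj_combE c : E (comb c) = comb c.
Proof. by rewrite proj_coords; congr comb; apply/rowP => j; rewrite mxE dot_combE. Qed.

(** Matrix of [idop H - compop E L] on the range of [E], acting on coordinate rows from the right;
    see [red_comb]. *)
Definition redmx L : 'M[R[i]]_n :=
  \matrix_(i, j) ((i == j)%:R - dot (L (e i)) (e j)).

Lemma coords_comb L c : coords (L (comb c)) = c - c *m redmx L.
Proof.
apply/rowP => j; rewrite !mxE /comb op_sum dot_suml.
under [X in _ = _ - X]eq_bigr do rewrite mxE mulrBr.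
rewrite sumrB [X in _ - (X - _)](bigD1 j)//= eqxx mulr1 [\sum_(_ < _ | _ != _) _]big1 ?addr0.
  rewrite opprB addrCA subrr addr0.
  by apply: eq_bigr => i _; rewrite opZ dotZl.
by move=> i ij; rewrite (negbTE ij) mulr0.
Qed.

Lemma red_comb L c : comb c - E (L (comb c)) = comb (c *m redmx L).
Proof. by rewrite proj_coords coords_comb combB opprB addrCA subrr addr0. Qed.

Definition rank1 u v : boundedOp H :=
  frop hn (fun _ : 'I_1 => u) (fun _ : 'I_1 => v).

Lemma rank1E u v x : rank1 u v x = dot x u *: v.
Proof. by rewrite fropE big_ord1. Qed.

(** The inverse of [1 - E L] is [1 + M^-1 E L], where [M^-1] acts on the range of [E]. Rank-one
    operators make it a bounded operator and display its singular part, whose trace is computed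
    later. *)
Definition redinv L : boundedOp H := idop H +
  \sum_i \sum_j (invmx (redmx L)) j i *: compop (rank1 (e j) (e i)) L.

Lemma sum_opE I (s : seq I) (P : pred I) (f : I -> boundedOp H) x :
  (\sum_(i <- s | P i) f i) x = \sum_(i <- s | P i) f i x.
Proof. exact: (big_morph (fun T : boundedOp H => T x)). Qed.

Lemma redinvE L x : redinv L x = x + comb (coords (L x) *m invmx (redmx L)).
Proof.
rewrite -[LHS]/(x + (\sum_i \sum_j (invmx (redmx L)) j i *:
  compop (rank1 (e j) (e i)) L : boundedOp H) x) sum_opE.
congr (_ + _); apply: eq_bigr => i _; rewrite sum_opE mxE scaler_suml; apply: eq_bigr => j _.
by rewrite -[LHS]/(_ *: rank1 _ _ (L x)) rank1E scalerA mxE mulrC.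
Qed.

Lemma redinvP L : \det (redmx L) != 0 -> inverse_of (idop H - compop E L) (redinv L).
Proof.
rewrite -unitfE -unitmxE => M_unit; apply/inverse_ofP; split=> x.
  rewrite redinvE; set c := _ *m _.
  rewrite -[LHS]/(x + comb c - E (L (x + comb c))) !opD opprD addrACA red_comb.
  by rewrite /c mulmxKV// proj_coords subrK.
rewrite -[X in redinv _ X]/(x - E (L x)) redinvE.
suff -> : coords (L (x - E (L x))) = coords (L x) *m redmx L.
  by rewrite mulmxK// proj_coords subrK.
rewrite opB proj_coords; set b := coords (L x).
have -> : coords (L x - L (comb b)) = b - coords (L (comb b)).
  by apply/rowP => j; rewrite !mxE dotBl.
by rewrite coords_comb opprB addrCA subrr addr0.
Qed.

Lemma red_kernel L : \det (redmx L) = 0 -> exists2 x, x != 0 & x - E (L x) = 0.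
Proof.
move/eqP/det0P => [c c0 cM]; exists (comb c).
  by apply: contra_neq c0; exact: comb_eq0.
by rewrite red_comb cM /comb big1// => i _; rewrite mxE scale0r.
Qed.

Lemma red_invertible L G G' : inverse_of G G' ->
  op_invertible (compop (idop H - compop E L) G) <-> \det (redmx L) != 0.
Proof.
move=> GG'; split=> [[S hS]|d0]; last first.
  by exists (compop G' (redinv L)); apply: inverse_of_comp => //; exact: redinvP.
apply/eqP => /red_kernel[x x0 hx]; move/eqP: x0; apply.
have [/inverse_ofP[hS1 hS2] /inverse_ofP[h1 h2]] := (hS, GG').
have := hS2 (G' x); rewrite -[X in S X]/(G (G' x) - E (L (G (G' x)))) h1 hx op0.
by move=> e0; rewrite -(h1 x) -e0 op0.
Qed.

Lemma red_det_bounds L (a b : R) : 0 <= a -> 0 <= b ->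
  (forall x, E x = x -> a * nrm x <= nrm (x - E (L x)) <= b * nrm x) ->
  a ^+ n <= nrm (\det (redmx L)) <= b ^+ n.
Proof.
move=> a0 b0 hL.
have key (v : 'rV_n) mu : v != 0 -> v *m redmx L = mu *: v -> a <= nrm mu <= b.
  move=> v0 vM; have := hL _ (proj_combE v); rewrite red_comb vM combZ nrmZ.
  have cv : 0 < nrm (comb v).
    by rewrite nrm_gt0; apply: contra_neq v0; exact: comb_eq0.
  by rewrite !ler_pM2r.
rewrite nrm_det_ge// ?nrm_det_le// => v mu v0 /(key _ _ v0) /andP[]//.
Qed.

Lemma redmx_hol (L : R[i] -> boundedOp H) z i j : hol L z ->
  hol (fun y => redmx (L y) i j : R[i]) z.
Proof.
move=> hL; apply: (@hol_ext _ _ (fun y => (i == j)%:R - dot (L y (e i)) (e j))).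
  by move=> y; rewrite mxE.
apply: holB; first exact: hol_cst.
have [c hc] := hL; exists (dot (c (e i)) (e j)).
apply: (@hd_lin _ _ _ (fun T : boundedOp H => dot (T (e i)) (e j) : R[i]) (nrm (e i) * nrm (e j))) hc.
- by move=> S T; rewrite -[(S + T) _]/(S _ + T _) dotDl.
- by move=> a T; rewrite -[(a *: T) _]/(a *: T _) dotZl.
- move=> T; apply: le_trans (cauchy_schwarz hn _ _) _.
  by rewrite mulrAC ler_wpM2r ?nrm_ge0// mulrC nrm_op.
Qed.

Lemma reddet_hol (L : R[i] -> boundedOp H) z : hol L z ->
  hol (fun y => \det (redmx (L y)) : R[i]) z.
Proof.
move=> hL; rewrite /determinant; apply: hol_sum => s _; apply: holM.
  exact: hol_cst.
by apply: hol_prod => i _; exact: redmx_hol.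
Qed.

End Family.

Lemma rank1_compl (K : boundedOp H) : fapprox hn K ->
  exists n (e : 'I_n -> H), orthonormal_fam dot e /\
    nrm (K - compop (oproj hn e) K) <= 1 / 4.
Proof.
move=> /(_ (1 / 4) ltac:(by rewrite divr_gt0)) [n [e [he hK]]].
by exists n, e; split=> //; apply: nrm_op_le => //; rewrite divr_ge0.
Qed.

Lemma split_invertible (K S : boundedOp H) n (e : 'I_n -> H) :
  inverse_of (idop H - (K - compop (oproj hn e) K)) S ->
  idop H - K = compop (idop H - compop (oproj hn e) (compop K S))
    (idop H - (K - compop (oproj hn e) K)).
Proof.
set G := (X in inverse_of X _) => /inverse_ofP[h1 h2]; apply: opext => x.
rewrite -[RHS]/(G x - oproj hn e (K (S (G x)))) h2.
by rewrite -[LHS]/(x - K x) -[G x]/(x - (K x - oproj hn e (K x))) opprB addrA addrAC addrK.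
Qed.

(** The Fredholm alternative: [K - E K] is small for a suitable finite-rank projection [E], so a
    Neumann series reduces the question to the matrix [redmx]. *)
Lemma fredholm (K : boundedOp H) : fapprox hn K ->
  (forall x, K x = x -> x = 0) -> op_invertible (idop H - K).
Proof.
move=> /rank1_compl[n [e [he hK]]] inj.
have [S hS _] : exists2 S, inverse_of (idop H - (K - compop (oproj hn e) K)) S & nrm S <= 2.
  by apply: neumann; apply: le_trans hK _; slra.
rewrite (split_invertible hS); apply/(red_invertible he _ hS).
apply/eqP => /(red_kernel he)[x x0 hx]; move/eqP: x0; apply.
have [h1 h2] := (inverse_ofP _ _).1 hS.
suff Sx0 : S x = 0 by rewrite -(h1 x) Sx0 op0.
apply: inj; apply/esym/eqP; rewrite -subr_eq0; apply/eqP.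
have := congr1 (fun T : boundedOp H => T (S x)) (split_invertible hS).
move=> eq; rewrite -[LHS]/((idop H - K) (S x)) eq -[LHS]/(_ - oproj hn e (K (S _))) .
by rewrite h1.
Qed.

(** Near [c], all singular behaviour of [F] is carried by the finite matrix of [1 - E L]:
    invertibility and multiplicities are read off its determinant. *)
Definition reduction (F : R[i] -> boundedOp H) (c : R[i]) (r : R) n (e : 'I_n -> H)
    (L G G' : R[i] -> boundedOp H) :=
  orthonormal_fam dot e /\ forall z, nrm (z - c) < r ->
    [/\ hol L z, hol G z, hol F z, inverse_of (G z) (G' z) &
      F z = compop (idop H - compop (oproj hn e) (L z)) (G z)].

Lemma hol_comp_op (S T : R[i] -> boundedOp H) z :
  hol S z -> hol T z -> hol (fun y => compop (S y) (T y)) z.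
Proof. by move=> hS hT; exact: hol_bil (blin_comp (H := H)) hS hT. Qed.

Lemma local_reduction (K : R[i] -> boundedOp H) c (r : R) : 0 < r ->
  (forall z, nrm (z - c) < r -> hol K z) -> fapprox hn (K c) ->
  exists r' n (e : 'I_n -> H) (L G G' : R[i] -> boundedOp H), [/\ 0 < r', r' <= r &
    reduction (fun z => idop H - K z) c r' e L G G'].
Proof.
move=> r0 hK /rank1_compl[n [e [he hKc]]].
pose X z := K z - compop (oproj hn e) (K z).
have hX z : nrm (z - c) < r -> hol X z.
  move=> /hK hz; apply: holB; first exact: hz.
  by apply: hol_comp_op; [exact: hol_cst|exact: hz].
have [d d0 hd'] : exists2 d, 0 < d & forall z, nrm (z - c) < d -> nrm (X z - X c) < 1 / 4.
  have hXc : ccont X c by apply: hol_ccont; apply: hX; rewrite subrr nrm0.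
  by apply: (hXc (1 / 4)); slra.
have inv z : nrm (z - c) < d -> inverse_of (idop H - X z) (invop (idop H - X z)).
  move=> /hd' h; apply: invopP.
  have [S hS _] : exists2 S, inverse_of (idop H - X z) S & nrm S <= 2.
    apply: neumann; have h1 := nrmD (X z - X c) (X c); rewrite subrK in h1.
    have h0 : nrm (X c) <= 1 / 4 := hKc.
    by apply: le_trans h1 _; apply: le_trans (lerD (ltW h) h0) _; slra.
  by exists S.
exists (Num.min r d), n, e, (fun z => compop (K z) (invop (idop H - X z))),
  (fun z => idop H - X z), (fun z => invop (idop H - X z)).
split=> //; first by rewrite lt_min r0.
  by rewrite ge_min lexx.
split=> // z; rewrite lt_min => /andP[zr zd].
have hG : hol (fun z => idop H - X z) z by apply: holB; [exact: hol_cst|exact: hX].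
split.
- apply: hol_comp_op; first exact: hK.
  by apply: hol_invop; [exact: hG|exists (invop (idop H - X z)); exact: inv].
- exact: hG.
- by apply: holB; [exact: hol_cst|exact: hK].
- exact: inv.
- exact: (split_invertible (inv z zd)).
Qed.

End MatrixReduction.

(** * Circle integrals and traces *)

Section RiemannSums.
Context {R : realType} {V : normedModType R[i]}.
Implicit Types (f : R -> V).

(** The length of the intersection of [[p, q]] and [[x, y]]. Written with clamps it telescopes along
    a partition; its symmetry is part of [overlapP]. *)
Definition overlap (p q x y : R) := Num.max x (Num.min q y) - Num.max x (Num.min p y).

Lemma clampP (x y t : R) : x <= y -> [/\ t <= x -> Num.max x (Num.min t y) = x,
  y <= t -> Num.max x (Num.min t y) = y &
  x <= t <= y -> Num.max x (Num.min t y) = t].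
Proof.
move=> xy; split=> [tx|yt|/andP[xt ty]].
- by rewrite min_l ?(le_trans tx xy)// max_l.
- by rewrite min_r// max_r.
- by rewrite min_l// max_r.
Qed.

Lemma overlapP p q x y : p <= q -> x <= y ->
  [/\ 0 <= overlap p q x y, overlap p q x y = overlap x y p q &
   overlap p q x y = 0 \/ (p < y /\ x < q)].
Proof.
rewrite /overlap => pq xy.
have [q1 q2 q3] := clampP q xy; have [p1 p2 p3] := clampP p xy.
have [y1 y2 y3] := clampP y pq; have [x1 x2 x3] := clampP x pq.
have ltle (a b : R) : a <= b \/ b < a by case: ltP; [right|left].
have [qx|xq] := ltle q x.
  rewrite (q1 qx) (p1 (le_trans pq qx)) (y2 (le_trans qx xy)) (x2 qx).
  by rewrite !subrr; split=> //; left.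
have [yp|py] := ltle y p.
  rewrite (q2 (le_trans yp pq)) (p2 yp) (y1 yp) (x1 (le_trans xy yp)).
  by rewrite !subrr; split=> //; left.
have [qy|/ltW yq] := ltle q y; have [px|/ltW xp] := ltle p x.
- rewrite q3 ?qy ?(ltW xq)// p1// y2// x3 ?px ?(ltW xq)//.
  by split=> //; [rewrite subr_ge0 ltW|right].
- rewrite q3 ?qy ?(ltW xq)// p3 ?xp ?(ltW py)// y2// x1//.
  by split=> //; [rewrite subr_ge0|right].
- rewrite q2// p1// y3 ?yq ?(ltW py)// x3 ?px ?(ltW xq)//.
  by split=> //; [rewrite subr_ge0|right].
- rewrite q2// p3 ?xp ?(ltW py)// y3 ?yq ?(ltW py)// x1//.
  by split=> //; [rewrite subr_ge0 ltW|right].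
Qed.

Definition tagged_partition (a b d : R) n (s xi : nat -> R) :=
  [/\ s 0%N = a, s n = b &
   forall i, (i < n)%N -> s i <= xi i <= s i.+1 /\ s i.+1 - s i < d].

Definition rsum f n (s xi : nat -> R) : V :=
  \sum_(i < n) ((s i.+1 - s i)%:C)%C *: f (xi i).

Lemma tagged_mono a b d n s xi : tagged_partition a b d n s xi ->
  forall i, (i <= n)%N -> a <= s i <= b.
Proof.
move=> [s0 sn h].
have mono i j : (i <= j)%N -> (j <= n)%N -> s i <= s j.
  elim: j => [|j IH]; first by rewrite leqn0 => /eqP->.
  rewrite leq_eqVlt => /orP[/eqP->//|]; rewrite ltnS => ij jn.
  by apply: le_trans (IH ij (ltnW jn)) _; have [/andP[h1 h2] _] := h j jn; slra.
by move=> i ni; rewrite -s0 -sn !mono.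
Qed.

Lemma overlap_sum a b d n s xi x y : tagged_partition a b d n s xi ->
  a <= x -> x <= y -> y <= b ->
  \sum_(i < n) overlap (s i) (s i.+1) x y = y - x.
Proof.
move=> [s0 sn _] ax xy yb.
rewrite -(big_mkord xpredT (fun i => overlap (s i) (s i.+1) x y)).
rewrite (telescope_sumr (fun i => Num.max x (Num.min (s i) y)))// s0 sn.
have [_ b2 _] := clampP b xy; have [a1 _ _] := clampP a xy.
by rewrite b2// a1.
Qed.

(** Two tagged partitions are compared on their common refinement, whose cells have the lengths
    [o i k]; where a cell is nonempty, the two tags are within [2 * d]. *)
Lemma rsum_dist f a b d e n s xi m t eta :
  (forall x y, a <= x <= b -> a <= y <= b -> `|x - y| < 2 * d -> nrm (f x - f y) <= e) ->
  tagged_partition a b d n s xi -> tagged_partition a b d m t eta ->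
  nrm (rsum f n s xi - rsum f m t eta) <= (b - a) * e.
Proof.
move=> fe hs ht; have ms := tagged_mono hs; have mt := tagged_mono ht.
have [s0 sn hsi] := hs; have [t0 tm hti] := ht.
pose o (i : 'I_n) (k : 'I_m) := overlap (s i) (s i.+1) (t k) (t k.+1).
have si (i : 'I_n) : s i <= s i.+1 by have [/andP[]] := hsi i (ltn_ord i); slra.
have ti (k : 'I_m) : t k <= t k.+1 by have [/andP[]] := hti k (ltn_ord k); slra.
have so (i : 'I_n) : \sum_k o i k = s i.+1 - s i.
  rewrite (eq_bigr (fun k : 'I_m => overlap (t k) (t k.+1) (s i) (s i.+1))); last first.
    by move=> k _; have [_ h _] := overlapP (si i) (ti k); exact: h.
  rewrite (overlap_sum ht)//; first by case/andP: (ms i (ltnW (ltn_ord i))).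
  by case/andP: (ms i.+1 (ltn_ord i)).
have to (k : 'I_m) : \sum_i o i k = t k.+1 - t k.
  rewrite (overlap_sum hs)//; first by case/andP: (mt k (ltnW (ltn_ord k))).
  by case/andP: (mt k.+1 (ltn_ord k)).
have rs : rsum f n s xi = \sum_i \sum_k ((o i k)%:C)%C *: f (xi i).
  by apply: eq_bigr => i _; rewrite -so rmorph_sum/= scaler_suml.
have rt : rsum f m t eta = \sum_i \sum_k ((o i k)%:C)%C *: f (eta k).
  rewrite exchange_big/=; apply: eq_bigr => k _.
  by rewrite -to rmorph_sum/= scaler_suml.
rewrite rs rt -sumrB; apply: le_trans (nrm_sum _ _ _) _.
have -> : (b - a) * e = \sum_(i < n) (s i.+1 - s i) * e.
  rewrite -mulr_suml -(big_mkord xpredT (fun i => s i.+1 - s i)).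
  by rewrite telescope_sumr// s0 sn.
apply: ler_sum => i _; rewrite -sumrB -so mulr_suml.
apply: le_trans (nrm_sum _ _ _) _; apply: ler_sum => k _.
rewrite -scalerBr nrmRZ; have [ov0 _ ovd] := overlapP (si i) (ti k).
rewrite ger0_norm// /o; case: ovd => [->|[h1 h2]]; first by rewrite !mul0r.
rewrite ler_wpM2l//; have [/andP[x1 x2] xd] := hsi i (ltn_ord i).
have [/andP[y1 y2] yd] := hti k (ltn_ord k).
have /andP[sa _] := ms i (ltnW (ltn_ord i)); have /andP[_ sb] := ms i.+1 (ltn_ord i).
have /andP[ta _] := mt k (ltnW (ltn_ord k)); have /andP[_ tb] := mt k.+1 (ltn_ord k).
by apply: fe; [slra|slra|rewrite ltr_norml; slra].
Qed.

Lemma dyadic_tagged f b d N : 0 < b -> b * 2 ^- N < d ->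
  let t k := b * (k%:R / 2 ^+ N) in
  tagged_partition 0 b d (2 ^ N) t t /\
  rsum f (2 ^ N) t t = (b%:C)%C *: dsum (fun u => f (b * u)) N.
Proof.
move=> b0 bd t; have p2 : 0 < (2 : R) ^+ N by rewrite exprn_gt0.
have tS k : t k.+1 - t k = b * 2 ^- N by rewrite /t -(addn1 k) natrD; ring.
have bN : 0 <= b * 2 ^- N by rewrite mulr_ge0 ?invr_ge0 ?(ltW p2)// ltW.
split; first split.
- by rewrite /t mul0r mulr0.
- by rewrite /t natrX divff ?mulr1// gt_eqF.
- by move=> i _; rewrite tS lexx/=; split=> //; rewrite -subr_ge0 tS.
rewrite /rsum /dsum scalerA -realcM scaler_sumr; apply: eq_bigr => k _.
by rewrite tS.
Qed.

Lemma riemann_mean f b l : 0 < b ->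
  (forall e, 0 < e -> exists2 d : R, 0 < d & forall x y, 0 <= x <= b -> 0 <= y <= b ->
     `|x - y| < d -> nrm (f x - f y) < e) ->
  is_mean (fun u => f (b * u)) l ->
  forall J, is_riemann_integral f 0 b J <-> J = (b%:C)%C *: l.
Proof.
move=> b0 uf hl.
have main : is_riemann_integral f 0 b ((b%:C)%C *: l).
  move=> e e0; have e1 : 0 < e / (2 * b) by rewrite divr_gt0// mulr_gt0.
  have [d d0 hd'] := uf _ e1; exists (d / 2); first by rewrite divr_gt0.
  move=> n s xi s0 sn hs; rewrite -nrm_lt.
  have fe x y : 0 <= x <= b -> 0 <= y <= b -> `|x - y| < 2 * (d / 2) ->
      nrm (f x - f y) <= e / (2 * b).
    by move=> xb yb; rewrite mulrC divfK// => xy; apply: ltW; exact: hd'.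
  have tb : tagged_partition 0 b (d / 2) n s xi by split.
  have d2 : 0 < d / 2 / b by rewrite !divr_gt0.
  have [N0 hN0] := exp2V_small d2.
  have lb : slim (fun N => (b%:C)%C *: dsum (fun u => f (b * u)) N) ((b%:C)%C *: l).
    apply: (@slim_lin _ _ _ (fun x => (b%:C)%C *: x) b) hl => [x y|x].
      by rewrite scalerBr.
    by rewrite nrmRZ ger0_norm// ltW.
  have := slim_le (x := rsum f n s xi) (r := e / 2) (n0 := N0) lb.
  rewrite nrmBC => h; apply: (@le_lt_trans _ _ (e / 2)); last by slra.
  apply: h => N N0N; have bd : b * 2 ^- N < d / 2.
    rewrite mulrC -ltr_pdivlMr//; apply: le_lt_trans hN0.
    by rewrite lef_pV2 ?posrE ?exprn_gt0// ler_weXn2l// ler1n.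
  have [ht <-] := dyadic_tagged f b0 bd.
  apply: le_trans (rsum_dist fe ht tb) _; rewrite subr0.
  by rewrite le_eqVlt; apply/orP; left; apply/eqP; field; rewrite gt_eqF.
move=> J; split=> [hJ|->//].
apply: (@slim_unique _ _ (fun N => (b%:C)%C *: dsum (fun u => f (b * u)) N)).
  move=> e /hJ[d d0 hd'].
  have d2 : 0 < d / b by rewrite divr_gt0.
  have [N0 hN0] := exp2V_small d2; exists N0 => N N0N.
  have bd : b * 2 ^- N < d.
    rewrite mulrC -ltr_pdivlMr//; apply: le_lt_trans hN0.
    by rewrite lef_pV2 ?posrE ?exprn_gt0// ler_weXn2l// ler1n.
  have [[t0 tb ht] <-] := dyadic_tagged f b0 bd.
  by rewrite nrm_lt; exact: hd'.
apply: (@slim_lin _ _ _ (fun x => (b%:C)%C *: x) b) hl => [x y|x].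
  by rewrite scalerBr.
by rewrite nrmRZ ger0_norm// ltW.
Qed.

Lemma itv_div (x b : R) : 0 < b -> 0 <= x <= b -> 0 <= x / b <= 1.
Proof.
move=> b0 /andP[x0 xb]; apply/andP; split; first exact: divr_ge0 x0 (ltW b0).
by rewrite ler_pdivrMr// mul1r.
Qed.

Lemma circle_integralE (G : R[i] -> V) w (rho : R) : seqcomplete V -> 0 < rho ->
  (forall z, nrm (z - w) = rho -> ccont G z) -> forall J,
  is_circle_integral G w rho J <->
  J = (2 * (pi%:C)%C * 'i%C) *: cmean (fun z => (z - w) *: G z) w rho.
Proof.
move=> cV rho0 cG J; set h := fun z => (z - w) *: G z.
have p0 : 0 < 2 * pi :> R by rewrite mulr_gt0// pi_gt0.
have ch z : nrm (z - w) = rho -> ccont h z.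
  move=> zr; apply: ccontZ; last exact: cG.
  by apply: hol_ccont; apply: holB; [exact: hol_id|exact: hol_cst].
have cc u : 0 <= u <= 1 -> ccont h (w + circ rho u).
  by move=> _; apply: ch; rewrite addrC addKr nrm_circ// ltW.
have hm := cmeanP cV ch (ltW rho0).
pose f t := ('i * (rho%:C)%C * expi t) *: G (w + (rho%:C)%C * expi t) : V.
have fE t : f t = 'i%C *: h (w + circ rho (t / (2 * pi))).
  rewrite /f /h /circ [2 * pi * _]mulrC divfK ?gt_eqF//.
  by rewrite scalerA [w + _ - w]addrC addKr mulrA.
have key : is_mean (fun u => f (2 * pi * u)) ('i%C *: cmean h w rho).
  apply: (@is_mean_eq _ _ (fun u => 'i%C *: h (w + circ rho u))).
    by move=> u _; rewrite fE [_ * u]mulrC mulfK// gt_eqF.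
  apply: (@is_mean_lin _ _ _ (fun x => 'i%C *: x) 1) hm => [x y|a x|x].
  - by rewrite scalerDr.
  - by rewrite !scalerA mulrC.
  - by rewrite nrmZ nrmi.
rewrite /is_circle_integral (riemann_mean p0 _ key).
  by rewrite scalerA realcM (_ : (2%:C)%C = 2 :> R[i])//; exact: (rmorph_nat (real_complex R) 2).
move=> e e0; have [d d0 hd'] := circ_ucont cc e0.
exists (d * (2 * pi)); first by rewrite mulr_gt0.
have in01 (x : R) := @itv_div x (2 * pi) p0.
move=> x y /in01 x1 /in01 y1 xy; rewrite !fE -scalerBr nrmZ nrmi mul1r.
apply: hd' => //; rewrite -mulrBl normrM normfV (gtr0_norm p0).
by rewrite ltr_pdivrMr.
Qed.

End RiemannSums.

(** * The derivative of a determinant *)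

Section Jacobi.
Context {R : realType}.
Implicit Types z : R[i].

Lemma hd_prod_ord n (f d : 'I_n -> R[i] -> R[i]) z :
  (forall i, hd (f i) z (d i z)) ->
  hd (fun y => \prod_i f i y) z (\sum_k \prod_i (if i == k then d i z else f i z)).
Proof.
elim: n f d => [|n IH] f d fd.
  rewrite big_ord0; apply: (@hd_ext _ _ (fun=> (1 : R[i]))); last exact: hd_cst.
  by move=> y; rewrite big_ord0.
apply: (@hd_ext _ _ (fun y => f ord0 y * \prod_(i < n) f (lift ord0 i) y)).
  by move=> y; rewrite big_ord_recl.
have := hdM (fd ord0) (IH _ (fun i => d (lift ord0 i)) (fun i => fd (lift ord0 i))).
congr (hd _ z _); rewrite [RHS]big_ord_recl big_ord_recl eqxx; congr (_ * _ + _).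
rewrite mulr_sumr; apply: eq_bigr => k _; rewrite big_ord_recl eq_liftF.
by congr (_ * _); apply: eq_bigr => i _; rewrite (inj_eq lift_inj).
Qed.

Lemma hd_sum I (s : seq I) (P : pred I) (f : I -> R[i] -> R[i]) (d : I -> R[i]) z :
  (forall i, P i -> hd (f i) z (d i)) ->
  hd (fun y => \sum_(i <- s | P i) f i y) z (\sum_(i <- s | P i) d i).
Proof.
move=> fd; elim: s => [|i s IH].
  rewrite big_nil; apply: (@hd_ext _ _ (fun=> (0 : R[i]))); last exact: hd_cst.
  by move=> y; rewrite big_nil.
rewrite big_cons; case: ifP => Pi; last first.
  by apply: hd_ext IH => y; rewrite big_cons Pi.
apply: (@hd_ext _ _ (fun y => f i y + \sum_(j <- s | P j) f j y)).
  by move=> y; rewrite big_cons Pi.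
by apply: hdD => //; exact: fd.
Qed.

(** [Mk k] is the matrix with row [k] differentiated; expanding its determinant along that row
    produces the cofactors. *)
Lemma jacobi_formula n (M : R[i] -> 'M[R[i]]_n) (dM : 'M[R[i]]_n) z :
  (forall i j, hd (fun y => M y i j) z (dM i j)) ->
  hd (fun y => \det (M y)) z (\sum_i \sum_j dM i j * (\adj (M z)) j i).
Proof.
move=> hM.
pose Mk k : 'M[R[i]]_n := \matrix_(i, j) (if i == k then dM i j else M z i j).
have -> : \sum_i \sum_j dM i j * (\adj (M z)) j i = \sum_k \det (Mk k).
  apply: eq_bigr => k _; rewrite (expand_det_row _ k); apply: eq_bigr => j _.
  rewrite !mxE eqxx; congr (_ * _); rewrite /cofactor; congr (_ * \det _).
  by apply/matrixP => a b; rewrite !mxE eq_sym eq_liftF.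
rewrite /determinant exchange_big/=.
apply: hd_sum => s _; rewrite -mulr_sumr.
have := hdcZ ((-1) ^+ s) (@hd_prod_ord n (fun i y => M y i (s i))
  (fun i _ => dM i (s i)) z (fun i => hM i (s i))).
congr (hd _ z _); congr (_ * _); apply: eq_bigr => k _.
by apply: eq_bigr => i _; rewrite mxE.
Qed.

End Jacobi.

Section Trace.
Context {R : realType} {H : completeNormedModType R[i]}.
Variable dot : {dot H for (@Num.conj R[i])}.
Hypothesis hn : hilbert_norm dot.

(** Both representations give the sum of [dot (T (f j)) (f j)] over one orthonormal family [f] whose
    span contains all [v i] and [v' i]. *)
Lemma finite_rank_trace_unique (T : boundedOp H) t t' :
  finite_rank_trace dot T t -> finite_rank_trace dot T t' -> t = t'.
Proof.
move=> [n [u [v [Tu ->]]]] [n' [u' [v' [Tu' ->]]]].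
have [m [f [hf fv _]]] := gram_schmidt hn
  ([seq v i | i <- enum 'I_n] ++ [seq v' i | i <- enum 'I_n']) (orthonormal_nil dot).
have key k (a b : 'I_k -> H) : (forall x, T x = \sum_i dot x (a i) *: b i) ->
    (forall i, oproj hn f (b i) = b i) ->
    \sum_i dot (b i) (a i) = \sum_j dot (T (f j)) (f j).
  move=> Tab fb; under [RHS]eq_bigr do rewrite Tab dot_suml.
  rewrite exchange_big/=; apply: eq_bigr => i _.
  rewrite -{1}(fb i) fropE dot_suml; apply: eq_bigr => j _.
  by rewrite !dotZl mulrC.
rewrite (key _ _ _ Tu) ?(key _ _ _ Tu')// => i; apply: fv; rewrite mem_cat.
  by apply/orP; right; apply: map_f; rewrite mem_enum.
by apply/orP; left; apply: map_f; rewrite mem_enum.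
Qed.

End Trace.

(** * Residues as circle means *)

Section CircleMeans.
Context {R : realType} {V : normedModType R[i]}.
Hypothesis cV : seqcomplete V.
Implicit Types (w z : R[i]) (f : R[i] -> V).

Definition ismc f w (rho : R) l := is_mean (fun u : R => f (w + circ rho u)) l.

Lemma ismcP f w rho : 0 < rho -> (forall z, nrm (z - w) = rho -> ccont f z) ->
  ismc f w rho (cmean f w rho).
Proof.
move=> r0 cf.
have h := cmeanP cV cf.
exact: (h (ltW r0)).
Qed.

Lemma ismc_eq f g w rho l : 0 < rho -> (forall z, nrm (z - w) = rho -> f z = g z) ->
  ismc f w rho l -> ismc g w rho l.
Proof.
move=> r0 fg; apply: is_mean_eq => u _; apply: fg.
by rewrite addrC addKr nrm_circ// ltW.
Qed.

Lemma ismc_unique f w rho l l' : ismc f w rho l -> ismc f w rho l' -> l = l'.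
Proof. exact: slim_unique. Qed.

(** The circle mean of [(z - w) *: f z] is the residue of [f] at [w], which is 0 here. *)
Lemma ismc_hol0 f w (r rho : R) : 0 < rho < r ->
  (forall z, nrm (z - w) < r -> hol f z) -> ismc (fun z => (z - w) *: f z) w rho 0.
Proof.
move=> /andP[rho0 rhor] hf; set h := fun z => (z - w) *: f z.
have hh z : nrm (z - w) < r -> hol h z.
  by move=> /hf; apply: holZ; apply: holB; [exact: hol_id|exact: hol_cst].
have <- : cmean h w rho = 0.
  rewrite (cmean_center cV (R0 := r)) ?rho0//.
  - by rewrite /h subrr scale0r.
  - by apply: hol_ccont; apply: hh; rewrite subrr nrm0; slra.
  - by move=> z /andP[_]; exact: hh.
by apply: ismcP => // z zr; apply: hol_ccont; apply: hh; rewrite zr.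
Qed.

Lemma ismcD f g w rho l m : ismc f w rho l -> ismc g w rho m ->
  ismc (fun z => f z + g z) w rho (l + m).
Proof. exact: is_meanD. Qed.

Lemma ismc_sum I (s : seq I) (f : I -> R[i] -> V) w rho (l : I -> V) :
  (forall i, ismc (f i) w rho (l i)) ->
  ismc (fun z => \sum_(i <- s) f i z) w rho (\sum_(i <- s) l i).
Proof.
move=> hf; elim: s => [|i s IH].
  rewrite big_nil; apply: (@is_mean_eq _ _ (fun=> 0)); last exact: is_mean_cst.
  by move=> u _; rewrite big_nil.
rewrite big_cons; apply: (@is_mean_eq _ _ (fun u : R => f i (w + circ rho u) +
  \sum_(j <- s) f j (w + circ rho u))).
  by move=> u _; rewrite big_cons.
have h := hf i.
exact: (is_meanD h IH).
Qed.

Lemma ismcZ f w rho l a : ismc f w rho l -> ismc (fun z => a *: f z) w rho (a *: l).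
Proof.
apply: (@is_mean_lin _ _ _ (fun x : V => a *: x) (nrm a)) => [x y|b x|x].
- by rewrite scalerDr.
- by rewrite !scalerA mulrC.
- by rewrite nrmZ.
Qed.

Lemma taylor_poly f w (r : R) m : (forall z, nrm (z - w) < r -> hol f z) ->
  exists (c : nat -> V) (g : R[i] -> V), (forall z, nrm (z - w) < r -> hol g z) /\
    forall z, f z = \sum_(a < m) (z - w) ^+ a *: c a + (z - w) ^+ m *: g z.
Proof.
elim: m f => [|m IH] f hf.
  by exists (fun=> 0), f; split=> // z; rewrite big_ord0 add0r scale1r.
have [c [g [hg fE]]] := IH _ (quot_hol cV hf).
exists (fun a => if a is a'.+1 then c a' else f w), g; split=> // z.
rewrite (quotE f w z) fE scalerDr scaler_sumr big_ord_recl/= scale1r -addrA.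
by congr (_ + (_ + _)); [apply: eq_bigr => i _|]; rewrite scalerA exprS.
Qed.

Lemma derive_hol_in f c (r : R) z : (forall y, nrm (y - c) < r -> hol f y) ->
  nrm (z - c) < r -> hol (derive1 f) z.
Proof.
move=> hf zr; apply: (derive_hol cV (R0 := r - nrm (z - c))); first by rewrite subr_gt0.
move=> y yz; apply: hf; have := nrmB_tri y z c; slra.
Qed.

End CircleMeans.

Lemma ismc_lin (R : realType) (V W : normedModType R[i]) (L : V -> W) (K : R)
    (f : R[i] -> V) w rho l :
  (forall x y, L (x + y) = L x + L y) -> (forall a x, L (a *: x) = a *: L x) ->
  (forall x, nrm (L x) <= K * nrm x) -> ismc f w rho l ->
  ismc (fun z => L (f z)) w rho (L l).
Proof. exact: is_mean_lin. Qed.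

Lemma hol_det (R : realType) n (M : R[i] -> 'M[R[i]]_n) z :
  (forall i j, hol (fun y => M y i j : R[i]) z) -> hol (fun y => \det (M y) : R[i]) z.
Proof.
move=> hM; rewrite /determinant; apply: hol_sum => s _; apply: holM.
  exact: hol_cst.
by apply: hol_prod => i _; exact: hM.
Qed.

Lemma hol_adj (R : realType) n (M : R[i] -> 'M[R[i]]_n) z i j :
  (forall i j, hol (fun y => M y i j : R[i]) z) -> hol (fun y => (\adj (M y)) i j : R[i]) z.
Proof.
move=> hM; apply: (@hol_ext _ _ (fun y => (-1) ^+ (j + i) * \det (row' j (col' i (M y))))).
  by move=> y; rewrite mxE.
apply: holM; first exact: hol_cst.
apply: hol_det => k l; apply: hol_ext (hM (lift j k) (lift i l)) => y.
by rewrite !mxE.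
Qed.

(** * The logarithmic derivative of the determinant *)

Section LogDet.
Context {R : realType} {H : completeNormedModType R[i]}.
Variable dot : {dot H for (@Num.conj R[i])}.
Hypothesis hn : hilbert_norm dot.
Context {n : nat} {e : 'I_n -> H}.
Hypothesis he : orthonormal_fam dot e.
Local Notation E := (oproj hn e).
Local Notation redmx := (redmx dot (e := e)).
Implicit Types (z : R[i]).

Lemma hol_dot (f : R[i] -> H) (u : H) z : hol f z -> hol (fun y => dot (f y) u : R[i]) z.
Proof.
move=> [c hc]; exists (dot c u).
apply: (@hd_lin _ _ _ (fun x : H => dot x u : R[i]) (nrm u)) hc => [x y|a x|x].
- exact: dotDl.
- exact: dotZl.
- by rewrite mulrC cauchy_schwarz.
Qed.

Lemma hol_app (f : R[i] -> boundedOp H) (g : R[i] -> H) z :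
  hol f z -> hol g z -> hol (fun y => f y (g y)) z.
Proof. by move=> hf hg; exact: hol_bil (blin_app (H := H)) hf hg. Qed.

Lemma hd_redmx (L : R[i] -> boundedOp H) dL z i j : hd L z dL ->
  hd (fun y => redmx (L y) i j : R[i]) z (- dot (dL (e i)) (e j)).
Proof.
move=> hL; apply: (@hd_ext _ _ (fun y => (i == j)%:R - dot (L y (e i)) (e j))).
  by move=> y; rewrite mxE.
rewrite -sub0r; apply: hdB; first exact: hd_cst.
apply: (@hd_lin _ _ _ (fun T : boundedOp H => dot (T (e i)) (e j) : R[i]) (nrm (e i) * nrm (e j))) hL.
- by move=> S T; rewrite -[(S + T) _]/(S _ + T _) dotDl.
- by move=> a T; rewrite -[(a *: T) _]/(a *: T _) dotZl.
- move=> T; apply: le_trans (cauchy_schwarz hn _ _) _.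
  by rewrite mulrAC ler_wpM2r ?nrm_ge0// mulrC nrm_op.
Qed.

(** The left side is the trace of the singular part of [F' F^-1], obtained from the formula for
    [redinv]. Differentiating [F = (1 - E L) G] and applying Jacobi's formula leaves the logarithmic
    derivative of the determinant and a sum that stays holomorphic where the determinant
    vanishes. *)
Lemma logdet (F L G : R[i] -> boundedOp H) dF dL dG Gi z (r : R) : 0 < r ->
  hd F z dF -> hd L z dL -> hd G z dG -> inverse_of (G z) Gi ->
  (forall y, nrm (y - z) < r -> F y = compop (idop H - compop E (L y)) (G y)) ->
  \det (redmx (L z)) != 0 ->
  \sum_i \sum_j invmx (redmx (L z)) j i * dot (L z (dF (Gi (e i)))) (e j) =
  derive1 (fun y => \det (redmx (L y)) : R[i]) z / \det (redmx (L z)) +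
  \sum_i dot (dL (e i) + L z (dG (Gi (e i)))) (e i).
Proof.
move=> r0 hF hL hG /inverse_ofP[G1 G2] FE f0.
have M_unit : redmx (L z) \in unitmx by rewrite unitmxE unitfE.
have hEL : hd (fun y => compop E (L y)) z (compop E dL).
  have := hd_bil (blin_comp (H := H)) (hd_cst E z) hL.
  have -> : compop 0 (L z) + compop E dL = compop E dL.
    by apply: opext => x; rewrite -[LHS]/(0 + _) add0r.
  by [].
have hIEL : hd (fun y => idop H - compop E (L y)) z (- compop E dL).
  by rewrite -sub0r; apply: hdB; [exact: hd_cst|exact: hEL].
have dFE : dF = compop (- compop E dL) (G z) + compop (idop H - compop E (L z)) dG.
  apply: hd_unique hF _; apply: hd_near r0 _ (hd_bil (blin_comp (H := H)) hIEL hG).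
  by move=> y /FE ->.
set M := redmx (L z) in f0 M_unit *.
have dFi i : dF (Gi (e i)) = - E (dL (e i)) + (dG (Gi (e i)) - E (L z (dG (Gi (e i))))).
  by rewrite dFE -[LHS]/(- E (dL (G z (Gi (e i)))) + _) G1.
pose d i := coords dot (e := e) (dL (e i)).
pose y i := coords dot (e := e) (L z (dG (Gi (e i)))).
have Xi i : coords dot (e := e) (L z (dF (Gi (e i)))) = - d i + d i *m M + y i *m M.
  have -> : L z (dF (Gi (e i))) = - L z (comb (e := e) (d i)) + (L z (dG (Gi (e i))) -
      L z (comb (e := e) (y i))).
    by rewrite dFi !opD !opN !proj_coords.
  have cD (a b : H) : coords dot (e := e) (a + b) =
      coords dot (e := e) a + coords dot (e := e) b.
    by apply/rowP => j; rewrite !mxE dotDl.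
  have cN (a : H) : coords dot (e := e) (- a) = - coords dot (e := e) a.
    by apply/rowP => j; rewrite !mxE dotNl.
  rewrite !cD !cN !coords_comb -/(y i) opprB.
  by rewrite subKr [_ - d i]addrC.
have djac : derive1 (fun y => \det (redmx (L y)) : R[i]) z =
    \sum_i \sum_j - dot (dL (e i)) (e j) * (\adj M) j i.
  have hM i j : hd (fun y => redmx (L y) i j : R[i]) z
      ((\matrix_(i, j) (- dot (dL (e i)) (e j)) : 'M[R[i]]_n) i j).
    by rewrite mxE; exact: hd_redmx.
  have [_ ->] := hd_derive (jacobi_formula hM).
  by apply: eq_bigr => i _; apply: eq_bigr => j _; rewrite mxE.
rewrite djac mulr_suml -big_split/=; apply: eq_bigr => i _.
have -> : \sum_j invmx M j i * dot (L z (dF (Gi (e i)))) (e j) =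
    (coords dot (e := e) (L z (dF (Gi (e i)))) *m invmx M) 0 i.
  by rewrite mxE; apply: eq_bigr => j _; rewrite mxE mulrC.
rewrite Xi !mulmxDl !(mulmxK M_unit) mulNmx !mxE dotDl addrA; congr (_ + _ + _).
rewrite mulr_suml -sumrN; apply: eq_bigr => j _.
by rewrite /invmx M_unit !mxE -/M; ring.
Qed.

End LogDet.

Section ResidueTrace.
Context {R : realType} {H : completeNormedModType R[i]}.
Variable dot : {dot H for (@Num.conj R[i])}.
Hypothesis hn : hilbert_norm dot.
Implicit Types (z w : R[i]).

Lemma log_derivative_order (f g : R[i] -> R[i]) w (r : R) m z :
  (forall y, nrm (y - w) < r -> f y = (y - w) ^+ m * g y) ->
  nrm (z - w) < r -> z - w != 0 -> hol g z -> g z != 0 ->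
  (z - w) * (derive1 f z / f z) = m%:R + (z - w) * (derive1 g z / g z).
Proof.
move=> fE zr zw0 hgz gz0; have zm : (z - w) ^+ m != 0 by rewrite expf_neq0.
have hpow k' : hd (fun y => (y - w) ^+ k') z (k'%:R * (z - w) ^+ k'.-1).
  elim: k' => [|k' IH]; first by rewrite mul0r; exact: hd_cst.
  have h := hdM (hdB (hd_id z) (hd_cst w z)) IH; rewrite subr0 mul1r in h.
  have -> : k'.+1%:R * (z - w) ^+ k'.+1.-1 =
      (z - w) ^+ k' + (z - w) * (k'%:R * (z - w) ^+ k'.-1).
    case: (k') => [|j]; first by rewrite mul0r mulr0 addr0 mul1r.
    by rewrite /= exprS -(addn1 j.+1) natrD; ring.
  by apply: hd_ext h => y; rewrite exprS.
have hfg := hdM (hpow m) (hol_hd hgz).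
have hf : hd f z (m%:R * (z - w) ^+ m.-1 * g z + (z - w) ^+ m * derive1 g z).
  apply: (@hd_near _ _ (fun y => (y - w) ^+ m * g y) _ _ _ (r - nrm (z - w))) hfg.
    by rewrite subr_gt0.
  by move=> y yz; rewrite fE//; have := nrmB_tri y z w; slra.
have [_ ->] := hd_derive hf; rewrite fE//.
move: (derive1 g z) (g z) gz0 => dg gz gz0.
case: (m) zm => [|m'] zm; first by rewrite expr0 !mul0r !add0r !mul1r.
by move: zm; rewrite exprS /=; move: ((z - w) ^+ m') => t; rewrite mulf_eq0 negb_or => /andP[_ t0];
  field; rewrite t0 gz0.
Qed.

(** [ld] is the logarithmic derivative, [P] its regular part. Only the first [m] Taylor coefficients
    of [L] contribute to the residue, which is thereby of finite rank; exchanging trace and circle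
    mean reduces its trace to a scalar residue, equal to [m]. *)
Lemma residue_trace w (r rho : R) m n (e : 'I_n -> H)
    (L P ld : R[i] -> boundedOp H) (q : 'I_n -> R[i] -> H) (psi : R[i] -> R[i]) :
  0 < rho < r ->
  (forall z, nrm (z - w) < r -> hol L z) ->
  (forall z, nrm (z - w) < r -> hol P z) ->
  (forall j z, nrm (z - w) < r -> hol (q j) z) ->
  (forall z, nrm (z - w) < r -> hol psi z) ->
  (forall z, nrm (z - w) = rho -> hol ld z) ->
  (forall z x, nrm (z - w) = rho -> ld z x = P z x + ((z - w) ^+ m)^-1 *:
     \sum_j dot (L z x) (e j) *: q j z) ->
  (forall z, nrm (z - w) = rho ->
     (z - w) * (((z - w) ^+ m)^-1 * \sum_j dot (L z (q j z)) (e j)) =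
     m%:R + (z - w) * psi z) ->
  forall c2, finite_rank_trace dot
    (c2 *: cmean (fun z => (z - w) *: ld z) w rho) (c2 * m%:R).
Proof.
move=> rr hL hP hq hpsi ldhol ldE hTh c2; have /andP[rho0 rhor] := rr.
have cO := @seqcomplete_op R H; have cH := @complete_seqcomplete R H.
have wr z : nrm (z - w) = rho -> nrm (z - w) < r by move=> ->.
have zw z : nrm (z - w) = rho -> z - w != 0 by move=> zr; rewrite -nrm_gt0 zr.
have zwm z : nrm (z - w) = rho -> (z - w) ^+ m != 0 by move=> /zw zw0; rewrite expf_neq0.
have [Lc [Lr [hLr LE]]] := taylor_poly cO m hL.
have hv : exists v : nat -> 'I_n -> H, forall a j,
    ismc (fun z => ((z - w) * ((z - w) ^+ m)^-1 * (z - w) ^+ a) *: q j z) w rho (v a j).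
  exists (fun a j => cmean (fun z => ((z - w) * ((z - w) ^+ m)^-1 * (z - w) ^+ a) *: q j z) w rho).
  move=> a j; apply: (ismcP cH) => // z zr; apply: hol_ccont; apply: holZ; last first.
    by apply: hq; exact: wr.
  have hzw : hol (fun z => z - w) z by apply: holB; [exact: hol_id|exact: hol_cst].
  apply: holM; last exact: holX.
  apply: holM; first exact: hzw.
  by apply: hol_invf; [exact: zwm|exact: holX].
have {hv} [v hv] := hv.
have hJ : exists2 J0, J0 = cmean (fun z => (z - w) *: ld z) w rho &
    ismc (fun z => (z - w) *: ld z) w rho J0.
  eexists; first reflexivity.
  apply: (ismcP cO) => // z zr; apply: ccontZ.
    by apply: hol_ccont; apply: holB; [exact: hol_id|exact: hol_cst].
  by apply: hol_ccont; exact: ldhol.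
have {hJ} [J0 <- hJ0] := hJ.
have LEa z x j : dot (L z x) (e j) = \sum_(a < m) (z - w) ^+ a * dot (Lc a x) (e j) +
    (z - w) ^+ m * dot (Lr z x) (e j).
  rewrite LE -[X in dot X _]/((\sum_(a < m) (z - w) ^+ a *: Lc a) x + _ *: Lr z x).
  rewrite sum_opE dotDl dot_suml dotZl; congr (_ + _).
  by apply: eq_bigr => a _; rewrite -[X in dot X _]/(_ *: Lc a x) dotZl.
(* The terms with [P] and with the Taylor remainder [Lr] are holomorphic and have residue 0. *)
have J0E x : J0 x = \sum_(a < m) \sum_j dot (Lc a x) (e j) *: v a j.
  apply: (@ismc_unique _ _ (fun z => (z - w) *: ld z x) w rho).
    apply: (@ismc_lin _ _ _ (fun T : boundedOp H => T x) (nrm x) _ _ _ _ _ _ _ hJ0).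
    - by [].
    - by [].
    - by move=> T; rewrite mulrC nrm_op.
  have hPx z : nrm (z - w) < r -> hol (fun z => P z x) z.
    by move=> zr; apply: hol_app; [exact: hP|exact: hol_cst].
  have h1 := ismc_hol0 cH rr hPx.
  have hLx z : nrm (z - w) < r -> hol (fun z => \sum_j dot (Lr z x) (e j) *: q j z) z.
    move=> zr; apply: hol_sum => j _; apply: holZ; last exact: hq.
    by apply: (hol_dot hn); apply: hol_app; [exact: hLr|exact: hol_cst].
  have h2 := ismc_hol0 cH rr hLx.
  have h3 : ismc (fun z => \sum_(a < m) \sum_j dot (Lc a x) (e j) *:
      (((z - w) * ((z - w) ^+ m)^-1 * (z - w) ^+ a) *: q j z)) w rho
      (\sum_(a < m) \sum_j dot (Lc a x) (e j) *: v a j).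
    by apply: ismc_sum => a; apply: ismc_sum => j; apply: ismcZ; exact: hv.
  have h4 := ismcD (ismcD h1 h2) h3; rewrite addr0 add0r in h4.
  apply: ismc_eq h4; first exact: rho0.
  move=> z zr; have zm := zwm z zr.
  rewrite ldE// [RHS]scalerDr -addrA; congr (_ + _).
  under [in RHS]eq_bigr do rewrite LEa scalerDl.
  rewrite big_split/= !scalerDr addrC; congr (_ + _); last first.
    rewrite !scaler_sumr; apply: eq_bigr => j _; rewrite !scalerA; congr (_ *: _).
    by rewrite -!mulrA; congr (_ * _); rewrite mulrA mulVf ?mul1r.
  rewrite exchange_big/= !scaler_sumr; apply: eq_bigr => j _.
  rewrite scaler_suml !scaler_sumr; apply: eq_bigr => a _.
  rewrite !scalerA; congr (_ *: _).
  move: (z - w) (dot _ _) ((z - w) ^+ a) ((z - w) ^+ m)^-1 => t1 t2 t3 t4; ring.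
have trE : \sum_(a < m) \sum_j dot (Lc a (v a j)) (e j) = m%:R.
  have lin (S : boundedOp H) u (h : R[i] -> H) l : ismc h w rho l ->
      ismc (fun z => dot (S (h z)) u : R[i]) w rho (dot (S l) u).
    apply: (@ismc_lin _ _ _ (fun x : H => dot (S x) u : R[i]) (nrm S * nrm u)).
    - by move=> x y; rewrite opD dotDl.
    - by move=> a x; rewrite opZ dotZl.
    - by move=> x; apply: le_trans (cauchy_schwarz hn _ _) _;
        rewrite mulrAC ler_wpM2r ?nrm_ge0// nrm_op.
  have hps z : nrm (z - w) < r ->
      hol (fun z => psi z - \sum_j dot (Lr z (q j z)) (e j) : R[i]) z.
    move=> zr; apply: holB; first exact: hpsi.
    apply: hol_sum => j _; apply: (hol_dot hn).
    by apply: hol_app; [exact: hLr|exact: hq].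
  have h1 := ismc_hol0 (@seqcompleteC R) rr hps.
  have h0 : ismc (fun=> m%:R : R[i]) w rho (m%:R : R[i]) by exact: is_mean_cst.
  have h2 := ismcD h0 h1.
  rewrite addr0 in h2; apply/esym; apply: ismc_unique h2 _.
  apply: (@ismc_eq _ _ (fun z => \sum_(a < m) \sum_j
      dot (Lc a (((z - w) * ((z - w) ^+ m)^-1 * (z - w) ^+ a) *: q j z)) (e j))).
  - exact: rho0.
  - move=> z zr; have zm := zwm z zr.
    rewrite -[X in _ = _ + X]/((z - w) * _) mulrBr addrA -hTh// exchange_big/=.
    rewrite mulr_sumr !mulr_sumr -sumrB; apply: eq_bigr => j _.
    rewrite LEa mulrDr mulrDr [X in _ = _ + X - _]mulrA.
    rewrite [X in _ = _ + X - _]mulrA -[_ * _ * (z - w) ^+ m]mulrA mulVf// mulr1 addrK.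
    rewrite !mulr_sumr; apply: eq_bigr => a _; rewrite opZ dotZl.
    move: (z - w) (dot _ _) ((z - w) ^+ a) ((z - w) ^+ m)^-1 => t1 t2 t3 t4; ring.
  - by apply: ismc_sum => a; apply: ismc_sum => j; exact: lin.
(* A representation of finite rank asks for functionals of the form [dot x (u a j)], hence Riesz
   representation. *)
have [u hu] : exists u : 'I_m -> 'I_n -> H, forall (a : 'I_m) j x,
    dot (Lc a x) (e j) = dot x (u a j).
  have ex (aj : 'I_m * 'I_n) : exists u, forall x, dot (Lc aj.1 x) (e aj.2) = dot x u.
    apply: (@riesz _ _ _ hn (fun x => dot (Lc aj.1 x) (e aj.2)) (nrm (Lc aj.1) * nrm (e aj.2))).
    - by move=> x y; rewrite opD dotDl.
    - by move=> b x; rewrite opZ dotZl.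
    - by move=> x; apply: le_trans (cauchy_schwarz hn _ _) _;
        rewrite mulrAC ler_wpM2r ?nrm_ge0// nrm_op.
  have [u hu] := choice ex; exists (fun a j => u (a, j)) => a j x; exact: (hu (a, j)).
exists #|{: 'I_m * 'I_n}|, (fun i : 'I_#|{: 'I_m * 'I_n}| => u (enum_val i).1 (enum_val i).2),
  (fun i : 'I_#|{: 'I_m * 'I_n}| => c2 *: v (enum_val i).1 (enum_val i).2); split.
  move=> x; rewrite -[LHS]/(c2 *: J0 x) J0E pair_big/= scaler_sumr.
  rewrite -(big_enum_val (fun aj => dot x (u aj.1 aj.2) *: (c2 *: v aj.1 aj.2))).
  by apply: eq_big => // aj _; rewrite hu !scalerA mulrC.
rewrite -(big_enum_val (fun aj : 'I_m * 'I_n => dot (c2 *: v aj.1 aj.2) (u aj.1 aj.2))).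
rewrite -trE pair_big/= mulr_sumr; apply: eq_big => // aj _.
by rewrite dotZl hu.
Qed.

End ResidueTrace.

Lemma two_pi_i_neq0 (R : realType) : (2 * (pi%:C)%C * 'i%C : R[i]) != 0.
Proof.
apply: mulf_neq0; last by rewrite -nrm_gt0 nrmi.
apply: mulf_neq0; first by rewrite pnatr_eq0.
by rewrite -nrm_gt0 nrmR normr_gt0 gt_eqF// pi_gt0.
Qed.

(** * Multiplicity as order of vanishing *)

Section Multiplicity.
Context {R : realType} {H : completeNormedModType R[i]}.
Variable dot : {dot H for (@Num.conj R[i])}.
Hypothesis hn : hilbert_norm dot.
Variables (D : set R[i]) (A : R[i] -> boundedOp H).
Hypotheses (oD : open D) (hA : holomorphic_on D A).
Implicit Types (z w : R[i]).
Local Notation F := (char_fun A).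

Lemma dom_near z : D z -> z != 0 -> exists2 d : R, 0 < d & forall y, nrm (y - z) < d ->
  [/\ D y, y != 0 & hol A y].
Proof.
move=> Dz z0; have [d d0 hd'] : exists2 d : R, 0 < d & forall y, nrm (y - z) < d -> D y.
  by apply/nbhs_nrmP; exact: open_nbhs_nbhs.
exists (Num.min d (nrm z)); first by rewrite lt_min d0 nrm_gt0.
move=> y; rewrite lt_min => /andP[yd yz]; have Dy := hd' y yd; split=> //.
  apply: contraTneq yz => ->; rewrite sub0r nrmN; by rewrite ltxx.
by exists (derive1 A y); apply: derivable_hd; exact: hA.
Qed.

Lemma char_fun_hol z : D z -> z != 0 -> hol F z.
Proof.
move=> Dz z0; rewrite /char_fun; apply: holB; first exact: hol_cst.
apply: holZ; first by apply: hol_invf => //; exact: hol_id.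
by exists (derive1 A z); apply: derivable_hd; exact: hA.
Qed.

Lemma log_derivative_hol z : D z -> z != 0 -> op_invertible (F z) ->
  hol (log_derivative A) z.
Proof.
move=> Dz z0 Fz; apply: hol_comp_op; last first.
  by apply: hol_invop; [exact: char_fun_hol|].
have [d d0 hd'] := dom_near Dz z0.
apply: (derive_hol (@seqcomplete_op R H) d0) => y /hd'[Dy y0 _].
exact: char_fun_hol.
Qed.

(** [char_mult] picks some admissible integer. Any two candidates agree: the circle mean does not
    change between their radii and the trace does not depend on the representation. *)
Lemma char_mult_unique w (rho r : R) J (m : nat) : 0 < rho < r ->
  (forall z, nrm (z - w) < r -> [/\ D z, z != 0 & z - w != 0 -> op_invertible (F z)]) ->
  J = (2 * (pi%:C)%C * 'i%C) *: cmean (fun z => (z - w) *: log_derivative A z) w rho ->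
  finite_rank_trace dot J ((2 * (pi%:C)%C * 'i%C) * m%:R) ->
  char_mult dot D A w = m%:Z.
Proof.
move=> /andP[rho0 rhor] hD JE trJ; have cO := @seqcomplete_op R H.
have iso : isolating_radius D A w rho.
  split=> // z; rewrite -nrm_le => zr.
  have [Dz z0 Fz] := hD z (le_lt_trans zr rhor); split=> // -[_ _ hz]; apply/eqP.
  by rewrite -subr_eq0; apply/negPn/negP => zw0; apply: hz; exact: Fz.
have ldhol z : 0 < nrm (z - w) <= rho -> hol (log_derivative A) z.
  move=> /andP[z1 z2]; have [Dz z0 Fz] := hD z (le_lt_trans z2 rhor).
  by apply: log_derivative_hol => //; apply: Fz; rewrite -nrm_gt0.
have cl z : nrm (z - w) = rho -> ccont (log_derivative A) z.
  by move=> zr; apply: hol_ccont; apply: ldhol; rewrite zr rho0 lexx.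
have hm : is_char_mult dot D A w m%:Z.
  exists rho, J; split=> //; exact/(circle_integralE cO rho0 cl).
rewrite /char_mult; case: xgetP => [m' _ hm'|/(_ m%:Z)]; last by [].
have [rho' [J' [[rho'0 iso'] int' tr']]] := hm'.
have hol' z : 0 < nrm (z - w) <= rho' -> hol (log_derivative A) z.
  move=> /andP[z1 z2]; rewrite nrm_le in z2; have [Dz z0 hz] := iso' z z2.
  apply: log_derivative_hol => //; apply: contrapT => nF.
  have zw' : z = w by apply: hz.
  by move: z1; rewrite zw' subrr nrm0 ltxx.
have cl' z : nrm (z - w) = rho' -> ccont (log_derivative A) z.
  by move=> zr; apply: hol_ccont; apply: hol'; rewrite zr rho'0 lexx.
have J'E := (circle_integralE cO rho'0 cl' J').1 int'.
have [r1 [r10 r1rho r1rho']] : exists r1 : R, [/\ 0 < r1, r1 <= rho & r1 <= rho'].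
  by exists (Num.min rho rho'); rewrite lt_min rho0 !ge_min !lexx orbT.
have hzl z : hol (log_derivative A) z -> hol (fun z => (z - w) *: log_derivative A z) z.
  by move=> hz; apply: holZ; [apply: holB; [exact: hol_id|exact: hol_cst]|exact: hz].
have hr1 z s : r1 <= nrm (z - w) <= s -> 0 < nrm (z - w) <= s.
  by move=> /andP[z1 ->]; rewrite (lt_le_trans r10).
have e1 := @cmean_const _ _ cO (fun z => (z - w) *: log_derivative A z) w r1 rho r10 r1rho.
have e2 := @cmean_const _ _ cO (fun z => (z - w) *: log_derivative A z) w r1 rho' r10 r1rho'.
have {}e1 := e1 (fun z h => hzl z (ldhol z (hr1 z rho h))).
have {}e2 := e2 (fun z h => hzl z (hol' z (hr1 z rho' h))).
have JJ : J' = J := (etrans J'E (etrans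
  (congr1 (fun x => (2 * (pi%:C)%C * 'i%C) *: x) (etrans (esym e2) e1)) (esym JE))).
rewrite JJ in tr'; have tt := finite_rank_trace_unique hn tr' trJ.
have c20 := two_pi_i_neq0 R.
have := mulfI c20 tt; rewrite -[m%:R]/((m%:Z)%:~R) => /eqP; rewrite eqr_int => /eqP//.
Qed.

(** The case [m = 0] is included: at a regular point the multiplicity is 0. *)
Lemma char_mult_reduction w (r : R) n (e : 'I_n -> H) L G Gi g m :
  0 < r -> (forall z, nrm (z - w) < r -> D z /\ z != 0) ->
  reduction hn F w r e L G Gi ->
  (forall z, nrm (z - w) < r -> hol g z /\ g z != 0) ->
  (forall z, nrm (z - w) < r -> \det (redmx dot (e := e) (L z)) = (z - w) ^+ m * g z) ->
  char_mult dot D A w = m%:Z.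
Proof.
move=> r0 hD [he hred] hg fE.
have cO := @seqcomplete_op R H.
have rr : 0 < r / 2 < r by rewrite divr_gt0//=; slra.
have /andP[rho0 rhor] := rr.
have zwm z : z - w != 0 -> (z - w) ^+ m != 0 by move=> zw0; rewrite expf_neq0.
have f0 z : nrm (z - w) < r -> z - w != 0 -> \det (redmx dot (e := e) (L z)) != 0.
  by move=> zr zw0; rewrite fE// mulf_neq0 ?zwm//; case: (hg z zr).
have hL z : nrm (z - w) < r -> hol L z by move=> /hred[].
have hG z : nrm (z - w) < r -> hol G z by move=> /hred[].
have hF z : nrm (z - w) < r -> hol F z by move=> /hred[].
have hGi z : nrm (z - w) < r -> hol Gi z.
  move=> zr; apply: (@hol_near _ _ (fun y => invop (G y)) _ _ (r - nrm (z - w))).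
  - by rewrite subr_gt0.
  - move=> y yz; apply: invopE; have yr : nrm (y - w) < r.
      by have := nrmB_tri y z w; slra.
    by case: (hred y yr).
  - by apply: hol_invop; [exact: hG|exists (Gi z); case: (hred z zr)].
have hdF z : nrm (z - w) < r -> hol (derive1 F) z by exact: (derive_hol_in cO hF).
have hdL z : nrm (z - w) < r -> hol (derive1 L) z by exact: (derive_hol_in cO hL).
have hdG z : nrm (z - w) < r -> hol (derive1 G) z by exact: (derive_hol_in cO hG).
have hg1 z : nrm (z - w) < r -> hol g z by move=> /hg[].
have hdg z : nrm (z - w) < r -> hol (derive1 g) z by exact: (derive_hol_ball hg1).
have Finv z : nrm (z - w) < r -> z - w != 0 ->
    inverse_of (F z) (compop (Gi z) (redinv hn (e := e) (L z))).
  move=> zr zw0; have [_ _ _ GGi ->] := hred z zr.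
  by apply: inverse_of_comp => //; apply: redinvP => //; exact: f0.
have hD' z : nrm (z - w) < r -> [/\ D z, z != 0 & z - w != 0 -> op_invertible (F z)].
  move=> zr; have [Dz z0] := hD z zr; split=> // zw0.
  by exists (compop (Gi z) (redinv hn (e := e) (L z))); exact: Finv.
apply: (char_mult_unique rr hD'); first reflexivity.
have hP z : nrm (z - w) < r -> hol (fun z => compop (derive1 F z) (Gi z)) z.
  by move=> zr; apply: hol_comp_op; [exact: hdF|exact: hGi].
have zw z : nrm (z - w) = r / 2 -> z - w != 0 by move=> zr; rewrite -nrm_gt0 zr.
have wr z : nrm (z - w) = r / 2 -> nrm (z - w) < r by move=> ->.
(* By Cramer's rule the inverse matrix is the adjugate divided by [(z - w) ^+ m * g z]; the [q]
   chosen below, built from the adjugate divided by [g], is holomorphic at [w] as well. *)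
have invME z j i : nrm (z - w) < r -> z - w != 0 ->
    invmx (redmx dot (e := e) (L z)) j i =
    ((z - w) ^+ m)^-1 * ((\adj (redmx dot (e := e) (L z))) j i / g z).
  move=> zr zw0; rewrite /invmx unitmxE unitfE f0// mxE fE// invfM.
  by rewrite -mulrA [in RHS]mulrC [in RHS]mulrC [_ / g z]mulrC.
apply: (residue_trace hn rr hL hP (e := e)
  (q := fun j z => \sum_i ((\adj (redmx dot (e := e) (L z))) j i / g z) *:
     derive1 F z (Gi z (e i)))
  (psi := fun z => derive1 g z / g z +
     \sum_i dot (derive1 L z (e i) + L z (derive1 G z (Gi z (e i)))) (e i))).
- move=> j z zr; apply: hol_sum => i _; apply: holZ; last first.
    apply: hol_app; first exact: hdF.
    by apply: hol_app; [exact: hGi|exact: hol_cst].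
  apply: holM; last by case: (hg z zr) => hgz gz0; exact: hol_invf.
  by apply: hol_adj => k l; apply: (redmx_hol hn); exact: hL.
- move=> z zr; apply: holD.
    by apply: holM; [exact: hdg|case: (hg z zr) => hgz gz0; exact: hol_invf].
  apply: hol_sum => i _; apply: (hol_dot hn); apply: holD.
    by apply: hol_app; [exact: hdL|exact: hol_cst].
  apply: hol_app; first exact: hL.
  apply: hol_app; first exact: hdG.
  by apply: hol_app; [exact: hGi|exact: hol_cst].
- move=> z zr; have [Dz z0 Fz] := hD' z (wr z zr).
  by apply: log_derivative_hol => //; apply: Fz; exact: zw.
- move=> z x zr; rewrite /log_derivative (invopE (Finv z (wr z zr) (zw z zr))).
  rewrite -[LHS]/(derive1 F z (Gi z (redinv hn (e := e) (L z) x))) redinvE// !opD.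
  congr (_ + _); rewrite /comb !op_sum.
  under eq_bigr do rewrite !opZ mxE scaler_suml.
  rewrite exchange_big/= scaler_sumr; apply: eq_bigr => j _.
  rewrite !scaler_sumr; apply: eq_bigr => i _.
  rewrite !scalerA (invME z j i (wr z zr) (zw z zr)) mxE; congr (_ *: _).
  by rewrite mulrCA mulrA.
- move=> z zr; have zr' := wr z zr; have zw0 := zw z zr; have [hgz gz0] := hg z zr'.
  have sub0' : 0 < r - nrm (z - w) by rewrite subr_gt0.
  have [hLz hGz hFz hGGi _] := hred z zr'.
  have FEz y : nrm (y - z) < r - nrm (z - w) ->
      F y = compop (idop H - compop (oproj hn e) (L y)) (G y).
    move=> yz; have yr : nrm (y - w) < r by have := nrmB_tri y z w; slra.
    by case: (hred y yr).
  have ld := logdet sub0' (hol_hd hFz) (hol_hd hLz) (hol_hd hGz) hGGi FEz (f0 z zr' zw0).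
  have order := log_derivative_order fE zr' zw0 hgz gz0.
  rewrite mulrDr addrA -order -mulrDr -ld; congr (_ * _).
  rewrite exchange_big/= mulr_sumr; apply: eq_bigr => j _.
  rewrite op_sum dot_suml mulr_sumr; apply: eq_bigr => i _.
  by rewrite opZ dotZl (invME z j i zr' zw0) mulrA.
Qed.

End Multiplicity.

(** * Spectral windows of a selfadjoint operator *)

Section Spectral.
Context {R : realType} {H : completeNormedModType R[i]}.
Variable dot : {dot H for (@Num.conj R[i])}.
Hypothesis hn : hilbert_norm dot.
Implicit Types (x u v : H) (T S : boundedOp H) (z : R[i]) (a b c r mu : R).

Lemma Re_dot_le x y : complex.Re (dot x y) <= nrm x * nrm y.
Proof.
apply: le_trans (cauchy_schwarz hn x y); apply: le_trans (Re_le_nrm _).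
exact: ler_norm.
Qed.

(* Expand [0 <= <P(v - B^-1 P v), v - B^-1 P v>]. *)
Lemma positive_op_bound (P : H -> H) (B : R) v : 0 < B ->
  (forall x y, P (x - y) = P x - P y) -> (forall r x, P ((r%:C)%C *: x) = (r%:C)%C *: P x) ->
  (forall x y, dot (P x) y = dot x (P y)) ->
  (forall x, 0 <= complex.Re (dot (P x) x)) -> (forall x, nrm (P x) <= B * nrm x) ->
  nrm (P v) ^+ 2 <= B * complex.Re (dot (P v) v).
Proof.
move=> B0 PB PZ Psym Ppos Pbd; pose s := B^-1; have s0 : 0 < s by rewrite invr_gt0.
have sB : s * B = 1 by rewrite mulVf// gt_eqF.
have := Ppos (v - (s%:C)%C *: P v); rewrite PB PZ dotBl !dotBr !dotZl !dotZr conjc_real.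
have -> : dot (P (P v)) v = ((nrm (P v) ^+ 2)%:C)%C by rewrite Psym dotxx.
rewrite (dotxx hn (P v)).
have h1 : complex.Re (dot (P (P v)) (P v)) <= B * nrm (P v) ^+ 2.
  apply: le_trans (Re_dot_le _ _) _; rewrite expr2 mulrA ler_wpM2r ?nrm_ge0//.
move: h1; move: (dot (P (P v)) (P v)) (dot (P v) v) (nrm (P v) ^+ 2) => c1 c2 p h1.
rewrite !(cReD, cReN, cReM, ReC, ImC) !mul0r !subr0 => h2.
have h3 : s * (s * complex.Re c1) <= s * p.
  rewrite ler_wpM2l ?(ltW s0)//; apply: le_trans (ler_wpM2l (ltW s0) h1) _.
  by rewrite mulrA sB mul1r.
have h4 : s * p <= complex.Re c2 by slra.
by have := ler_wpM2l (ltW B0) h4; rewrite mulrA [B * s]mulrC sB mul1r.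
Qed.

Lemma inverse_lower T S x : inverse_of T S -> nrm x <= nrm S * nrm (T x).
Proof. by move=> /inverse_ofP[_ h]; rewrite -{1}(h x); exact: nrm_op. Qed.

Definition shift T mu : boundedOp H := T - (mu%:C)%C *: idop H.

Lemma shiftE T mu x : shift T mu x = T x - (mu%:C)%C *: x.
Proof. by []. Qed.

Lemma shift_sym T mu : selfadjoint_op dot T -> selfadjoint_op dot (shift T mu).
Proof.
by move=> sT x y; rewrite !shiftE dotBl dotBr sT dotZl dotZr conjc_real.
Qed.

(** Replaces the spectral theorem. Let [m] be the infimum of [|Y x|] over unit vectors. If
    [m < rho], then [Y - m] and [Y + m] are invertible, so [P = Y^2 - m^2] is bounded below; but [P]
    is positive and [dot (P x) x] tends to 0 along a minimising sequence, so [P x] tends to 0 by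
    [positive_op_bound]. *)
Lemma spectral_gap T c rho v : selfadjoint_op dot T ->
  (forall mu, `|mu - c| < rho -> op_invertible (shift T mu)) ->
  rho * nrm v <= nrm (shift T c v).
Proof.
move=> sT inv; have [->|v0] := eqVneq v 0; first by rewrite nrm0 mulr0 nrm_ge0.
set Y := shift T c; have sY : selfadjoint_op dot Y by exact: shift_sym.
pose A := [set nrm (Y x) | x in [set x | nrm x = 1]].
have nv : 0 < nrm v by rewrite nrm_gt0.
pose v1 := (((nrm v)^-1)%:C)%C *: v.
have v11 : nrm v1 = 1 by rewrite nrmRZ ger0_norm ?invr_ge0 ?(ltW nv)// mulVf// gt_eqF.
have hA : has_inf A by split; [exists (nrm (Y v1)), v1|exists 0 => _ [x _ <-]; exact: nrm_ge0].
have m_low x : inf A * nrm x <= nrm (Y x).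
  have [->|x0] := eqVneq x 0; first by rewrite op0 nrm0 mulr0.
  have nx : 0 < nrm x by rewrite nrm_gt0.
  rewrite -ler_pdivlMr// mulrC -(ger0_norm (x := (nrm x)^-1)) ?invr_ge0 ?(ltW nx)//.
  rewrite -nrmRZ -opZ; apply: ge_inf; first exact: hA.2.
  exists ((((nrm x)^-1)%:C)%C *: x) => //=.
  by rewrite nrmRZ ger0_norm ?invr_ge0 ?(ltW nx)// mulVf// gt_eqF.
have m0 : 0 <= inf A by apply: lb_le_inf; [exact: hA.1|move=> _ [x _ <-]; exact: nrm_ge0].
suff : rho <= inf A by move=> h; apply: le_trans (m_low v); rewrite ler_wpM2r ?(ltW nv).
rewrite leNgt; apply/negP => mrho.
move: m_low m0 mrho; have adh := @inf_adherent _ A; move: (inf A) adh => m adh m_low m0 mrho.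
have [S1 hS1] := inv (c + m) ltac:(by rewrite addrAC subrr add0r ger0_norm).
have [S2 hS2] := inv (c - m) ltac:(by rewrite addrAC subrr add0r normrN ger0_norm).
pose P x := Y (Y x) - ((m ^+ 2)%:C)%C *: x.
have hp x : shift T (c + m) x = Y x - (m%:C)%C *: x.
  by rewrite /Y !shiftE realcD scalerDl opprD addrA.
have hm x : shift T (c - m) x = Y x + (m%:C)%C *: x.
  by rewrite /Y !shiftE realcD rmorphN/= scalerDl scaleNr opprD opprK addrA.
clearbody Y.
have PE x : P x = shift T (c + m) (shift T (c - m) x).
  by rewrite hp hm opD opZ scalerDr opprD scalerA -realcM -expr2 addrA addrK.
have K_low x : nrm x <= nrm S2 * nrm S1 * nrm (P x).
  apply: le_trans (inverse_lower x hS2) _; rewrite -mulrA ler_wpM2l ?nrm_ge0//.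
  by rewrite PE; exact: inverse_lower.
pose B := nrm Y * nrm Y + m ^+ 2 + 1.
have B0 : 0 < B by have := sqr_ge0 m; have := mulr_ge0 (nrm_ge0 Y) (nrm_ge0 Y); rewrite /B; slra.
have Pre x : complex.Re (dot (P x) x) = nrm (Y x) ^+ 2 - m ^+ 2 * nrm x ^+ 2.
  by rewrite /P dotBl sY !dotxx// dotZl dotxx// cReD cReN cReM !ReC !ImC mul0r subr0.
have Pbound x : nrm (P x) ^+ 2 <= B * complex.Re (dot (P x) x).
  apply: positive_op_bound => //.
  - by move=> u w; rewrite /P !opB scalerBr !opprD !opprK addrACA.
  - by move=> r u; rewrite /P !opZ scalerBr !scalerA mulrC.
  - by move=> u w; rewrite /P dotBl dotBr !sY dotZl dotZr conjc_real.
  - move=> u; rewrite Pre subr_ge0 -exprMn ler_pXn2r ?nnegrE ?mulr_ge0 ?nrm_ge0//.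
  - move=> u; apply: le_trans (nrmB _ _) _; rewrite nrmRZ ger0_norm ?sqr_ge0//.
    have h1 : nrm (Y (Y u)) <= nrm Y * nrm Y * nrm u.
      apply: le_trans (nrm_op _ _) _; rewrite -mulrA ler_wpM2l ?nrm_ge0//; exact: nrm_op.
    by rewrite /B; have := nrm_ge0 u; slra.
clearbody B P; set K := nrm S2 * nrm S1 in K_low.
have K0 : 0 <= K by rewrite mulr_ge0 ?nrm_ge0.
have Q0 : 0 <= K ^+ 2 * B * (2 * m + 1) by apply: mulr_ge0; [exact: mulr_ge0 (sqr_ge0 _) (ltW B0)|slra].
move: Q0; set Q := K ^+ 2 * B * (2 * m + 1) => Q0.
(* At this accuracy [1 <= K ^+ 2 * nrm (P x) ^+ 2 <= Q * e], while [Q * e <= 1 / 2]. *)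
have e0 : 0 < Num.min 1 (1 / (2 * (Q + 1))) by rewrite lt_min ltr01 divr_gt0//; slra.
have [_ [x /= x1 <-] hx] := adh _ e0 hA; move: e0 hx.
have : Num.min 1 (1 / (2 * (Q + 1))) <= 1 by rewrite ge_min lexx.
have : Num.min 1 (1 / (2 * (Q + 1))) <= 1 / (2 * (Q + 1)) by rewrite ge_min lexx orbT.
move: (Num.min _ _) => e; rewrite ler_pdivlMr; last by slra.
move=> eQ e1 e0 hx.
have h1 := K_low x; have h2 := Pbound x; rewrite Pre x1 expr1n mulr1 in h2.
rewrite x1 in h1.
have h3 : 1 <= K ^+ 2 * nrm (P x) ^+ 2.
  by rewrite -exprMn -[leLHS](expr1n _ 2) ler_pXn2r ?nnegrE ?mulr_ge0 ?nrm_ge0.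
have h4 : nrm (Y x) ^+ 2 - m ^+ 2 <= e * (2 * m + 1).
  have := nrm_ge0 (Y x); move: hx; move: (nrm (Y x)) => y yx y0; snra.
have h5 : K ^+ 2 * nrm (P x) ^+ 2 <= K ^+ 2 * (B * (e * (2 * m + 1))).
  rewrite ler_wpM2l ?sqr_ge0//; apply: le_trans h2 _.
  by rewrite ler_wpM2l ?(ltW B0).
have h6 : K ^+ 2 * (B * (e * (2 * m + 1))) = Q * e by rewrite /Q; ring.
rewrite h6 in h5; have := le_trans h3 h5; snra.
Qed.

Lemma sa_imag T z v : selfadjoint_op dot T ->
  `|complex.Im z| * nrm v <= nrm (T v - z *: v).
Proof.
move=> sT; have [->|v0] := eqVneq v 0; first by rewrite nrm0 mulr0 nrm_ge0.
have nv : 0 < nrm v by rewrite nrm_gt0.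
have hd : complex.Im (dot (T v - z *: v) v) = - (complex.Im z * nrm v ^+ 2).
  have im0 : complex.Im (dot (T v) v) = 0.
    have : dot (T v) v = ((dot (T v) v)^*)%C by rewrite -[in RHS]dotC sT.
    by case: (dot (T v) v) => p q /= [] h; slra.
  rewrite dotBl cImD cImN im0 dotZl dotxx// cImM ReC ImC; ring.
have h1 := Im_le_nrm (dot (T v - z *: v) v).
have h2 := cauchy_schwarz hn (T v - z *: v) v.
rewrite hd normrN normrM (ger0_norm (sqr_ge0 _)) in h1.
by rewrite -(ler_pM2r nv) -mulrA -expr2; apply: le_trans h1 h2.
Qed.

Lemma fapproxZ T (k : R[i]) : fapprox hn T -> fapprox hn (k *: T).
Proof.
move=> hT; apply: fapprox_lincomb => e e0; exists k, 0, T, T; split=> // x.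
by rewrite scale0r addr0 -[X in X - _]/(k *: T x) subrr nrm0 mulr_ge0 ?nrm_ge0 ?(ltW e0).
Qed.

Lemma resolvent_of_lower T z r : fapprox hn T -> z != 0 -> 0 < r ->
  (forall v, r * nrm v <= nrm (T v - z *: v)) ->
  exists2 S, inverse_of (idop H - z^-1 *: T) S & nrm S <= nrm z / r.
Proof.
move=> fT z0 r0 low.
have [S hS] : op_invertible (idop H - z^-1 *: T).
  apply: (fredholm (hn := hn)); first exact: fapproxZ.
  move=> x; rewrite -[LHS]/(z^-1 *: T x) => hx; apply/eqP; rewrite -nrm_eq0.
  have := low x; have -> : T x = z *: x by rewrite -{2}hx scalerA divff// scale1r.
  rewrite subrr nrm0 => h; apply/eqP/le_anti; rewrite nrm_ge0 andbT.
  by rewrite -(ler_pM2l r0) mulr0.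
exists S => //; apply: nrm_op_le; first by rewrite divr_ge0 ?nrm_ge0// ltW.
move=> x; have [/(_ x) h1 _] := (inverse_ofP _ _).1 hS.
have h2 : nrm (T (S x) - z *: S x) = nrm z * nrm x.
  have h1' : S x - z^-1 *: T (S x) = x := h1.
  by rewrite -nrmZ -[in RHS]h1' scalerBr scalerA divff// scale1r nrmBC.
have := low (S x); rewrite h2 mulrAC => h; rewrite ler_pdivlMr// mulrC.
exact: h.
Qed.

Lemma orthonormal_nrm n (e : 'I_n -> H) i : orthonormal_fam dot e -> nrm (e i) = 1.
Proof.
move=> he; apply/eqP; rewrite -(@eqrXn2 _ 2) ?nrm_ge0 ?ler01// expr1n; apply/eqP.
by apply: complexI; rewrite -(dotxx hn) he eqxx.
Qed.

Section Eigenfamily.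
Variable A0 : boundedOp H.
Hypotheses (sA : selfadjoint_op dot A0) (fA : fapprox hn A0).

Definition eigvecs a b n (e : 'I_n -> H) (lam : 'I_n -> R) :=
  [/\ orthonormal_fam dot e, forall i, A0 (e i) = ((lam i)%:C)%C *: e i &
      forall i, a <= lam i <= b].

(** The second clause is maximality: the family exhausts the eigenvectors with eigenvalue in
    [[a, b]]. *)
Definition eigfam a b n (e : 'I_n -> H) (lam : 'I_n -> R) :=
  eigvecs a b e lam /\ forall v mu, a <= mu <= b -> A0 v = (mu%:C)%C *: v ->
    (forall i, dot v (e i) = 0) -> v = 0.

(** A projection of rank [m] that approximates [A0] within [a / 2] keeps at least 3/4 of the squared
    norm of each eigenvector, and by Bessel's inequality the kept parts add up to at most [m]. *)
Lemma eigvecs_bound a b : 0 < a -> exists N, forall n (e : 'I_n -> H) lam,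
  eigvecs a b e lam -> (n <= N)%N.
Proof.
move=> a0; have a2 : 0 < a / 2 by rewrite divr_gt0.
have [m [f [hf hE]]] := fA a2.
exists (2 * m)%N => n e lam [he eE lamab].
have h1 i : 3 / 4 <= nrm (oproj hn f (e i)) ^+ 2.
  have n1 := orthonormal_nrm i he.
  have /andP[la _] := lamab i.
  have := hE (e i); rewrite eE opZ -scalerBr nrmRZ ger0_norm ?n1 ?mulr1; last by slra.
  move=> h; have h2 : nrm (e i - oproj hn f (e i)) <= 1 / 2.
    have := nrm_ge0 (e i - oproj hn f (e i)); snra.
  have := proj_split hn hf (e i); rewrite n1 expr1n.
  have := nrm_ge0 (e i - oproj hn f (e i)); snra.
have h2 : \sum_i nrm (oproj hn f (e i)) ^+ 2 <= m%:R.
  under eq_bigr do rewrite nrm_proj2//.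
  rewrite exchange_big/=; have -> : m%:R = \sum_(k < m) (1 : R) by rewrite sumr_const card_ord.
  apply: ler_sum => k _.
  have -> : 1 = nrm (f k) ^+ 2 by rewrite (orthonormal_nrm k hf) expr1n.
  apply: le_trans (bessel hn he (f k)).
  by apply: ler_sum => i _; rewrite dotC nrm_conj.
have h3 : n%:R * (3 / 4) <= m%:R :> R.
  apply: le_trans h2; have -> : n%:R * (3 / 4) = \sum_(i < n) (3 / 4 : R).
    by rewrite sumr_const card_ord mulr_natl.
  by apply: ler_sum => i _.
rewrite -(ler_nat R) natrM; have : 0 <= m%:R :> R by []; slra.
Qed.

Lemma eigvecs_extend a b n (e : 'I_n -> H) lam v mu : eigvecs a b e lam ->
  a <= mu <= b -> A0 v = (mu%:C)%C *: v -> (forall i, dot v (e i) = 0) -> v != 0 ->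
  eigvecs a b (ocons (e := e) ((((nrm v)^-1)%:C)%C *: v))
    (fun i => if unlift ord0 i is Some j then lam j else mu).
Proof.
move=> [he eE lamab] mab Av ve v0; have nv : 0 < nrm v by rewrite nrm_gt0.
split.
- apply: (ocons_orthonormal hn he).
    by rewrite nrmRZ ger0_norm ?invr_ge0 ?(ltW nv)// mulVf// gt_eqF.
  by move=> j; rewrite dotZl ve mulr0.
- move=> i; case: (unliftP ord0 i) => [j|] ->.
    by rewrite oconsS eE.
  by rewrite ocons0 opZ Av !scalerA mulrC.
- by move=> i; case: (unliftP ord0 i).
Qed.

Lemma eigfam_exists a b : 0 < a -> exists n (e : 'I_n -> H) lam, eigfam a b e lam.
Proof.
move=> a0; have [N hN] := eigvecs_bound b a0.
have ind k : forall n (e : 'I_n -> H) lam, eigvecs a b e lam -> (N - n <= k)%N ->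
    exists n (e : 'I_n -> H) lam, eigfam a b e lam.
  elim: k => [|k IH] n e lam he Nk.
  - exists n, e, lam; split=> // v mu mab Av ve; apply: contrapT => /eqP v0.
    have := hN _ _ _ (eigvecs_extend he mab Av ve v0); move: Nk; rewrite leqn0 subn_eq0.
    by move=> h1 h2; have := leq_trans h2 h1; rewrite ltnn.
  - have [mx|] := pselect (forall v mu, a <= mu <= b -> A0 v = (mu%:C)%C *: v ->
      (forall i, dot v (e i) = 0) -> v = 0); first by exists n, e, lam; split.
    move=> /existsNP[v /existsNP[mu /not_implyP[mab /not_implyP[Av /not_implyP[ve /eqP v0]]]]].
    apply: (IH _ _ _ (eigvecs_extend he mab Av ve v0)).
    by move: Nk; rewrite subnS; case: (N - n)%N.
apply: (ind N 0%N (fun=> 0) (fun=> 0)); last exact: leq_subr.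
by split; case.
Qed.

Section Window.
Context {a b : R} {n : nat} {e : 'I_n -> H} {lam : 'I_n -> R}.
Hypotheses (a0 : 0 < a) (hE : eigfam a b e lam).

Let he : orthonormal_fam dot e. Proof. by case: hE => -[]. Qed.
Let eE i : A0 (e i) = ((lam i)%:C)%C *: e i. Proof. by case: hE => -[]. Qed.
Let lamab i : a <= lam i <= b. Proof. by case: hE => -[]. Qed.

Lemma eigfam_sub (a' b' : R) : a <= a' -> b' <= b ->
  eigfam a' b' (fun i : 'I_#|[pred j | a' <= lam j <= b']| => e (enum_val i))
    (fun i => lam (enum_val i)).
Proof.
move=> aa bb; split; first split.
- by move=> i j; rewrite he (inj_eq enum_val_inj).
- by move=> i; exact: eE.
- by move=> i; have := enum_valP i; rewrite inE.
move=> v mu /andP[m1 m2] Av ve; apply: (hE.2 v mu) => // [|j].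
  by rewrite (le_trans aa)// (le_trans m2).
have [jw|jw] := boolP (a' <= lam j <= b').
  have jin : j \in [pred j | a' <= lam j <= b'] by [].
  by have := ve (enum_rank_in jin j); rewrite enum_rankK_in.
have : dot (A0 v) (e j) = dot v (A0 (e j)) by rewrite sA.
rewrite Av eE dotZl dotZr conjc_real => /eqP; rewrite -subr_eq0 -mulrBl mulf_eq0.
rewrite -rmorphB/= -nrm_eq0 nrmR normr_eq0 subr_eq0 => /orP[/eqP ml|/eqP//].
by move: jw; rewrite -ml m1 m2.
Qed.

Lemma eigfam_comm x : oproj hn e (A0 x) = A0 (oproj hn e x).
Proof.
have -> : A0 (oproj hn e x) = A0 (\sum_i dot x (e i) *: e i) by [].
rewrite op_sum fropE; apply: eq_bigr => i _.
by rewrite opZ eE sA eE dotZr conjc_real scalerA mulrC.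
Qed.

Lemma eigfam_part x : 0 <= b -> nrm (A0 (oproj hn e x)) <= b * nrm x.
Proof.
move=> b0; rewrite -(@ler_pXn2r _ 2)// ?nnegrE ?mulr_ge0 ?nrm_ge0// exprMn.
have -> : A0 (oproj hn e x) = \sum_i (((lam i)%:C)%C * dot x (e i)) *: e i.
  have -> : A0 (oproj hn e x) = A0 (\sum_i dot x (e i) *: e i) by [].
  by rewrite op_sum; apply: eq_bigr => i _; rewrite opZ eE scalerA mulrC.
rewrite (nrm_comb hn he); apply: (@le_trans _ _ (\sum_i b ^+ 2 * nrm (dot x (e i)) ^+ 2)).
  apply: ler_sum => i _; rewrite nrmM nrmR exprMn ler_wpM2r ?sqr_ge0//.
  have := lamab i => /andP[l1 l2].
  have l0 : 0 <= lam i := ltW (lt_le_trans a0 l1).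
  by rewrite ler_pXn2r ?nnegrE ?normr_ge0// ger0_norm.
by rewrite -mulr_sumr ler_wpM2l ?sqr_ge0// bessel.
Qed.

(** [A0] with the eigenvalues of the window replaced by 0, so that its spectrum avoids [[a, b]]. *)
Definition cutop : boundedOp H := A0 - compop A0 (oproj hn e).

Lemma cutopE x : cutop x = A0 (x - oproj hn e x).
Proof. by rewrite opB. Qed.

Lemma cutop_sym : selfadjoint_op dot cutop.
Proof.
move=> x y; rewrite !cutopE !opB dotBl dotBr -eigfam_comm proj_dot; congr (_ - _).
  exact: sA.
exact: sA.
Qed.

Lemma cutop_fapprox : fapprox hn cutop.
Proof.
move=> r r0; have [m [f [hf hfA]]] := fA r0; exists m, f; split=> // x.
rewrite cutopE; apply: le_trans (hfA _) _; rewrite ler_wpM2l ?(ltW r0)//.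
exact: nrm_projC.
Qed.

Lemma cutop_shift_invertible mu : a <= mu <= b -> op_invertible (shift cutop mu).
Proof.
move=> mab; have /andP[mu1 mu2] := mab; have mu0 : 0 < mu := lt_le_trans a0 mu1.
have muC : (mu%:C)%C != 0 :> R[i] by rewrite -nrm_eq0 nrmR normr_eq0 gt_eqF.
have [S hS] : op_invertible (idop H - ((mu%:C)%C)^-1 *: cutop).
  apply: (fredholm (hn := hn)); first exact: fapproxZ cutop_fapprox.
  move=> x; rewrite -[LHS]/(_ *: cutop x) => hx.
  have Tx : cutop x = (mu%:C)%C *: x by rewrite -{2}hx scalerA divff// scale1r.
  have xe i : dot x (e i) = 0.
    have Tei : cutop (e i) = 0 by rewrite cutopE proj_e// subrr op0.
    have : dot (cutop x) (e i) = 0 by rewrite cutop_sym Tei dot0r.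
    by rewrite Tx dotZl => /eqP; rewrite mulf_eq0 (negbTE muC) => /eqP.
  apply: (hE.2 x mu) => //; rewrite -Tx cutopE.
  have -> : oproj hn e x = 0 by rewrite fropE big1// => i _; rewrite xe scale0r.
  by rewrite subr0.
exists (- (((mu%:C)%C)^-1 *: S)); have [h1 h2] := (inverse_ofP _ _).1 hS.
have shE x : shift cutop mu x = - ((mu%:C)%C *: (x - ((mu%:C)%C)^-1 *: cutop x)).
  by rewrite shiftE scalerBr scalerA divff// scale1r opprB.
apply/inverse_ofP; split=> x.
  rewrite -[X in shift _ _ X]/(- (((mu%:C)%C)^-1 *: S x)) opN opZ shE.
  have := h1 x; rewrite -[LHS]/(S x - _ *: cutop (S x)) => ->.
  by rewrite scalerN opprK scalerA mulVf// scale1r.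
rewrite -[LHS]/(- (((mu%:C)%C)^-1 *: S (shift cutop mu x))) shE opN opZ.
have := h2 x; rewrite -[LHS]/(S (x - _ *: cutop x)) => ->.
by rewrite scalerN opprK scalerA mulVf// scale1r.
Qed.

(** [spectral_gap] at the midpoint of the window, with radius its half-width, then the triangle
    inequality. *)
Lemma cutop_lower z v : 0 < nrm z ->
  ((b - a) / 2 - nrm (z - (((a + b) / 2)%:C)%C)) * nrm v <= nrm (cutop v - z *: v).
Proof.
move=> z0; have gap : (b - a) / 2 * nrm v <= nrm (shift cutop ((a + b) / 2) v).
  apply: spectral_gap; first exact: cutop_sym.
  move=> mu; rewrite ltr_norml => /andP[m1 m2]; apply: cutop_shift_invertible; slra.
rewrite shiftE in gap; set c := (((a + b) / 2)%:C)%C in gap *.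
have := nrmB_tri (cutop v) (z *: v) (c *: v).
rewrite -scalerBl nrmZ mulrBl => h; slra.
Qed.

(** Eigenvectors for [l] expand along the members with eigenvalue [l], so [k] independent ones yield
    a matrix with [k] independent rows and [#|J|] columns. *)
Lemma ker_dim (l : R) : a <= l <= b ->
  subspace_dim (op_ker (A0 - (l%:C)%C *: idop H)) =
  (#|[pred j | lam j == l]|%:R)%:E.
Proof.
move=> lab; set J := [pred j | lam j == l].
have kerP v : op_ker (A0 - (l%:C)%C *: idop H) v <-> A0 v = (l%:C)%C *: v.
  split=> [|h].
    by rewrite /op_ker/= -[X in X = 0]/(A0 v - (l%:C)%C *: v) => /eqP; rewrite subr_eq0 => /eqP.
  by rewrite /op_ker/= -[LHS]/(A0 v - (l%:C)%C *: v) h subrr.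
apply/le_anti/andP; split.
  apply: ge_ereal_sup => _ [k [v vk vfree] <-]; rewrite lee_fin ler_nat.
  have vE i : v i = \sum_(j in J) dot (v i) (e j) *: e j.
    have /kerP Av := vk i.
    have z0 j : lam j != l -> dot (v i) (e j) = 0.
      move=> lj; have : dot (A0 (v i)) (e j) = dot (v i) (A0 (e j)) by rewrite sA.
      rewrite Av eE dotZl dotZr conjc_real => /eqP; rewrite -subr_eq0 -mulrBl mulf_eq0.
      by rewrite -rmorphB/= -nrm_eq0 nrmR normr_eq0 subr_eq0 eq_sym (negbTE lj) => /eqP.
    have vp : v i = oproj hn e (v i).
      apply/eqP; rewrite -subr_eq0; apply/eqP; apply: (hE.2 _ l) => //.
        by rewrite opB -eigfam_comm Av opZ scalerBr.
      by move=> j; rewrite dotBl dot_proj// subrr.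
    rewrite {1}vp fropE (bigID (mem J))/= [X in _ + X]big1 ?addr0// => j.
    by rewrite inE => /z0 ->; rewrite scale0r.
  rewrite leqNgt; apply/negP => kJ.
  pose C : 'M[R[i]]_(k, #|J|) := \matrix_(i, j) dot (v i) (e (enum_val j)).
  have : row_free C.
    apply: inj_row_free => c cC; apply/rowP => i; rewrite mxE.
    apply: (vfree (fun i => c 0 i)).
    transitivity (\sum_(j in J) (\sum_i c 0 i * dot (v i) (e j)) *: e j).
      under eq_bigr do rewrite vE scaler_sumr.
      rewrite exchange_big/=; apply: eq_bigr => j _.
      by rewrite scaler_suml; apply: eq_bigr => i' _; rewrite scalerA.
    rewrite big1// => j jJ; have := congr1 (fun X : 'rV_#|J| => X 0 (enum_rank_in jJ j)) cC.
    rewrite !mxE => h; rewrite (_ : \sum_i _ = 0) ?scale0r// -[RHS]h.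
    by apply: eq_bigr => i' _; rewrite mxE enum_rankK_in.
  by rewrite /row_free => /eqP rk; have := rank_leq_col C; rewrite rk leqNgt kJ.
apply: ereal_sup_ubound; exists #|J| => //; exists (fun i : 'I_#|J| => e (enum_val i)).
  by move=> i; apply/kerP; rewrite eE; have := enum_valP i; rewrite inE => /eqP->.
move=> c hc i; have := congr1 (fun x => dot x (e (enum_val i))) hc.
rewrite dot0l dot_suml (bigD1 i)//= big1 ?addr0.
  by rewrite dotZl he eqxx mulr1.
by move=> j ji; rewrite dotZl he (inj_eq enum_val_inj) (negbTE ji) mulr0.
Qed.

Lemma eigen_count_window (x y : R) : a <= x -> y <= b ->
  eigen_count A0 [set l | x <= l <= y] = ((\sum_j nat_of_bool (x <= lam j <= y)%R)%:R)%:E.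
Proof.
move=> ax yb; rewrite /eigen_count.
rewrite (eq_esum (b := fun l => \sum_(j < n) ((lam j == l)%:R)%:E)); last first.
  move=> l /= /andP[xl ly]; rewrite ker_dim ?(le_trans ax)//=; last by apply: le_trans yb.
  by rewrite sumEFin -natr_sum -sum1_card big_mkcond.
rewrite esum_sum; last by move=> l j _ _; rewrite lee_fin.
rewrite natr_sum -sumEFin; apply: eq_bigr => j _.
have [hj|hj] := boolP (x <= lam j <= y).
  rewrite (esumID [set lam j]); last by move=> l _; rewrite lee_fin.
  rewrite [X in (_ + X)%E]esum1 ?adde0; last first.
    by move=> l [_ /= /eqP]; rewrite eq_sym => /negbTE ->.
  by rewrite setIC setIidl ?esum_set1 ?eqxx ?lee_fin// => l /= ->.
rewrite esum1// => l /= hl; have [jl|//] := eqVneq (lam j) l.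
by move: hj; rewrite jl hl.
Qed.

End Window.
End Eigenfamily.
End Spectral.

(** * The resolvent near 0 *)

Section ResolventLimit.
Context {R : realType} {H : completeNormedModType R[i]}.
Variable dot : {dot H for (@Num.conj R[i])}.
Hypothesis hn : hilbert_norm dot.
Variables (A0 P0 : boundedOp H).
Hypotheses (sA : selfadjoint_op dot A0) (hP0 : orth_proj dot (op_ker A0) P0).
Implicit Types (x u v f : H) (T S Rz Y : boundedOp H) (z : R[i]) (C r t : R).

(* [Rz] is [z (z - T)^-1], for a [T] that differs from [A0] by [O(|z|)]. *)
Definition resolvent_pair C z T Rz := [/\ z != 0, forall x, A0 x = 0 -> T x = 0,
  nrm (A0 - T) <= C * nrm z, inverse_of (idop H - z^-1 *: T) Rz & nrm Rz <= C].

Lemma fin_pos_min m (t : 'I_m -> R) : (forall k, 0 < t k) ->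
  exists2 t0, 0 < t0 & forall k, t0 <= t k.
Proof.
elim: m t => [|m IH] t t0; first by exists 1 => // -[].
have [s s0 hs] := IH (fun k => t (lift ord0 k)) (fun k => t0 _).
exists (Num.min s (t ord0)); first by rewrite lt_min s0 t0.
move=> k; case: (unliftP ord0 k) => [j|] ->; rewrite ge_min ?hs// lexx orbT//.
Qed.

(** The orthogonal complement of the range of a selfadjoint operator is its kernel. *)
Lemma kernel_split f : exists s, [/\ A0 s = 0, s = P0 f &
  forall r, 0 < r -> exists x, nrm (f - s - A0 x) < r].
Proof.
have W0 : exists x, (0 : H) = A0 x by exists 0; rewrite op0.
have Wl (a : R[i]) x y : (exists x', x = A0 x') -> (exists y', y = A0 y') ->
    exists z' : H, a *: x + y = A0 z'.
  by move=> [x' ->] [y' ->]; exists (a *: x' + y'); rewrite opD opZ.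
have [s [sW app]] := @projection_lemma _ _ dot hn (fun w => exists x, w = A0 x) f W0 Wl.
have s0 : A0 s = 0.
  by apply: (dot_eq0P hn) => y; rewrite sA; apply: sW; exists y.
exists s; split=> // [|r /app[w [x ->] h]]; last by exists x.
have [P1 P2] := hP0 f; set d := s - P0 f.
have d0 : A0 d = 0 by rewrite opB s0 P1 subrr.
have fs : dot (f - s) d = 0.
  apply/eqP; rewrite -nrm_eq0; apply/eqP/le_anti; rewrite nrm_ge0 andbT.
  apply/ler_addgt0Pr => r r0; rewrite add0r.
  have r1 : 0 < r / (nrm d + 1) by rewrite divr_gt0//; have := nrm_ge0 d; slra.
  have [w [x ->] h] := app _ r1.
  have -> : dot (f - s) d = dot (f - s - A0 x) d by rewrite [RHS]dotBl sA d0 dot0r subr0.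
  apply: le_trans (cauchy_schwarz hn _ _) _.
  move: h; rewrite ltr_pdivlMr; last by have := nrm_ge0 d; slra.
  have := nrm_ge0 (f - s - A0 x); have := nrm_ge0 d; snra.
have dd : dot d d = 0.
  have -> : dot d d = dot (f - P0 f) d - dot (f - s) d.
    have dE : d = (f - P0 f) - (f - s) by rewrite /d opprB [RHS]addrC addrA subrK.
    by rewrite {1}dE dotBl.
  by rewrite fs P2// subr0.
apply/eqP; rewrite -subr_eq0 -/d -nrm_eq0; have := dotxx hn d; rewrite dd => /esym/eqP.
by rewrite -nrm_eq0 nrmR normr_eq0 sqrf_eq0.
Qed.

(** Strong convergence of [Rz] to [P0], uniform over all pairs with constant [C]: [Rz] fixes the
    kernel of [A0], it sends [T x] to [z *: (Rz x - x)], and [A0 - T] is of order [|z|]. *)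
Lemma resolvent_point C f (eps : R) : 0 <= C -> 0 < eps -> exists2 t0, 0 < t0 &
  forall z T Rz, resolvent_pair C z T Rz -> nrm z < t0 -> nrm (Rz f - P0 f) <= eps.
Proof.
move=> C0 e0; have [s [s0 <- app]] := kernel_split f.
have c1 : 0 < 2 * (C + 1) by slra.
have [x hx] := app (eps / (2 * (C + 1))) (divr_gt0 e0 c1).
pose M := (C + 1 + C * C) * nrm x.
have M0 : 0 <= M by rewrite mulr_ge0 ?nrm_ge0//; have := mulr_ge0 C0 C0; slra.
exists (eps / (2 * (M + 1))); first by rewrite divr_gt0//; slra.
move=> z T Rz [z0 ker dT /inverse_ofP[R1 R2] nR] zt.
have Rs : Rz s = s.
  have e1 : s - z^-1 *: T s = s by rewrite (ker _ s0) scaler0 subr0.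
  by have := R2 s; rewrite -[X in Rz X]/(s - z^-1 *: T s) e1.
have Tx : Rz (T x) = z *: (Rz x - x).
  have := R2 x; rewrite -[X in Rz X]/(x - z^-1 *: T x) opB opZ => h.
  have -> : Rz x - x = z^-1 *: Rz (T x).
    by apply/eqP; rewrite subr_eq addrC -subr_eq; apply/eqP.
  by rewrite scalerA divff// scale1r.
have RA : nrm (Rz (A0 x)) <= nrm z * M.
  have -> : A0 x = T x + (A0 - T) x by rewrite -[X in _ + X]/(A0 x - T x) addrC subrK.
  rewrite opD Tx; apply: le_trans (nrmD _ _) _; rewrite nrmZ /M.
  have h1 : nrm (Rz x - x) <= (C + 1) * nrm x.
    apply: le_trans (nrmB _ _) _; have := nrm_op Rz x.
    have := ler_wpM2r (nrm_ge0 x) nR; slra.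
  have h2 : nrm (Rz ((A0 - T) x)) <= C * (C * nrm z * nrm x).
    apply: le_trans (nrm_op _ _) _; apply: ler_pM; rewrite ?nrm_ge0//.
    apply: le_trans (nrm_op _ _) _; by rewrite ler_wpM2r ?nrm_ge0.
  have := ler_wpM2l (nrm_ge0 z) h1; slra.
have -> : Rz f - s = Rz (f - s - A0 x) + Rz (A0 x).
  by rewrite !opB Rs subrK.
apply: le_trans (nrmD _ _) _.
have h3 : nrm (Rz (f - s - A0 x)) <= eps / 2.
  apply: le_trans (nrm_op _ _) _; apply: (@le_trans _ _ (C * (eps / (2 * (C + 1))))).
    by apply: ler_pM; rewrite ?nrm_ge0// ltW.
  rewrite mulrA ler_pdivrMr//; have := mulr_ge0 C0 (ltW e0); snra.
have h4 : nrm z * M <= eps / 2.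
  move: zt; rewrite ltr_pdivlMr; last by slra.
  have := nrm_ge0 z; snra.
by apply: le_trans (lerD h3 (le_trans RA h4)) _; slra.
Qed.

(** Strong convergence becomes norm convergence after composition with a compact operator: it is
    used at finitely many vectors [f k]. *)
Lemma resolvent_compact C (B0 : boundedOp H) (eps : R) : 0 <= C -> fapprox hn B0 ->
  0 < eps -> exists2 t0, 0 < t0 &
  forall z T Rz, resolvent_pair C z T Rz -> nrm z < t0 ->
    nrm (compop Rz B0 - compop P0 B0) <= eps.
Proof.
move=> C0 fB e0; have K0 : 0 < 2 * (C + nrm P0 + 1) by have := nrm_ge0 P0; slra.
have [m [f [hf hB]]] := fB _ (divr_gt0 e0 K0).
have m0 : 0 <= m%:R * nrm B0 by rewrite mulr_ge0 ?nrm_ge0.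
have d0 : 0 < eps / (2 * (m%:R * nrm B0 + 1)) by rewrite divr_gt0//; slra.
move: d0; set d := eps / (2 * (m%:R * nrm B0 + 1)) => d0.
have hk k : exists t, 0 < t /\ forall z T Rz, resolvent_pair C z T Rz -> nrm z < t ->
    nrm (Rz (f k) - P0 (f k)) <= d.
  by have [t t0 ht] := resolvent_point (f k) C0 d0; exists t.
have [t ht] := choice hk.
have [t0 t00 t0k] := fin_pos_min (fun k => (ht k).1).
exists t0 => // z T Rz hR zt; have [_ _ _ _ nR] := hR.
apply: nrm_op_le; first exact: ltW.
move=> x; rewrite -[X in nrm X]/(Rz (B0 x) - P0 (B0 x)).
set y := B0 x; set p := oproj hn f y.
have -> : Rz y - P0 y = (Rz (y - p) - P0 (y - p)) + (Rz p - P0 p).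
  by rewrite !opB opprB [RHS](AC (2*2*2)%AC ((1*4)*(2*5)*(3*6))%AC)/= addNr subrr !addr0.
have h1 : nrm (Rz (y - p) - P0 (y - p)) <= eps / 2 * nrm x.
  apply: le_trans (nrmB _ _) _.
  apply: (@le_trans _ _ ((C + nrm P0) * nrm (y - p))).
    rewrite mulrDl lerD ?nrm_op//; apply: le_trans (nrm_op _ _) _.
    by rewrite ler_wpM2r ?nrm_ge0.
  have := hB x; rewrite -/y -/p => h; apply: (@le_trans _ _ ((C + nrm P0) * (eps / (2 * (C + nrm P0 + 1)) * nrm x))).
    by rewrite ler_wpM2l// addr_ge0 ?nrm_ge0.
  rewrite mulrA ler_wpM2r ?nrm_ge0// mulrA ler_pdivrMr//.
  by have := ltW e0; snra.
have h2 : nrm (Rz p - P0 p) <= eps / 2 * nrm x.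
  have -> : Rz p - P0 p = \sum_k dot y (f k) *: (Rz (f k) - P0 (f k)).
    have pE : p = \sum_k dot y (f k) *: f k by [].
    rewrite pE !op_sum -sumrB; apply: eq_bigr => k _.
    by rewrite !opZ scalerBr.
  apply: le_trans (nrm_sum _ _ _) _.
  apply: (@le_trans _ _ (\sum_(k < m) nrm B0 * nrm x * d)).
    apply: ler_sum => k _; rewrite nrmZ; apply: ler_pM; rewrite ?nrm_ge0//.
      apply: le_trans (cauchy_schwarz hn _ _) _.
      by rewrite (orthonormal_nrm hn k hf) mulr1 nrm_op.
    by apply: (ht k).2 hR _; apply: lt_le_trans zt (t0k k).
  rewrite sumr_const card_ord -(mulr_natl _ m).
  have -> : m%:R * (nrm B0 * nrm x * d) = m%:R * nrm B0 * d * nrm x by ring.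
  rewrite ler_wpM2r ?nrm_ge0// /d mulrA ler_pdivrMr; last by slra.
  by have := ltW e0; snra.
by apply: le_trans (nrmD _ _) _; apply: le_trans (lerD h1 h2) _; slra.
Qed.

Variable B : R[i] -> boundedOp H.
Hypotheses (cB : ccont B 0) (fB : fapprox hn (B 0)).

Lemma resolvent_limit C (eps : R) : 0 <= C -> 0 < eps -> exists2 t0, 0 < t0 &
  forall z T Rz, resolvent_pair C z T Rz -> nrm z < t0 ->
    nrm (compop Rz (B z) - compop P0 (B 0)) <= eps.
Proof.
move=> C0 e0; have e2 : 0 < eps / 2 by slra.
have [t1 t10 h1] := resolvent_compact C0 fB e2.
have c1 : 0 < C + 1 by slra.
have [d d0 hd'] := cB (divr_gt0 e2 c1).
exists (Num.min t1 d); first by rewrite lt_min t10.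
move=> z T Rz hR; rewrite lt_min => /andP[z1 z2]; have [_ _ _ _ nR] := hR.
have {}h1 := h1 z T Rz hR z1; have := hd' z; rewrite subr0 => /(_ z2) h2.
have -> : compop Rz (B z) - compop P0 (B 0) =
    compop Rz (B z - B 0) + (compop Rz (B 0) - compop P0 (B 0)).
  apply: opext => x; rewrite -[LHS]/(Rz (B z x) - P0 (B 0 x)).
  rewrite -[RHS]/(Rz (B z x - B 0 x) + (Rz (B 0 x) - P0 (B 0 x))).
  by rewrite opB addrA subrK.
apply: le_trans (nrmD _ _) _.
have h3 : nrm (compop Rz (B z - B 0)) <= eps / 2.
  apply: le_trans (nrm_comp _ _) _.
  apply: (@le_trans _ _ (C * (eps / 2 / (C + 1)))).
    by apply: ler_pM; rewrite ?nrm_ge0// ltW.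
  rewrite mulrA ler_pdivrMr//; have := ltW e2; snra.
by apply: le_trans (lerD h3 h1) _; slra.
Qed.

(** The hypothesis concerns [1 - B P0] but the limit is [1 - P0 B]; the inverses are related by
    [(1 - P0 B)^-1 = 1 + P0 (1 - B P0)^-1 B]. *)
Lemma projected_inverse : op_invertible (idop H - compop (B 0) P0) ->
  op_invertible (idop H - compop P0 (B 0)).
Proof.
move=> [S /inverse_ofP[S1 S2]]; exists (idop H + compop P0 (compop S (B 0))).
apply/inverse_ofP; split=> x.
  rewrite -[LHS]/((x + P0 (S (B 0 x))) - P0 (B 0 (x + P0 (S (B 0 x))))).
  have := S1 (B 0 x); rewrite -[LHS]/(S (B 0 x) - B 0 (P0 (S (B 0 x)))) => h.
  rewrite opD -{1}(subrK (B 0 (P0 (S (B 0 x)))) (S (B 0 x))) h !opD.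
  by rewrite addrK.
rewrite -[LHS]/((x - P0 (B 0 x)) + P0 (S (B 0 (x - P0 (B 0 x))))).
have := S2 (B 0 x); rewrite -[LHS]/(S (B 0 x - B 0 (P0 (B 0 x)))) => h.
by rewrite opB h subrK.
Qed.

Hypothesis invB : op_invertible (idop H - compop (B 0) P0).

(** [K] comes before [C]: it depends on the limit operator alone, and only the threshold [t0]
    depends on [C]. *)
Lemma resolvent_perturbed : exists2 K : R, 0 < K & forall C, 0 <= C ->
  exists2 t0, 0 < t0 & forall z T Rz, resolvent_pair C z T Rz -> nrm z < t0 ->
    exists2 Y, inverse_of (idop H - compop Rz (B z)) Y & nrm Y <= K.
Proof.
have [S0 hS0] := projected_inverse invB; have n0 := nrm_ge0 S0.
exists (2 * nrm S0 + 1); first by lra.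
move=> C C0; have e0 : 0 < 1 / (2 * (nrm S0 + 1)) by rewrite divr_gt0//; lra.
have [t0 t00 ht] := resolvent_limit C0 e0; exists t0 => // z T Rz hR zt.
have [Y hY nY] : exists2 Y, inverse_of (idop H - compop Rz (B z)) Y & nrm Y <= 2 * nrm S0.
  apply: (inverse_perturb hS0).
  have -> : idop H - compop Rz (B z) - (idop H - compop P0 (B 0)) =
      - (compop Rz (B z) - compop P0 (B 0)).
    by rewrite [RHS]opprB [X in _ + X = _]opprB addrC addrA subrK.
  rewrite nrmN; have := ht z T Rz hR zt; rewrite ler_pdivlMr; last by lra.
  have := nrm_ge0 (compop Rz (B z) - compop P0 (B 0)); snra.
by exists Y => //; lra.
Qed.

Lemma perturbed_inverse z T Rz Y : inverse_of (idop H - z^-1 *: T) Rz ->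
  inverse_of (idop H - compop Rz (B z)) Y ->
  inverse_of (idop H - z^-1 *: T - B z) (compop Y Rz).
Proof.
move=> hR hY; have -> : idop H - z^-1 *: T - B z =
    compop (idop H - z^-1 *: T) (idop H - compop Rz (B z)).
  have [h1 _] := (inverse_ofP _ _).1 hR; apply: opext => x.
  have := h1 (B z x); set W := idop H - z^-1 *: T => h.
  rewrite -[LHS]/(W x - B z x) -[RHS]/(W (x - Rz (B z x))).
  by rewrite opB h.
exact: inverse_of_comp.
Qed.

Section WindowDet.
Context {a b : R} {n : nat} {e : 'I_n -> H} {lam : 'I_n -> R}.
Hypotheses (a0 : 0 < a) (hE : eigfam dot A0 a b e lam).
Let he : orthonormal_fam dot e. Proof. by case: hE => -[]. Qed.
Let eE i : A0 (e i) = ((lam i)%:C)%C *: e i. Proof. by case: hE => -[]. Qed.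

Local Notation cut := (cutop hn A0 (e := e)).

(** With [Gi] the inverse of the pencil of the cut operator, this is the [L] of the reduction in the
    window; see [window_factor]. *)
Definition winL z Gi : boundedOp H := z^-1 *: compop A0 Gi.

Lemma window_factor z Gi : inverse_of (idop H - z^-1 *: cut - B z) Gi ->
  idop H - z^-1 *: A0 - B z =
  compop (idop H - compop (oproj hn e) (winL z Gi)) (idop H - z^-1 *: cut - B z).
Proof.
move=> /inverse_ofP[h1 h2]; apply: opext => x.
set G := idop H - _ - _ in h1 h2 *.
rewrite -[RHS]/(G x - oproj hn e (z^-1 *: A0 (Gi (G x)))) h2 opZ (eigfam_comm hn sA hE).
rewrite -[G x]/(x - z^-1 *: (A0 x - A0 (oproj hn e x)) - B z x).
rewrite -[LHS]/(x - z^-1 *: A0 x - B z x) scalerBr opprB addrA.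
by rewrite [RHS](AC 5%AC ((1*3*4)*(2*5))%AC)/= subrr addr0.
Qed.

Lemma window_det_le z Gi (Q : R) : 0 <= b -> 0 <= Q -> b * nrm Gi <= Q * nrm z -> z != 0 ->
  nrm (\det (redmx dot (e := e) (winL z Gi))) <= (1 + Q) ^+ n.
Proof.
move=> b0 Q0 hQ z0; have nz : 0 < nrm z by rewrite nrm_gt0.
have := red_det_bounds he (L := winL z Gi) (a := 0) (b := 1 + Q) (lexx _) _ _.
move=> h; have q1 : 0 <= 1 + Q by rewrite addr_ge0.
suff hx : forall x, oproj hn e x = x -> 0 * nrm x <=
    nrm (x - oproj hn e (winL z Gi x)) <= (1 + Q) * nrm x.
  by have /andP[] := h hn q1 hx.
move=> x _.
apply/andP; split; first by rewrite mul0r nrm_ge0.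
apply: le_trans (nrmB _ _) _; rewrite mulrDl mul1r lerD2l.
rewrite -[winL z Gi x]/(z^-1 *: A0 (Gi x)) opZ (eigfam_comm hn sA hE) nrmZ nrmV mulrC ler_pdivrMr//.
apply: le_trans (eigfam_part hn a0 hE _ b0) _.
apply: (@le_trans _ _ (b * (nrm Gi * nrm x))); first by rewrite ler_wpM2l// nrm_op.
by have := ler_wpM2r (nrm_ge0 x) hQ; lra.
Qed.

(** The pencil is [(1 - A0 / z) (1 - R' B)]. On [Y (e i)] the second factor gives [e i - W (e i)]
    with [W = (R' - Rz) B Y], and the first is diagonal on the family. Thus the first determinant
    measures how far the two resolvents differ after composition with [B]. *)
Lemma window_det_factor z Rz R' Y : z != 0 ->
  inverse_of (idop H - z^-1 *: cut) Rz -> inverse_of (idop H - z^-1 *: A0) R' ->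
  inverse_of (idop H - compop Rz (B z)) Y ->
  \det (redmx dot (e := e) (winL z (compop Y Rz))) =
  \det (redmx dot (e := e) (compop (R' - Rz) (compop (B z) Y))) *
  \prod_j (1 - ((lam j)%:C)%C / z).
Proof.
move=> z0 hR hR' hY.
have hG := perturbed_inverse hR hY; have Fw := window_factor hG.
have [R1 R2] := (inverse_ofP _ _).1 hR; have [R1' R2'] := (inverse_ofP _ _).1 hR'.
have [Y1 Y2] := (inverse_ofP _ _).1 hY; have [G1 G2] := (inverse_ofP _ _).1 hG.
rewrite -[X in _ * X](eq_bigr _ (fun j _ => mxE matrix_key
  (fun (_ : 'I_1) (j : 'I_n) => 1 - ((lam j)%:C)%C / z) 0 j)) -det_diag -det_mulmx.
congr (\det _); apply/matrixP => i j.
rewrite mul_mx_diag !mxE.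
have Rei : Rz (e i) = e i.
  have e1 : cut (e i) = 0 by rewrite cutopE (proj_e hn he) subrr op0.
  have := R2 (e i); rewrite -[X in Rz X]/(e i - z^-1 *: cut (e i)) e1.
  by rewrite scaler0 subr0.
set Gi := compop Y Rz in hG G1 G2 Fw *.
have eqx : (idop H - z^-1 *: A0 - B z) (Gi (e i)) = e i - oproj hn e (winL z Gi (e i)).
  rewrite Fw -[LHS]/((idop H - z^-1 *: cut - B z) (Gi (e i)) -
    oproj hn e (winL z Gi ((idop H - z^-1 *: cut - B z) (Gi (e i))))).
  by rewrite G1.
have hF : dot ((idop H - z^-1 *: A0 - B z) (Gi (e i))) (e j) =
    dot (e i - oproj hn e (winL z Gi (e i))) (e j) by rewrite eqx.
rewrite [X in _ = X]dotBl (dot_proj hn he) he in hF; rewrite -hF.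
have -> : Gi (e i) = Y (e i) by rewrite -{2}Rei.
set y := Y (e i).
have ye : y - Rz (B z y) = e i by exact: Y1.
set w := (compop (R' - Rz) (compop (B z) Y)) (e i).
have wE : y - R' (B z y) = e i - w.
  have -> : w = R' (B z y) - Rz (B z y) by [].
  by rewrite -ye opprB addrA subrK.
have -> : (idop H - z^-1 *: A0 - B z) y = (idop H - z^-1 *: A0) (y - R' (B z y)).
  by rewrite opB R1'.
rewrite wE -[X in dot X _]/((e i - w) - z^-1 *: A0 (e i - w)) dotBl dotZl sA eE dotZr.
rewrite conjc_real dotBl he; move: (_ - dot w _) => t; ring.
Qed.

End WindowDet.
End ResolventLimit.

(** * The logarithmic kernel *)

Section Kernel.
Context {R : realType}.
Implicit Types (A B m k x y rho : R) (w : R[i]).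

Lemma ln_sub_le A B : 0 < A -> 0 < B -> ln A - ln B <= (A - B) / B.
Proof.
move=> A0 B0; rewrite -ln_div ?posrE//.
have -> : A / B = 1 + (A - B) / B by field; rewrite gt_eqF.
apply: le_ln1Dx; have : 0 < A / B by rewrite divr_gt0.
have -> : (A - B) / B = A / B - 1 by field; rewrite gt_eqF.
slra.
Qed.

Lemma ln_sub_ge A B : 0 < A -> 0 < B -> (A - B) / A <= ln A - ln B.
Proof.
move=> A0 B0; have := ln_sub_le B0 A0.
have -> : (B - A) / A = - ((A - B) / A) by rewrite -mulNr opprB.
slra.
Qed.

Lemma ln_dist A B m : 0 < m -> m <= A -> m <= B -> `|ln A - ln B| <= `|A - B| / m.
Proof.
move=> m0 mA mB; have A0 := lt_le_trans m0 mA; have B0 := lt_le_trans m0 mB.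
have key C : 0 < C -> m <= C -> (A - B) / C <= `|A - B| / m /\ (B - A) / C <= `|A - B| / m.
  move=> C0 mC; have n0 := normr_ge0 (A - B).
  have h1 : `|A - B| / C <= `|A - B| / m by rewrite ler_wpM2l// lef_pV2 ?posrE.
  split; apply: le_trans h1; rewrite ler_wpM2r ?invr_ge0 ?(ltW C0)//.
    exact: ler_norm.
  by rewrite -normrN opprB ler_norm.
rewrite ler_norml; apply/andP; split.
  have := ln_sub_le B0 A0; have [_ h] := key A A0 mA; slra.
have := ln_sub_le A0 B0; have [h _] := key B B0 mB; slra.
Qed.

(** The value of [diff4] at 1 with step [i k] on [ln |z - x|], for real [x]; see
    [diff4_kern_real]. *)
Definition kern k x := ln ((x - 1) ^+ 2 + 4 * k ^+ 2) - ln ((x - 1) ^+ 2 + k ^+ 2).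

Lemma kern_pos k x : 0 < k -> [/\ 0 < k ^+ 2, 0 < (x - 1) ^+ 2 + 4 * k ^+ 2,
  0 < (x - 1) ^+ 2 + k ^+ 2 & 0 <= (x - 1) ^+ 2].
Proof.
by move=> k0; have k2 : 0 < k ^+ 2 by [rewrite exprn_gt0]; have := sqr_ge0 (x - 1); split=> //; slra.
Qed.

Lemma kern_le k x : 0 < k -> kern k x <= 3 * k ^+ 2 / ((x - 1) ^+ 2 + k ^+ 2).
Proof.
move=> k0; have [k2 p1 p2 _] := kern_pos x k0; apply: le_trans (ln_sub_le p1 p2) _.
by rewrite (_ : _ + 4 * _ - _ = 3 * k ^+ 2)//; ring.
Qed.

Lemma kern_ge k x : 0 < k -> 3 * k ^+ 2 / ((x - 1) ^+ 2 + 4 * k ^+ 2) <= kern k x.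
Proof.
move=> k0; have [k2 p1 p2 _] := kern_pos x k0; apply: le_trans (ln_sub_ge p1 p2).
by rewrite (_ : _ + 4 * _ - _ = 3 * k ^+ 2)//; ring.
Qed.

Lemma kern_ge0 k x : 0 < k -> 0 <= kern k x.
Proof.
move=> k0; have [k2 p1 p2 _] := kern_pos x k0; apply: le_trans (kern_ge x k0).
by rewrite divr_ge0 ?(ltW p1)// mulr_ge0 ?(ltW k2).
Qed.

Lemma kern_le3 k x : 0 < k -> kern k x <= 3.
Proof.
move=> k0; have [k2 p1 p2 q] := kern_pos x k0; apply: le_trans (kern_le x k0) _.
by rewrite ler_pdivrMr//; slra.
Qed.

Lemma kern_half k x : 0 < k -> `|x - 1| <= k -> 1 / 2 <= kern k x.
Proof.
move=> k0 xk; have [k2 p1 p2 q] := kern_pos x k0; apply: le_trans (kern_ge x k0).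
rewrite ler_pdivlMr//; have : (x - 1) ^+ 2 <= k ^+ 2.
  by rewrite -[X in X <= _]real_normK ?num_real// ler_pXn2r ?nnegrE ?(ltW k0).
slra.
Qed.

Lemma kern_far k x rho : 0 < k -> 0 < rho -> rho <= `|x - 1| ->
  kern k x <= 3 * k ^+ 2 / rho ^+ 2.
Proof.
move=> k0 r0 xr; have [k2 p1 p2 q] := kern_pos x k0; apply: le_trans (kern_le x k0) _.
have r2 : 0 < rho ^+ 2 by rewrite exprn_gt0.
apply: ler_wpM2l; first by slra.
rewrite lef_pV2 ?posrE//.
have : rho ^+ 2 <= (x - 1) ^+ 2.
  by rewrite -[X in _ <= X]real_normK ?num_real// ler_pXn2r ?nnegrE ?(ltW r0).
slra.
Qed.

Lemma kern_mono k x y : 0 < k -> `|y - 1| <= `|x - 1| -> kern k x <= kern k y.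
Proof.
move=> k0 yx; have [k2 p1 p2 q1] := kern_pos x k0; have [_ p3 p4 q2] := kern_pos y k0.
have h : (y - 1) ^+ 2 <= (x - 1) ^+ 2.
  by rewrite -[X in X <= _]real_normK ?num_real// -[X in _ <= X]real_normK ?num_real//
    ler_pXn2r ?nnegrE ?normr_ge0.
rewrite /kern lerBlDr addrAC lerBrDr -!lnM ?posrE// ler_ln ?posrE ?mulr_gt0//; snra.
Qed.

(** A compact support makes the kernel ignore zeros and eigenvalues outside the window; the
    truncation costs [O(k ^+ 2)] per point. *)
Definition kcut k rho x := if `|x - 1| < rho then kern k x else 0.

Lemma kcut_ge0 k rho x : 0 < k -> 0 <= kcut k rho x.
Proof. by move=> k0; rewrite /kcut; case: ifP => // _; exact: kern_ge0. Qed.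

Lemma kcut_le3 k rho x : 0 < k -> kcut k rho x <= 3.
Proof. by move=> k0; rewrite /kcut; case: ifP => // _; exact: kern_le3. Qed.

Lemma kcut_mono k rho x y : 0 < k -> `|y - 1| <= `|x - 1| ->
  kcut k rho x <= kcut k rho y.
Proof.
move=> k0 yx; rewrite /kcut; case: ifP => [xr|_]; last exact: (kcut_ge0 rho y k0).
by rewrite (le_lt_trans yx xr); exact: kern_mono.
Qed.

Lemma kcut_kern k rho x : 0 < k -> 0 < rho ->
  `|kcut k rho x - kern k x| <= 3 * k ^+ 2 / rho ^+ 2.
Proof.
move=> k0 r0; rewrite /kcut; case: ltP => xr.
  by rewrite subrr normr0 divr_ge0 ?sqr_ge0// mulr_ge0 ?sqr_ge0.
by rewrite sub0r normrN ger0_norm ?kern_ge0//; exact: kern_far.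
Qed.

Lemma ln_nrm_sqr (z : R[i]) : z != 0 -> ln (nrm z) = ln (nrm z ^+ 2) / 2.
Proof.
by move=> z0; rewrite lnXn ?nrm_gt0// mulr2n; slra.
Qed.

(** Both arguments are at least [k ^+ 2 / 4], and they differ by [|y (y - 2 s k)|], at most
    [5 k |y|]. *)
Lemma ln_shift_dist (X y k c : R) : 0 < k -> `|y| <= k / 2 -> 1 <= c <= 2 ->
  forall s : R, s = c \/ s = - c ->
  `|ln (X ^+ 2 + (s * k - y) ^+ 2) - ln (X ^+ 2 + c ^+ 2 * k ^+ 2)| <= 20 * `|y| / k.
Proof.
move=> k0 yk /andP[c1 c2] s sc; have k2 : 0 < k ^+ 2 by rewrite exprn_gt0.
have m0 : 0 < k ^+ 2 / 4 by slra.
have X0 := sqr_ge0 X; have /andP[y1 y2] : - (k / 2) <= y <= k / 2 by rewrite -ler_norml.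
have s2 : s ^+ 2 = c ^+ 2 by case: sc => ->; rewrite ?sqrrN.
have mA : k ^+ 2 / 4 <= X ^+ 2 + (s * k - y) ^+ 2.
  have h : k ^+ 2 / 4 <= (s * k - y) ^+ 2.
    case: sc => ->.
      have h1 : k / 2 <= c * k - y by snra.
      snra.
    have h1 : k / 2 <= c * k + y by snra.
    snra.
  slra.
have cc : 1 <= c ^+ 2 by snra.
have mB : k ^+ 2 / 4 <= X ^+ 2 + c ^+ 2 * k ^+ 2.
  have := ler_peMl (ltW k2) cc; slra.
apply: le_trans (ln_dist m0 mA mB) _.
have -> : X ^+ 2 + (s * k - y) ^+ 2 - (X ^+ 2 + c ^+ 2 * k ^+ 2) = y * (y - 2 * s * k).
  by rewrite -s2; ring.
rewrite normrM; have h : `|y - 2 * s * k| <= 5 * k.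
  by rewrite ler_norml; case: sc => ->; apply/andP; split; snra.
have -> : 20 * `|y| / k = `|y| * (5 * k) / (k ^+ 2 / 4) by field; rewrite gt_eqF.
by rewrite ler_wpM2r ?invr_ge0 ?(ltW m0)// ler_wpM2l.
Qed.

Lemma diff4_kern w k : 0 < k -> `|complex.Im w| <= k / 2 ->
  `|diff4 (fun z => ln (nrm (z - w))) 1 (0 +i* k)%C - kern k (complex.Re w)| <=
  40 * `|complex.Im w| / k.
Proof.
case: w => x y /= k0 yk; rewrite /diff4.
have key (s : R) (z : R[i]) : z = (1 +i* (s * k))%C -> 1 <= `|s| ->
    ln (nrm (z - (x +i* y)%C)) = ln ((x - 1) ^+ 2 + (s * k - y) ^+ 2) / 2.
  move=> -> s1; rewrite ln_nrm_sqr.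
    by rewrite nrm_sqr /= (_ : (1 - x) ^+ 2 = (x - 1) ^+ 2)//; ring.
  apply/eqP => -[_ h]; move: yk s1; have -> : y = s * k by slra.
  rewrite normrM (gtr0_norm k0); snra.
rewrite (key 2); first last.
- by rewrite ger0_norm; slra.
- by apply: complex_eq => /=; ring.
rewrite (key (- 2)); first last.
- by rewrite normrN ger0_norm; slra.
- by apply: complex_eq => /=; ring.
rewrite (key 1); first last.
- by rewrite ger0_norm; slra.
- by apply: complex_eq => /=; ring.
rewrite (key (- 1)); first last.
- by rewrite normrN ger0_norm; slra.
- by apply: complex_eq => /=; ring.
have c2 : ((1 : R) <= 2) && ((2 : R) <= 2) by apply/andP; split; slra.
have c1 : ((1 : R) <= 1) && ((1 : R) <= 2) by apply/andP; split; slra.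
have := ln_shift_dist (x - 1) k0 yk c2 (or_introl erefl).
have := ln_shift_dist (x - 1) k0 yk c2 (or_intror erefl).
have := ln_shift_dist (x - 1) k0 yk c1 (or_introl erefl).
have := ln_shift_dist (x - 1) k0 yk c1 (or_intror erefl).
rewrite /kern expr1n mul1r (_ : 2 ^+ 2 = 4 :> R); last by ring.
have -> : 40 * `|y| / k = 2 * (20 * `|y| / k) by ring.
move: (20 * `|y| / k) => q.
move: (ln _) (ln _) (ln _) (ln _) (ln _) (ln _) => a b c d e f.
by rewrite !ler_norml => /andP[? ?] /andP[? ?] /andP[? ?] /andP[? ?]; apply/andP; split; slra.
Qed.

Lemma diff4_kern_real x k : 0 < k ->
  diff4 (fun z => ln (nrm (z - (x%:C)%C))) 1 (0 +i* k)%C = kern k x.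
Proof.
move=> k0; apply/eqP; rewrite -subr_eq0 -normr_le0.
by have := @diff4_kern (x%:C)%C k k0; rewrite /= normr0 mulr0 mul0r; apply; slra.
Qed.

End Kernel.

(** * Zeros of a scalar function against real points *)

Section ScalarComparison.
Context {R : realType}.
Implicit Types (f g : R[i] -> R[i]) (u w z : R[i]).

(** The centre for counting zeros. Off the axis [ln |f|] is bounded below through the points [x j],
    whereas on the axis [f] may vanish. *)
Definition base_point (b : R) : R[i] := (1 +i* b)%C.

Lemma diff4_sum n (phi : 'I_n -> R[i] -> R) a h :
  diff4 (fun z => \sum_j phi j z) a h = \sum_j diff4 (phi j) a h.
Proof. by rewrite /diff4 -big_split/= -!sumrB. Qed.

Lemma diff4_dist (phi psi : R[i] -> R) a h (d : R) :
  `|phi (a + 2 * h) - psi (a + 2 * h)| <= d -> `|phi (a - 2 * h) - psi (a - 2 * h)| <= d ->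
  `|phi (a + h) - psi (a + h)| <= d -> `|phi (a - h) - psi (a - h)| <= d ->
  `|diff4 phi a h - diff4 psi a h| <= 4 * d.
Proof.
rewrite /diff4 !ler_norml => /andP[? ?] /andP[? ?] /andP[? ?] /andP[? ?].
by apply/andP; split; slra.
Qed.

Lemma sum_dist_seq (T : Type) (s : seq T) (f g : T -> R) (c : R) (P : T -> Prop) :
  (forall x, P x -> `|f x - g x| <= c) -> all (fun x => `[< P x >]) s ->
  `|\sum_(x <- s) f x - \sum_(x <- s) g x| <= (size s)%:R * c.
Proof.
move=> h; elim: s => [|x s IH] /=; first by rewrite !big_nil subrr normr0 mul0r.
move=> /andP[/asboolP/h hx /IH hs]; rewrite !big_cons -addn1 natrD mulrDl mul1r.
rewrite opprD addrACA; apply: le_trans (ler_normD _ _) _; slra.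
Qed.

Lemma sum_dist_ord n (f g : 'I_n -> R) (c : R) : (forall j, `|f j - g j| <= c) ->
  `|\sum_j f j - \sum_j g j| <= n%:R * c.
Proof.
move=> h; rewrite -sumrB; apply: le_trans (ler_norm_sum _ _ _) _.
apply: (@le_trans _ _ (\sum_(j < n) c)); first exact: ler_sum.
by rewrite sumr_const card_ord mulr_natl.
Qed.

Lemma kern0_le (k : R) : 0 < k -> `|kern k 0| <= 3 * k ^+ 2.
Proof.
move=> k0; rewrite ger0_norm ?kern_ge0//; apply: le_trans (kern_le 0 k0) _.
rewrite sub0r sqrrN expr1n; have k2 : 0 < k ^+ 2 by rewrite exprn_gt0.
by rewrite ler_pdivrMr; snra.
Qed.

Lemma dist4 (q1 q2 q3 q4 q5 b1 b2 b3 b4 : R) : `|q1 - q2| <= b1 -> `|q1 - q4| <= b2 ->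
  `|q4 - q5| <= b3 -> `|q2 - q3| <= b4 -> `|q3 - q5| <= b1 + b2 + b3 + b4.
Proof.
rewrite !ler_norml => /andP[? ?] /andP[? ?] /andP[? ?] /andP[? ?].
by apply/andP; split; slra.
Qed.

(* The zeros of [f] near the real axis are compared with the points [x j] through
   the fourth-order difference of [ln |f|], computed once from the zeros and once
   from the approximation of [ln |f|] off the axis. *)
Lemma scalar_comparison_aux (rho k eta Q : R) n (x : 'I_n -> R) f (Lam : R) :
  (0 < n)%N -> 0 < rho -> 60 * rho < 1 -> 0 < k -> 64 * k <= rho -> 0 <= eta ->
  2 * eta <= k -> 0 <= Q ->
  Lam = 2 * ln 2 + ln (1 + Q) - ln (rho / 8) + 1 -> eta <= 1 ->
  (forall u, nrm (u - 1) < 1 / 4 -> hol f u) ->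
  (forall u, nrm (u - 1) < 1 / 4 -> nrm (f u) <= (1 + Q) ^+ n) ->
  (forall u, nrm (u - 1) < 1 / 4 -> k <= `|complex.Im u| -> f u != 0 /\
    `|ln (nrm (f u)) - \sum_j (ln (nrm (u - (x j)%:C%C)) - ln (nrm u))| <= n%:R * eta) ->
  (forall u, nrm (u - 1) < 1 / 4 -> f u = 0 -> `|complex.Im u| <= eta) ->
  exists zs g, [/\ factorized f (base_point (rho / 8)) (1 / 5) (2 * rho) zs g,
    forall u, nrm (u - base_point (rho / 8)) < 2 * rho -> g u != 0 &
    `|\sum_(w <- zs) kcut k rho (complex.Re w) - \sum_j kcut k rho (x j)| <=
    n%:R * (k ^+ 2 * (3 + 40 * Lam / (rho / 16) ^+ 2 + 3 * (1 + 2 * Lam) / rho ^+ 2) +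
      eta * (4 + 80 * Lam / k))].
Proof.
move=> n0 r0 r60 k0 k64 eta0 etak Q0 LamE eta1 hf fM fclose floc.
have n1 : 1 <= n%:R :> R by rewrite ler1n.
have etak2 : eta <= k / 2 by slra.
set p := base_point (rho / 8).
have p1 : nrm (p - 1) <= rho / 8.
  apply: le_trans (nrm_le_ReIm _) _; rewrite /p /= subrr normr0 add0r subr0.
  by rewrite ger0_norm//; slra.
have ball (u : R[i]) : nrm (u - p) < 1 / 5 -> nrm (u - 1) < 1 / 4.
  move=> up; have := nrmB_tri u p 1; slra.
have [fp0 fpc] : f p != 0 /\ `|ln (nrm (f p)) -
    \sum_j (ln (nrm (p - (x j)%:C%C)) - ln (nrm p))| <= n%:R * eta.
  apply: fclose; first by slra.
  by rewrite /p /= ger0_norm; slra.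
have np0 : 0 < nrm (f p) by rewrite nrm_gt0.
(* Here [|p - x j|] is at least the height [rho / 8] of [p], and [|p| <= 2]; the final 1 absorbs
   [eta]. *)
have lowp : n%:R * (ln (rho / 8) - ln 2 - 1) <= ln (nrm (f p)).
  have : n%:R * (ln (rho / 8) - ln 2) <= \sum_j (ln (nrm (p - (x j)%:C%C)) - ln (nrm p)).
    have -> : n%:R * (ln (rho / 8) - ln 2) = \sum_(j < n) (ln (rho / 8) - ln 2).
      by rewrite sumr_const card_ord mulr_natl.
    apply: ler_sum => j _; apply: lerB.
      rewrite ler_ln ?posrE; first last.
      - rewrite nrm_gt0 -nrm_eq0; apply/eqP => h.
        by have := Im_le_nrm (p - (x j)%:C%C); rewrite h /p /= subr0 ger0_norm; slra.
      - slra.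
      by apply: le_trans (Im_le_nrm _); rewrite /p /= subr0 ger0_norm; slra.
    have np : 0 < nrm p.
      rewrite nrm_gt0 -nrm_eq0; apply/eqP => h.
      by have := Re_le_nrm p; rewrite h /p /= ger0_norm; slra.
    rewrite ler_ln ?posrE//.
    by have := nrmD (p - 1) 1; rewrite subrK nrm1; slra.
  move: fpc; rewrite ler_norml => /andP[h1 h2] h3.
  have h4 : n%:R * eta <= n%:R :> R by rewrite ler_piMr//; slra.
  slra.
have M0 : 0 < (1 + Q) ^+ n by rewrite exprn_gt0//; slra.
have rr : 5 * (2 * rho) < 1 / 5 by slra.
have r2 : 0 < 2 * rho by slra.
have fM' z : nrm (z - p) = 5 * (2 * rho) -> nrm (f z) <= (1 + Q) ^+ n.
  by move=> zp; apply: fM; apply: ball; rewrite zp.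
have ap : nrm (1 - p) <= 2 * rho / 16 by rewrite nrmBC; slra.
have hfp z : nrm (z - p) < 1 / 5 -> hol f z by move=> /ball; exact: hf.
have [zs [g [fac g0 cnt dif]]] := zeros_diff4 hfp r2 rr fM' fp0 ap.
exists zs, g; split=> //.
have lnQ : ln ((1 + Q) ^+ n) = n%:R * ln (1 + Q) by rewrite lnXn ?mulr_natl//; slra.
have ln2 : 0 <= ln 2 :> R by rewrite ln_ge0// ler1n.
(* [Lam] collects the contributions per point of the upper bound on [f] and of [lowp]; since
   [0 < n], the extra [ln 2] may be counted [n] times. *)
have lnM' : ln (2 * (1 + Q) ^+ n / nrm (f p)) <= n%:R * Lam.
  rewrite ln_div ?posrE ?mulr_gt0// lnM ?posrE// lnQ LamE.
  have := ler_peMl ln2 n1; slra.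
have lnq : 0 <= ln (1 + Q) by rewrite ln_ge0//; slra.
have lnb : ln (rho / 8) <= 0 by rewrite ln_le0//; slra.
have Lam1 : 0 <= Lam by rewrite LamE; slra.
have size_le : (size zs)%:R <= n%:R * (2 * Lam).
  have h1 : ln (4 ^+ size zs) <= n%:R * Lam.
    apply: le_trans lnM'; rewrite ler_ln ?posrE ?exprn_gt0 ?divr_gt0 ?mulr_gt0//.
    apply: le_trans cnt _; rewrite ler_wpM2r ?invr_ge0 ?(ltW np0)//; slra.
  have h2 : 3 / 4 <= ln 4 :> R.
    by have := @ln_sub_ge R 4 1; rewrite ln1 subr0 => h; apply: le_trans (h _ _); slra.
  rewrite lnXn// -[ln 4 *+ _]mulr_natl in h1.
  have s0 : 0 <= (size zs)%:R :> R by [].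
  have := ler_wpM2l s0 h2; slra.
pose h : R[i] := (0 +i* k)%C.
have nh : nrm h = k.
  apply/le_anti/andP; split.
    by apply: le_trans (nrm_le_ReIm _) _; rewrite /h /= normr0 add0r ger0_norm// ltW.
  by apply: le_trans (Im_le_nrm _); rewrite /h /= ger0_norm// ltW.
have pt (s : R) z : z = (1 +i* (s * k))%C -> 1 <= `|s| -> `|s| <= 2 -> f z != 0 /\
    `|ln (nrm (f z)) - \sum_j (ln (nrm (z - (x j)%:C%C)) - ln (nrm z))| <= n%:R * eta.
  move=> -> s1 s2; have sk : `|s * k| = `|s| * k by rewrite normrM (gtr0_norm k0).
  apply: fclose.
    apply: le_lt_trans (nrm_le_ReIm _) _; rewrite /= subrr normr0 add0r subr0 sk.
    have := normr_ge0 s; snra.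
  by rewrite /= sk; snra.
have a2 : (1 : R) <= `|2| /\ `|2| <= (2 : R) by rewrite normr_nat lexx ler1n.
have a1 : (1 : R) <= `|1| /\ `|1| <= (2 : R) by rewrite normr1 lexx ler1n.
have [f1 c1] : f (1 + 2 * h) != 0 /\ `|ln (nrm (f (1 + 2 * h))) -
    \sum_j (ln (nrm (1 + 2 * h - (x j)%:C%C)) - ln (nrm (1 + 2 * h)))| <= n%:R * eta.
  by apply: (pt 2); [apply: complex_eq => /=; ring|case: a2..].
have [f2 c2] : f (1 - 2 * h) != 0 /\ `|ln (nrm (f (1 - 2 * h))) -
    \sum_j (ln (nrm (1 - 2 * h - (x j)%:C%C)) - ln (nrm (1 - 2 * h)))| <= n%:R * eta.
  by apply: (pt (- 2)); [apply: complex_eq => /=; ring|rewrite normrN; case: a2..].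
have [f3 c3] : f (1 + h) != 0 /\ `|ln (nrm (f (1 + h))) -
    \sum_j (ln (nrm (1 + h - (x j)%:C%C)) - ln (nrm (1 + h)))| <= n%:R * eta.
  by apply: (pt 1); [apply: complex_eq => /=; ring|case: a1..].
have [f4 c4] : f (1 - h) != 0 /\ `|ln (nrm (f (1 - h))) -
    \sum_j (ln (nrm (1 - h - (x j)%:C%C)) - ln (nrm (1 - h)))| <= n%:R * eta.
  by apply: (pt (- 1)); [apply: complex_eq => /=; ring|rewrite normrN; case: a1..].
have h128 : 128 * nrm h <= 2 * rho by rewrite nh; slra.
have e1 := dif h h128 f1 f2 f3 f4.
have e2 := diff4_dist (phi := fun z => ln (nrm (f z)))
  (psi := fun z => \sum_j (ln (nrm (z - (x j)%:C%C)) - ln (nrm z))) c1 c2 c3 c4.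
(* The normalising terms [ln |z|] produce [kern k 0], which is [O(k ^+ 2)]. *)
have e3 : diff4 (fun z => \sum_j (ln (nrm (z - (x j)%:C%C)) - ln (nrm z))) 1 h =
    \sum_j (kern k (x j) - kern k 0).
  rewrite diff4_sum; apply: eq_bigr => j _.
  rewrite -(diff4_kern_real (x j) k0) -(diff4_kern_real 0 k0) /diff4 -/h !subr0.
  ring.
have k2 : 0 < k ^+ 2 by rewrite exprn_gt0.
have rho2 : 0 < rho ^+ 2 by rewrite exprn_gt0.
have e4 : `|\sum_j (kern k (x j) - kern k 0) - \sum_j kcut k rho (x j)| <=
    n%:R * (3 * k ^+ 2 + 3 * k ^+ 2 / rho ^+ 2).
  apply: sum_dist_ord => j.
  have -> : kern k (x j) - kern k 0 - kcut k rho (x j) =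
      - kern k 0 - (kcut k rho (x j) - kern k (x j)) by ring.
  apply: le_trans (ler_normB _ _) _; rewrite normrN.
  by apply: lerD; [exact: kern0_le|exact: kcut_kern].
have zin z : z \in zs -> nrm (z - p) < 2 * rho by case: fac => _ h2 _; exact: h2.
have zim z : z \in zs -> `|complex.Im z| <= eta.
  move=> zz; have zp := zin z zz; have zp5 : nrm (z - p) < 1 / 5 by slra.
  apply: floc; first exact: ball.
  case: fac => _ _ /(_ z zp5) ->; rewrite (big_rem z)//= subrr mul0r mul0r//.
have e5 : `|\sum_(w <- zs) diff4 (fun z => ln (nrm (z - w))) 1 h -
    \sum_(w <- zs) kcut k rho (complex.Re w)| <=
    (size zs)%:R * (40 * eta / k + 3 * k ^+ 2 / rho ^+ 2).
  apply: (sum_dist_seq (P := fun w => `|complex.Im w| <= eta)) => [w wi|]; last first.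
    by apply/allP => w /zim wi; apply/asboolP.
  have wk : `|complex.Im w| <= k / 2 := le_trans wi etak2.
  have := diff4_kern k0 wk; rewrite -/h => q1.
  have q2 : 40 * `|complex.Im w| / k <= 40 * eta / k.
    by apply: ler_wpM2r; [rewrite invr_ge0 ltW|apply: ler_wpM2l].
  apply: le_trans (ler_distD (kern k (complex.Re w)) _ _) _.
  apply: lerD; first exact: le_trans q1 q2.
  by rewrite distrC; exact: kcut_kern.
have c0 : 0 <= 40 * eta / k + 3 * k ^+ 2 / rho ^+ 2.
  apply: addr_ge0; apply: divr_ge0; [by rewrite mulr_ge0|exact: ltW| |exact: ltW].
  by rewrite mulr_ge0 ?(ltW k2).
have e5' := le_trans e5 (ler_wpM2r c0 size_le).
have e1' : 40 * ln (2 * (1 + Q) ^+ n / nrm (f p)) / (2 * rho / 32) ^+ 2 * nrm h ^+ 2 <=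
    n%:R * (k ^+ 2 * (40 * Lam / (rho / 16) ^+ 2)).
  have r16 : 2 * rho / 32 = rho / 16 by field.
  rewrite nh r16.
  have -> : n%:R * (k ^+ 2 * (40 * Lam / (rho / 16) ^+ 2)) =
      40 * (n%:R * Lam) / (rho / 16) ^+ 2 * k ^+ 2 by ring.
  apply: ler_wpM2r; first exact: ltW.
  apply: ler_wpM2r; first by rewrite invr_ge0 sqr_ge0.
  by apply: ler_wpM2l lnM'.
have {}e1 := le_trans e1 e1'.
rewrite e3 in e2.
have -> : n%:R * (k ^+ 2 * (3 + 40 * Lam / (rho / 16) ^+ 2 + 3 * (1 + 2 * Lam) / rho ^+ 2) +
      eta * (4 + 80 * Lam / k)) =
   n%:R * (k ^+ 2 * (40 * Lam / (rho / 16) ^+ 2)) + 4 * (n%:R * eta) +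
   n%:R * (3 * k ^+ 2 + 3 * k ^+ 2 / rho ^+ 2) +
   n%:R * (2 * Lam) * (40 * eta / k + 3 * k ^+ 2 / rho ^+ 2) by ring.
exact: (dist4 e1 e2 e4 e5').
Qed.

(** [k] is fixed first, so that the quadratic terms fall below [eps * k / 2]; then [eta], which is
    divided by [k] in the error, is chosen in terms of [k]. Neither depends on [n], [x] or [f]. *)
Lemma scalar_comparison (rho eps Q : R) : 0 < rho -> 60 * rho < 1 -> 0 < eps -> 0 <= Q ->
  exists k eta, [/\ 0 < k, 64 * k <= rho, 0 < eta <= k / 2 &
  forall n (x : 'I_n -> R) f, (0 < n)%N ->
  (forall u, nrm (u - 1) < 1 / 4 -> hol f u) ->
  (forall u, nrm (u - 1) < 1 / 4 -> nrm (f u) <= (1 + Q) ^+ n) ->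
  (forall u, nrm (u - 1) < 1 / 4 -> k <= `|complex.Im u| -> f u != 0 /\
    `|ln (nrm (f u)) - \sum_j (ln (nrm (u - (x j)%:C%C)) - ln (nrm u))| <= n%:R * eta) ->
  (forall u, nrm (u - 1) < 1 / 4 -> f u = 0 -> `|complex.Im u| <= eta) ->
  exists zs g, [/\ factorized f (base_point (rho / 8)) (1 / 5) (2 * rho) zs g,
    forall u, nrm (u - base_point (rho / 8)) < 2 * rho -> g u != 0 &
    `|\sum_(w <- zs) kcut k rho (complex.Re w) - \sum_j kcut k rho (x j)| <=
    eps * k * n%:R]].
Proof.
move=> r0 r60 e0 Q0.
pose Lam := 2 * ln 2 + ln (1 + Q) - ln (rho / 8) + 1.
have Lam0 : 0 <= Lam.
  have ln2 : 0 <= ln 2 :> R by rewrite ln_ge0// ler1n.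
  have lnq : 0 <= ln (1 + Q) by rewrite ln_ge0//; slra.
  have lnb : ln (rho / 8) <= 0 by rewrite ln_le0//; slra.
  by rewrite /Lam; slra.
have rho2 : 0 < rho ^+ 2 by rewrite exprn_gt0.
pose C0 := 3 + 40 * Lam / (rho / 16) ^+ 2 + 3 * (1 + 2 * Lam) / rho ^+ 2.
have C00 : 0 < C0.
  have h1 : 0 <= 40 * Lam / (rho / 16) ^+ 2 by rewrite divr_ge0 ?sqr_ge0// mulr_ge0.
  have h2 : 0 <= 3 * (1 + 2 * Lam) / rho ^+ 2 by rewrite divr_ge0 ?(ltW rho2)//; slra.
  by rewrite /C0; slra.
have [k [k0 k64 kC]] : exists k, [/\ 0 < k, 64 * k <= rho & k * C0 <= eps / 2].
  exists (Num.min (rho / 64) (eps / 2 / C0)); split.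
  - by rewrite lt_min !divr_gt0.
  - have : Num.min (rho / 64) (eps / 2 / C0) <= rho / 64 by rewrite ge_min lexx.
    slra.
  - by rewrite -ler_pdivlMr// ge_min lexx orbT.
have D0 : 0 < 4 + 80 * Lam / k.
  have h : 0 <= 80 * Lam / k by rewrite divr_ge0 ?(ltW k0)// mulr_ge0.
  slra.
have [eta [eta0 eta1 etak etaD]] : exists eta, [/\ 0 < eta, eta <= 1, 2 * eta <= k &
    eta * (4 + 80 * Lam / k) <= eps * k / 2].
  exists (Num.min (k / 2) (eps * k / 2 / (4 + 80 * Lam / k))).
  have m1 : Num.min (k / 2) (eps * k / 2 / (4 + 80 * Lam / k)) <= k / 2 by rewrite ge_min lexx.
  split; [|slra|slra|].
  - by rewrite lt_min !divr_gt0// mulr_gt0.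
  - by rewrite -ler_pdivlMr// ge_min lexx orbT.
exists k, eta; split=> //; first by rewrite eta0/=; slra.
move=> n x f n0 hf fM fc fl.
have [zs [g [h1 h2 h3]]] := scalar_comparison_aux n0 r0 r60 k0 k64 (ltW eta0) etak Q0
  erefl eta1 hf fM fc fl.
exists zs, g; split=> //; apply: le_trans h3 _; rewrite -/Lam -/C0 mulrC.
rewrite ler_wpM2r//; have : k ^+ 2 * C0 <= eps * k / 2.
  by have := ler_wpM2l (ltW k0) kC; rewrite mulrA -expr2; slra.
slra.
Qed.

End ScalarComparison.

(** * Comparison in a spectral window *)

Lemma difference_quotient_error (K : fieldType) (V : lmodType K) (s : K) (x y d : V) :
  s != 0 -> d - (s^-1 *: x + - s^-1 *: y) = - (s^-1 *: (x - y - s *: d)).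
Proof.
by move=> s0; rewrite !scalerBr scalerA mulVf// scale1r opprB scaleNr.
Qed.

Section WindowComparison.
Context {R : realType} {H : completeNormedModType R[i]}.
Variable dot : {dot H for (@Num.conj R[i])}.
Hypothesis hn : hilbert_norm dot.
Variables (D : set R[i]) (A : R[i] -> boundedOp H) (P0 : boundedOp H).
Hypotheses (oD : open D) (D0 : D 0) (hA : holomorphic_on D A).
Hypotheses (cA : forall z, D z -> fapprox hn (A z)) (sA : selfadjoint_op dot (A 0)).
Hypotheses (hP0 : orth_proj dot (op_ker (A 0)) P0).
Hypothesis invA : op_invertible (idop H - compop (derive1 A 0) P0).
Implicit Types (z w u v : R[i]) (t k rho eps theta : R).

Local Notation F := (char_fun A).
Local Notation B := (quot A 0).

Lemma red_det_small n (e : 'I_n -> H) (W : boundedOp H) (d : R) : orthonormal_fam dot e ->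
  0 <= d -> d <= 1 / 2 -> nrm W <= d ->
  (1 - d) ^+ n <= nrm (\det (redmx dot (e := e) W)) <= (1 + d) ^+ n.
Proof.
move=> he d0 d2 nW.
have l0 : 0 <= 1 - d by slra.
have u0 : 0 <= 1 + d by slra.
apply: (@red_det_bounds _ _ dot hn n e he W (1 - d) (1 + d) l0 u0) => x _.
have h3 : nrm (oproj hn e (W x)) <= d * nrm x.
  apply: le_trans (nrm_proj hn he _) _; apply: le_trans (nrm_op _ _) _.
  by rewrite ler_wpM2r ?nrm_ge0.
have := nrmBD x (oproj hn e (W x)); have := nrmB x (oproj hn e (W x)).
move: (nrm (x - _)) (nrm (oproj hn e _)) (nrm x) h3 => p q r h3 h4 h5.
by apply/andP; split; slra.
Qed.

Lemma quot0E : B 0 = derive1 A 0.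
Proof. by rewrite /quot eqxx. Qed.

Lemma ball_D : exists2 r : R, 0 < r & forall z, nrm z < r -> [/\ D z, hol A z & hol B z].
Proof.
have [r r0 hr] : exists2 d : R, 0 < d & forall y, nrm (y - 0) < d -> D y.
  by apply/nbhs_nrmP; exact: open_nbhs_nbhs.
have hol_A z : nrm (z - 0) < r -> hol A z.
  by move=> /hr Dz; exists (derive1 A z); apply: derivable_hd; exact: hA.
exists r => // z; rewrite -[z]subr0 => zr; have Dz := hr _ zr; rewrite subr0 in Dz zr *.
split=> //; first by apply: hol_A; rewrite subr0.
by apply: (quot_hol (@seqcomplete_op R H) hol_A); rewrite subr0.
Qed.

Lemma char_funE z : z != 0 -> F z = idop H - z^-1 *: A 0 - B z.
Proof.
move=> z0; rewrite /char_fun {1}(quotE A 0 z) subr0 scalerDr scalerA mulVf// scale1r.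
by rewrite opprD addrA.
Qed.

Lemma cB0 : ccont B 0.
Proof.
have [r r0 hr] := ball_D; apply: hol_ccont.
by have [] := hr 0; rewrite ?nrm0.
Qed.

(** [A'(0)] is a norm limit of the difference quotients [(A(s) - A(0)) / s], which are compact. *)
Lemma fB0 : fapprox hn (B 0).
Proof.
rewrite quot0E; apply: fapprox_lincomb => e e0.
have [r r0 hr] := ball_D; have hd0 := derivable_hd (hA D0).
have [d d0 hd'] := hd0 e e0.
have [s [s0 sd sr]] : exists s : R, [/\ 0 < s, s < d & s < r].
  exists (Num.min d r / 2); have m0 : 0 < Num.min d r by rewrite lt_min d0.
  have m1 : Num.min d r <= d by rewrite ge_min lexx.
  have m2 : Num.min d r <= r by rewrite ge_min lexx orbT.
  split; slra.
have ns : nrm (s%:C)%C = s by rewrite nrmR gtr0_norm.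
have sC : (s%:C)%C != 0 :> R[i] by rewrite -nrm_gt0 ns.
exists ((s%:C)%C)^-1, (- ((s%:C)%C)^-1), (A (s%:C)%C), (A 0); split.
- by apply: cA; have [] := hr (s%:C)%C; rewrite ?ns.
- exact: cA.
- move=> x; have := hd' (s%:C)%C; rewrite ns => /(_ sd) h.
  have h2 := le_trans (nrm_op (A (0 + (s%:C)%C) - A 0 - (s%:C)%C *: derive1 A 0) x)
    (ler_wpM2r (nrm_ge0 x) h).
  rewrite add0r in h2.
  have -> : derive1 A 0 x - (((s%:C)%C)^-1 *: A (s%:C)%C x + - ((s%:C)%C)^-1 *: A 0 x) =
      - (((s%:C)%C)^-1 *: ((A (s%:C)%C - A 0 - (s%:C)%C *: derive1 A 0) x)).
    rewrite -[X in _ = - (_ *: X)]/(A (s%:C)%C x - A 0 x - (s%:C)%C *: derive1 A 0 x).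
    exact: difference_quotient_error.
  rewrite nrmN nrmZ nrmV ns mulrC ler_pdivrMr//.
  by apply: le_trans h2 _; rewrite mulrAC.
Qed.

Lemma invB0 : op_invertible (idop H - compop (B 0) P0).
Proof. by rewrite quot0E. Qed.

(** Selfadjointness bounds the resolvent of [A 0] itself by the distance to the real axis. *)
Lemma pair_axis (d : R) z : 0 < d -> z != 0 -> d * nrm z <= `|complex.Im z| ->
  exists Rz, resolvent_pair (A 0) d^-1 z (A 0) Rz.
Proof.
move=> d0 z0 hz; have nz : 0 < nrm z by rewrite nrm_gt0.
have iz : 0 < `|complex.Im z| by apply: lt_le_trans hz; rewrite mulr_gt0.
have [S hS nS] := resolvent_of_lower (cA D0) z0 iz (fun v : H => sa_imag hn z v sA).
exists S; split=> //.
  by rewrite subrr nrm0 mulr_ge0 ?invr_ge0 ?(ltW d0) ?(ltW nz).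
by apply: le_trans nS _; rewrite ler_pdivrMr// mulrC -ler_pdivrMr ?invr_gt0// invrK mulrC.
Qed.

Lemma resolvent_pair_mono (C C' : R) z T Rz : C <= C' -> resolvent_pair (A 0) C z T Rz ->
  resolvent_pair (A 0) C' z T Rz.
Proof.
move=> CC [z0 kT dT inv nR]; split=> //; last exact: le_trans nR CC.
by apply: le_trans dT _; rewrite ler_wpM2r ?nrm_ge0.
Qed.

Lemma off_axis (d : R) : 0 < d -> exists2 t0, 0 < t0 & forall z, z != 0 -> nrm z < t0 ->
  d * nrm z <= `|complex.Im z| -> op_invertible (F z).
Proof.
move=> d0; have [K K0 hK] := resolvent_perturbed sA hP0 cB0 fB0 invB0.
have C0 : 0 <= d^-1 by rewrite invr_ge0 ltW.
have [t0 t00 ht] := hK _ C0; exists t0 => // z z0 zt hz.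
have [Rz hR] := pair_axis d0 z0 hz.
have [Y hY _] := ht _ _ _ hR zt; have [_ _ _ inv _] := hR.
exists (compop Y Rz); rewrite char_funE//; exact: perturbed_inverse inv hY.
Qed.

(** The window has midpoint [5 t / 4] and half-width [3 t / 4], and [z] is within [t / 2] of the
    midpoint, which leaves a gap [t / 4]; with [|z| < 5 t / 4] the resolvent is bounded by 5. *)
Lemma pair_window t z n (e : 'I_n -> H) lam : 0 < t ->
  eigfam dot (A 0) (t / 2) (2 * t) e lam -> nrm (z - (t%:C)%C) < t / 4 ->
  exists Rz, resolvent_pair (A 0) 5 z (cutop hn (A 0) (e := e)) Rz.
Proof.
move=> t0 hE zt; have nt : nrm (t%:C)%C = t by rewrite nrmR gtr0_norm.
have t20 : 0 < t / 2 by slra.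
have zlow : 3 * t / 4 < nrm z.
  have := nrmBD (t%:C)%C ((t%:C)%C - z); rewrite nt subKr nrmBC; slra.
have zup : nrm z < 5 * t / 4.
  have := nrmD (z - (t%:C)%C) (t%:C)%C; rewrite nt subrK; slra.
have nz : 0 < nrm z by slra.
have z0 : z != 0 by rewrite -nrm_gt0.
have t4 : 0 < t / 4 by slra.
have low (v : H) : t / 4 * nrm v <= nrm (cutop hn (A 0) (e := e) v - z *: v).
  have hcut := cutop_lower sA (cA D0) t20 hE v nz.
  apply: (le_trans _ hcut).
  rewrite ler_wpM2r ?nrm_ge0//.
  have := nrmB_tri z (t%:C)%C (((t / 2 + 2 * t) / 2)%:C)%C.
  have : nrm ((t%:C)%C - (((t / 2 + 2 * t) / 2)%:C)%C) = t / 4.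
    by rewrite -rmorphB/= nrmR ler0_norm; slra.
  move=> ->; slra.
have [S hS nS] := resolvent_of_lower (cutop_fapprox (cA D0) hE) z0 t4 low.
exists S; split=> //.
- move=> x Ax; rewrite cutopE opB Ax -(eigfam_comm hn sA hE) Ax.
  by rewrite op0 subr0.
- apply: nrm_op_le; first by rewrite mulr_ge0// ltW.
  move=> x; rewrite -[X in nrm X]/(A 0 x - (A 0 x - A 0 (oproj hn e x))) subKr.
  have b0 : 0 <= 2 * t by slra.
  apply: le_trans (eigfam_part hn t20 hE x b0) _.
  by rewrite ler_wpM2r ?nrm_ge0//; slra.
- by apply: le_trans nS _; rewrite ler_pdivrMr//; slra.
Qed.

Lemma prod_sub_count (s : seq R[i]) u (y : R[i]) : \prod_(v <- s) (y - v) =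
  (y - u) ^+ count_mem u s * \prod_(v <- s | v != u) (y - v).
Proof.
elim: s => [|v s IH]; first by rewrite !big_nil mulr1.
rewrite !big_cons /= IH; have [->|vu] /= := eqVneq v u; first by rewrite exprS mulrA.
by rewrite add0n mulrCA.
Qed.

(** The factors other than [w / t] do not vanish near [w]; together with [g] and powers of [t] they
    form the nonvanishing cofactor [q]. *)
Lemma mult_factorized w (r t : R) n (e : 'I_n -> H) L G Gi (zs : seq R[i]) g :
  0 < r -> 0 < t -> (forall z, nrm (z - w) < r -> D z /\ z != 0) ->
  reduction hn F w r e L G Gi ->
  (forall z, nrm (z - w) < r -> hol g (z / (t%:C)%C)) -> g (w / (t%:C)%C) != 0 ->
  (forall z, nrm (z - w) < r -> \det (redmx dot (e := e) (L z)) =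
     (\prod_(v <- zs) (z / (t%:C)%C - v)) * g (z / (t%:C)%C)) ->
  char_mult dot D A w = (count_mem (w / (t%:C)%C) zs)%:Z.
Proof.
move=> r0 t0 hD [he hred] hg gw fE; set u := w / (t%:C)%C in gw *; set m := count_mem u zs.
have tC : (t%:C)%C != 0 :> R[i] by rewrite -nrm_gt0 nrmR gtr0_norm.
pose q z : R[i] := (t%:C)%C^-1 ^+ m * \prod_(v <- zs | v != u) (z / (t%:C)%C - v) * g (z / (t%:C)%C).
have hzt z : hol (fun y => y / (t%:C)%C) z by apply: holM; [exact: hol_id|exact: hol_cst].
have hq z : nrm (z - w) < r -> hol q z.
  move=> zr; apply: holM; last first.
    by apply: (hol_comp (f := g) (g := fun y => y / (t%:C)%C)); [exact: hzt|exact: hg].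
  apply: holM; first exact: hol_cst.
  by apply: hol_prod => v _; apply: holB; [exact: hzt|exact: hol_cst].
have qw : q w != 0.
  rewrite /q -/u !mulf_neq0// ?expf_neq0 ?invr_neq0//.
  rewrite prodf_seq_neq0; apply/allP => v _; apply/implyP => vu.
  by rewrite subr_eq0 eq_sym.
have [d d0 hd'] : exists2 d : R, 0 < d & forall z, nrm (z - w) < d -> q z != 0.
  have cq : ccont q w by apply: hol_ccont; apply: hq; rewrite subrr nrm0.
  have nq : 0 < nrm (q w) by rewrite nrm_gt0.
  have [d d0 hd'] := cq _ nq; exists d => // z /hd'; apply: contraTneq => ->.
  by rewrite sub0r nrmN ltxx.
have [s [s0 sr sd]] : exists s : R, [/\ 0 < s, s <= r & s <= d].
  by exists (Num.min r d); rewrite lt_min r0 !ge_min !lexx orbT.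
apply: (@char_mult_reduction _ _ _ hn D A oD hA w s n e L G Gi q m s0).
- by move=> z zs'; apply: hD; exact: lt_le_trans zs' sr.
- by split=> // z zs'; apply: hred; exact: lt_le_trans zs' sr.
- move=> z zs'; split; first by apply: hq; exact: lt_le_trans zs' sr.
  by apply: hd'; exact: lt_le_trans zs' sd.
- move=> z zs'; rewrite fE; last exact: lt_le_trans zs' sr.
  rewrite (prod_sub_count zs u) -/m /q.
  have -> : z / (t%:C)%C - u = (z - w) * (t%:C)%C^-1 by rewrite mulrBl.
  by rewrite exprMn !mulrA.
Qed.

Lemma ln_prod_ord n (a : 'I_n -> R) : (forall j, 0 < a j) ->
  ln (\prod_j a j) = \sum_j ln (a j).
Proof.
elim: n a => [|n IH] a a0; first by rewrite !big_ord0 ln1.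
by rewrite !big_ord_recl lnM ?posrE ?prodr_gt0// IH.
Qed.

Lemma ln_pow_close n (d e : R) : 0 <= e -> e <= 1 / 2 ->
  (1 - e) ^+ n <= d <= (1 + e) ^+ n -> `|ln d| <= n%:R * (2 * e).
Proof.
move=> e0 e1 /andP[d1 d2]; have l0 : 0 < 1 - e by slra.
have p0 : 0 < (1 - e) ^+ n by rewrite exprn_gt0.
have dp := lt_le_trans p0 d1.
have h1 : ln (1 + e) <= 2 * e by apply: le_trans (le_ln1Dx _) _; slra.
have h2 : - (2 * e) <= ln (1 - e).
  have := ln_sub_ge l0 ltr01; rewrite ln1 subr0; apply: le_trans.
  by rewrite ler_pdivlMr//; snra.
have n0 : 0 <= n%:R :> R by [].
have h3 : ln d <= n%:R * ln (1 + e).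
  rewrite mulr_natl -lnXn; last by slra.
  by rewrite ler_ln ?posrE// exprn_gt0//; slra.
have h4 : n%:R * ln (1 - e) <= ln d.
  by rewrite mulr_natl -lnXn// ler_ln ?posrE.
have := ler_wpM2l n0 h1; have := ler_wpM2l n0 h2; rewrite mulrN => h5 h6.
by rewrite ler_norml; apply/andP; split; slra.
Qed.

Definition winG n (e : 'I_n -> H) z := idop H - z^-1 *: cutop hn (A 0) (e := e) - B z.

(* [Q = 14 K] below: [|V| <= 2 t], [|G^-1| <= 5 K] and [|z| >= 3 t / 4]. *)
Lemma window_reduction : exists2 K : R, 0 < K & exists2 t0 : R, 0 < t0 &
  forall t n (e : 'I_n -> H) lam, 0 < t -> t < t0 ->
  eigfam dot (A 0) (t / 2) (2 * t) e lam ->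
  (forall z, nrm (z - (t%:C)%C) < t / 4 -> [/\ D z, z != 0, nrm z < 2 * t &
     nrm (\det (redmx dot (e := e) (winL (A 0) z (invop (winG e z))))) <= (1 + 14 * K) ^+ n]) /\
  reduction hn F (t%:C)%C (t / 4) e (fun z => winL (A 0) z (invop (winG e z))) (winG e)
    (fun z => invop (winG e z)).
Proof.
have [K K0 hK] := resolvent_perturbed sA hP0 cB0 fB0 invB0.
have [t1 t10 h1] := hK 5 ltac:(by []); have [r r0 hr] := ball_D.
exists K => //; exists (Num.min t1 r / 2); first by rewrite divr_gt0// lt_min t10.
move=> t n e lam t0 tlt hE; have nt : nrm (t%:C)%C = t by rewrite nrmR gtr0_norm.
have m1 : Num.min t1 r <= t1 by rewrite ge_min lexx.
have m2 : Num.min t1 r <= r by rewrite ge_min lexx orbT.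
have t20 : 0 < t / 2 by slra.
have key z : nrm (z - (t%:C)%C) < t / 4 -> [/\ z != 0, 3 * t / 4 < nrm z, nrm z < 2 * t,
    inverse_of (winG e z) (invop (winG e z)) & nrm (invop (winG e z)) <= 5 * K].
  move=> zt; have [Rz hR] := pair_window t0 hE zt.
  have zlow : 3 * t / 4 < nrm z.
    have := nrmBD (t%:C)%C ((t%:C)%C - z); rewrite nt subKr nrmBC; slra.
  have zup : nrm z < 5 * t / 4.
    have := nrmD (z - (t%:C)%C) (t%:C)%C; rewrite nt subrK; slra.
  have zt1 : nrm z < t1 by slra.
  have [Y hY nY] := h1 _ _ _ hR zt1; have [z0 _ _ inv nR] := hR.
  have hG := perturbed_inverse inv hY.
  split=> //; first by slra.
    by apply: invopP; exists (compop Y Rz).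
  rewrite (invopE hG); apply: le_trans (nrm_comp _ _) _.
  by rewrite mulrC; apply: ler_pM; rewrite ?nrm_ge0.
split.
  move=> z zt; have [z0 zlow zup hG nG] := key z zt.
  have zr : nrm z < r by slra.
  have [Dz _ _] := hr z zr; split=> //.
  apply: (window_det_le (b := 2 * t) hn sA t20 hE) => //; [slra|slra|].
  have : 2 * t * nrm (invop (winG e z)) <= 2 * t * (5 * K).
    by apply: ler_wpM2l => //; slra.
  have : 14 * K * (3 * t / 4) <= 14 * K * nrm z by apply: ler_wpM2l; slra.
  have := mulr_gt0 K0 t0; slra.
split; first by case: hE => -[].
move=> z zt; have [z0 zlow zup hG nG] := key z zt.
have zr : nrm z < r by slra.
have [Dz hAz hBz] := hr z zr.
have hzV : hol (fun y : R[i] => y^-1) z by apply: hol_invf => //; exact: hol_id.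
have hGz : hol (winG e) z.
  rewrite /winG; apply: holB; last exact: hBz.
  by apply: holB; [exact: hol_cst|apply: holZ; [exact: hzV|exact: hol_cst]].
split.
- rewrite /winL; apply: holZ; first exact: hzV.
  apply: hol_comp_op; first exact: hol_cst.
  by apply: hol_invop; [exact: hGz|exists (invop (winG e z))].
- exact: hGz.
- exact: (char_fun_hol hA Dz z0).
- exact: hG.
- by rewrite char_funE//; exact: (window_factor sA hE hG).
Qed.

(** At height at least [k] the resolvents of [A 0] and of the cut operator both exist, with constant
    [5 + 2 / k]. Composed with [B z] they have the same limit, so [W] of [window_det_factor] has
    norm at most [d] and its determinant lies between [(1 - d) ^+ n] and [(1 + d) ^+ n]. *)
Lemma window_close k eta : 0 < k -> 0 < eta -> exists2 t0 : R, 0 < t0 &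
  forall t n (e : 'I_n -> H) lam u, 0 < t -> t < t0 ->
  eigfam dot (A 0) (t / 2) (2 * t) e lam ->
  nrm (u - 1) < 1 / 4 -> k <= `|complex.Im u| ->
  let f := \det (redmx dot (e := e)
    (winL (A 0) ((t%:C)%C * u) (invop (winG e ((t%:C)%C * u))))) in
  f != 0 /\ `|ln (nrm f) - \sum_j (ln (nrm (u - ((lam j / t)%:C)%C)) - ln (nrm u))| <=
    n%:R * eta.
Proof.
move=> k0 eta0; have [K K0 hK] := resolvent_perturbed sA hP0 cB0 fB0 invB0.
pose C := 5 + (k / 2)^-1.
have k2 : 0 < (k / 2)^-1 by rewrite invr_gt0; slra.
have C0 : 0 <= C by rewrite /C; slra.
have [t1 t10 h1] := hK _ C0.
pose d := Num.min (eta / 2) (1 / 2).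
have d0 : 0 < d by rewrite lt_min; apply/andP; split; slra.
have d1 : d <= eta / 2 by rewrite ge_min lexx.
have d2 : d <= 1 / 2 by rewrite ge_min lexx orbT.
have dlt : 0 < 1 - d by slra.
have deta : 2 * d <= eta by slra.
have dK : 0 < d / (2 * K) by rewrite divr_gt0//; slra.
have [t2 t20 h2] := resolvent_limit sA hP0 cB0 fB0 C0 dK.
exists (Num.min t1 t2 / 2); first by rewrite divr_gt0// lt_min t10.
move=> t n e lam u t0 tlt hE u1 uk f.
have m1 : Num.min t1 t2 <= t1 by rewrite ge_min lexx.
have m2 : Num.min t1 t2 <= t2 by rewrite ge_min lexx orbT.
have he : orthonormal_fam dot e by case: hE => -[].
have nt : nrm (t%:C)%C = t by rewrite nrmR gtr0_norm.
have tC : (t%:C)%C != 0 :> R[i] by rewrite -nrm_gt0 nt.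
have uup : nrm u < 5 / 4 by have := nrmD (u - 1) 1; rewrite subrK nrm1; slra.
have u0 : u != 0.
  rewrite -nrm_gt0; have := nrmBD (1 : R[i]) (1 - u); rewrite subKr nrm1 nrmBC; slra.
set z := (t%:C)%C * u in f *.
have nz : nrm z = t * nrm u by rewrite nrmM nt.
have z0 : z != 0 by rewrite mulf_neq0.
have zt : nrm (z - (t%:C)%C) < t / 4.
  rewrite /z -[X in _ - X]mulr1 -mulrBr nrmM nt.
  by have := ltr_pM2l t0 (nrm (u - 1)) (1 / 4); rewrite u1; slra.
have zt2 : nrm z < 2 * t by rewrite nz; snra.
have [Rz hR] := pair_window t0 hE zt.
have k20 : 0 < k / 2 by slra.
(* The factor 1/2 allows for [|u| < 2]. *)
have zim : k / 2 * nrm z <= `|complex.Im z|.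
  rewrite /z cImM ReC ImC mul0r addr0 normrM (gtr0_norm t0) -/z nz.
  have : nrm u * k <= 2 * k by apply: ler_wpM2r; slra.
  have := ler_wpM2l (ltW t0) uk; snra.
have [R' hR'] := pair_axis k20 z0 zim.
have {}hR : resolvent_pair (A 0) C z (cutop hn (A 0) (e := e)) Rz.
  by apply: resolvent_pair_mono hR; rewrite /C; slra.
have {}hR' : resolvent_pair (A 0) C z (A 0) R'.
  by apply: resolvent_pair_mono hR'; rewrite /C; slra.
have zt1 : nrm z < t1 by slra.
have zt2' : nrm z < t2 by slra.
have [Y hY nY] := h1 _ _ _ hR zt1.
have b1 := h2 _ _ _ hR zt2'; have b2 := h2 _ _ _ hR' zt2'.
have [_ _ _ inv _] := hR; have [_ _ _ inv' _] := hR'.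
have fE : f = \det (redmx dot (e := e) (compop (R' - Rz) (compop (B z) Y))) *
    \prod_j (1 - ((lam j)%:C)%C / z).
  rewrite /f (invopE (perturbed_inverse inv hY)).
  exact: (window_det_factor sA hE z0 inv inv' hY).
set W := compop (R' - Rz) (compop (B z) Y) in fE.
have nW : nrm W <= d.
  have -> : W = compop (compop R' (B z) - compop Rz (B z)) Y by exact: opext.
  apply: le_trans (nrm_comp _ _) _.
  have : nrm (compop R' (B z) - compop Rz (B z)) <= d / K.
    have -> : compop R' (B z) - compop Rz (B z) = (compop R' (B z) - compop P0 (B 0)) -
        (compop Rz (B z) - compop P0 (B 0)) by rewrite opprB addrA subrK.
    apply: le_trans (nrmB _ _) _; apply: le_trans (lerD b2 b1) _.
    rewrite le_eqVlt; apply/orP; left; apply/eqP; field; rewrite gt_eqF//.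
  move=> h; apply: (@le_trans _ _ (d / K * K)); last by rewrite divfK// gt_eqF.
  by apply: ler_pM; rewrite ?nrm_ge0.
have dW := red_det_small he (ltW d0) d2 nW.
have lW := ln_pow_close (ltW d0) d2 dW.
have W0 : 0 < nrm (\det (redmx dot (e := e) W)).
  by case/andP: dW => h3 _; apply: lt_le_trans h3; rewrite exprn_gt0.
have xE j : 1 - ((lam j)%:C)%C / z = (u - ((lam j / t)%:C)%C) / u.
  rewrite realcM /z (_ : ((t^-1)%:C)%C = ((t%:C)%C)^-1); last exact: fmorphV.
  by field; rewrite u0 tC.
have uj j : u - ((lam j / t)%:C)%C != 0.
  rewrite -nrm_gt0; apply: lt_le_trans (Im_le_nrm _).
  by rewrite cImD cImN ImC subr0; apply: lt_le_trans uk.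
have pj j : 0 < nrm (1 - ((lam j)%:C)%C / z).
  by rewrite xE nrm_gt0 mulf_neq0// invr_neq0.
have pf0 : 0 < \prod_j nrm (1 - ((lam j)%:C)%C / z) by rewrite prodr_gt0.
split.
  by rewrite fE -nrm_gt0 nrmM nrm_prod mulr_gt0.
rewrite fE nrmM nrm_prod lnM ?posrE// ln_prod_ord//.
have -> : \sum_j ln (nrm (1 - ((lam j)%:C)%C / z)) =
    \sum_j (ln (nrm (u - ((lam j / t)%:C)%C)) - ln (nrm u)).
  apply: eq_bigr => j _; rewrite xE nrmM nrmV ln_div ?posrE ?nrm_gt0//.
rewrite addrK; apply: le_trans lW _; exact: ler_wpM2l.
Qed.

End WindowComparison.

Section WindowCount.
Context {R : realType} {H : completeNormedModType R[i]}.
Variable dot : {dot H for (@Num.conj R[i])}.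
Hypothesis hn : hilbert_norm dot.
Variables (D : set R[i]) (A : R[i] -> boundedOp H) (P0 : boundedOp H).
Hypotheses (oD : open D) (D0 : D 0) (hA : holomorphic_on D A).
Hypotheses (cA : forall z, D z -> fapprox hn (A z)) (sA : selfadjoint_op dot (A 0)).
Hypotheses (hP0 : orth_proj dot (op_ker (A 0)) P0).
Hypothesis invA : op_invertible (idop H - compop (derive1 A 0) P0).
Implicit Types (z w u v : R[i]) (t k rho eps theta : R).

Local Notation F := (char_fun A).

Lemma reduction_char_value z c (r : R) n (e : 'I_n -> H) L G Gi :
  reduction hn F c r e L G Gi -> nrm (z - c) < r ->
  op_invertible (F z) <-> \det (redmx dot (e := e) (L z)) != 0.
Proof.
move=> [he hred] zr; have [_ _ _ inv FE] := hred z zr; rewrite FE.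
have h := red_invertible hn he (L z) inv.
exact: h.
Qed.

Lemma factorized_mem f p (R0 r1 : R) zs g u : factorized f p R0 r1 zs g ->
  (forall z, nrm (z - p) < r1 -> g z != 0) -> r1 <= R0 -> nrm (u - p) < r1 ->
  (u \in zs) = (f u == 0 :> R[i]).
Proof.
move=> [_ _ fE] g0 rR up; rewrite fE; last exact: lt_le_trans up rR.
rewrite mulf_eq0 (negbTE (g0 _ up)) orbF.
apply/idP/idP => [uz|]; first by rewrite (big_rem u)//= subrr mul0r.
rewrite -[_ == 0]negbK prodf_seq_neq0 -has_predC => /hasP[v vz] /=.
by rewrite subr_eq0 negbK => /eqP ->.
Qed.

(** Apply [scalar_comparison] in the variable [u = z / t]. The list holds the zeros in a disc of
    radius [2 * rho], while the kernel only sees [|Re u - 1| < rho]; characteristic values of the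
    sector with such a real part are all listed, because [off_axis] forces them close to the real
    axis. *)
Lemma window_comparison theta rho eps : 0 < theta -> 0 < rho -> 60 * rho < 1 -> 0 < eps ->
  exists k t0 : R, [/\ 0 < k, 64 * k <= rho, 0 < t0 &
  forall t n (e : 'I_n -> H) lam, 0 < t -> t < t0 ->
  eigfam dot (A 0) (t / 2) (2 * t) e lam ->
  exists zs : seq R[i], [/\
    forall u, u \in zs -> [/\ char_value D A ((t%:C)%C * u),
      `|complex.Im ((t%:C)%C * u)| <= theta * `|complex.Re ((t%:C)%C * u)| &
      char_mult dot D A ((t%:C)%C * u) = (count_mem u zs)%:Z],
    forall w, char_value D A w -> `|complex.Im w| <= theta * `|complex.Re w| ->
      `|complex.Re w / t - 1| < rho -> w / (t%:C)%C \in zs &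
    `|\sum_(u <- zs) kcut k rho (complex.Re u) - \sum_j kcut k rho (lam j / t)| <=
      eps * k * n%:R]].
Proof.
move=> th0 r0 r60 e0.
have [K K0 [t1 t10 hw]] := window_reduction oD D0 hA cA sA hP0 invA.
have Q0 : 0 <= 14 * K by slra.
have rr4 : rho + rho / 4 < 1 / 4 by slra.
have rr2 : rho + (rho / 4 + rho / 8) < 2 * rho by slra.
have [k [eta [k0 k64 /andP[eta0 etak] hsc]]] := scalar_comparison r0 r60 e0 Q0.
have [t2 t20 hc] := window_close oD D0 hA cA sA hP0 invA k0 eta0.
have [d [d0 d1 d2 d3]] : exists d : R, [/\ 0 < d, d <= eta / 2, d <= theta / 2 & d <= rho / 16].
  exists (Num.min (eta / 2) (Num.min (theta / 2) (rho / 16))).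
  rewrite !lt_min !ge_min !lexx !orbT; split=> //.
  by apply/andP; split; [|apply/andP; split]; slra.
have [t3 t30 ho] := off_axis oD D0 hA cA sA hP0 invA d0.
have [t0 [t00 t01 t02 t03]] : exists t0 : R, [/\ 0 < t0, t0 <= t1, t0 <= t2 & 2 * t0 <= t3].
  exists (Num.min t1 (Num.min t2 (t3 / 2))); split.
  - by rewrite !lt_min t10 t20 divr_gt0.
  - by rewrite ge_min lexx.
  - by rewrite !ge_min lexx orbT.
  - have : Num.min t1 (Num.min t2 (t3 / 2)) <= t3 / 2 by rewrite !ge_min lexx !orbT.
    slra.
(* A point of the sector with real part at most [2 t] has modulus at most [2 t (1 + theta)], which
   must stay below the threshold [t3] of [off_axis]. *)
exists k, (t0 / (1 + theta)); split=> //; first by rewrite divr_gt0//; slra.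
move=> t n e lam tpos; rewrite ltr_pdivlMr; last by slra.
move=> tth hE; have tt0 : t < t0 by have := mulr_gt0 tpos th0; slra.
have tt1 := lt_le_trans tt0 t01; have tt2 := lt_le_trans tt0 t02.
have [hball hred] := hw t n e lam tpos tt1 hE.
have nt : nrm (t%:C)%C = t by rewrite nrmR gtr0_norm.
have tC : (t%:C)%C != 0 :> R[i] by rewrite -nrm_gt0 nt.
set L := fun z => winL (A 0) z (invop (winG hn A e z)) in hred.
pose f u : R[i] := \det (redmx dot (e := e) (L ((t%:C)%C * u))).
have sc u : nrm (u - 1) < 1 / 4 -> nrm ((t%:C)%C * u - (t%:C)%C) < t / 4.
  move=> u1; rewrite -[X in _ - X]mulr1 -mulrBr nrmM nt.
  by have := ltr_pM2l tpos (nrm (u - 1)) (1 / 4); rewrite u1; slra.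
have scv u : nrm (u - 1) < 1 / 4 -> (f u == 0) <-> ~ op_invertible (F ((t%:C)%C * u)).
  move=> /sc u1; have := reduction_char_value hred u1; rewrite -/(f u) => h.
  by split=> [/eqP fu /h|nF]; [rewrite fu eqxx|apply/negPn/negP => /h].
(* the zeros of [f] are almost real *)
have floc u : nrm (u - 1) < 1 / 4 -> f u = 0 -> `|complex.Im u| <= d * nrm u.
  move=> u1 fu; have [Dz z0 zt _] := hball _ (sc u u1).
  rewrite leNgt; apply/negP => lt; have /scv := u1; rewrite fu eqxx => -[/(_ isT) nF _].
  apply: nF; apply: ho => //; first by apply: lt_le_trans zt _; slra.
  rewrite cImM ReC ImC mul0r addr0 normrM nrmM nt (gtr0_norm tpos) mulrCA.
  by rewrite ler_pM2l// ltW.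
have u54 u : nrm (u - 1) < 1 / 4 -> nrm u < 5 / 4 /\ 3 / 4 < complex.Re u.
  move=> u1; split; first by have := nrmD (u - 1) 1; rewrite subrK nrm1; slra.
  by have := Re_le_nrm (u - 1); rewrite cReD cReN ler_norml /= => /andP[]; slra.
have fIm u : nrm (u - 1) < 1 / 4 -> f u = 0 -> `|complex.Im u| <= eta.
  move=> u1 fu; apply: le_trans (floc u u1 fu) _; have [h1 _] := u54 u u1.
  by have := nrm_ge0 u; snra.
have fsec u : nrm (u - 1) < 1 / 4 -> f u = 0 ->
    `|complex.Im ((t%:C)%C * u)| <= theta * `|complex.Re ((t%:C)%C * u)|.
  move=> u1 fu; have [h1 h2] := u54 u u1; have h3 := floc u u1 fu.
  rewrite cImM cReM ReC ImC !mul0r addr0 subr0 !normrM (gtr0_norm tpos) mulrCA.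
  rewrite ler_pM2l// (ger0_norm (x := complex.Re u)); last by slra.
  by apply: le_trans h3 _; have := nrm_ge0 u; snra.
have capt w : char_value D A w -> `|complex.Im w| <= theta * `|complex.Re w| ->
    `|complex.Re w / t - 1| < rho ->
    nrm (w / (t%:C)%C - 1) < 1 / 4 /\ nrm (w / (t%:C)%C - base_point (rho / 8)) < 2 * rho.
  move=> [Dw w0 nF] ws wr; set u := w / (t%:C)%C.
  have wE : w = (t%:C)%C * u by rewrite mulrC divfK.
  have Re_u : complex.Re w = t * complex.Re u.
    by rewrite {1}wE cReM ReC ImC mul0r subr0.
  have Im_u : complex.Im w = t * complex.Im u.
    by rewrite {1}wE cImM ReC ImC mul0r addr0.
  have tR : t * complex.Re u / t = complex.Re u by rewrite mulrAC divff ?gt_eqF// mul1r.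
  move: wr ws; rewrite Re_u Im_u tR !normrM (gtr0_norm tpos) mulrCA.
  rewrite ler_pM2l// => wr ws; have := wr; rewrite ltr_norml => /andP[wr1 wr2].
  have Reu : `|complex.Re u| = complex.Re u by rewrite ger0_norm//; slra.
  rewrite Reu in ws.
  have nu : nrm u <= complex.Re u * (1 + theta).
    by apply: le_trans (nrm_le_ReIm u) _; rewrite Reu; slra.
  have wt3 : nrm w < t3.
    rewrite wE nrmM nt; apply: (@le_lt_trans _ _ (t * (complex.Re u * (1 + theta)))).
      by rewrite ler_pM2l.
    have -> : t * (complex.Re u * (1 + theta)) = complex.Re u * (t * (1 + theta)) by ring.
    have : complex.Re u * (t * (1 + theta)) <= 2 * (t * (1 + theta)).
      by rewrite ler_wpM2r ?mulr_ge0//; slra.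
    slra.
  have imd : `|complex.Im u| <= d * nrm u.
    rewrite leNgt; apply/negP => lt; apply: nF; apply: ho => //.
    rewrite wE cImM ReC ImC mul0r addr0 normrM nrmM nt (gtr0_norm tpos) mulrCA.
    by rewrite ler_pM2l// ltW.
  have imr : `|complex.Im u| <= rho / 4.
    have := nrm_le_ReIm u; rewrite Reu => h; have := normr_ge0 (complex.Im u).
    have := nrm_ge0 u; snra.
  split.
    apply: le_lt_trans (nrm_le_ReIm _) _.
    have -> : complex.Re (u - 1) = complex.Re u - 1 by rewrite cReD cReN.
    have -> : complex.Im (u - 1) = complex.Im u by rewrite cImD cImN /= subr0.
    exact: le_lt_trans (lerD (ltW wr) imr) rr4.
  apply: le_lt_trans (nrm_le_ReIm _) _; rewrite cReD cReN cImD cImN /base_point /=.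
  have h8 : `|complex.Im u - rho / 8| <= rho / 4 + rho / 8.
    by apply: le_trans (ler_normB _ _) _; apply: lerD imr _; rewrite ger0_norm// divr_ge0// ltW.
  exact: le_lt_trans (lerD (ltW wr) h8) rr2.
have char_of u : nrm (u - 1) < 1 / 4 -> f u = 0 -> char_value D A ((t%:C)%C * u).
  move=> u1 fu; have [Dz z0 _ _] := hball _ (sc u u1); split=> //.
  by apply/(scv u u1); rewrite fu.
have zero_of w : char_value D A w -> nrm (w / (t%:C)%C - 1) < 1 / 4 -> f (w / (t%:C)%C) = 0.
  move=> [Dw w0 nF] u1; apply/eqP/(scv _ u1).
  by rewrite [_ * (w / _)]mulrC divfK.
(* An empty window has determinant 1, hence no zeros; [scalar_comparison] covers [0 < n]. *)
have [n0|n0] := posnP n.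
  exists [::]; split=> //.
    move=> w hw' ws wr; have [u1 _] := capt w hw' ws wr.
    have := zero_of w hw' u1; rewrite /f; move: (redmx dot _) => M /eqP.
    have : \det M = 1 by move: M; rewrite n0 => M; exact: det_mx00.
    by move=> ->; rewrite oner_eq0.
  rewrite big_nil big1 ?subrr ?normr0 ?n0 ?mulr0// => -[j jn] _; exfalso.
  by move: jn; rewrite n0.
have hf u : nrm (u - 1) < 1 / 4 -> hol f u.
  move=> /sc u1; apply: (hol_comp (f := fun z => \det (redmx dot (e := e) (L z)) : R[i])
    (g := fun u => (t%:C)%C * u)).
    by apply: holM; [exact: hol_cst|exact: hol_id].
  by apply: (reddet_hol hn); have [] := hred.2 _ u1.
have fM u : nrm (u - 1) < 1 / 4 -> nrm (f u) <= (1 + 14 * K) ^+ n.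
  by move=> /sc /hball[].
have fclose u : nrm (u - 1) < 1 / 4 -> k <= `|complex.Im u| -> f u != 0 /\
    `|ln (nrm (f u)) - \sum_j (ln (nrm (u - ((lam j / t)%:C)%C)) - ln (nrm u))| <= n%:R * eta.
  by move=> u1 uk; exact: (hc t n e lam u tpos tt2 hE u1 uk).
have [zs [g [fac g0 bound]]] := hsc n (fun j => lam j / t) f n0 hf fM fclose fIm.
have rR : 2 * rho <= 1 / 5 by slra.
have ball1 u : nrm (u - base_point (rho / 8)) < 1 / 5 -> nrm (u - 1) < 1 / 4.
  have : nrm (base_point (rho / 8) - 1) <= rho / 8.
    apply: le_trans (nrm_le_ReIm _) _; rewrite /base_point /= subrr normr0 add0r subr0.
    by rewrite ger0_norm//; slra.
  by move=> h up; have := nrmB_tri u (base_point (rho / 8)) 1; slra.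
exists zs; split=> //.
- move=> u uz; have up : nrm (u - base_point (rho / 8)) < 2 * rho by case: fac => _ h _; exact: h.
  have up5 := lt_le_trans up rR; have u1 := ball1 u up5.
  have fu : f u = 0 by apply/eqP; rewrite -(factorized_mem fac g0 rR up).
  split; [exact: char_of|exact: fsec|].
  have uE : (t%:C)%C * u / (t%:C)%C = u by rewrite mulrAC divff// mul1r.
  pose s := t * (1 / 5 - nrm (u - base_point (rho / 8))).
  have s0 : 0 < s by rewrite mulr_gt0//; slra.
  have zball z : nrm (z - (t%:C)%C * u) < s ->
      nrm (z / (t%:C)%C - base_point (rho / 8)) < 1 / 5.
    move=> zs'; have zE : z / (t%:C)%C - u = (z - (t%:C)%C * u) / (t%:C)%C.
      by rewrite mulrBl uE.
    have : nrm (z / (t%:C)%C - u) < 1 / 5 - nrm (u - base_point (rho / 8)).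
      by rewrite zE nrmM nrmV nt ltr_pdivrMr// [X in _ < X]mulrC.
    have := nrmB_tri (z / (t%:C)%C) u (base_point (rho / 8)); slra.
  have zin z : nrm (z - (t%:C)%C * u) < s -> nrm (z - (t%:C)%C) < t / 4.
    by move=> /zball/ball1/sc; rewrite [_ * (z / _)]mulrC divfK.
  have red' : reduction hn F ((t%:C)%C * u) s e L (winG hn A e)
      (fun z => invop (winG hn A e z)).
    by split; [exact: hred.1|move=> z /zin; exact: hred.2].
  rewrite (mult_factorized oD hA s0 tpos (g := g) (zs := zs) _ red') ?uE//.
  + by move=> z /zin/hball[].
  + by move=> z /zball; case: fac => h _ _; exact: h.
  + exact: g0.
  + move=> z /zball zb; case: fac => _ _ /(_ _ zb) <-.
    by rewrite /f [_ * (z / _)]mulrC divfK.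
- move=> w hw' ws wr; have [u1 up] := capt w hw' ws wr.
  by rewrite (factorized_mem fac g0 rR up) zero_of.
Qed.

End WindowCount.

(** * Finiteness of the characteristic values *)

Section Finiteness.
Context {R : realType} {H : completeNormedModType R[i]}.
Variable dot : {dot H for (@Num.conj R[i])}.
Hypothesis hn : hilbert_norm dot.
Variables (D : set R[i]) (A : R[i] -> boundedOp H) (P0 : boundedOp H).
Hypotheses (oD : open D) (D0 : D 0) (hA : holomorphic_on D A).
Hypotheses (cA : forall z, D z -> fapprox hn (A z)) (sA : selfadjoint_op dot (A 0)).
Hypotheses (hP0 : orth_proj dot (op_ker (A 0)) P0).
Hypothesis invA : op_invertible (idop H - compop (derive1 A 0) P0).
Implicit Types (z w u v : R[i]) (t k rho eps theta : R).

Local Notation F := (char_fun A).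

(** The second clause records that multiplicities near [w] are natural numbers, since [char_mult]
    takes values in [int]. *)
Definition isolated w := exists2 d : R, 0 < d & exists zs : seq R[i],
  forall z, nrm (z - w) < d -> (~ op_invertible (F z) -> z \in zs) /\
    exists m : nat, char_mult dot D A z = m%:Z.

Definition singular_near w := exists2 d : R, 0 < d &
  forall z, nrm (z - w) < d -> ~ op_invertible (F z).

(** Analytic Fredholm theory: near [w] the singular points are the zeros of a determinant, which
    either vanishes on a whole disc or has finitely many zeros there. *)
Lemma dichotomy w : D w -> w != 0 -> singular_near w \/ isolated w.
Proof.
move=> Dw w0; have [d d0 hd'] := dom_near oD hA Dw w0.
have hK z : nrm (z - w) < d -> hol (fun z => z^-1 *: A z) z.
  move=> /hd'[Dz z0 Az]; apply: holZ => //; apply: hol_invf => //; exact: hol_id.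
have [r1 [n [e [L [G [Gi [r10 r1d red]]]]]]] := local_reduction d0 hK (fapproxZ (w^-1) (cA Dw)).
have hf z : nrm (z - w) < r1 -> hol (fun z => \det (redmx dot (e := e) (L z)) : R[i]) z.
  by move=> zr; apply: (reddet_hol hn); have [] := red.2 z zr.
have fw : ccont (fun z => \det (redmx dot (e := e) (L z)) : R[i]) w.
  by apply: hol_ccont; apply: hf; rewrite subrr nrm0.
have [d2 d20 hbd] := ccont_bounded fw.
pose f z : R[i] := \det (redmx dot (e := e) (L z)).
have [r [r0 rr1 rd2]] : exists r : R, [/\ 0 < r, r <= r1 & r <= d2].
  by exists (Num.min r1 d2); rewrite lt_min r10 !ge_min !lexx orbT.
have inv z : nrm (z - w) < r -> op_invertible (F z) <-> f z != 0.
  by move=> zr; apply: (reduction_char_value red); exact: lt_le_trans zr rr1.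
(* [factorization] needs a centre where [f] does not vanish. A nearby [p] serves: its disc of radius
   [r / 10] still contains the disc of radius [r / 100] about [w]. *)
have [sing|] := pselect (forall z, nrm (z - w) < r / 100 -> f z = 0).
  left; exists (r / 100); first by rewrite divr_gt0.
  move=> z zr; have zr' : nrm (z - w) < r by slra.
  by move=> /(inv z zr'); rewrite sing// eqxx.
move=> /existsNP[p /not_implyP[pw /eqP fp]]; right.
have pin z : nrm (z - p) < r / 2 -> nrm (z - w) < r.
  by move=> zp; have := nrmB_tri z p w; slra.
have hfp z : nrm (z - p) < r / 2 -> hol f z.
  by move=> /pin zr; apply: hf; exact: lt_le_trans zr rr1.
have fM z : nrm (z - p) = r / 4 -> nrm (f z) <= nrm (f w) + 1.
  move=> zp; apply: hbd; have zr : nrm (z - w) < r by apply: pin; rewrite zp; slra.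
  exact: lt_le_trans zr rd2.
have r10' : 0 < r / 10 by slra.
have r210 : 2 * (r / 10) < r / 4 by slra.
have r42 : r / 4 < r / 2 by slra.
have [zs [g [fac g0]]] := factorization hfp r10' r210 r42 fM fp.
have r102 : r / 10 <= r / 2 by slra.
exists (r / 100); first by rewrite divr_gt0.
exists zs => z zw; have zp : nrm (z - p) < r / 10.
  by have := nrmB_tri z w p; rewrite [nrm (w - p)]nrmBC; slra.
split.
  move=> nF; rewrite (factorized_mem fac g0 r102 zp).
  apply/negPn/negP => fz; apply: nF; apply/(inv z _) => //; slra.
have o1 (y : R[i]) : y / (1%:C)%C = y by rewrite (_ : (1%:C)%C = 1 :> R[i])// divr1.
pose s := r / 10 - nrm (z - p).
have s0 : 0 < s by rewrite subr_gt0.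
have yp y : nrm (y - z) < s -> nrm (y - p) < r / 10.
  by rewrite /s => yz; have := nrmB_tri y z p; slra.
have yw y : nrm (y - z) < s -> nrm (y - w) < r1.
  move=> /yp h; apply: lt_le_trans rr1; apply: pin; slra.
have hDz y : nrm (y - z) < s -> D y /\ y != 0.
  by move=> /yw h; have [] := hd' y (lt_le_trans h r1d).
have redz : reduction hn F z s e L G Gi.
  by split; [exact: red.1|move=> y /yw; exact: red.2].
exists (count_mem z zs); have := mult_factorized oD hA s0 ltr01 hDz redz (g := g) (zs := zs).
rewrite o1; apply.
- move=> y /yp h; rewrite o1; case: fac => h1 _ _; apply: h1; exact: lt_le_trans h r102.
- exact: g0.
- move=> y /yp h; rewrite o1; case: fac => _ _ h1.
  rewrite -/(f y) h1; last exact: lt_le_trans h r102.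
  by congr (_ * _); apply: eq_bigr => v _; rewrite o1.
Qed.

Lemma avoid_seq (s : seq R[i]) z eps : 0 < eps -> exists2 d : R, 0 < d <= eps &
  forall v, v \in s -> v != z -> d <= nrm (v - z).
Proof.
move=> e0; elim: s => [|v s [d /andP[d0 de] hd']]; first by exists eps; rewrite ?e0 ?lexx.
have [->|vz] := eqVneq v z.
  exists d; rewrite ?d0// => u; rewrite in_cons => /orP[/eqP->|]; first by rewrite eqxx.
  exact: hd'.
have nv : 0 < nrm (v - z) by rewrite nrm_gt0 subr_eq0.
exists (Num.min d (nrm (v - z))); first by rewrite lt_min d0 nv ge_min de.
move=> u; rewrite in_cons => /orP[/eqP-> _|us uz]; rewrite ge_min ?lexx ?orbT//.
by rewrite hd'.
Qed.

Lemma isolated_regular w z (d : R) (zs : seq R[i]) :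
  (forall z, nrm (z - w) < d -> ~ op_invertible (F z) -> z \in zs) ->
  nrm (z - w) < d -> ~ singular_near z.
Proof.
move=> hz zw [eps e0 sing].
have m0 : 0 < Num.min eps (d - nrm (z - w)) by rewrite lt_min e0 subr_gt0.
have [s /andP[s0 se] hs] := avoid_seq zs z m0.
have s1 : s <= eps by apply: le_trans se _; rewrite ge_min lexx.
have s2 : s <= d - nrm (z - w) by apply: le_trans se _; rewrite ge_min lexx orbT.
pose y := z + ((s / 2)%:C)%C.
have yz : nrm (y - z) = s / 2 by rewrite /y addrC addKr nrmR gtr0_norm//; slra.
have yzs : y \in zs.
  apply: hz; first by have := nrmB_tri y z w; slra.
  by apply: sing; rewrite yz; slra.
have := hs y yzs; rewrite yz -subr_eq0 -nrm_gt0 yz => h.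
by have := h ltac:(slra); slra.
Qed.

(** A connectedness argument inside the convex sector: along the segment from [w] to a point [p]
    where [F] is invertible, [singular_near] is locally constant by [dichotomy], and it fails at
    [p]. *)
Lemma sector_isolated theta w : 0 < theta -> (forall r : R, 0 < r < 1 -> sector theta r 1 `<=` D) ->
  0 < complex.Re w <= 1 -> `|complex.Im w| <= theta * complex.Re w -> isolated w.
Proof.
move=> th0 secD /andP[w0 w1] wth.
pose good z := 0 < complex.Re z <= 1 /\ `|complex.Im z| <= theta * complex.Re z.
have goodD z : good z -> D z /\ z != 0.
  move=> [/andP[z0 z1] zth]; split; last first.
    by apply: contraTneq z0 => ->; rewrite /= ltxx.
  apply: (secD (complex.Re z / 2)); first by apply/andP; split; slra.
  rewrite /sector/= (ger0_norm (x := complex.Re z)) ?(ltW z0)// zth z1 andbT.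
  by split=> //; slra.
have dich z : good z -> singular_near z \/ isolated z.
  by move=> /goodD[Dz z0]; exact: dichotomy.
(* a reference point off the real axis, close to 0 *)
have [m [m0 m1 mth]] : exists m : R, [/\ 0 < m, m <= 1 & m <= theta].
  by exists (Num.min 1 theta); rewrite lt_min ltr01 th0 !ge_min !lexx orbT.
have m2 : 0 < m / 2 by slra.
have [t0 t00 ho] := off_axis oD D0 hA cA sA hP0 invA m2.
have [s [s0 s1 st]] : exists s : R, [/\ 0 < s, s <= 1 & 2 * s < t0].
  exists (Num.min 1 (t0 / 3)); have h : Num.min 1 (t0 / 3) <= t0 / 3 by rewrite ge_min lexx orbT.
  split; [by rewrite lt_min ltr01 divr_gt0|by rewrite ge_min lexx|slra].
pose p : R[i] := (s +i* (s * m))%C.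
have sm0 : 0 < s * m by rewrite mulr_gt0.
have smth : s * m <= theta * s by rewrite mulrC ler_pM2r.
have goodp : good p.
  by rewrite /good /p /= s0 s1 (gtr0_norm sm0).
have invp : op_invertible (F p).
  have [_ p0] := goodD p goodp; have np : nrm p <= s + s * m.
    by apply: le_trans (nrm_le_ReIm p) _; rewrite /p /= (gtr0_norm s0) (gtr0_norm sm0).
  have sms : s * m <= s by rewrite ler_piMr// ltW.
  apply: ho => //; first by slra.
  have h2 : m / 2 * nrm p <= m / 2 * (2 * s) by apply: ler_wpM2l; slra.
  by apply: le_trans h2 _; rewrite /p /= (gtr0_norm sm0); slra.
have regp : ~ singular_near p.
  by move=> [d d0 /(_ p)]; rewrite subrr nrm0 => /(_ d0); apply.
pose phi (u : R) := w + (u%:C)%C * (p - w).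
have goodphi (u : R) : 0 <= u <= 1 -> good (phi u).
  move=> /andP[u0 u1]; rewrite /good /phi cReD cImD cReM cImM ReC ImC !mul0r subr0 addr0.
  rewrite cReD cReN cImD cImN /p /=.
  have [/andP[_ _]] := goodp; rewrite /p /= (gtr0_norm sm0) => _.
  move: wth; rewrite ler_norml => /andP[i1 i2]; split.
    by apply/andP; split; snra.
  have e1 : complex.Im w + u * (s * m - complex.Im w) =
      (1 - u) * complex.Im w + u * (s * m) by ring.
  have e2 : theta * (complex.Re w + u * (s - complex.Re w)) =
      (1 - u) * (theta * complex.Re w) + u * (theta * s) by ring.
  rewrite e1 e2; have v0 : 0 <= 1 - u by slra.
  have h1 := ler_wpM2l v0 i1; have h2 := ler_wpM2l v0 i2.
  have h3 := ler_wpM2l u0 smth; have h4 : 0 <= u * (s * m) by rewrite mulr_ge0// ltW.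
  have h5 : 0 <= u * (theta * s) by rewrite !mulr_ge0// ltW.
  rewrite mulrN in h1; rewrite ler_norml; apply/andP; split; slra.
(* Local constancy is put in the interval form required by [cousin1]. *)
pose P (x a : R) := 0 <= a -> (singular_near (phi x) <-> singular_near (phi (x + a))).
have : P 0 1.
  apply: cousin1 => //.
    move=> x a _ _ a0 h1 h2 _; have a2 : 0 <= a / 2 by slra.
    have {}h1 := h1 a2; have {}h2 := h2 a2.
    by rewrite h1 h2 (_ : x + a / 2 + a / 2 = x + a)//; slra.
  move=> X X01; rewrite add0r in X01; have gX := goodphi X X01.
  have npw : 0 < nrm (p - w) + 1 by have := nrm_ge0 (p - w); slra.
  have [d d0 hconst] : exists2 d : R, 0 < d & forall z, nrm (z - phi X) < d ->
      (singular_near z <-> singular_near (phi X)).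
    case: (dich _ gX) => [sing|[d d0 [zs hz]]].
      have [d d0 hd'] := sing; exists (d / 2); first by slra.
      move=> z zX; split=> // _; exists (d / 2); first by slra.
      by move=> y yz; apply: hd'; have := nrmB_tri y z (phi X); slra.
    exists d => // z zX; have hz1 := fun z h => (hz z h).1.
    split=> hs; exfalso.
      exact: (isolated_regular hz1 zX hs).
    by apply: (isolated_regular hz1 _ hs); rewrite subrr nrm0.
  exists (d / (nrm (p - w) + 1)); first by rewrite divr_gt0.
  move=> x a x0 xa /andP[xX Xa]; rewrite ltr_pdivlMr// => ad a0.
  have near y : `|y - X| <= a -> nrm (phi y - phi X) < d.
    move=> yX; have -> : phi y - phi X = ((y - X)%:C)%C * (p - w).
      by rewrite /phi opprD addrACA subrr add0r -mulrBl rmorphB.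
    rewrite nrmM nrmR; have := ler_wpM2r (nrm_ge0 (p - w)) yX; have := nrm_ge0 (p - w); slra.
  rewrite (hconst (phi x)); last by apply: near; rewrite ler_norml; apply/andP; split; slra.
  by rewrite (hconst (phi (x + a)))//; apply: near; rewrite ler_norml; apply/andP; split; slra.
move=> /(_ ler01); rewrite add0r.
have -> : phi 0 = w by rewrite /phi mul0r addr0.
have -> : phi 1 = p by rewrite /phi (_ : (1%:C)%C = 1 :> R[i])// mul1r addrC subrK.
move=> h; have gw : good w by split=> //; rewrite w0.
by case: (dich w gw) => // /h /regp.
Qed.

(** [psi] parametrises the truncated sector by the rectangle [[r0, 1] x [- theta, theta]], so
    compactness is [cousin2]. *)
Lemma sector_finite theta (r0 : R) : 0 < theta -> (forall r : R, 0 < r < 1 -> sector theta r 1 `<=` D) ->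
  0 < r0 <= 1 -> exists (s : seq R[i]) (m : R[i] -> nat), [/\ uniq s,
    forall w, w \in s <-> char_value D A w /\ sector theta r0 1 w &
    forall w, w \in s -> char_mult dot D A w = (m w)%:Z].
Proof.
move=> th0 secD /andP[r00 r01].
pose psi (x y : R) : R[i] := (x +i* (x * y))%C.
pose P (x y a b : R) := exists zs : seq R[i], forall x' y', x <= x' <= x + a ->
  y <= y' <= y + b -> ~ op_invertible (F (psi x' y')) -> psi x' y' \in zs.
have isol x y : r0 <= x <= 1 -> - theta <= y <= theta -> isolated (psi x y).
  move=> /andP[x0 x1] yt; have xp : 0 < x by slra.
  apply: (sector_isolated th0 secD); rewrite /psi /= ?xp//.
  by rewrite normrM (gtr0_norm xp) mulrC ler_pM2r// ler_norml.
have [zs hzs] : P r0 (- theta) (1 - r0) (2 * theta).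
  apply: cousin2; [slra|slra| |].
    move=> x y a b _ _ _ _ a0 b0 [z1 h1] [z2 h2] [z3 h3] [z4 h4].
    exists (z1 ++ z2 ++ z3 ++ z4) => x' y' /andP[xa xb] /andP[ya yb] nF.
    rewrite !mem_cat; have [xl|xr] := leP x' (x + a / 2); have [yl|yr] := leP y' (y + b / 2).
    - by rewrite h1// ?xa ?ya.
    - by rewrite (h3 x' y')// ?orbT// ?xa//; apply/andP; split; slra.
    - by rewrite (h2 x' y')// ?orbT// ?ya//; apply/andP; split; slra.
    - by rewrite (h4 x' y')// ?orbT//; apply/andP; split; slra.
  move=> X Y XX YY; have Xr : r0 <= X <= 1 by move/andP: XX => [? ?]; apply/andP; split; slra.
  have Yt : - theta <= Y <= theta by move/andP: YY => [? ?]; apply/andP; split; slra.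
  have [d d0 [zs hz]] := isol X Y Xr Yt.
  have th2 : 0 < theta + 2 by slra.
  exists (d / (theta + 2)); first by rewrite divr_gt0.
  move=> x y a b x0 xa y0 yb /andP[xX Xa] /andP[yY Yb]; rewrite !ltr_pdivlMr// => ad bd.
  exists zs => x' y' /andP[x1 x2] /andP[y1 y2] nF; apply: (hz _ _).1 => //.
  apply: le_lt_trans (nrm_le_ReIm _) _; rewrite /psi cReD cReN cImD cImN /=.
  have e1 : `|x' - X| <= a by rewrite ler_norml; apply/andP; split; slra.
  have e2 : `|y' - Y| <= b by rewrite ler_norml; apply/andP; split; slra.
  have e3 : `|x' * y' - X * Y| <= b + theta * a.
    have -> : x' * y' - X * Y = x' * (y' - Y) + (x' - X) * Y by ring.
    apply: le_trans (ler_normD _ _) _; rewrite !normrM; apply: lerD.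
      have x'1 : `|x'| <= 1.
        by move/andP: Xr => [? ?]; rewrite ler_norml; apply/andP; split; slra.
      by have := normr_ge0 (y' - Y); have := normr_ge0 x'; snra.
    have Y1 : `|Y| <= theta by rewrite ler_norml.
    by have := normr_ge0 (x' - X); have := normr_ge0 Y; snra.
  have a0 : 0 <= a by slra.
  have b0 : 0 <= b by slra.
  move: ad bd e1 e3; move: (`|x' - X|) (`|x' * y' - _|) => q1 q2 ad bd e1 e3.
  snra.
have inz w : char_value D A w -> sector theta r0 1 w -> w \in zs.
  move=> [_ _ nF] [/andP[w1 w2] wt]; have w0 : 0 < complex.Re w by slra.
  have wE : w = psi (complex.Re w) (complex.Im w / complex.Re w).
    by rewrite /psi mulrC divfK ?gt_eqF//; case: (w).
  rewrite wE; apply: hzs; last by rewrite -wE.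
    by apply/andP; split; slra.
  rewrite (gtr0_norm w0) ler_norml in wt; have /andP[t1 t2] := wt.
  by rewrite ler_pdivlMr// ler_pdivrMr//; apply/andP; split; slra.
have mult w : exists m : nat, char_value D A w -> sector theta r0 1 w ->
    char_mult dot D A w = m%:Z.
  have [[cw [/andP[w1 w2] wt]]|nw] := pselect (char_value D A w /\ sector theta r0 1 w).
    have w0 : 0 < complex.Re w by slra.
    have iso : isolated w.
      apply: (sector_isolated th0 secD); first by rewrite w0.
      by rewrite -(ger0_norm (ltW w0)).
    have [d d0 [zs' hz]] := iso; have := (hz w); rewrite subrr nrm0 => /(_ d0)[_ [m hm]].
    by exists m.
  by exists 0%N => cw sw; exfalso; apply: nw.
have [m hm] := choice mult.
exists (undup [seq w <- zs | `[< char_value D A w /\ sector theta r0 1 w >]]), m.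
have mem w : w \in undup [seq w <- zs | `[< char_value D A w /\ sector theta r0 1 w >]] <->
    char_value D A w /\ sector theta r0 1 w.
  rewrite mem_undup mem_filter; split=> [/andP[/asboolP//]|h].
  by apply/andP; split; [apply/asboolP|apply: inz; case: h].
split; [exact: undup_uniq|exact: mem|].
by move=> w /mem[cw sw]; exact: hm.
Qed.

End Finiteness.

(** * Geometric grids of scales *)

Section Grid.
Context {R : realType}.
Implicit Types (x y q r t k rho : R) (I J W n m i j : nat) (l : seq (nat * R)).

Lemma sum_le_ext (a b : nat -> R) m J :
  (forall j, (j < m)%N -> (j < J)%N -> a j <= b j) ->
  (forall j, (j < m)%N -> (J <= j)%N -> a j <= 0) ->
  (forall j, (m <= j)%N -> (j < J)%N -> 0 <= b j) ->
  \sum_(j < m) a j <= \sum_(j < J) b j.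
Proof.
move=> h1 h2 h3.
rewrite (big_ord_widen (m + J) a (leq_addr J m)) (big_ord_widen (m + J) b (leq_addl m J)).
rewrite big_mkcond [X in _ <= X]big_mkcond; apply: ler_sum => j _ /=.
case: (ltnP j m) => jm; case: (ltnP j J) => jJ //; [exact: h1|exact: h2|exact: h3].
Qed.

(** A list of pairs (weight, position) stands for a discrete measure, against which [g] is
    integrated. *)
Definition wsum l (g : R -> R) : R := \sum_(p <- l) p.1%:R * g p.2.

Lemma wsum_le l g h : (forall p, p \in l -> g p.2 <= h p.2) -> wsum l g <= wsum l h.
Proof.
move=> gh; rewrite /wsum big_seq [X in _ <= X]big_seq; apply: ler_sum => p pl.
by rewrite ler_wpM2l ?ler0n// gh.
Qed.

Lemma wsumZ l (c : R) g : wsum l (fun x => c * g x) = c * wsum l g.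
Proof. by rewrite /wsum mulr_sumr; apply: eq_bigr => p _; rewrite mulrCA. Qed.

Lemma wsum_sum l I (g : nat -> R -> R) :
  wsum l (fun x => \sum_(i < I) g i x) = \sum_(i < I) wsum l (g i).
Proof. by rewrite /wsum exchange_big/=; apply: eq_bigr => p _; rewrite mulr_sumr. Qed.

Lemma wsum_ge0 l g : (forall x, 0 <= g x) -> 0 <= wsum l g.
Proof. by move=> g0; apply: sumr_ge0 => p _; rewrite mulr_ge0. Qed.

Lemma grid_split q r x I : exists2 i1, (i1 <= I)%N &
  (forall i, (i < i1)%N -> r * q ^+ i <= x) /\ ((i1 < I)%N -> x < r * q ^+ i1).
Proof.
elim: I => [|I [i1 i1I [h1 h2]]]; first by exists 0%N.
have [i1lt|i1ge] := ltnP i1 I.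
  by exists i1; [exact: leq_trans (ltnW i1lt) _|split=> // _; exact: h2].
have e : i1 = I by apply/eqP; rewrite eqn_leq i1I.
subst i1; have [xI|xI] := leP (r * q ^+ I) x.
  exists I.+1 => //; split; last by rewrite ltnn.
  by move=> i; rewrite ltnS leq_eqVlt => /orP[/eqP->|/h1].
by exists I.
Qed.

Lemma sum_split_rev (f : nat -> R) I i1 : (i1 <= I)%N ->
  \sum_(i < I) f i = \sum_(j < i1) f (i1 - j.+1)%N + \sum_(j < I - i1) f (i1 + j)%N.
Proof.
move=> h; rewrite -[in LHS](subnKC h) big_split_ord /=; congr (_ + _).
by rewrite (reindex_inj rev_ord_inj).
Qed.

Variables (k rho q r t : R) (I J W : nat).
Hypotheses (k0 : 0 < k) (rho0 : 0 < rho) (rho1 : rho < 1 / 2) (q1 : 1 < q) (r0 : 0 < r).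
Hypotheses (qJ : 2 <= q ^+ J) (qW : 8 < q ^+ W) (tI : t <= r * q ^+ I).

Local Notation K := (kcut k rho).

(* [lra] ignores section hypotheses, so they are copied. *)
Ltac lrax := move: (k0) (rho0) (rho1) (q1) (r0) (qJ) (qW) (tI) => ? ? ? ? ? ? ? ?; slra.
Ltac nrax := move: (rho0) (rho1) (q1) (r0) => ? ? ? ?; snra.

Lemma q_gt0 : 0 < q. Proof. exact: lt_trans q1. Qed.
Let qX i : 0 < q ^+ i. Proof. by rewrite exprn_gt0// q_gt0. Qed.
Let qmono i j : (i <= j)%N -> q ^+ i <= q ^+ j.
Proof. by move=> ij; rewrite ler_eXn2l. Qed.

(** Up to a bounded error, the sum of the kernel over all scales for any interior point. The value
    at ratio 1 is counted on both sides, which makes it an upper bound wherever the point falls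
    between two scales; [2 <= q ^+ J] exhausts the support of the kernel. *)
Definition grid_total : R := \sum_(j < J) K (q ^+ j) + \sum_(j < J) K (q ^- j).

Lemma kcut0 y : rho <= `|y - 1| -> K y = 0.
Proof. by rewrite /kcut; case: ltP. Qed.

Lemma kcut_up y : 1 + rho <= y -> K y = 0.
Proof. by move=> h; apply: kcut0; rewrite ger0_norm; lrax. Qed.

Lemma kcut_dn y : y <= 1 - rho -> K y = 0.
Proof. by move=> h; apply: kcut0; rewrite ler0_norm; lrax. Qed.

Lemma kcut_up_le x y : 1 <= x -> x <= y -> K y <= K x.
Proof. by move=> x1 xy; apply: kcut_mono => //; rewrite !ger0_norm; lrax. Qed.

Lemma kcut_dn_le x y : y <= x -> x <= 1 -> K y <= K x.
Proof. by move=> x1 xy; apply: kcut_mono => //; rewrite !ler0_norm; lrax. Qed.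

Let s i : R := r * q ^+ i.
Let s0 i : 0 < s i. Proof. by rewrite mulr_gt0. Qed.
Let sD i j : s (i + j)%N = s i * q ^+ j. Proof. by rewrite /s exprD mulrA. Qed.
Let sB i j : (j < i)%N -> s (i - j.+1)%N * q ^+ j = s i.-1.
Proof. by move=> ji; rewrite -sD; congr s; case: i ji => //= i ji; rewrite subSS subnK. Qed.
Let sB1 i j : (j < i)%N -> s (i - j.+1)%N * q ^+ j.+1 = s i.
Proof. by move=> ji; rewrite -sD subnK. Qed.
Let smono i j : (i <= j)%N -> s i <= s j.
Proof. by move=> ij; rewrite ler_wpM2l ?(ltW r0)// qmono. Qed.

Lemma grid_upper x : 0 < x -> \sum_(i < I) K (x / s i) <= grid_total.
Proof.
move=> x0; have [i1 i1I [h1 h2]] := grid_split q r x I.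
rewrite (sum_split_rev (fun i => K (x / s i)) i1I) /grid_total.
apply: lerD; [apply: (sum_le_ext (a := fun j => K (x / s (i1 - j.+1)%N)) (b := fun j => K (q ^+ j)))|
  apply: (sum_le_ext (a := fun j => K (x / s (i1 + j)%N)) (b := fun j => K (q ^- j)))].
- move=> j ji _; apply: kcut_up_le; first by rewrite exprn_ege1// ltW.
  rewrite ler_pdivlMr// mulrC sB//; apply: h1; by case: (i1) ji => //.
- move=> j ji jJ; rewrite kcut_up//; apply: (@le_trans _ _ (q ^+ j)).
    by apply: le_trans (qmono jJ); lrax.
  rewrite ler_pdivlMr// mulrC sB//; apply: h1; by case: (i1) ji => //.
- by move=> *; exact: kcut_ge0.
- move=> j ji _; have xs : x < s i1 by apply: h2; rewrite -subn_gt0; exact: leq_ltn_trans ji.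
  apply: kcut_dn_le; last by rewrite invf_le1 ?exprn_ege1 ?(ltW q1).
  by rewrite ler_pdivrMr// sD mulrCA mulVf ?gt_eqF// mulr1 ltW.
- move=> j ji jJ; have xs : x < s i1 by apply: h2; rewrite -subn_gt0; exact: leq_ltn_trans ji.
  rewrite kcut_dn//; apply: (@le_trans _ _ (2^-1)); last by lrax.
  rewrite ler_pdivrMr// sD; apply: le_trans (ltW xs) _.
  rewrite mulrCA ler_peMr ?(ltW (s0 _))//.
  have := qmono jJ; lrax.
- by move=> *; exact: kcut_ge0.
Qed.

(** Monotonicity of the kernel on either side of 1 shifts each sum by one index; this loses one term
    on each side, each at most 3. *)
Lemma grid_lower x : r * (1 + rho) <= x -> x <= t * (1 - rho) ->
  grid_total - 6 <= \sum_(i < I) K (x / s i).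
Proof.
move=> xr xt; have [i1 i1I [h1 h2]] := grid_split q r x I.
have x0 : 0 < x by apply: lt_le_trans xr; rewrite mulr_gt0//; lrax.
have t0 : 0 < t by nrax.
have xI : x < s I by apply: lt_le_trans tI; nrax.
have xs : x < s i1.
  by case: (ltnP i1 I) => [/h2//|iI]; rewrite (_ : i1 = I)//; apply/eqP; rewrite eqn_leq i1I.
have i10 : (0 < i1)%N.
  by case: (i1) xs => //; rewrite /s expr0 mulr1; nrax.
have xs1 : s i1.-1 <= x by apply: h1; rewrite prednK.
rewrite (sum_split_rev (fun i => K (x / s i)) i1I).
have tele (a : nat -> R) : a 0%N <= 3 -> 0 <= a J ->
    \sum_(j < J) a j - 3 <= \sum_(j < J) a j.+1.
  move=> a3 aJ; have := telescope_sumr a (leq0n J).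
  rewrite sumrB !big_mkord; lrax.
have := tele (fun j => K (q ^+ j)) (kcut_le3 _ _ k0) (kcut_ge0 _ _ k0).
have := tele (fun j => K (q ^- j)) (kcut_le3 _ _ k0) (kcut_ge0 _ _ k0).
have hU : \sum_(j < J) K (q ^+ j.+1) <= \sum_(j < i1) K (x / s (i1 - j.+1)%N).
  apply: (sum_le_ext (a := fun j => K (q ^+ j.+1)) (b := fun j => K (x / s (i1 - j.+1)%N))).
  - move=> j _ ji; apply: kcut_up_le.
      rewrite ler_pdivlMr// mul1r; apply: h1; by rewrite ltn_subrL.
    by rewrite ler_pdivrMr// mulrC sB1// ltW.
  - move=> j _ ij; rewrite kcut_up//; apply: (@le_trans _ _ (q ^+ i1)).
      have : r * (1 + rho) <= r * q ^+ i1 by apply: le_trans xr (ltW xs).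
      by rewrite ler_pM2l.
    exact/qmono/leqW.
  - by move=> *; exact: kcut_ge0.
have hV : \sum_(j < J) K (q ^- j.+1) <= \sum_(j < I - i1) K (x / s (i1 + j)%N).
  have bd j : q ^- j.+1 <= x / s (i1 + j)%N.
    rewrite ler_pdivlMr// mulrC ler_pdivrMr//; apply: (@le_trans _ _ (s i1.-1 * q ^+ j.+1)).
      by rewrite -sD addnS -addSn prednK.
    by rewrite ler_wpM2r// ltW.
  apply: (sum_le_ext (a := fun j => K (q ^- j.+1)) (b := fun j => K (x / s (i1 + j)%N))).
  - move=> j _ ji; apply: kcut_dn_le; first exact: bd.
    rewrite ler_pdivrMr// mul1r; apply/ltW/(lt_le_trans xs)/smono; exact: leq_addr.
  - move=> j _ ij; rewrite kcut_dn//; apply: le_trans (bd j) _.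
    rewrite ler_pdivrMr//; apply: le_trans xt _.
    rewrite mulrC ler_wpM2l//; first by lrax.
    by apply: le_trans tI _; apply: smono; rewrite -leq_subLR.
  - by move=> *; exact: kcut_ge0.
rewrite /grid_total; lrax.
Qed.

(** Scales whose window contains [x] lie between [x / 4] and [2 * x], a ratio 8 that [W] steps
    exceed. *)
Lemma grid_overlap x : 0 < x ->
  \sum_(i < I) (s i / 2 <= x <= 2 * s i)%R%:R <= W%:R * (r / 2 <= x)%R%:R :> R.
Proof.
move=> x0; have [xr|xr] := leP (r / 2) x; last first.
  rewrite mulr0 big1// => i _; rewrite (_ : (s i / 2 <= x) = false)//.
  apply/negbTE; rewrite -ltNge; apply: (lt_le_trans xr).
  by have := smono (leq0n i); rewrite /s expr0 mulr1; lrax.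
rewrite mulr1; have [i1 i1I [h1 h2]] := grid_split q r (x / 4) I.
rewrite (sum_split_rev (fun i => (s i / 2 <= x <= 2 * s i)%R%:R) i1I) big1 ?add0r; last first.
  move=> j _; have h : s (i1 - j.+1)%N <= x / 4.
    by apply: h1; rewrite ltn_subrL /=; apply: leq_ltn_trans (ltn_ord j).
  by rewrite [X in _ && X](_ : _ = false) ?andbF//; apply/negbTE; rewrite -ltNge; lrax.
have -> : W%:R = \sum_(j < W) (1 : R) by rewrite sumr_const card_ord.
apply: (sum_le_ext (a := fun j => (s (i1 + j)%N / 2 <= x <= 2 * s (i1 + j)%N)%R%:R) (b := fun=> 1)) => // j ji.
  by move=> _; case: (_ && _).
move=> Wj; have xs : x / 4 < s i1.
  by apply: h2; rewrite -subn_gt0; exact: leq_ltn_trans ji.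
rewrite (_ : (s _ / 2 <= x) = false)//; apply/negbTE; rewrite -ltNge.
rewrite sD; have h8 : 8 < q ^+ j by exact: lt_le_trans (qmono Wj).
have := s0 i1; move: (s i1) (q ^+ j) xs h8 => a b xs h8 a0; snra.
Qed.

(** Sum the inequalities of the single scales. [l1] and [l2] are the two measures, in either order,
    and [l0] carries the error. *)
Lemma grid_comparison (l0 l1 l2 : seq (nat * R)) (eps : R) : 0 <= eps ->
  (forall p, p \in l0 -> 0 < p.2) -> (forall p, p \in l1 -> 0 < p.2) ->
  (forall p, p \in l2 -> 0 < p.2) ->
  (forall i, (i < I)%N -> wsum l1 (fun x => K (x / s i)) <=
    wsum l2 (fun x => K (x / s i)) +
    eps * k * wsum l0 (fun x => (s i / 2 <= x <= 2 * s i)%R%:R)) ->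
  (grid_total - 6) * wsum l1 (fun x => (r * (1 + rho) <= x <= t * (1 - rho))%R%:R) <=
  grid_total * wsum l2 (fun x => (r * (1 - rho) <= x)%R%:R) +
  eps * k * W%:R * wsum l0 (fun x => (r / 2 <= x)%R%:R).
Proof.
move=> e0 p0 p1 p2 h.
have h1 : (grid_total - 6) * wsum l1 (fun x => (r * (1 + rho) <= x <= t * (1 - rho))%R%:R) <=
    wsum l1 (fun x => \sum_(i < I) K (x / s i)).
  rewrite -wsumZ; apply: wsum_le => p pl; case: (boolP (_ && _)) => [/andP[h1 h2]|_].
    by rewrite mulr1; exact: grid_lower.
  by rewrite mulr0; apply: sumr_ge0 => i _; exact: kcut_ge0.
have h2 : wsum l2 (fun x => \sum_(i < I) K (x / s i)) <=
    grid_total * wsum l2 (fun x => (r * (1 - rho) <= x)%R%:R).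
  rewrite -wsumZ; apply: wsum_le => p pl; have [pr|pr] := leP (r * (1 - rho)) p.2.
    by rewrite mulr1; apply: grid_upper; exact: p2.
  rewrite mulr0 big1// => i _; apply: kcut_dn; rewrite ler_pdivrMr//.
  apply: le_trans (ltW pr) _; rewrite mulrC ler_wpM2l//; first by lrax.
  by have := smono (leq0n i); rewrite /s expr0 mulr1.
apply: le_trans h1 _; apply: le_trans (lerD h2 (lexx _)).
have ek0 : 0 <= eps * k by rewrite mulr_ge0// ltW.
have h0 : wsum l0 (fun x => \sum_(i < I) (s i / 2 <= x <= 2 * s i)%R%:R) <=
    W%:R * wsum l0 (fun x => (r / 2 <= x)%R%:R).
  by rewrite -wsumZ; apply: wsum_le => p pl; apply: grid_overlap; exact: p0.
rewrite -(mulrA (eps * k)); apply: le_trans (lerD (lexx _) (ler_wpM2l ek0 h0)).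
rewrite (wsum_sum l1 I (fun i x => K (x / s i))) (wsum_sum l2 I (fun i x => K (x / s i))).
rewrite (wsum_sum l0 I (fun i x => (s i / 2 <= x <= 2 * s i)%R%:R)) mulr_sumr -big_split/=.
 apply: ler_sum => i _; exact: h.
Qed.

(** The first [m0] powers of [q] stay within [k] of 1, where the kernel is at least 1/2. *)
Lemma grid_total_ge (m0 : nat) : k < rho -> (m0 <= J)%N -> q ^+ m0 <= 1 + k -> m0%:R / 2 <= grid_total.
Proof.
move=> krho mJ qk; rewrite /grid_total; apply: (@le_trans _ _ (\sum_(j < J) K (q ^+ j))); last first.
  by rewrite lerDl; apply: sumr_ge0 => j _; exact: kcut_ge0.
have -> : m0%:R / 2 = \sum_(j < m0) (2^-1 : R).
  by rewrite sumr_const card_ord -[X in _ = X]mulr_natl.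
apply: (sum_le_ext (a := fun=> 2^-1) (b := fun j => K (q ^+ j))).
- move=> j jm jJ; have q1j : 1 <= q ^+ j by rewrite exprn_ege1 ?(ltW q1).
  have qkj : q ^+ j <= 1 + k by apply: le_trans (qmono (ltnW jm)) qk.
  have yk : `|q ^+ j - 1| <= k by rewrite ger0_norm; slra.
  by rewrite /kcut (le_lt_trans yk krho) -div1r; exact: kern_half.
- by move=> j jm; rewrite leqNgt (leq_trans jm mJ).
- by move=> *; exact: kcut_ge0.
Qed.

End Grid.

Lemma bernoulli_upper {R : realType} (x : R) n : 0 <= x -> 2 * n%:R * x <= 1 ->
  (1 + x) ^+ n <= 1 + 2 * n%:R * x.
Proof.
move=> x0; elim: n => [|n IH]; first by rewrite expr0 mulr0 mul0r addr0.
rewrite -natr1 => h; have n0 : (0 : R) <= n%:R by [].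
have nx : 0 <= n%:R * x by rewrite mulr_ge0.
have := IH ltac:(slra); rewrite exprS => {}IH.
apply: (@le_trans _ _ ((1 + x) * (1 + 2 * n%:R * x))).
  by apply: ler_wpM2l => //; slra.
have : 2 * (n%:R * x) * x <= 1 * x by apply: ler_wpM2r => //; slra.
slra.
Qed.

Lemma bernoulli_lower {R : realType} (x : R) n : 0 <= x -> 1 + n%:R * x <= (1 + x) ^+ n.
Proof.
move=> x0; elim: n => [|n IH]; first by rewrite expr0 mul0r addr0.
rewrite -natr1 exprS; apply: (@le_trans _ _ ((1 + x) * (1 + n%:R * x))).
  have : 0 <= n%:R * x * x by rewrite !mulr_ge0.
  slra.
by apply: ler_wpM2l => //; slra.
Qed.

Lemma esum_seq {R : realType} (T : choiceType) (s : seq T) (S : set T) (f : T -> \bar R)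
  (m : T -> nat) : uniq s -> (forall w, S w <-> w \in s) ->
  (forall w, w \in s -> f w = (m w)%:R%:E) ->
  \esum_(w in S) f w = (\sum_(w <- s) (m w)%:R)%:E.
Proof.
move=> us hS hf; have -> : S = [set` s] by apply/seteqP; split=> w; rewrite /= hS.
rewrite esum_fset//; last by move=> w; rewrite inE /= => ws; rewrite (hf w ws) lee_fin.
rewrite -fsbig_seq// -sumEFin big_seq [RHS]big_seq; apply: eq_bigr => w ws; exact: hf.
Qed.

(** Regroups a list of zeros with repetitions into distinct points with multiplicities; the two
    lists have to match only where [g] does not vanish. *)
Lemma sum_count {R : realType} (T : eqType) (zs s : seq T) (h h' : T -> T) (m : T -> nat)
  (g : T -> R) : uniq s -> cancel h h' -> cancel h' h ->
  (forall u, u \in zs -> g u != 0 -> h' u \in s) ->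
  (forall w, w \in s -> g (h w) != 0 -> m w = count_mem (h w) zs) ->
  \sum_(u <- zs) g u = \sum_(w <- s) (m w)%:R * g (h w).
Proof.
move=> us hK h'K hz hm.
have cnt (a : pred T) (r : seq T) : \sum_(x <- r) (a x)%:R = (count a r)%:R :> R.
  by elim: r => [|x r IH]; rewrite ?big_nil// big_cons IH /= natrD.
have hs w : w \in s -> (m w)%:R * g (h w) = \sum_(u <- zs) (u == h w)%:R * g u.
  move=> ws; rewrite (eq_bigr (fun u => (pred1 (h w) u)%:R * g (h w))); last first.
    by move=> u _ /=; case: eqP => [->|_]; rewrite ?mul0r.
  rewrite -mulr_suml cnt; have [->|gw] := eqVneq (g (h w)) 0; first by rewrite !mulr0.
  by rewrite hm.
rewrite [RHS](eq_big_seq _ hs).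
rewrite exchange_big; apply: eq_big_seq => u uz /=; rewrite -mulr_suml.
have [->|gu] := eqVneq (g u) 0; first by rewrite mulr0.
rewrite (eq_bigr (fun w => (pred1 (h' u) w)%:R)).
  by rewrite cnt count_uniq_mem// hz// mul1r.
by move=> w _ /=; rewrite eq_sym (can2_eq hK h'K).
Qed.

Lemma nat_ceil {R : realType} (x : R) : 0 <= x -> exists n : nat, x < n%:R <= x + 1.
Proof.
move=> x0; exists (Num.truncn x).+1; have /andP[h1 h2] := Num.Theory.truncn_itv x0.
by rewrite h2 -natr1 lerD2r.
Qed.

(** Division by the grid total [Z]: the loss 6 and the error [c] are both at most [eta * Z], and [K]
    accounts for the points above the grid. *)
Lemma cancel_weight {R : realType} (Z X X' Y V K c eta : R) : 0 < eta -> 6 <= eta * Z -> c <= eta * Z ->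
  eta < 1 -> 0 <= X -> 0 <= V -> X' <= X + K -> (Z - 6) * X <= Z * Y + c * V ->
  (1 - eta) * (X' - K) <= Y + eta * V.
Proof.
move=> eta0 h6 hc e1 X0 V0 X'X h; have Z0 : 0 < Z.
  by rewrite -(pmulr_rgt0 _ eta0); exact: lt_le_trans h6.
apply: (@le_trans _ _ ((1 - eta) * X)).
  by apply: ler_wpM2l; slra.
rewrite -(ler_pM2l Z0); have h1 : 6 * X <= eta * Z * X by exact: ler_wpM2r.
have h2 : c * V <= eta * Z * V by exact: ler_wpM2r.
slra.
Qed.

Lemma dist_le2 {R : realType} (a b c : R) : `|a - b| <= c -> a <= b + c /\ b <= a + c.
Proof. by move=> /ler_normlP[h1 h2]; split; slra. Qed.

Lemma radii_le {R : realType} (r t rho eta : R) : 0 < r -> r < t -> 0 < rho -> rho < eta ->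
  eta < 1 / 2 ->
  [/\ r * (1 + rho) <= r * (1 + eta), r * (1 - eta) <= r * (1 - rho) & r / 4 <= r * (1 - eta)] /\
  [/\ r / 4 <= r * (1 + eta), r / 4 <= t * (1 - rho) & r / 4 <= r / 2].
Proof.
move=> r0 rt rho0 rhoe eta1; have t0 := lt_trans r0 rt.
have h1 : r * rho <= r * eta by rewrite ler_pM2l// ltW.
have h2 : r * eta <= r * (1 / 2) by rewrite ler_pM2l// ltW.
have h3 : t * rho <= t * (1 / 2) by rewrite ler_pM2l//; slra.
have h4 : 0 < r * rho by rewrite mulr_gt0.
by split; split; slra.
Qed.

Lemma wsum_tail {R : realType} (l : seq (nat * R)) (a b x : R) : b <= a ->
  wsum l (fun y => (a <= y)%R%:R) <=
  wsum l (fun y => (b <= y <= x)%R%:R) + wsum l (fun y => (x <= y)%R%:R).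
Proof.
move=> ba; rewrite /wsum -big_split/=; apply: ler_sum => p _; rewrite -mulrDr ler_wpM2l//.
case: (leP a p.2) => h; last by rewrite addr_ge0.
rewrite (le_trans ba h) /=; case: (leP x p.2) => hx; first by rewrite lerDr.
by rewrite (ltW hx) addr0.
Qed.

Lemma wsum_mono {R : realType} (l : seq (nat * R)) (a b : R) : b <= a ->
  wsum l (fun y => (a <= y)%R%:R) <= wsum l (fun y => (b <= y)%R%:R).
Proof.
move=> ba; apply: wsum_le => p _; case: (leP a p.2) => [h|_]; last by [].
by rewrite (le_trans ba h).
Qed.

(** * Comparison of the two counting functions *)

Section Comparison.
Context {R : realType} {H : completeNormedModType R[i]}.
Variable dot : {dot H for (@Num.conj R[i])}.
Hypothesis hn : hilbert_norm dot.
Variables (D : set R[i]) (A : R[i] -> boundedOp H) (P0 : boundedOp H).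
Hypotheses (oD : open D) (D0 : D 0) (hA : holomorphic_on D A).
Hypotheses (cA : forall z, D z -> fapprox hn (A z)) (sA : selfadjoint_op dot (A 0)).
Hypotheses (hP0 : orth_proj dot (op_ker (A 0)) P0).
Hypothesis invA : op_invertible (idop H - compop (derive1 A 0) P0).
Implicit Types (z w u v : R[i]) (t k rho eps theta r x : R).

Definition char_list (s : seq R[i]) (m : R[i] -> nat) : seq (nat * R) :=
  [seq (m w, complex.Re w) | w <- s].

Definition eigen_list n (lam : 'I_n -> R) : seq (nat * R) := [seq (1%N, lam j) | j <- enum 'I_n].

Lemma wsum_char s m (g : R -> R) :
  wsum (char_list s m) g = \sum_(w <- s) (m w)%:R * g (complex.Re w).
Proof. by rewrite /wsum big_map. Qed.

Lemma wsum_eigen n (lam : 'I_n -> R) (g : R -> R) : wsum (eigen_list lam) g = \sum_j g (lam j).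
Proof.
by rewrite /wsum big_map big_enum; apply: eq_bigr => j _; rewrite mul1r.
Qed.

(** As [kcut] vanishes outside [(1 - rho, 1 + rho)], the sums over a window equal sums over lists of
    all points down to [a], which no longer depend on the scale [t]. *)
Lemma window_lists theta rho eps : 0 < theta -> 0 < rho -> 60 * rho < 1 -> 0 < eps ->
  exists k t0 : R, [/\ 0 < k, 64 * k <= rho, 0 < t0 &
  forall t a n (e : 'I_n -> H) lam s m, 0 < t -> t < t0 -> t <= 1 / 2 -> a <= t / 2 ->
  eigfam dot (A 0) a 1 e lam -> uniq s ->
  (forall w, w \in s <-> char_value D A w /\ sector theta a 1 w) ->
  (forall w, w \in s -> char_mult dot D A w = (m w)%:Z) ->
  `|wsum (char_list s m) (fun x => kcut k rho (x / t)) -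
    wsum (eigen_list lam) (fun x => kcut k rho (x / t))| <=
  eps * k * wsum (eigen_list lam) (fun x => (t / 2 <= x <= 2 * t)%R%:R)].
Proof.
move=> th0 rho0 rho60 e0.
have [k [t0 [k0 k64 t00 hw]]] := window_comparison oD D0 hA cA sA hP0 invA th0 rho0 rho60 e0.
exists k, t0; split=> // t a n e lam s m tp tt0 t2 at2 hE us hs hm.
have tC : (t%:C)%C != 0 :> R[i] by rewrite eq_complex /= gt_eqF.
have cK : cancel (fun w => w / (t%:C)%C) (fun u => (t%:C)%C * u).
  by move=> w; rewrite mulrC mulfVK.
have cK' : cancel (fun u => (t%:C)%C * u) (fun w => w / (t%:C)%C).
  by move=> w; rewrite mulrC mulKf.
have Reu u : complex.Re ((t%:C)%C * u) = t * complex.Re u.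
  by case: u => x y /=; rewrite mul0r subr0.
have Rew w : complex.Re (w / (t%:C)%C) = complex.Re w / t.
  by have := Reu (w / (t%:C)%C); rewrite (cK w : _ = w) => ->; rewrite mulrAC mulfV ?mul1r// gt_eqF.
have t21 : 2 * t <= 1 by slra.
have [zs [h1 h2]] := hw t _ _ _ tp tt0 (eigfam_sub sA hE at2 t21).
have nk x : kcut k rho x != 0 -> `|x - 1| < rho.
  by rewrite /kcut; case: ifP => //; rewrite eqxx.
rewrite (sum_count (h := fun w => w / (t%:C)%C) (h' := fun u => (t%:C)%C * u) (s := s)
  (m := m) (g := fun u => kcut k rho (complex.Re u)) us cK cK'); first last.
- move=> w ws; rewrite Rew => /nk wr; have [cw [_ sw]] := (hs w).1 ws.
  have wz := h2 w cw sw wr; have [_ _] := h1 _ wz; rewrite cK hm// => -[].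
  exact.
- move=> u uz /nk ur; have [c1 s1 _] := h1 u uz; apply/hs; split=> //; split=> //.
  rewrite Reu; move: ur; rewrite ltr_norml => /andP[u1 u2]; apply/andP; split; snra.
rewrite wsum_char !wsum_eigen.
rewrite (eq_bigr (fun w => (m w)%:R * kcut k rho (complex.Re w / t))); last first.
  by move=> w _; rewrite Rew.
set W := [pred j | _]; have -> : \sum_(j < #|W|) kcut k rho (lam (enum_val j) / t) =
    \sum_j kcut k rho (lam j / t).
  rewrite -(big_enum_val (fun j => kcut k rho (lam j / t))) big_mkcond /=.
  apply: eq_bigr => j _; case: ifP => // jW; apply/esym/eqP; apply: contraFT jW => /nk.
  rewrite inE ltr_norml => /andP[u1 u2].
  have u1' : 1 / 2 < lam j / t by slra.
  have u2' : lam j / t < 2 by slra.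
  by move: u1' u2'; rewrite ltr_pdivlMr// ltr_pdivrMr// => *; apply/andP; split; slra.
have -> : \sum_j (t / 2 <= lam j <= 2 * t)%R%:R = #|W|%:R :> R.
  by rewrite -natr_sum -sum1_card [in RHS]big_mkcond.
exact.
Qed.

(** [fine] loses nothing for small [r]: finiteness of the two counts is in [eigen_num_list] and
    [sector_numE]. *)
Definition eigen_num r : R := fine (eigen_count (A 0) [set x | r <= x <= 1]).
Definition sector_num theta r : R := fine (char_count dot D A (sector theta r 1)).

Lemma eigen_num_list a n (e : 'I_n -> H) lam r : eigfam dot (A 0) a 1 e lam -> a <= r ->
  eigen_count (A 0) [set x | r <= x <= 1] = (eigen_num r)%:E /\
  eigen_num r = wsum (eigen_list lam) (fun x => (r <= x)%R%:R).
Proof.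
move=> hE ar; rewrite /eigen_num (eigen_count_window hn sA hE ar (lexx 1)); split=> //=.
rewrite wsum_eigen natr_sum; apply: eq_bigr => j _.
have [[_ _ /(_ j)/andP[_ ->]] _] := hE; by rewrite andbT.
Qed.

Lemma sector_num_list theta a s m r : a <= r -> uniq s ->
  (forall w, w \in s <-> char_value D A w /\ sector theta a 1 w) ->
  (forall w, w \in s -> char_mult dot D A w = (m w)%:Z) ->
  char_count dot D A (sector theta r 1) = (sector_num theta r)%:E /\
  sector_num theta r = wsum (char_list s m) (fun x => (r <= x)%R%:R).
Proof.
move=> ar us hs hm; rewrite /sector_num /char_count.
rewrite (esum_seq (s := [seq w <- s | r <= complex.Re w]) (m := m)); first last.
- by move=> w; rewrite mem_filter => /andP[_ ws]; rewrite hm.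
- move=> w; rewrite mem_filter; split.
    move=> [[/andP[h1 h2] h3] h4]; rewrite h1; apply/hs; split=> //; split=> //.
    by rewrite h2 (le_trans ar).
  by move=> /andP[h1 /hs[h4 [/andP[_ h2] h3]]]; split=> //; split=> //; rewrite h1.
- exact: filter_uniq.
split=> //=; rewrite wsum_char big_filter big_mkcond; apply: eq_bigr => w _.
by case: ifP; rewrite ?mulr1 ?mulr0.
Qed.

Hypothesis (theta : R) (th0 : 0 < theta).
Hypothesis secD : forall r, 0 < r < 1 -> sector theta r 1 `<=` D.

Lemma sector_numE r : 0 < r <= 1 ->
  char_count dot D A (sector theta r 1) = (sector_num theta r)%:E.
Proof.
move=> rr; have [s [m [us hs hm]]] := sector_finite oD D0 hA cA sA hP0 invA th0 secD rr.
by have [] := sector_num_list (lexx r) us hs hm.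
Qed.

(** The grid runs from [r] up to a scale [t] fixed independently of [r], so everything above it
    contributes a constant [K]; the roles of the two measures are symmetric except in the error
    term. *)
Lemma global_comparison eta : 0 < eta -> eta < 1 / 2 ->
  exists K r1 : R, 0 < r1 /\ forall r, 0 < r -> r < r1 ->
    (1 - eta) * (sector_num theta (r * (1 + eta)) - K) <=
      eigen_num (r * (1 - eta)) + eta * eigen_num (r / 2) /\
    (1 - eta) * (eigen_num (r * (1 + eta)) - K) <=
      sector_num theta (r * (1 - eta)) + eta * eigen_num (r / 2).
Proof.
(* [eta / 61] ensures [60 * rho < 1] and [rho < eta]; [eta / 34] matches the bounds
   [k * W <= 17 * m0] and [m0 / 2 <= Z] below. *)
move=> eta0 eta1; pose rho := eta / 61; pose eps := eta / 34.
have rho0 : 0 < rho by rewrite /rho; lra.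
have rhoe : rho < eta by rewrite /rho; lra.
have rho60 : 60 * rho < 1 by rewrite /rho; lra.
have rho2 : rho < 1 / 2 by lra.
have eps0 : 0 < eps by rewrite /eps; lra.
have [k [t0 [k0 k64 t00 hw]]] := window_lists th0 rho0 rho60 eps0.
have k1 : k < rho by lra.
have eta1' : eta < 1 by lra.
have [t [tp tt0 t2]] : exists t : R, [/\ 0 < t, t < t0 & t <= 1 / 2].
  exists (Num.min (t0 / 2) (1 / 2)); rewrite lt_min gt_min ge_min lexx orbT.
  by split=> //; [apply/andP; split|apply/orP; left]; lra.
have e12 : 0 <= 12 / eta by rewrite divr_ge0// ltW.
have [m0 /andP[m0l _]] := nat_ceil e12.
have m00 : (0 : R) < m0%:R by exact: le_lt_trans m0l.
have m0eta : 12 <= eta * m0%:R.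
  by rewrite mulrC -ler_pdivrMr// ltW.
(* With this ratio [m0] steps stay within [k] of 1, hence [m0 / 2 <= Z]; [12 <= eta * m0] then gives
   [6 <= eta * Z]. *)
pose sg := k / (2 * m0%:R); have sg0 : 0 < sg by rewrite /sg divr_gt0// mulr_gt0.
have sgk : 2 * m0%:R * sg = k by rewrite /sg mulrC mulfVK// gt_eqF// mulr_gt0.
have s8 : 0 <= 8 / sg by rewrite divr_ge0// ltW.
have [W /andP[Wl Wu]] := nat_ceil s8.
have q1 : 1 < 1 + sg by lra.
have qW : 8 < (1 + sg) ^+ W.
  apply: lt_le_trans (bernoulli_lower W (ltW sg0)).
  move: Wl; rewrite ltr_pdivrMr//; lra.
have qJ : 2 <= (1 + sg) ^+ W by lra.
have s8E : 8 / sg * k = 16 * m0%:R by rewrite -sgk; field; rewrite gt_eqF.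
have m0W : (m0 <= W)%N.
  rewrite -(ler_nat R); apply: le_trans (ltW Wl); rewrite -(ler_pM2r k0) s8E mulrC.
  by apply: ler_wpM2r; [exact: ltW|lra].
have qm : (1 + sg) ^+ m0 <= 1 + k.
  by rewrite -[k in X in _ <= X]sgk; apply: bernoulli_upper; rewrite ?(ltW sg0)// sgk; lra.
have Zge := grid_total_ge k0 q1 k1 m0W qm.
set Z := grid_total k rho (1 + sg) W in Zge.
have Z6 : 6 <= eta * Z.
  have : eta * (m0%:R / 2) <= eta * Z by apply: ler_wpM2l => //; exact: ltW.
  lra.
have cZ : eps * k * W%:R <= eta * Z.
  have h1 : k * W%:R <= 17 * m0%:R.
    have : k * W%:R <= k * (8 / sg + 1) by apply: ler_wpM2l => //; exact: ltW.
    have m01 : (1 : R) <= m0%:R by rewrite ler1n -(ltr_nat R).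
    by rewrite mulrDr mulr1 (mulrC k (8 / sg)) s8E; lra.
  rewrite -mulrA; apply: (@le_trans _ _ (eps * (17 * m0%:R))).
    by apply: ler_wpM2l => //; exact: ltW.
  have : eta * (m0%:R / 2) <= eta * Z by apply: ler_wpM2l => //; exact: ltW.
  rewrite /eps; lra.
(* The counts above the top scale; the constant must serve both inequalities. *)
pose KC := sector_num theta (t * (1 - rho)); pose KE := eigen_num (t * (1 - rho)).
exists (Num.max KC KE), t; split=> // r r0 rt.
have [I rI hI] : exists2 I, t <= r * (1 + sg) ^+ I & forall i, (i < I)%N -> r * (1 + sg) ^+ i <= t.
  have rs : 0 < r * sg by exact: mulr_gt0.
  have trs : 0 <= t / (r * sg) by rewrite divr_ge0// ltW.
  have [I' /andP[hI' _]] := nat_ceil trs.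
  have tI' : t <= r * (1 + sg) ^+ I'.
    apply: (@le_trans _ _ (r * (1 + I'%:R * sg))); last first.
      by apply: ler_wpM2l; [exact: ltW|apply: bernoulli_lower; exact: ltW].
    move: hI'; rewrite ltr_pdivrMr//; lra.
  have [I II' [h1 h2]] := grid_split (1 + sg) r t I'; exists I => //.
  case: (ltnP I I') => [/h2/ltW//|I'I].
  by rewrite (_ : I = I')//; apply/eqP; rewrite eqn_leq II'.
(* One family and one list reaching down to [r / 4] serve all scales: windows extend down to
   [r / 2], and counts are taken at [r / 2] and [r * (1 - eta)]. *)
have a0 : 0 < r / 4 by lra.
have a1 : 0 < r / 4 <= 1 by rewrite a0; lra.
have [n [e [lam hE]]] := eigfam_exists (cA D0) 1 a0.
have [s [m [us hs hm]]] := sector_finite oD D0 hA cA sA hP0 invA th0 secD a1.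
have pE p : p \in eigen_list lam -> 0 < p.2.
  move=> /mapP[j _ ->] /=; have [[_ _ /(_ j)/andP[h _]] _] := hE; exact: lt_le_trans h.
have pM p : p \in char_list s m -> 0 < p.2.
  move=> /mapP[w /hs[_ [/andP[h _] _]] ->] /=; exact: lt_le_trans h.
have win i : (i < I)%N -> `|wsum (char_list s m) (fun x => kcut k rho (x / (r * (1 + sg) ^+ i))) -
    wsum (eigen_list lam) (fun x => kcut k rho (x / (r * (1 + sg) ^+ i)))| <=
    eps * k * wsum (eigen_list lam)
      (fun x => (r * (1 + sg) ^+ i / 2 <= x <= 2 * (r * (1 + sg) ^+ i))%R%:R).
  move=> /hI si; have si0 : r <= r * (1 + sg) ^+ i.
    by rewrite ler_peMr ?(ltW r0)// exprn_ege1// ltW.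
  apply: hw hE us hs hm.
  - exact: lt_le_trans r0 si0.
  - exact: le_lt_trans si tt0.
  - exact: le_trans si t2.
  - by lra.
have e0 := ltW eps0.
have winM i iI := (dist_le2 (win i iI)).1.
have winE i iI := (dist_le2 (win i iI)).2.
have GM := grid_comparison k0 rho0 rho2 q1 r0 qJ qW rI e0 pE pM pE winM.
have GE := grid_comparison k0 rho0 rho2 q1 r0 qJ qW rI e0 pE pE pM winE.
have ratioC x : r / 4 <= x -> sector_num theta x = wsum (char_list s m) (fun y => (x <= y)%R%:R).
  by move=> rx; have [] := sector_num_list rx us hs hm.
have ratioE x : r / 4 <= x -> eigen_num x = wsum (eigen_list lam) (fun y => (x <= y)%R%:R).
  by move=> rx; have [] := eigen_num_list hE rx.
have [[re1 re2 re3] [re4 re5 re6]] := radii_le r0 rt rho0 rhoe eta1.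
have tail l := wsum_tail l (t * (1 - rho)) re1; have mono l := wsum_mono l re2.
have Z0 : 0 <= Z by apply: le_trans Zge; rewrite divr_ge0.
split.
- apply: (cancel_weight eta0 Z6 cZ eta1' _ _ _ (le_trans GM _)).
  + exact: wsum_ge0.
  + by rewrite ratioE//; exact: wsum_ge0.
  + rewrite ratioC//; apply: le_trans (tail _) _.
    by rewrite lerD2l -ratioC// le_max lexx.
  + by rewrite lerD// ?ratioE// ler_wpM2l// ratioE.
- apply: (cancel_weight eta0 Z6 cZ eta1' _ _ _ (le_trans GE _)).
  + exact: wsum_ge0.
  + by rewrite ratioE//; exact: wsum_ge0.
  + rewrite ratioE//; apply: le_trans (tail _) _.
    by rewrite lerD2l -ratioE// le_max lexx orbT.
  + by rewrite lerD// ?ratioE// ler_wpM2l// ratioC.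
Qed.

End Comparison.

(** * Regular growth *)

Section Growth.
Context {R : realType}.
Implicit Types (Phi f g e : R -> R) (r y d eps delta : R).

Lemma near_right0 (P : R -> Prop) : (\forall r \near 0^'+, P r) <->
  exists2 d : R, 0 < d & forall r, 0 < r -> r < d -> P r.
Proof.
split.
  rewrite near_withinE => /nbhs_ballP[d /= d0 h]; exists d => // r r0 rd.
  by apply: h => //; rewrite /ball /= sub0r normrN gtr0_norm.
move=> [d d0 h]; rewrite near_withinE; apply/nbhs_ballP; exists d => // r.
by rewrite /ball /= sub0r normrN => rd r0; apply: h => //; rewrite gtr0_norm in rd.
Qed.

(** The three clauses absorb, in this order, the constant [K], the error term taken at radius
    [r / 2], and the dilations of the radius by [1 + eta] and [1 - eta]. *)
Definition regular_growth Phi :=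
  [/\ forall M : R, exists2 d, 0 < d & forall r, 0 < r -> r < d -> M <= Phi r,
    exists M d : R, [/\ 0 < M, 0 < d & forall r y, 0 < r -> r < d -> r / 4 <= y -> y <= r ->
      Phi y <= M * Phi r] &
    forall eps, 0 < eps -> exists delta d : R, [/\ 0 < delta, 0 < d &
      forall r y, 0 < r -> r < d -> (1 - delta) * r <= y -> y <= r ->
        Phi y <= (1 + eps) * Phi r]].

Lemma powR_near1 (gamma eps : R) : 0 < gamma -> 0 < eps -> exists2 delta : R, 0 < delta &
  forall y, 1 <= y -> y <= 1 + delta -> y `^ gamma <= 1 + eps.
Proof.
move=> g0 e0; have l0 : 0 < ln (1 + eps) by apply: ln_gt0; slra.
exists (ln (1 + eps) / gamma); first exact: divr_gt0.
move=> y y1 yd; have y0 : 0 < y by slra.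
rewrite /powR gt_eqF//; apply: (@le_trans _ _ (expR (ln (1 + eps)))).
  rewrite ler_expR mulrC -ler_pdivlMr//; have := ln_sub_le y0 (@ltr01 R).
  by rewrite ln1 subr0 divr1; slra.
by rewrite lnK// posrE; slra.
Qed.

Lemma norm_ln_gt (B r : R) : 0 < B -> 0 < r -> r < expR (- B) -> B < `|ln r| /\ `|ln r| = - ln r.
Proof.
move=> B0 r0 rB; have h : ln r < - B by rewrite -ltr_expR lnK.
have -> : `|ln r| = - ln r by rewrite ltr0_norm//; slra.
by split=> //; slra.
Qed.

Lemma norm_ln_quarter (eps : R) : 0 < eps -> exists2 d : R, 0 < d &
  forall r y, 0 < r -> r < d -> r / 4 <= y -> y <= r ->
  [/\ 1 < `|ln r|, `|ln r| <= `|ln y| & `|ln y| <= (1 + eps) * `|ln r|].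
Proof.
move=> e0; have l4 : 0 < ln 4 :> R by apply: ln_gt0; slra.
pose B := Num.max 1 (ln 4 / eps); have B0 : 0 < B by rewrite lt_max ltr01.
exists (expR (- B)); first exact: expR_gt0.
move=> r y r0 rB ry yr; have [rL ->] := norm_ln_gt B0 r0 rB.
have y0 : 0 < y by slra.
have [_ ->] := norm_ln_gt B0 y0 (le_lt_trans yr rB).
have [] := norm_ln_gt B0 r0 rB; rewrite gt_max => /andP[h1 h2] h3; rewrite h3 in h1 h2.
have lyr : ln y <= ln r by rewrite ler_ln.
have : ln (r / 4) <= ln y by rewrite ler_ln// posrE; slra.
rewrite ln_div ?posrE// => l3; split; [exact: h1|slra|].
by move: h2; rewrite ltr_pdivrMr// => h2; slra.
Qed.

(** The logarithmic growths vary slowly even over a factor 4, so a single estimate gives both ratio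
    clauses. *)
Lemma regular_growth_slow Phi :
  (forall M : R, exists2 d, 0 < d & forall r, 0 < r -> r < d -> M <= Phi r) ->
  (forall eps : R, 0 < eps -> exists2 d : R, 0 < d & forall r y, 0 < r -> r < d ->
    r / 4 <= y -> y <= r -> Phi y <= (1 + eps) * Phi r) ->
  regular_growth Phi.
Proof.
move=> h1 h2; split=> //.
  by have [d d0 hd] := h2 1 ltr01; exists (1 + 1), d.
move=> eps e0; have [d d0 hd] := h2 eps e0; exists (3 / 4), d; split=> // r y r0 rd ry yr.
by apply: hd => //; slra.
Qed.

Lemma admissible_regular Phi : admissible_growth Phi -> regular_growth Phi.
Proof.
move=> [gamma [C [g0 C0 hPhi]]].
have inf M : exists2 d : R, 0 < d & forall r, 0 < r -> r < d -> M <= Phi r.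
  pose M' := Num.max M 1; have M0 : 0 < M' by rewrite lt_max ltr01 orbT.
  have MM : M <= M' by rewrite le_max lexx.
  have exp_ge (x : R) : x <= expR x by have := expR_ge1Dx x; slra.
  have MC : 0 < M' / C by exact: divr_gt0.
  suff : exists2 d : R, 0 < d & forall r, 0 < r -> r < d -> M' / C <= Phi r / C.
    move=> [d d0 hd]; exists d => // r r0 rd; apply: le_trans MM _.
    by have := hd r r0 rd; rewrite ler_pM2r ?invr_gt0.
  case: hPhi => hPhi.
  - have B0 : 0 < M' / C / gamma by exact: divr_gt0.
    exists (expR (- (M' / C / gamma))); first exact: expR_gt0.
    move=> r r0 rd; have [h1 h2] := norm_ln_gt B0 r0 rd; rewrite hPhi [C * _]mulrC mulfK ?gt_eqF//.
    rewrite /powR gt_eqF//; apply: le_trans (exp_ge _).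
    by move: h1; rewrite h2 ltr_pdivrMr//; slra.
  - have B0 : 0 < expR (M' / C / gamma) by exact: expR_gt0.
    exists (expR (- expR (M' / C / gamma))); first exact: expR_gt0.
    move=> r r0 rd; have [h1 _] := norm_ln_gt B0 r0 rd; rewrite hPhi [C * _]mulrC mulfK ?gt_eqF//.
    have L0 := lt_trans B0 h1.
    rewrite /powR gt_eqF//; apply: le_trans (exp_ge _).
    by move: h1; rewrite -ltr_ln ?posrE// expRK ltr_pdivrMr//; slra.
  - have B0 : 0 < expR (4 * (M' / C)) by exact: expR_gt0.
    exists (expR (- expR (4 * (M' / C)))); first exact: expR_gt0.
    move=> r r0 rd; have [h1 _] := norm_ln_gt B0 r0 rd; rewrite hPhi [C * _]mulrC mulfK ?gt_eqF//.
    have L0 := lt_trans B0 h1; move: h1; rewrite -ltr_ln ?posrE// expRK => h1.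
    have u0 : 0 < ln `|ln r| by slra.
    (* With [u = ln |ln r|] the growth is [exp u / u], which is at least [u / 4] because
       [exp (u / 2)] exceeds [u / 2]. *)
    rewrite ler_pdivlMr// -[X in _ <= X]lnK ?posrE//; move: (ln `|ln r|) u0 h1 => u u0 h1.
    have h2 := expR_ge1Dx (u / 2).
    have -> : u = u / 2 + u / 2 by slra.
    rewrite expRD; move: (expR (u / 2)) h2 => E h2.
    have : (u / 2) * (u / 2) <= E * E by apply: ler_pM; slra.
    have : M' / C * u <= u / 4 * u by apply: ler_wpM2r; slra.
    slra.
case: hPhi => hPhi.
- have ratio (r y c : R) : 0 < y -> y <= r -> r <= c * y -> Phi y <= c `^ gamma * Phi r.
    move=> y0 yr rc; have r0 : 0 < r by slra.
    have -> : Phi y = (r / y) `^ gamma * Phi r.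
      rewrite !hPhi mulrCA; congr (C * _); rewrite /powR !gt_eqF ?divr_gt0// -expRD.
      by rewrite ln_div ?posrE//; congr expR; ring.
    have c0 : 0 <= c by rewrite -(pmulr_lge0 _ y0); slra.
    apply: ler_wpM2r; first by rewrite hPhi mulr_ge0 ?powR_ge0// ltW.
    by apply: ge0_ler_powR; rewrite ?nnegrE ?(ltW g0)// ?divr_ge0 ?ler_pdivrMr// ltW.
  split=> //.
    exists (4 `^ gamma), 1; rewrite powR_gt0//; split=> // r y r0 _ ry yr.
    by apply: ratio => //; slra.
  move=> eps e0; have [delta d0 hd] := powR_near1 g0 e0.
  (* Then [(1 - delta / (1 + delta)) * r <= y] reads [r <= (1 + delta) * y]. *)
  exists (delta / (1 + delta)), 1; split=> //; first by rewrite divr_gt0//; slra.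
  move=> r y r0 _ ry yr; have E : 1 - delta / (1 + delta) = (1 + delta)^-1.
    by field; rewrite gt_eqF//; slra.
  have d1 : 0 < 1 + delta by slra.
  rewrite E mulrC ler_pdivrMr// mulrC in ry.
  have y0 : 0 < y by rewrite -(pmulr_rgt0 _ d1); slra.
  apply: le_trans (ratio _ _ _ y0 yr ry) _; apply: ler_wpM2r.
    by rewrite hPhi mulr_ge0 ?powR_ge0// ltW.
  by apply: hd; slra.
- apply: regular_growth_slow => // eps e0; have [delta d0 hd] := powR_near1 g0 e0.
  have [d dp h] := norm_ln_quarter d0; exists d => // r y r0 rd ry yr.
  have [h1 h2 h3] := h r y r0 rd ry yr; rewrite !hPhi (mulrCA (1 + eps)) ler_pM2l//.
  have L0 : 0 < `|ln r| by slra.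
  apply: (@le_trans _ _ (((1 + delta) * `|ln r|) `^ gamma)).
    by apply: ge0_ler_powR; rewrite ?nnegrE ?(ltW g0)// mulr_ge0//; slra.
  rewrite powRM//; last by slra.
  by apply: ler_wpM2r; [exact: powR_ge0|apply: hd; slra].
- apply: regular_growth_slow => // eps e0.
  have [d dp h] := norm_ln_quarter e0; exists d => // r y r0 rd ry yr.
  have [h1 h2 h3] := h r y r0 rd ry yr; rewrite !hPhi (mulrCA (1 + eps)) ler_pM2l//.
  have u0 : 0 < ln `|ln r| by rewrite ln_gt0.
  have uv : ln `|ln r| <= ln `|ln y| by rewrite ler_ln ?posrE//; slra.
  rewrite mulrA; apply: ler_pM => //.
    by rewrite invr_ge0; slra.
  by rewrite lef_pV2 ?posrE//; slra.
Qed.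

(** [F], [F1] and [F2] stand for [Phi] at the point itself, at the slightly smaller radius and at
    the radius of the error term. *)
Lemma ratio_upper (eps eta F K M f g1 g2 F1 F2 : R) : 0 < eps -> eps <= 1 / 20 -> 0 < eta ->
  eta <= eps -> 0 < F -> K <= eps * F -> (1 - eta) * (f - K) <= g1 + eta * g2 ->
  g1 <= (1 + eps) * F1 -> F1 <= (1 + eps) * F -> g2 <= 2 * F2 -> F2 <= M * F ->
  eta * M <= eps -> f <= (1 + 20 * eps) * F.
Proof.
move=> e0 e1 n0 ne F0 KF h h1 h2 h3 h4 h5.
have k1 : (1 + eps) * F1 <= (1 + eps) * ((1 + eps) * F) by apply: ler_wpM2l => //; slra.
have k2 : eta * g2 <= eta * (2 * (M * F)) by apply: ler_wpM2l; slra.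
have k3 : eta * M * F <= eps * F by apply: ler_wpM2r; slra.
have k4 : eps * (eps * F) <= 1 / 20 * (eps * F) by apply: ler_wpM2r => //; rewrite mulr_ge0; slra.
have eF : 0 < eps * F by exact: mulr_gt0.
have k5 : (1 - eta) * (f - K) <= (1 + 5 * eps) * F by slra.
rewrite leNgt; apply/negP => hf.
have k6 : (1 - eps) * (18 * eps * F + F) <= (1 - eta) * (f - K).
  by apply: ler_pM; slra.
slra.
Qed.

Lemma ratio_lower (eps eta F K M f g1 g2 F1 F2 : R) : 0 < eps -> eps <= 1 / 20 -> 0 < eta ->
  eta <= eps -> 0 < F -> K <= eps * F -> (1 - eta) * (g1 - K) <= f + eta * g2 ->
  (1 - eps) * F1 <= g1 -> F <= (1 + eps) * F1 -> g2 <= 2 * F2 -> F2 <= M * F ->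
  eta * M <= eps -> (1 - 20 * eps) * F <= f.
Proof.
move=> e0 e1 n0 ne F0 KF h h1 h2 h3 h4 h5.
have k1 : (1 - eps) * F <= (1 - eps) * ((1 + eps) * F1) by apply: ler_wpM2l => //; slra.
have k2 : eta * g2 <= eta * (2 * (M * F)) by apply: ler_wpM2l; slra.
have k3 : eta * M * F <= eps * F by apply: ler_wpM2r; slra.
have eF : 0 < eps * F by exact: mulr_gt0.
have k0 : (1 + eps) * ((1 - eps) * F1) <= (1 + eps) * g1 by apply: ler_wpM2l; slra.
have k4 : (1 - 3 * eps) * F <= g1.
  rewrite leNgt; apply/negP => hg.
  have : (1 + eps) * g1 < (1 + eps) * ((1 - 3 * eps) * F) by rewrite ltr_pM2l; slra.
  have : 0 <= eps * (eps * F) by rewrite mulr_ge0; slra.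
  slra.
have k6 : (1 - eps) * ((1 - 4 * eps) * F) <= (1 - eta) * (g1 - K).
  by apply: ler_pM; rewrite ?mulr_ge0; slra.
have : 0 <= eps * (eps * F) by rewrite mulr_ge0; slra.
slra.
Qed.

Lemma dilated_radius (x eta delta : R) : 0 < x -> 0 < eta -> eta <= 1 / 20 ->
  2 * eta <= delta -> exists r, [/\ r * (1 + eta) = x, 0 < r <= x,
    0 < r * (1 - eta) <= x, (1 - delta) * x <= r * (1 - eta) & x / 4 <= r / 2 <= x].
Proof.
move=> x0 n0 n1 n2; exists (x / (1 + eta)).
have E : x / (1 + eta) * (1 + eta) = x by rewrite mulfVK// gt_eqF//; slra.
have : 0 < x / (1 + eta) by rewrite divr_gt0//; slra.
move: (x / (1 + eta)) E => r E r0; have rn : 0 < r * eta by exact: mulr_gt0.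
have rn1 : r * eta <= r * (1 / 20) by rewrite ler_pM2l.
have rn2 : r * eta * (1 + eta) <= r * eta * (1 + eta) * 1 by rewrite mulr1.
have d1 : 2 * eta * x <= delta * x by rewrite ler_pM2r.
have re : 0 <= r * eta * eta by rewrite mulr_ge0// ltW.
by rewrite -E in d1 *; split=> //; try (apply/andP; split); slra.
Qed.

Lemma contracted_radius (x eta delta : R) : 0 < x -> 0 < eta -> eta <= 1 / 20 ->
  2 * eta <= delta -> exists r, [/\ r * (1 - eta) = x, 0 < r <= 4 * x,
    x <= r * (1 + eta) <= 4 * x, (1 - delta) * (r * (1 + eta)) <= x & x / 4 <= r / 2 <= x].
Proof.
move=> x0 n0 n1 n2; exists (x / (1 - eta)).
have E : x / (1 - eta) * (1 - eta) = x by rewrite mulfVK// gt_eqF//; slra.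
have : 0 < x / (1 - eta) by rewrite divr_gt0//; slra.
move: (x / (1 - eta)) E => r E r0; have rn : 0 < r * eta by exact: mulr_gt0.
have rn1 : r * eta <= r * (1 / 20) by rewrite ler_pM2l.
have y0 : 0 < r * (1 + eta) by rewrite mulr_gt0//; slra.
have d1 : 2 * eta * (r * (1 + eta)) <= delta * (r * (1 + eta)) by rewrite ler_pM2r.
have re : 0 <= r * eta * eta by rewrite mulr_ge0// ltW.
by split=> //; try (apply/andP; split); slra.
Qed.

Lemma approx_bounds (eps P e : R) : 0 < eps -> eps <= 1 / 20 -> 1 <= P -> `|0 - e| <= eps ->
  [/\ (1 - eps) * P <= P * (1 + e), P * (1 + e) <= (1 + eps) * P & P * (1 + e) <= 2 * P].
Proof.
move=> e0 e1 P1; rewrite sub0r normrN ler_norml => /andP[h1 h2].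
have k1 : P * - eps <= P * e by apply: ler_wpM2l => //; slra.
have k2 : P * e <= P * eps by apply: ler_wpM2l => //; slra.
have k3 : P * eps <= P * (1 / 20) by apply: ler_wpM2l => //; slra.
by split; slra.
Qed.

(** At a given [x] the upper bound uses the radius with [r * (1 + eta) = x] in the first inequality,
    the lower bound the radius with [r * (1 - eta) = x] in the second; [eta] is small enough that
    the error term costs at most [2 * eps]. *)
Lemma asymptotic_transfer Phi f g e : regular_growth Phi ->
  (forall eta : R, 0 < eta -> eta < 1 / 2 -> exists K r1 : R, 0 < r1 /\
    forall r, 0 < r -> r < r1 ->
    (1 - eta) * (f (r * (1 + eta)) - K) <= g (r * (1 - eta)) + eta * g (r / 2) /\
    (1 - eta) * (g (r * (1 + eta)) - K) <= f (r * (1 - eta)) + eta * g (r / 2)) ->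
  e @ 0^'+ --> 0 -> (\forall r \near 0^'+, g r = Phi r * (1 + e r)) ->
  (fun r => f r / Phi r - 1) @ 0^'+ --> 0.
Proof.
move=> [hinf [M [d1 [M0 d10 hM]]] hc] hcmp he hg.
apply/cvgrPdist_le => /= eps0 eps00.
pose eps := Num.min (eps0 / 20) (1 / 20).
have [e0 e1 e2] : [/\ 0 < eps, eps <= 1 / 20 & 20 * eps <= eps0].
  have h1 : eps <= eps0 / 20 by rewrite ge_min lexx.
  have h2 : eps <= 1 / 20 by rewrite ge_min lexx orbT.
  by rewrite lt_min; split; [apply/andP; split| |]; slra.
have [delta [d2 [delta0 d20 hd2]]] := hc eps e0.
have [eta [n0 n1 n2 n3]] : exists eta : R, [/\ 0 < eta, eta <= eps, 2 * eta <= delta & eta * M <= eps].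
  exists (Num.min eps (Num.min (delta / 2) (eps / M))); set x := Num.min _ _.
  have h1 : x <= eps by rewrite ge_min lexx.
  have h2 : x <= delta / 2 by rewrite !ge_min lexx orbT.
  have h3 : x <= eps / M by rewrite !ge_min lexx !orbT.
  split=> //; last by rewrite -ler_pdivlMr.
    by rewrite /x lt_min e0 lt_min !divr_gt0.
  slra.
have n4 : eta < 1 / 2 by slra.
have [K [r1 [r10 hK]]] := hcmp eta n0 n4.
have [d3 d30 hd3] := hinf (Num.max 1 (K / eps)).
have /near_right0[d4 d40 hd4] := hg.
have /cvgrPdist_le/(_ _ e0)/near_right0[d5 d50 hd5] := he.
pose d := Num.min r1 (Num.min d1 (Num.min d2 (Num.min d3 (Num.min d4 d5)))).
have d0 : 0 < d by rewrite !lt_min r10 d10 d20 d30 d40.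
have dle r : r < d -> [/\ r < r1, r < d1, r < d2, r < d3 & r < d4 /\ r < d5].
  by rewrite !lt_min => /and5P[? ? ? ? /andP[? ?]].
have gE y : 0 < y -> y < d -> [/\ 1 <= Phi y, K <= eps * Phi y &
    [/\ (1 - eps) * Phi y <= g y, g y <= (1 + eps) * Phi y & g y <= 2 * Phi y]].
  move=> y0 /dle[_ _ _ y3 [y4 y5]].
  have := hd3 y y0 y3; rewrite ge_max ler_pdivrMr// [Phi y * eps]mulrC => /andP[P1 KP].
  by split=> //; rewrite hd4//; apply: approx_bounds => //; exact: hd5.
(* The radii of [contracted_radius] may reach [4 * x]. *)
apply/near_right0; exists (d / 4); first by rewrite divr_gt0.
move=> x x0; rewrite ltr_pdivlMr// mulrC => x4d.
have xd : x < d by apply: le_lt_trans x4d; rewrite ler_peMl ?(ltW x0) ?ler1n.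
have [x1 x2 x3 x4 [x5 x6]] := dle x xd.
have [P1 KF _] := gE x x0 xd; have F0 : 0 < Phi x by apply: lt_le_trans P1.
have n20 := le_trans n1 e1.
rewrite sub0r normrN ler_norml.
have up : f x <= (1 + 20 * eps) * Phi x.
  have [r [rx /andP[r0 rlex] /andP[y0 yx] dy /andP[h1 h2]]] := dilated_radius x0 n0 n20 n2.
  have s1 : r < r1 by exact: le_lt_trans rlex x1.
  have [hA _] := hK r r0 s1; rewrite rx in hA.
  have [_ _ [_ G1 _]] := gE _ y0 (le_lt_trans yx xd).
  have [_ _ [_ _ G2]] := gE _ (divr_gt0 r0 (ltr0n _ 2)) (le_lt_trans h2 xd).
  exact: (ratio_upper e0 e1 n0 n1 F0 KF hA G1 (hd2 _ _ x0 x3 dy yx) G2 (hM _ _ x0 x2 h1 h2) n3).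
have lo : (1 - 20 * eps) * Phi x <= f x.
  have [r [rx /andP[r0 rlex] /andP[xy yx] dy /andP[h1 h2]]] := contracted_radius x0 n0 n20 n2.
  have [s1 _ _ _ _] := dle r (le_lt_trans rlex x4d).
  have [_ hA] := hK r r0 s1; rewrite rx in hA.
  have y0 := lt_le_trans x0 xy; have yd := le_lt_trans yx x4d.
  have [_ _ y2 _ _] := dle _ yd; have [_ _ [G1 _ _]] := gE _ y0 yd.
  have [_ _ [_ _ G2]] := gE _ (divr_gt0 r0 (ltr0n _ 2)) (le_lt_trans h2 xd).
  exact: (ratio_lower e0 e1 n0 n1 F0 KF hA G1 (hd2 _ _ y0 y2 dy xy) G2 (hM _ _ x0 x2 h1 h2) n3).
have q1 : f x / Phi x <= 1 + 20 * eps by rewrite ler_pdivrMr.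
have q2 : 1 - 20 * eps <= f x / Phi x by rewrite ler_pdivlMr.
by apply/andP; split; clear - q1 q2 e2; slra.
Qed.

End Growth.

Theorem corollary3p11 (R : realType) (H : completeNormedModType R[i])
    (dot : {dot H for (@Num.conj R[i])}) (D : set R[i])
    (A : R[i] -> boundedOp H) (P0 : boundedOp H)
    (theta : R) (Phi : R -> R) :
  hilbert_norm dot -> separable_space H ->
  open D -> connected D -> D 0 ->
  (forall z, D z -> compact_op (A z)) -> holomorphic_on D A ->
  selfadjoint_op dot (A 0) ->
  orth_proj dot (op_ker (A 0)) P0 ->
  op_invertible (idop H - compop (derive1 A 0) P0) ->
  0 < theta -> (forall r : R, 0 < r < 1 -> sector theta r 1 `<=` D) ->
  admissible_growth Phi ->
  asymptotic_at0 (fun r => eigen_count (A 0) [set x | r <= x <= 1]) Phi ->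
  asymptotic_at0 (fun r => char_count dot D A (sector theta r 1)) Phi.
Proof.
move=> hn _ oD _ D0 kA hA sA hP0 invA th0 secD adm [e e0 he].
have cA z : D z -> fapprox hn (A z) by move=> Dz; exact: compact_fapprox (kA z Dz).
have reg := admissible_regular adm.
have hg : \forall r \near 0^'+, eigen_num A r = Phi r * (1 + e r).
  have [d d0 hd] := (near_right0 _).1 he; apply/near_right0; exists d => // r r0 rd.
  by rewrite /eigen_num (hd r r0 rd).
exists (fun r => sector_num dot D A theta r / Phi r - 1).
  apply: (asymptotic_transfer reg _ e0 hg) => eta eta0 eta1.
  exact: (global_comparison oD D0 hA cA sA hP0 invA th0 secD eta0 eta1).
(* Near 0 one has [1 <= Phi r], so the division by [Phi r] in the witness can be undone. *)
have [inf _ _] := reg; have [d d0 hd] := inf 1.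
apply/near_right0; exists (Num.min d 1); first by rewrite lt_min d0 ltr01.
move=> r r0; rewrite lt_min => /andP[rd r1].
rewrite (sector_numE oD D0 hA cA sA hP0 invA th0 secD); last by rewrite r0 ltW.
have Phi0 : Phi r != 0 by rewrite gt_eqF//; apply: lt_le_trans (hd r r0 rd).
by congr (_%:E); field.
Qed.
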